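(* Let $(T,M)$ be a complete local ring of characteristic zero and dimension $n>1$. Suppose that the following conditions hold: (i) no integer of $T$ is a zero divisor; (ii) $T$ is reduced; (iii) for every minimal prime ideal $P$ of $T$, either $\dim(T/P)=1$ or $\dim(T/P)=n$; and (iv) there exist minimal prime ideals $P_0,P_1$ of $T$ such that $\dim(T/P_0)=1$ and $\dim(T/P_1)=n$. Then $T$ is the completion of a quasi-excellent catenary local domain, but $T$ is not the completion of a universally catenary local domain.
   Context: All rings are commutative with identity. A local ring is a Noetherian ring with a unique maximal ideal; $(T,M)$ denotes a local ring $T$ with maximal ideal $M$. For a local ring $A$, $\widehat{A}$ denotes its completion at its maximal ideal, and ''$T$ is the completion of $A$'' means $\widehat{A}\cong T$. A complete local ring is a local ring that is complete with respect to its maximal ideal. ''No integer of $T$ is a zero divisor'' means that no nonzero element of $T$ of the form $n\cdot 1_T$ with $n\in\mathbb{Z}$ is a zero divisor. A ring $A$ is catenary if for all prime ideals $P\subseteq Q$ of $A$, all saturated chains of prime ideals between $P$ and $Q$ have the same length. A ring $A$ is universally catenary if all finitely generated $A$-algebras are catenary. A local ring $A$ is quasi-excellent if: (a) for all prime ideals $P$ of $A$, the ring $\widehat{A}\otimes_A L$ is regular for every finite field extension $L$ of $A_P/PA_P$; and (b) for every finitely generated $A$-algebra $B$, the regular locus $\mathrm{Reg}(B)=\{\mathfrak{q}\in\mathrm{Spec}(B) : B_{\mathfrak{q}} \text{ is a regular local ring}\}$ is open in $\mathrm{Spec}(B)$. *)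

(* Defs.v *)
From HB Require Import structures.
From mathcomp Require Import all_boot all_algebra.
From mathcomp Require Import ring.
From mathcomp Require Import generic_quotient boolp classical_sets.

Set Implicit Arguments.
Unset Strict Implicit.
Unset Printing Implicit Defensive.

Import GRing.Theory.
Local Open Scope ring_scope.
Local Open Scope quotient_scope.
Local Open Scope classical_set_scope.

(* Rings are [comPzRingType]: commutative with identity, the zero ring being
   allowed.  MathComp's own ideals ([idealr], [prime_idealr]) only cover proper
   boolean ideals of nonzero rings, which is too narrow for arbitrary finitely
   generated algebras and tensor products; hence the [ideal] type below. *)

(* A commutative ring up to an equivalence, and the quotient ring it defines;
   residue rings, localizations, completions and tensor products are all
   obtained this way. *)
Record comring_setoid := ComRingSetoid {
  cs_car :> choiceType;
  cs_eq : cs_car -> cs_car -> Prop;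
  cs_zero : cs_car;
  cs_one : cs_car;
  cs_opp : cs_car -> cs_car;
  cs_add : cs_car -> cs_car -> cs_car;
  cs_mul : cs_car -> cs_car -> cs_car;
  cs_refl : forall x, cs_eq x x;
  cs_sym : forall x y, cs_eq x y -> cs_eq y x;
  cs_trans : forall y x z, cs_eq x y -> cs_eq y z -> cs_eq x z;
  cs_oppP : forall x x', cs_eq x x' -> cs_eq (cs_opp x) (cs_opp x');
  cs_addP : forall x x' y y', cs_eq x x' -> cs_eq y y' ->
    cs_eq (cs_add x y) (cs_add x' y');
  cs_mulP : forall x x' y y', cs_eq x x' -> cs_eq y y' ->
    cs_eq (cs_mul x y) (cs_mul x' y');
  cs_addA : forall x y z,
    cs_eq (cs_add x (cs_add y z)) (cs_add (cs_add x y) z);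
  cs_addC : forall x y, cs_eq (cs_add x y) (cs_add y x);
  cs_add0 : forall x, cs_eq (cs_add cs_zero x) x;
  cs_addN : forall x, cs_eq (cs_add (cs_opp x) x) cs_zero;
  cs_mulA : forall x y z,
    cs_eq (cs_mul x (cs_mul y z)) (cs_mul (cs_mul x y) z);
  cs_mulC : forall x y, cs_eq (cs_mul x y) (cs_mul y x);
  cs_mul1 : forall x, cs_eq (cs_mul cs_one x) x;
  cs_mulD : forall x y z,
    cs_eq (cs_mul (cs_add x y) z) (cs_add (cs_mul x z) (cs_mul y z))
}.

Section SetoidQuotient.
Variable S : comring_setoid.

Definition cs_eqb (x y : S) : bool := `[< cs_eq x y >].

Lemma cs_eqb_equiv : equiv_class_of cs_eqb.
Proof.
split=> [x|x y|y x z]; first by apply/asboolP/cs_refl.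
  by apply/asboolP/asboolP; apply: cs_sym.
by move=> /asboolP xy /asboolP yz; apply/asboolP/(cs_trans xy yz).
Qed.

Canonical cs_eqb_equivRel := EquivRelPack cs_eqb_equiv.
Canonical cs_eqb_encModRel := defaultEncModRel cs_eqb.

Definition setoid_quot := {eq_quot cs_eqb}.
HB.instance Definition _ := Choice.on setoid_quot.

Definition cs_pi (x : S) : setoid_quot := \pi_setoid_quot x.
Definition cs_repr (x : setoid_quot) : S := repr x.

Lemma cs_piP x y : cs_pi x = cs_pi y <-> cs_eq x y.
Proof.
split=> [/eqmodP/asboolP//|xy]; apply/eqmodP; exact/asboolP.
Qed.

Lemma cs_reprK x : cs_pi (cs_repr x) = x.
Proof. exact: reprK. Qed.

Lemma cs_repr_pi x : cs_eq (cs_repr (cs_pi x)) x.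
Proof. by apply/cs_piP; rewrite cs_reprK. Qed.

Definition sq_opp x := cs_pi (cs_opp (cs_repr x)).
Definition sq_add x y := cs_pi (cs_add (cs_repr x) (cs_repr y)).
Definition sq_mul x y := cs_pi (cs_mul (cs_repr x) (cs_repr y)).

Lemma sq_oppE x : sq_opp (cs_pi x) = cs_pi (cs_opp x).
Proof. by apply/cs_piP/cs_oppP/cs_repr_pi. Qed.

Lemma sq_addE x y : sq_add (cs_pi x) (cs_pi y) = cs_pi (cs_add x y).
Proof. by apply/cs_piP/cs_addP; apply: cs_repr_pi. Qed.

Lemma sq_mulE x y : sq_mul (cs_pi x) (cs_pi y) = cs_pi (cs_mul x y).
Proof. by apply/cs_piP/cs_mulP; apply: cs_repr_pi. Qed.

Lemma sq_addA : associative sq_add.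
Proof.
move=> x y z; rewrite -[x]cs_reprK -[y]cs_reprK -[z]cs_reprK !sq_addE.
exact/cs_piP/cs_addA.
Qed.

Lemma sq_addC : commutative sq_add.
Proof. by move=> x y; apply/cs_piP/cs_addC. Qed.

Lemma sq_add0 : left_id (cs_pi (cs_zero S)) sq_add.
Proof. by move=> x; rewrite -[x]cs_reprK sq_addE; apply/cs_piP/cs_add0. Qed.

Lemma sq_addN : left_inverse (cs_pi (cs_zero S)) sq_opp sq_add.
Proof.
by move=> x; rewrite -[x]cs_reprK sq_oppE sq_addE; apply/cs_piP/cs_addN.
Qed.

Lemma sq_mulA : associative sq_mul.
Proof.
move=> x y z; rewrite -[x]cs_reprK -[y]cs_reprK -[z]cs_reprK !sq_mulE.
exact/cs_piP/cs_mulA.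
Qed.

Lemma sq_mulC : commutative sq_mul.
Proof. by move=> x y; apply/cs_piP/cs_mulC. Qed.

Lemma sq_mul1 : left_id (cs_pi (cs_one S)) sq_mul.
Proof. by move=> x; rewrite -[x]cs_reprK sq_mulE; apply/cs_piP/cs_mul1. Qed.

Lemma sq_mulD : left_distributive sq_mul sq_add.
Proof.
move=> x y z; rewrite -[x]cs_reprK -[y]cs_reprK -[z]cs_reprK.
rewrite !(sq_mulE, sq_addE); exact/cs_piP/cs_mulD.
Qed.

HB.instance Definition _ := GRing.isZmodule.Build setoid_quot
  sq_addA sq_addC sq_add0 sq_addN.
HB.instance Definition _ := GRing.Zmodule_isComPzRing.Build setoid_quot
  sq_mulA sq_mulC sq_mul1 sq_mulD.

Definition setoid_ring : comPzRingType := setoid_quot.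

Lemma cs_pi0 : cs_pi (cs_zero S) = 0 :> setoid_ring. Proof. by []. Qed.
Lemma cs_pi1 : cs_pi (cs_one S) = 1 :> setoid_ring. Proof. by []. Qed.
Lemma cs_piN x : cs_pi (cs_opp x) = - (cs_pi x : setoid_ring).
Proof. by rewrite -sq_oppE. Qed.
Lemma cs_piD x y :
  cs_pi (cs_add x y) = (cs_pi x : setoid_ring) + (cs_pi y : setoid_ring).
Proof. by rewrite -sq_addE. Qed.
Lemma cs_piM x y :
  cs_pi (cs_mul x y) = (cs_pi x : setoid_ring) * (cs_pi y : setoid_ring).
Proof. by rewrite -sq_mulE. Qed.

End SetoidQuotient.

Section SetoidMorphism.
Variables (R : comPzRingType) (S : comring_setoid) (f : R -> S).
Hypothesis fB : forall x y, cs_eq (f (x - y)) (cs_add (f x) (cs_opp (f y))).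
Hypothesis f1 : cs_eq (f 1) (cs_one S).
Hypothesis fM : forall x y, cs_eq (f (x * y)) (cs_mul (f x) (f y)).

Definition setoid_map (x : R) : setoid_ring S := cs_pi (f x).

Lemma setoid_map_zmod : zmod_morphism setoid_map.
Proof. by move=> x y; rewrite /setoid_map -cs_piN -cs_piD; apply/cs_piP. Qed.

Lemma setoid_map_monoid : monoid_morphism setoid_map.
Proof.
split; first by rewrite -cs_pi1; apply/cs_piP.
by move=> x y; rewrite /setoid_map -cs_piM; apply/cs_piP.
Qed.

Definition setoid_rmorphism : {rmorphism R -> setoid_ring S} :=
  HB.pack setoid_map
    (GRing.isZmodMorphism.Build R (setoid_ring S) setoid_map setoid_map_zmod)
    (GRing.isMonoidMorphism.Build R (setoid_ring S) setoid_map setoid_map_monoid).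

End SetoidMorphism.

Identity Coercion set_pred : set >-> Funclass.

Record ideal (R : comPzRingType) := Ideal {
  ideal_set :> set R;
  ideal0 : ideal_set 0;
  idealD : forall x y, ideal_set x -> ideal_set y -> ideal_set (x + y);
  idealM : forall a x, ideal_set x -> ideal_set (a * x)
}.

Section Ideals.
Variable R : comPzRingType.
Implicit Types (I J : ideal R) (E : set R).

Lemma idealN I x : I x -> I (- x).
Proof. by move=> Ix; rewrite -mulN1r; apply: idealM. Qed.

Lemma idealB I x y : I x -> I y -> I (x - y).
Proof. by move=> Ix Iy; apply/idealD/idealN. Qed.

Lemma idealMl I a x : I x -> I (x * a).
Proof. by rewrite mulrC; apply: idealM. Qed.

Lemma ideal_sub_sym I x y : I (x - y) -> I (y - x).
Proof. by move=> /idealN; rewrite opprB. Qed.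

Lemma ideal_sub_trans I y x z : I (x - y) -> I (y - z) -> I (x - z).
Proof. by move=> xy /(idealD xy); rewrite addrA subrK. Qed.

Lemma ideal_subD I x x' y y' :
  I (x - x') -> I (y - y') -> I (x + y - (x' + y')).
Proof. by rewrite opprD addrACA; apply: idealD. Qed.

Lemma ideal_subN I x x' : I (x - x') -> I (- x - - x').
Proof. by move=> /idealN; rewrite opprD. Qed.

Lemma ideal_subM I x x' y y' :
  I (x - x') -> I (y - y') -> I (x * y - x' * y').
Proof.
move=> xx' yy'; apply: (@ideal_sub_trans _ (x' * y)).
  by rewrite -mulrBl; apply: idealMl.
by rewrite -mulrBr; apply: idealM.
Qed.

Lemma ideal_sub0 I x y : x = y -> I (x - y).
Proof. by move=> ->; rewrite subrr; apply: ideal0. Qed.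

Definition ideal_span E : ideal R.
Proof.
exists [set x | forall I, E `<=` I -> I x] => [I _|x y xE yE I EI|a x xE I EI].
- exact: ideal0.
- by apply: idealD; [apply: xE|apply: yE].
- by apply: idealM; apply: xE.
Defined.

Definition ideal_mul I J : ideal R :=
  ideal_span [set a * b | a in I & b in J].

Definition ideal_pow I (n : nat) : ideal R :=
  iter n (ideal_mul I) (ideal_span setT).

Definition is_prime I : Prop :=
  ~ I 1 /\ forall x y, I (x * y) -> I x \/ I y.

Definition is_maximal I : Prop :=
  ~ I 1 /\ forall J, ~ J 1 -> I `<=` J -> J `<=` I.

Definition noetherian : Prop :=
  forall I, exists s : seq R, ideal_set I = ideal_span [set` s].

End Ideals.

Record Spec (R : comPzRingType) := PrimeIdeal {
  prime_ideal :> ideal R;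
  primeP : is_prime prime_ideal
}.

Definition local_ring (R : comPzRingType) (M : ideal R) : Prop :=
  [/\ noetherian R, is_maximal M &
      forall N : ideal R, is_maximal N -> ideal_set N = M].

Section Dimension.
Variable R : comPzRingType.
Implicit Types (P Q : Spec R) (c : nat -> Spec R) (d : nat).

(* Only the values c 0, ..., c d matter. *)
Definition prime_chain d c : Prop :=
  forall i, (i < d)%N -> ideal_set (c i) `<` ideal_set (c i.+1).

Definition krull_dim d : Prop :=
  (exists c, prime_chain d c) /\ ~ (exists c, prime_chain d.+1 c).

Definition minimal_prime P : Prop := forall Q, Q `<=` P -> P `<=` Q.

Definition saturated_chain P Q d c : Prop :=
  [/\ ideal_set (c 0%N) = P, ideal_set (c d) = Q, prime_chain d c &
      forall i, (i < d)%N -> forall P' : Spec R,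
        ~ (ideal_set (c i) `<` ideal_set P' /\
           ideal_set P' `<` ideal_set (c i.+1))].

Definition catenary : Prop :=
  forall P Q, P `<=` Q ->
  forall d c d' c', saturated_chain P Q d c -> saturated_chain P Q d' c' ->
  d = d'.

Definition zariski_closed (Z : set (Spec R)) : Prop :=
  exists E : set R, Z = [set P | E `<=` P].

Definition zariski_open (U : set (Spec R)) : Prop := zariski_closed (~` U).

End Dimension.

Section ResidueRing.
Variables (R : comPzRingType) (I : ideal R).

Definition quotient_setoid : comring_setoid.
Proof.
refine (@ComRingSetoid R (fun x y => I (x - y)) 0 1 -%R +%R *%R
  _ _ _ _ _ _ _ _ _ _ _ _ _ _).
- by move=> x; apply: ideal_sub0.
- exact: ideal_sub_sym.
- exact: ideal_sub_trans.
- exact: ideal_subN.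
- exact: ideal_subD.
- exact: ideal_subM.
- by move=> *; apply: ideal_sub0; rewrite addrA.
- by move=> *; apply: ideal_sub0; rewrite addrC.
- by move=> *; apply: ideal_sub0; rewrite add0r.
- by move=> *; apply: ideal_sub0; rewrite addNr.
- by move=> *; apply: ideal_sub0; rewrite mulrA.
- by move=> *; apply: ideal_sub0; rewrite mulrC.
- by move=> *; apply: ideal_sub0; rewrite mul1r.
- by move=> *; apply: ideal_sub0; rewrite mulrDl.
Defined.

Definition quotient_ring : comPzRingType := setoid_ring quotient_setoid.

Definition quotient_map : {rmorphism R -> quotient_ring}.
Proof.
by apply: (@setoid_rmorphism R quotient_setoid id) => *; apply: ideal_sub0.
Defined.

End ResidueRing.

Section Localization.
Variables (R : comPzRingType) (P : Spec R).

Lemma prime_compl1 : 1 \notin ideal_set P.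
Proof. by rewrite notin_setE; case: (primeP P). Qed.

Lemma prime_complM s t :
  s \notin ideal_set P -> t \notin ideal_set P -> s * t \notin ideal_set P.
Proof. by rewrite !notin_setE => Ps Pt /(primeP P).2 []. Qed.

Definition denominator : choiceType := {s : R | s \notin ideal_set P}.

Definition denom1 : denominator := Sub 1 prime_compl1.
Definition denomM (s t : denominator) : denominator :=
  Sub (val s * val t) (prime_complM (valP s) (valP t)).

(* Fractions (a, s), to be read as a / s. *)
Definition frac_eq (x y : R * denominator) : Prop :=
  exists t : denominator, val t * (x.1 * val y.2 - y.1 * val x.2) = 0.


Lemma frac_eq_refl x : frac_eq x x.
Proof. by exists denom1; rewrite subrr mulr0. Qed.

Lemma frac_eq_sym x y : frac_eq x y -> frac_eq y x.
Proof. by case=> t xy; exists t; rewrite -opprB mulrN xy oppr0. Qed.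

Lemma frac_eq_trans y x z : frac_eq x y -> frac_eq y z -> frac_eq x z.
Proof.
case: x y z => [a s] [b t] [c u] [v /= v0] [w /= w0].
exists (denomM t (denomM v w)) => /=.
set S := val s; set T := val t; set U := val u.
set V := val v; set W := val w.
have -> : T * (V * W) * (a * U - c * S) =
    (U * W) * (V * (a * T - b * S)) + (S * V) * (W * (b * U - c * T)) by ring.
by rewrite v0 w0 !mulr0 addr0.
Qed.

Definition frac_opp (x : R * denominator) := (- x.1, x.2).
Definition frac_add (x y : R * denominator) :=
  (x.1 * val y.2 + y.1 * val x.2, denomM x.2 y.2).
Definition frac_mul (x y : R * denominator) := (x.1 * y.1, denomM x.2 y.2).

Lemma frac_oppP x x' : frac_eq x x' -> frac_eq (frac_opp x) (frac_opp x').
Proof.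
case: x x' => [a s] [a' s'] [v /= v0]; exists v => /=.
by rewrite !mulNr -opprD mulrN v0 oppr0.
Qed.

Lemma frac_addP x x' y y' :
  frac_eq x x' -> frac_eq y y' -> frac_eq (frac_add x y) (frac_add x' y').
Proof.
case: x x' y y' => [a s] [a' s'] [b t] [b' t'] [v /= v0] [w /= w0].
exists (denomM v w) => /=.
set S := val s; set S' := val s'; set T := val t; set T' := val t'.
set V := val v; set W := val w.
have -> : V * W * ((a * T + b * S) * (S' * T') - (a' * T' + b' * S') * (S * T))
  = (W * T * T') * (V * (a * S' - a' * S)) +
    (V * S * S') * (W * (b * T' - b' * T)) by ring.
by rewrite v0 w0 !mulr0 addr0.
Qed.

Lemma frac_mulP x x' y y' :
  frac_eq x x' -> frac_eq y y' -> frac_eq (frac_mul x y) (frac_mul x' y').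
Proof.
case: x x' y y' => [a s] [a' s'] [b t] [b' t'] [v /= v0] [w /= w0].
exists (denomM v w) => /=.
set S := val s; set S' := val s'; set T := val t; set T' := val t'.
set V := val v; set W := val w.
have -> : V * W * (a * b * (S' * T') - a' * b' * (S * T))
  = (W * b * T') * (V * (a * S' - a' * S)) +
    (V * a' * S) * (W * (b * T' - b' * T)) by ring.
by rewrite v0 w0 !mulr0 addr0.
Qed.

Lemma frac_eqE x y : x.1 * val y.2 = y.1 * val x.2 -> frac_eq x y.
Proof. by move=> xy; exists denom1; rewrite xy subrr mulr0. Qed.

Definition localization_setoid : comring_setoid.
Proof.
refine (@ComRingSetoid (R * denominator)%type frac_eq
  (0, denom1) (1, denom1) frac_opp frac_add frac_mul
  frac_eq_refl frac_eq_sym frac_eq_trans frac_oppP frac_addP frac_mulP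
  _ _ _ _ _ _ _ _).
all: by move=> *; apply: frac_eqE => /=; ring.
Defined.

Definition localization : comPzRingType := setoid_ring localization_setoid.

Definition localization_map : {rmorphism R -> localization}.
Proof.
apply: (@setoid_rmorphism R localization_setoid (fun a => (a, denom1))) => *.
all: by apply: frac_eqE => /=; ring.
Defined.

Definition localization_ideal : ideal localization :=
  ideal_span [set localization_map x | x in ideal_set P].

Definition residue_field : comPzRingType := quotient_ring localization_ideal.

Definition residue_map : {rmorphism R -> residue_field} :=
  quotient_map localization_ideal \o localization_map.

End Localization.

(* The M-adic completion: Cauchy sequences modulo null sequences. *)
Section Completion.
Variables (R : comPzRingType) (M : ideal R).

Definition cauchy_seq (x : nat -> R) : Prop :=
  forall k, exists N, forall i j, (N <= i)%N -> (N <= j)%N ->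
    ideal_pow M k (x i - x j).

Definition cauchy : choiceType := {x : nat -> R | `[< cauchy_seq x >]}.

Definition cauchy_eq (x y : cauchy) : Prop :=
  forall k, exists N, forall i, (N <= i)%N -> ideal_pow M k (val x i - val y i).

Lemma cauchyP (x : cauchy) : cauchy_seq (val x).
Proof. exact/asboolP/(valP x). Qed.

Lemma cst_cauchy a : cauchy_seq (fun=> a).
Proof. by move=> k; exists 0%N => *; apply: ideal_sub0. Qed.

Lemma opp_cauchy (x : cauchy) : cauchy_seq (fun i => - val x i).
Proof.
move=> k; have [N xN] := cauchyP x k; exists N => i j Ni Nj.
by apply: ideal_subN; apply: xN.
Qed.

Lemma add_cauchy (x y : cauchy) : cauchy_seq (fun i => val x i + val y i).
Proof.
move=> k; have [N xN] := cauchyP x k; have [N' yN] := cauchyP y k.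
exists (maxn N N') => i j; rewrite !geq_max => /andP[? ?] /andP[? ?].
by apply: ideal_subD; [apply: xN|apply: yN].
Qed.

Lemma mul_cauchy (x y : cauchy) : cauchy_seq (fun i => val x i * val y i).
Proof.
move=> k; have [N xN] := cauchyP x k; have [N' yN] := cauchyP y k.
exists (maxn N N') => i j; rewrite !geq_max => /andP[? ?] /andP[? ?].
by apply: ideal_subM; [apply: xN|apply: yN].
Qed.

Definition mk_cauchy (x : nat -> R) (xP : cauchy_seq x) : cauchy :=
  Sub x (introT (asboolP _) xP).

Definition cauchy_cst a := mk_cauchy (cst_cauchy a).
Definition cauchy_opp x := mk_cauchy (opp_cauchy x).
Definition cauchy_add x y := mk_cauchy (add_cauchy x y).
Definition cauchy_mul x y := mk_cauchy (mul_cauchy x y).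

Lemma cauchy_eqE (x y : cauchy) : (forall i, val x i = val y i) -> cauchy_eq x y.
Proof. by move=> xy k; exists 0%N => i _; apply: ideal_sub0. Qed.

Definition completion_setoid : comring_setoid.
Proof.
refine (@ComRingSetoid cauchy cauchy_eq (cauchy_cst 0) (cauchy_cst 1)
  cauchy_opp cauchy_add cauchy_mul _ _ _ _ _ _ _ _ _ _ _ _ _ _).
- by move=> x; apply: cauchy_eqE.
- move=> x y xy k; have [N H] := xy k; exists N => i Ni.
  exact/ideal_sub_sym/H.
- move=> y x z xy yz k; have [N H] := xy k; have [N' H'] := yz k.
  exists (maxn N N') => i; rewrite geq_max => /andP[? ?].
  by apply: (@ideal_sub_trans _ _ (val y i)); [apply: H|apply: H'].
- move=> x x' xx' k; have [N H] := xx' k; exists N => i Ni.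
  exact/ideal_subN/H.
- move=> x x' y y' xx' yy' k; have [N H] := xx' k; have [N' H'] := yy' k.
  exists (maxn N N') => i; rewrite geq_max => /andP[? ?].
  by apply: ideal_subD; [apply: H|apply: H'].
- move=> x x' y y' xx' yy' k; have [N H] := xx' k; have [N' H'] := yy' k.
  exists (maxn N N') => i; rewrite geq_max => /andP[? ?].
  by apply: ideal_subM; [apply: H|apply: H'].
all: by move=> *; apply: cauchy_eqE => i /=; ring.
Defined.

Definition completion : comPzRingType := setoid_ring completion_setoid.

Definition completion_map : {rmorphism R -> completion}.
Proof.
apply: (@setoid_rmorphism R completion_setoid cauchy_cst) => *.
all: by apply: cauchy_eqE.
Defined.

End Completion.

(* The tensor product B (x)_A C of two A-algebras f : A -> B, g : A -> C.
   A sequence [:: (b1, c1); ...; (bk, ck)] stands for the sum of the pure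
   tensors bi (x) ci; opposites are obtained by negating the bi. *)
Section TensorProduct.
Variables (A B C : comPzRingType).
Variables (f : {rmorphism A -> B}) (g : {rmorphism A -> C}).

Inductive tensor_eq : seq (B * C) -> seq (B * C) -> Prop :=
| tensor_refl s : tensor_eq s s
| tensor_sym s t : tensor_eq s t -> tensor_eq t s
| tensor_trans t s u : tensor_eq s t -> tensor_eq t u -> tensor_eq s u
| tensor_cat s s' t t' :
    tensor_eq s s' -> tensor_eq t t' -> tensor_eq (s ++ t) (s' ++ t')
| tensor_catC s t : tensor_eq (s ++ t) (t ++ s)
| tensor_0 c : tensor_eq [:: (0, c)] [::]
| tensor_Dl b b' c : tensor_eq [:: (b + b', c)] [:: (b, c); (b', c)]
| tensor_Dr b c c' : tensor_eq [:: (b, c + c')] [:: (b, c); (b, c')]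
| tensor_balanced a b c : tensor_eq [:: (f a * b, c)] [:: (b, g a * c)].

Definition tensor_opp (s : seq (B * C)) := [seq (- x.1, x.2) | x <- s].
Definition tensor_mul (s t : seq (B * C)) :=
  [seq (x.1 * y.1, x.2 * y.2) | x <- s, y <- t].

Lemma tensor_oppP s s' :
  tensor_eq s s' -> tensor_eq (tensor_opp s) (tensor_opp s').
Proof.
rewrite /tensor_opp.
elim=> {s s'} [s|s t _|t s u _ IH _|s s' t t' _ IH _ IH'|s t|c|b b' c|b c c'|a b c].
- exact: tensor_refl.
- exact: tensor_sym.
- exact: tensor_trans.
- by rewrite !map_cat; apply: tensor_cat.
- by rewrite !map_cat; apply: tensor_catC.
- by rewrite /= oppr0; apply: tensor_0.
- by rewrite /= opprD; apply: tensor_Dl.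
- exact: tensor_Dr.
- by rewrite /= -mulrN; apply: tensor_balanced.
Qed.

Lemma tensor_addN s : tensor_eq (tensor_opp s ++ s) [::].
Proof.
elim: s => [|[b c] s IH]; first exact: tensor_refl.
rewrite /= -cat1s -(cat1s _ s).
apply: (@tensor_trans ([:: (- b, c)] ++ [:: (b, c)] ++ (tensor_opp s ++ s))).
  apply: tensor_cat; first exact: tensor_refl.
  rewrite !catA; apply: tensor_cat; last exact: tensor_refl.
  exact: tensor_catC.
rewrite catA -[X in tensor_eq _ X]cats0; apply: tensor_cat => //.
apply: tensor_trans (tensor_0 c); rewrite -(addNr b).
exact/tensor_sym/tensor_Dl.
Qed.

Lemma tensor_mulC s t : tensor_eq (tensor_mul s t) (tensor_mul t s).
Proof.
elim: s t => [|x s IH] t.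
  rewrite /tensor_mul /=; elim: t => [|y t IHt] //=; exact: tensor_refl.
apply: (@tensor_trans (tensor_mul t [:: x] ++ tensor_mul t s)).
  apply: tensor_cat (IH t); rewrite /tensor_mul.
  elim: t => [|y t IHt] /=; first exact: tensor_refl.
  rewrite -cat1s -[X in tensor_eq _ X]cat1s; apply: tensor_cat => //.
  by rewrite mulrC [x.2 * _]mulrC; apply: tensor_refl.
rewrite /tensor_mul; elim: t => [|y t IHt] /=; first exact: tensor_refl.
rewrite -cat1s -[X in tensor_eq _ X]cat1s.
apply: tensor_cat; first exact: tensor_refl.
apply: tensor_trans (tensor_cat (tensor_refl _) IHt).
rewrite !catA; apply: tensor_cat; last exact: tensor_refl.
exact: tensor_catC.
Qed.

Lemma tensor_map2 (p q r : B * C -> B * C) t :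
  (forall y, tensor_eq [:: r y] [:: p y; q y]) ->
  tensor_eq (map r t) (map p t ++ map q t).
Proof.
move=> rE; elim: t => [|y t IH] /=; first exact: tensor_refl.
apply: (@tensor_trans ([:: p y] ++ ([:: q y] ++ map p t) ++ map q t)).
  by rewrite -[r y :: _]cat1s -catA catA; apply: tensor_cat.
apply: (@tensor_cat [:: p y] [:: p y]); first exact: tensor_refl.
rewrite -(cat1s (q y) (map q t)) catA.
apply: tensor_cat; last exact: tensor_refl.
exact: tensor_catC.
Qed.

Lemma tensor_mulPl s s' t :
  tensor_eq s s' -> tensor_eq (tensor_mul s t) (tensor_mul s' t).
Proof.
rewrite /tensor_mul.
elim=> {s s'} [s|s s' _|s' s u _ IH _|s s' u u' _ IH _ IH'|s u|c|b b' c|b c c'|a b c].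
- exact: tensor_refl.
- exact: tensor_sym.
- exact: tensor_trans.
- by rewrite !allpairs_cat; apply: tensor_cat.
- by rewrite !allpairs_cat; apply: tensor_catC.
all: rewrite /= ?cats0.
- elim: t => [|y t IH] /=; first exact: tensor_refl.
  rewrite -cat1s -[[::]]/([::] ++ [::]); apply: tensor_cat => //.
  by rewrite mul0r; apply: tensor_0.
- by apply: tensor_map2 => y; rewrite mulrDl; apply: tensor_Dl.
- by apply: tensor_map2 => y; rewrite mulrDl; apply: tensor_Dr.
- elim: t => [|[y z] t IH] /=; first exact: tensor_refl.
  rewrite -cat1s -[X in tensor_eq _ X]cat1s; apply: tensor_cat => //.
  by rewrite -!mulrA; apply: tensor_balanced.
Qed.

Lemma tensor_mulP s s' t t' : tensor_eq s s' -> tensor_eq t t' ->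
  tensor_eq (tensor_mul s t) (tensor_mul s' t').
Proof.
move=> ss' tt'; apply: tensor_trans (tensor_mulPl t ss') _.
apply: tensor_trans (tensor_mulC _ _) _.
exact: tensor_trans (tensor_mulPl s' tt') (tensor_mulC _ _).
Qed.

Lemma tensor_mulA s t u :
  tensor_mul s (tensor_mul t u) = tensor_mul (tensor_mul s t) u.
Proof.
rewrite /tensor_mul; elim: s => [|x s IH] //=.
rewrite allpairs_cat -IH; congr (_ ++ _).
elim: t {IH} => [|y t IHt] //=; rewrite map_cat IHt; congr (_ ++ _).
by rewrite -map_comp; apply: eq_map => z /=; rewrite !mulrA.
Qed.

Lemma tensor_mul1 s : tensor_mul [:: (1, 1)] s = s.
Proof.
rewrite /tensor_mul /= cats0 -[RHS]map_id.
by apply: eq_map => -[b c] /=; rewrite !mul1r.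
Qed.

Definition tensor_setoid : comring_setoid.
Proof.
refine (@ComRingSetoid (seq (B * C)) tensor_eq [::] [:: (1, 1)]
  tensor_opp cat tensor_mul tensor_refl tensor_sym tensor_trans
  tensor_oppP tensor_cat tensor_mulP _ tensor_catC tensor_refl tensor_addN
  _ tensor_mulC _ _).
- by move=> s t u; rewrite catA; apply: tensor_refl.
- by move=> s t u; rewrite tensor_mulA; apply: tensor_refl.
- by move=> s; rewrite tensor_mul1; apply: tensor_refl.
- by move=> s t u; rewrite /tensor_mul allpairs_cat; apply: tensor_refl.
Defined.

Definition tensor_product : comPzRingType := setoid_ring tensor_setoid.

End TensorProduct.

Section Algebras.
Variables (A B : comPzRingType) (f : {rmorphism A -> B}).

Definition finite_type : Prop :=
  exists s : seq B, forall S : set B,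
    (forall a, S (f a)) -> (forall b, b \in s -> S b) ->
    (forall b c, S b -> S c -> S (b + c)) ->
    (forall b c, S b -> S c -> S (b * c)) ->
    forall b, S b.

Definition module_finite : Prop :=
  exists s : seq B, forall b, exists a : 'I_(size s) -> A,
    b = \sum_(i < size s) f (a i) * s`_i.

End Algebras.

Definition regular_local_ring (R : comPzRingType) : Prop :=
  exists (M : ideal R) (d : nat), [/\ local_ring M, krull_dim R d &
    exists s : seq R, size s = d /\ ideal_set M = ideal_span [set` s]].

Definition regular_ring (R : comPzRingType) : Prop :=
  noetherian R /\ forall P : Spec R, regular_local_ring (localization P).

Definition regular_locus (R : comPzRingType) : set (Spec R) :=
  [set P | regular_local_ring (localization P)].

Definition universally_catenary (A : comPzRingType) : Prop :=
  forall (B : comPzRingType) (f : {rmorphism A -> B}), finite_type f -> catenary B.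

Definition quasi_excellent (A : comPzRingType) (M : ideal A) : Prop :=
  (forall (P : Spec A) (L : fieldType) (h : {rmorphism residue_field P -> L}),
     module_finite h ->
     regular_ring (tensor_product (completion_map M) (h \o residue_map P))) /\
  (forall (B : comPzRingType) (f : {rmorphism A -> B}), finite_type f ->
     zariski_open (@regular_locus B)).

Definition complete_local_ring (R : comPzRingType) (M : ideal R) : Prop :=
  local_ring M /\ bijective (completion_map M).

Definition ring_isomorphic (R S : comPzRingType) : Prop :=
  exists f : {rmorphism R -> S}, bijective f.

Definition zero_divisor (R : comPzRingType) (x : R) : Prop :=
  exists y : R, y <> 0 /\ x * y = 0.

Definition reduced (R : comPzRingType) : Prop :=
  forall (x : R) (k : nat), x ^+ k = 0 -> x = 0.

(* [pchar R] only tests prime integers, so it is also empty when R has prime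
   power characteristic p ^ k with k > 1; it cannot express this property. *)
Definition char_zero (R : comPzRingType) : Prop :=
  forall k : nat, k%:R = 0 :> R -> k = 0%N.

(* Main.v *)
(* Choose by transfinite recursion elements w (u, t) in u + t T that are generic modulo every minimal prime of T, and
   let A consist of the elements of T which a nonzerodivisor multiplies into the ring R generated by the w (u, t), the
   nonzerodivisor being itself in R. Nonzero elements of A avoid the minimal primes, and A + a T = T and a T meets A in
   a A for nonzero a in A; so A is Noetherian with completion T, and the quotients of A by nonzero primes are complete.
   At the zero prime the formal fibre is a separable base change of a product of fields. Openness of regular loci
   follows from Nagata's criterion, as complete local domains are finite over power series over a coefficient ring.
   Conversely, let P0 be a minimal prime of coheight 1, J the intersection of the minimal primes other than P0, and
   x = s + w in A with s in P0 and w in J. If y in A approximates w to high order, then z = y / x approximates an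
   idempotent, and the kernel of A[X] -> A[z] lies in (N, X - 1) on a saturated chain of length 2, although
   (N, X - 1) has height at least 3. *)
Require Import Defs.
From HB Require Import structures.
From mathcomp Require Import all_boot all_algebra.
From mathcomp Require Import ring zify.
From mathcomp Require Import fraction boolp classical_sets wochoice.
Set Implicit Arguments.
Unset Strict Implicit.
Unset Printing Implicit Defensive.
Import GRing.Theory.
Local Open Scope ring_scope.
Local Open Scope classical_set_scope.

Implicit Types D R S T : comPzRingType.

#[local] Hint Resolve ideal0 : core.
#[local] Notation ipow := ideal_pow.

(** The recursion must never run out of candidates. At each stage the pairs already treated form a
    set too small for finite trees over it to code all sequences in the residue field, while u + t T
    contains a family indexed by those sequences and separated modulo every minimal prime. Condition
    (i) starts the recursion, since the integers must avoid the minimal primes as well. Nagata's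
    criterion rests on the localisation of regularity, proved here through finite free resolutions
    written as matrices, and on a supply of derivations. Proper quotients of T may have positive
    characteristic, where derivations are scarce; so the constants of all derivations are followed
    through power series, finite extensions and adjunctions. Catenarity of A survives minimal primes
    of coheight 1 because a height one prime of A extends to a prime of T of coheight n - 1 in every
    case. Conversely, coheight 1 makes P0 + J primary to M. Hence the idempotent which is 1 modulo
    P0 and 0 modulo J, written as the fraction w / x, has a numerator that is torsion modulo x; such
    torsion comes from A, so that a fraction of A can imitate the idempotent. *)

Lemma arg_min (X : Type) (f : X -> nat) (P : X -> Prop) : (exists x, P x) ->
  exists2 x, P x & forall y, P y -> (f x <= f y)%N.
Proof.
move=> [x0 Px0]; have ex : exists n, `[< exists2 x, P x & f x = n >] by exists (f x0); apply/asboolP; exists x0.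
case: (ex_minnP ex) => n /asboolP[x Px <-] fmin; exists x => // y Py.
by apply/fmin/asboolP; exists y.
Qed.

Lemma min_nat (P : nat -> Prop) : (exists n, P n) -> exists2 m, P m & forall n, P n -> (m <= n)%N.
Proof. exact: (arg_min id). Qed.

Lemma min_size (R : nzRingType) (P : {poly R} -> Prop) : (exists f, P f) ->
  exists2 f, P f & forall g, P g -> (size f <= size g)%N.
Proof. exact: (arg_min (fun f : {poly R} => size f)). Qed.

Lemma max_nat (P : nat -> Prop) b : (exists n, P n) -> (forall n, P n -> (n <= b)%N) ->
  exists2 m, P m & forall n, P n -> (n <= m)%N.
Proof.
move=> ex ub; have [m Pm mP] := arg_min (subn b) ex; exists m => // n Pn.
by have := mP n Pn; have := ub n Pn; have := ub m Pm; lia.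
Qed.

(** * Ideal arithmetic: generators, sums, colons, saturation, powers *)

Section IdealBasics.
Variable R : comPzRingType.
Implicit Types (I J K L P Q : ideal R) (s : seq R) (a b t u x y z : R).

Lemma ideal_ext I J : (forall x, I x <-> J x) -> ideal_set I = J.
Proof. by move=> IJ; apply/seteqP; split=> x /IJ. Qed.

(** The proofs stored in an ideal are identified by proof irrelevance, so that equal carriers allow
    whole ideals to be rewritten. *)
Lemma ideal_eq I J : ideal_set I = J -> I = J.
Proof.
case: I J => I I0 ID IM [J J0 JD JM] /= IJ; case: _ / IJ in J0 JD JM *.
by rewrite (Prop_irrelevance I0 J0) (Prop_irrelevance ID JD) (Prop_irrelevance IM JM).
Qed.

Definition igen s : ideal R := ideal_span [set` s].

Definition comb s x := exists c : nat -> R, x = \sum_(i < size s) c i * s`_i.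

Definition comb_ideal s : ideal R.
Proof.
exists (comb s).
- by exists (fun=> 0); rewrite big1 // => i _; rewrite mul0r.
- move=> x y [c ->] [d ->]; exists (fun i => c i + d i).
  by rewrite -big_split; apply: eq_bigr => i _; rewrite /= mulrDl.
- move=> a x [c ->]; exists (fun i => a * c i).
  by rewrite mulr_sumr; apply: eq_bigr => i _; rewrite mulrA.
Defined.

Lemma idealS I (T : Type) (r : seq T) (p : pred T) (F : T -> R) :
  (forall i, p i -> I (F i)) -> I (\sum_(i <- r | p i) F i).
Proof. by move=> IF; elim/big_rec: _ => [|i x /IF]; [|apply: idealD]. Qed.

Lemma igen_mem s x : x \in s -> igen s x.
Proof. by move=> xs I; apply. Qed.

Lemma igen_sub s I : (forall x, x \in s -> I x) -> forall x, igen s x -> I x.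
Proof. by move=> sI x; apply. Qed.

Lemma igen1_sub a I : I a -> igen [:: a] `<=` I.
Proof. by move=> Ia; apply: igen_sub => x; rewrite mem_seq1 => /eqP ->. Qed.

Lemma igenP s x : igen s x <-> comb s x.
Proof.
split=> [|[c ->]].
  apply: (@igen_sub _ (comb_ideal s)) => y /(nthP 0)[i si <-] /=.
  exists (fun j => (j == i)%:R); rewrite (bigD1 (Ordinal si)) //= eqxx mul1r.
  rewrite big1 ?addr0 // => j; rewrite -val_eqE /= => /negPf ->; exact: mul0r.
by apply: idealS => i _; apply/idealM/igen_mem; rewrite mem_nth.
Qed.

Lemma igen_nil x : igen [::] x <-> x = 0.
Proof. by split=> [/igenP[c ->]|->]; [rewrite big_ord0|apply: ideal0]. Qed.

Lemma igen_cons a s x : igen (a :: s) x <-> exists r y, igen s y /\ x = r * a + y.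
Proof.
split=> [/igenP[c ->]|[r [y [sy ->]]]].
  exists (c 0%N), (\sum_(i < size s) c i.+1 * s`_i); rewrite big_ord_recl; split=> //.
  by apply/igenP; exists (fun i => c i.+1).
apply: idealD; first by apply/idealM/igen_mem; rewrite mem_head.
by move: sy; apply: igen_sub => z zs; apply: igen_mem; rewrite inE zs orbT.
Qed.

Lemma igen1 a x : igen [:: a] x <-> exists r, x = r * a.
Proof.
split=> [/igen_cons[r [y [/igen_nil -> ->]]]|[r ->]]; first by exists r; rewrite addr0.
by apply/idealM/igen_mem; rewrite mem_head.
Qed.

Definition isum I J : ideal R.
Proof.
exists [set x | exists a b, [/\ I a, J b & x = a + b]].
- by exists 0, 0; split; rewrite ?addr0 //.
- move=> x y [a [b [Ia Jb ->]]] [c [d [Ic Jd ->]]]; exists (a + c), (b + d).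
  by rewrite addrACA; split=> //; apply: idealD.
- move=> r x [a [b [Ia Jb ->]]]; exists (r * a), (r * b).
  by rewrite mulrDr; split=> //; apply: idealM.
Defined.

Lemma isumL I J x : I x -> isum I J x.
Proof. by move=> Ix; exists x, 0; split; rewrite ?addr0 //. Qed.
Lemma isumR I J x : J x -> isum I J x.
Proof. by move=> Ix; exists 0, x; split; rewrite ?add0r //. Qed.
Lemma isum_sub I J K : I `<=` K -> J `<=` K -> isum I J `<=` K.
Proof. by move=> IK JK _ [a [b [/IK Ka /JK Kb ->]]]; apply: idealD. Qed.

Definition iadd1 I (a : R) := isum I (igen [:: a]).
Lemma iadd1P I a x : iadd1 I a x <-> exists r y, I y /\ x = y + r * a.
Proof.
split=> [[y [b [Iy /igen1[r ->] ->]]]|[r [y [Iy ->]]]]; first by exists r, y.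
by exists y, (r * a); split=> //; apply/igen1; exists r.
Qed.
Lemma iadd1L I a x : I x -> iadd1 I a x. Proof. exact: isumL. Qed.
Lemma iadd1R I a : iadd1 I a a.
Proof. by apply/isumR/igen_mem; rewrite mem_head. Qed.
Lemma iadd1_sub I a K : I `<=` K -> K a -> iadd1 I a `<=` K.
Proof. by move=> IK Ka; apply: isum_sub => // x /igen1[r ->]; apply: idealM. Qed.

Definition colon I (a : R) : ideal R.
Proof.
exists [set x | I (a * x)].
- by rewrite /mkset mulr0.
- by move=> x y Ix Iy; rewrite /mkset mulrDr; apply: idealD.
- by move=> r x Ix; rewrite /mkset mulrCA; apply: idealM.
Defined.

Definition iscale I (a : R) : ideal R.
Proof.
exists [set x | exists2 r, I r & x = r * a].
- by exists 0; [|rewrite mul0r].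
- by move=> _ _ [r Ir ->] [q Iq ->]; exists (r + q); [apply: idealD|rewrite mulrDl].
- by move=> z _ [r Ir ->]; exists (z * r); [apply: idealM|rewrite mulrA].
Defined.

(** The contraction to R of the ideal generated by I in the localisation at P. Local statements are
    phrased with it, so that most local arguments stay inside R. *)
Definition sat P (primeP : is_prime P) I : ideal R.
Proof.
exists [set x | exists2 t, ~ P t & I (t * x)].
- by exists 1; [case: primeP|rewrite mulr0].
- move=> x y [t Pt Ix] [u Pu Iy]; exists (t * u); first by case/primeP.2.
  by rewrite mulrDr (mulrC t u) -mulrA (mulrC u t) -mulrA; apply: idealD; apply: idealM.
- by move=> r x [t Pt Ix]; exists t; rewrite // mulrCA; apply: idealM.
Defined.

Lemma sat_sub P (pP : is_prime P) I x : I x -> sat pP I x.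
Proof. by move=> Ix; exists 1; rewrite ?mul1r //; case: pP. Qed.

Lemma sat_mono P (pP : is_prime P) I J : I `<=` J -> sat pP I `<=` sat pP J.
Proof. by move=> IJ x [t Pt /IJ Jx]; exists t. Qed.

Lemma sat_sat P (pP : is_prime P) I t x : ~ P t -> sat pP I (t * x) -> sat pP I x.
Proof. by move=> Pt [u Pu Ix]; exists (u * t); rewrite -?mulrA //; case/(pP.2). Qed.

Lemma imul_mem I J x y : I x -> J y -> ideal_mul I J (x * y).
Proof. by move=> Ix Jy K; apply; exists x => //; exists y. Qed.

Lemma imul_sub I J K : (forall x y, I x -> J y -> K (x * y)) -> ideal_mul I J `<=` K.
Proof. by move=> IJK z; apply=> _ [x Ix] [y Jy <-]; apply: IJK. Qed.

Lemma ideal_mul1 I a x : ideal_mul I (igen [:: a]) x -> exists2 r, I r & x = r * a.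
Proof.
suff: ideal_mul I (igen [:: a]) `<=` iscale I a by apply.
apply: imul_sub => p y Ip /igen1[q ->].
by exists (p * q); [apply: idealMl|rewrite mulrA].
Qed.

Lemma ipow0 I x : ipow I 0 x.
Proof. by move=> K; apply. Qed.

Lemma ipowS I n x y : I x -> ipow I n y -> ipow I n.+1 (x * y).
Proof. exact: imul_mem. Qed.

Lemma ipowX I n x : I x -> ipow I n (x ^+ n).
Proof.
by move=> Ix; elim: n => [|n IH]; [apply: ipow0|rewrite exprS; apply: ipowS].
Qed.

Lemma ipowS_sub I n : ipow I n.+1 `<=` ipow I n.
Proof. by apply: imul_sub => x y _; apply: idealM. Qed.

Lemma ipow_le I m n : (m <= n)%N -> ipow I n `<=` ipow I m.
Proof.
move=> /subnK <-; elim: (n - m)%N => // k IH x /ipowS_sub; exact: IH.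
Qed.

Lemma ipow1 I x : ipow I 1 x <-> I x.
Proof.
split; first by apply: imul_sub => a b Ia _; apply: idealMl.
by move=> Ix; rewrite -[x]mulr1; apply: ipowS => //; apply: ipow0.
Qed.

Lemma ipowD I m n x y : ipow I m x -> ipow I n y -> ipow I (m + n) (x * y).
Proof.
elim: m x => [|m IH] x; first by move=> _ yn; apply: idealM.
move=> xm yn; have: colon (ipow I (m.+1 + n)) y x.
  move: x xm; apply: imul_sub => a b Ia bm /=; rewrite mulrC -mulrA.
  by apply: ipowS => //; apply: IH.
by rewrite /= mulrC.
Qed.

Lemma prime_exp P x n : is_prime P -> P (x ^+ n) -> P x.
Proof.
move=> pP; elim: n => [|n IH]; first by rewrite expr0; case: pP.
by rewrite exprS => /pP.2[].
Qed.

Lemma proper_sub (A B : set R) : (A `<` B) -> exists2 x, B x & ~ A x.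
Proof. by move=> [AB /existsNP[x /not_implyP[Bx Ax]]]; exists x. Qed.

Lemma properI (A B : set R) x : A `<=` B -> B x -> ~ A x -> (A `<` B).
Proof. by move=> AB Bx Ax; split=> // /(_ _ Bx). Qed.

Definition is_unit x := exists y, x * y = 1.

Lemma unit_ideal I x : is_unit x -> I x -> I 1.
Proof. by move=> [y <-]; apply: idealMl. Qed.

Lemma local_sub I J : (forall x, ~ I x -> is_unit x) -> ~ J 1 -> J `<=` I.
Proof. by move=> uI J1 x Jx; apply: contrapT => /uI/unit_ideal/(_ Jx). Qed.

Definition icap (F : ideal R -> Prop) : ideal R.
Proof.
exists [set x | forall J, F J -> J x] => [J _ //|x y Fx Fy J FJ|a x Fx J FJ].
  by apply: idealD; [apply: Fx|apply: Fy].
by apply/idealM/Fx.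
Defined.

Lemma unitM x y : is_unit x -> is_unit y -> is_unit (x * y).
Proof. by move=> [z xz] [w yw]; exists (z * w); rewrite mulrACA xz yw mul1r. Qed.

Definition idealT : ideal R.
Proof. by exists setT. Defined.
Definition izero : ideal R.
Proof.
exists [set x | x = 0] => // [x y -> ->|a x ->]; by rewrite /mkset ?addr0 ?mulr0.
Defined.
Lemma izero_sub I : izero `<=` I. Proof. by move=> x ->. Qed.
Lemma isum0_sub s K : (forall x, x \in s -> K x) -> isum izero (igen s) `<=` K.
Proof. by move=> sK; apply: isum_sub; [apply: izero_sub|apply: igen_sub]. Qed.

End IdealBasics.

#[local] Hint Resolve izero_sub : core.

(** * Noetherian rings: existence of primes, Artin-Rees, Krull intersection, Nakayama *)

Section Noetherian.
Variable R : comPzRingType.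
Hypothesis noeth : noetherian R.
Implicit Types (I J K L P Q : ideal R) (s : seq R) (a b t u x y z : R).

Lemma noeth_fg I : exists s, forall x, I x <-> igen s x.
Proof. by have [s sE] := noeth I; exists s => x; rewrite sE. Qed.

Lemma mono_le (J : nat -> ideal R) (mono : forall n, J n `<=` J n.+1) m n :
  (m <= n)%N -> J m `<=` J n.
Proof. by move=> /subnK <-; elim: (n - m)%N => // k IH x /IH; apply: mono. Qed.

Definition ideal_union (J : nat -> ideal R) (mono : forall n, J n `<=` J n.+1) : ideal R.
Proof.
exists [set x | exists n, J n x].
- by exists 0%N.
- move=> x y [m Jx] [n Jy]; exists (maxn m n).
  by apply: idealD; [apply: (mono_le mono) Jx; apply: leq_maxl|apply: (mono_le mono) Jy; apply: leq_maxr].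
- by move=> a x [n Jx]; exists n; apply: idealM.
Defined.

Lemma acc (J : nat -> ideal R) : (forall n, J n `<=` J n.+1) ->
  exists n, forall m, J m `<=` J n.
Proof.
move=> mono.
have le := mono_le mono.
have [s sE] := noeth_fg (ideal_union mono).
have [n sn] : exists n, forall x, x \in s -> J n x.
  have : forall x, x \in s -> exists n, J n x by move=> x xs; apply: ((sE x).2 (igen_mem xs)).
  elim: s {sE} => [|a s IH] H; first by exists 0%N.
  have [x xs|n Hn] := IH; first by apply: H; rewrite inE xs orbT.
  have [|m Jm] := H a; first by rewrite mem_head.
  exists (maxn m n) => x; rewrite inE => /predU1P[->|/Hn].
    by apply: le Jm; apply: leq_maxl.
  by apply/le/leq_maxr.
by exists n => m x Jx; apply: (igen_sub sn); apply/sE; exists m.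
Qed.

Lemma noeth_max (F : ideal R -> Prop) I : F I ->
  exists J, [/\ F J, I `<=` J & forall K, F K -> J `<=` K -> K `<=` J].
Proof.
move=> FI; apply: contrapT => noJ.
have step J : exists K, F J -> I `<=` J -> [/\ F K, J `<=` K & ~ (K `<=` J)].
  have [FJ|] := pselect (F J); last by exists J.
  have [IJ|] := pselect (I `<=` J); last by exists J.
  apply: contrapT => noK; apply: noJ; exists J; split=> // K FK JK.
  by apply: contrapT => KJ; apply: noK; exists K.
have [f fP] := choice step.
pose J n := iter n f I.
have JP n : F (J n) /\ I `<=` J n.
  elim: n => [|n [FJ IJ]]; first by split.
  by have [F' JK _] := fP _ FJ IJ; split=> //; apply: subset_trans IJ JK.
have [n nP] := @acc J (fun n => let: And3 _ H _ := fP _ (JP n).1 (JP n).2 in H).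
by have [_ _] := fP _ (JP n).1 (JP n).2; apply; apply: nP n.+1.
Qed.

(** An ideal maximal among those above I and disjoint from the multiplicative set S is prime. *)
Lemma prime_avoid (S : set R) I : S 1 -> (forall x y, S x -> S y -> S (x * y)) ->
  (forall x, I x -> ~ S x) ->
  exists P, [/\ is_prime P, I `<=` P & forall x, P x -> ~ S x].
Proof.
move=> S1 SM IS.
have [P [PS IP Pmax]] := @noeth_max (fun J => forall x, J x -> ~ S x) I IS.
exists P; split=> //; split=> [/PS//|x y Pxy]; apply: contrapT => /not_orP[Px Py].
have H z : ~ P z -> exists2 u, S u & iadd1 P z u.
  move=> Pz; apply: contrapT => no; apply: Pz; apply: (Pmax (iadd1 P z)).
  - by move=> u uz Su; apply: no; exists u.
  - exact: iadd1L.
  - exact: iadd1R.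
have [u Su /iadd1P[r [p [Pp ue]]]] := H _ Px; have [v Sv /iadd1P[q [p' [Pp' ve]]]] := H _ Py.
apply: (PS (u * v)); last exact: SM.
rewrite ue ve mulrDl; apply: idealD; first exact: idealMl.
rewrite mulrDr; apply: idealD; first exact: idealM.
by rewrite mulrACA; apply: idealM.
Qed.

Lemma maximal_above I : ~ I 1 -> exists P, [/\ is_prime P, is_maximal P & I `<=` P].
Proof.
move=> I1; have [P [P1 IP Pmax]] := @noeth_max (fun J => ~ J 1) I I1.
have [Q [pQ PQ Q1]] : exists Q, [/\ is_prime Q, P `<=` Q & forall x, Q x -> ~ [set 1] x].
  apply: (@prime_avoid [set 1]) => // [x y|x Px xE].
    by rewrite /set1 /mkset => -> ->; rewrite mulr1.
  by apply: P1; have <- : x = 1 := xE.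
have mP : is_maximal P by split=> [//|J J1 PJ]; exact: Pmax.
exists P; split=> //.
have QP := Pmax _ pQ.1 PQ.
by split=> // x y /PQ /pQ.2 [] /QP; [left|right].
Qed.

Lemma radical_prime I x : (forall P, is_prime P -> I `<=` P -> P x) -> exists n, I (x ^+ n).
Proof.
move=> H; apply: contrapT => no.
have [P [pP IP PS]] : exists P, [/\ is_prime P, I `<=` P & forall y, P y -> ~ [set y | exists n, y = x ^+ n] y].
  apply: prime_avoid => [|y z [m ->] [n ->]|y Iy [n yn]].
  - by exists 0%N.
  - by exists (m + n)%N; rewrite exprD.
  - by apply: no; exists n; rewrite -yn.
by apply: (PS x (H _ pP IP)); exists 1%N; rewrite expr1.
Qed.

Definition min_over P I := [/\ is_prime P, I `<=` P &
  forall Q, is_prime Q -> I `<=` Q -> Q `<=` P -> P `<=` Q].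

(** The localisation of R/I at P has P as its only prime. Otherwise the multiplicative set of all t
    x^n with t outside P misses I, and a prime avoiding it lies below P without containing x. *)
Lemma min_over_nil P I x : min_over P I -> P x -> exists t n, ~ P t /\ I (t * x ^+ n).
Proof.
move=> [pP IP Pmin] Px; apply: contrapT => no.
pose S := [set y | exists t n, ~ P t /\ y = t * x ^+ n].
have [Q [pQ IQ QS]] : exists Q, [/\ is_prime Q, I `<=` Q & forall y, Q y -> ~ S y].
  apply: prime_avoid => [|y z [t [m [Pt ->]]] [u [n [Pu ->]]]|y Iy [t [n [Pt yE]]]].
  - by exists 1, 0%N; split; [case: pP|rewrite mulr1].
  - exists (t * u), (m + n)%N; split; first by case/pP.2.
    by rewrite exprD mulrACA.
  - by apply: no; exists t, n; rewrite -yE.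
have QP : Q `<=` P.
  move=> y Qy; apply: contrapT => Py; apply: (QS _ Qy).
  by exists y, 0%N; rewrite mulr1.
apply: (QS x (Pmin _ pQ IQ QP _ Px)); exists 1, 1%N; split; first by case: pP.
by rewrite mul1r.
Qed.

(** Noetherian induction: a largest counterexample J is not prime, and J + (x), J + (y) with x y in
    J both have such lists. The list stands in for the finite set of minimal primes; it may repeat
    primes or contain nonminimal ones. *)
Lemma prime_prod I : exists ps : seq (ideal R),
  (forall i, (i < size ps)%N -> is_prime (nth I ps i) /\ I `<=` nth I ps i) /\
  forall f : nat -> R, (forall i, (i < size ps)%N -> (nth I ps i) (f i)) ->
    I (\prod_(i < size ps) f i).
Proof.
apply: contrapT => no.
pose bad J := ~ exists ps : seq (ideal R),
  (forall i, (i < size ps)%N -> is_prime (nth I ps i) /\ J `<=` nth I ps i) /\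
  forall f : nat -> R, (forall i, (i < size ps)%N -> (nth I ps i) (f i)) ->
    J (\prod_(i < size ps) f i).
have [J [bJ _ Jmax]] := @noeth_max bad I no.
have good K : J `<` K -> ~ bad K by move=> [JK KJ] bK; apply/KJ/Jmax.
have J1 : ~ J 1 by move=> J1; apply: bJ; exists [::]; split=> // f _; rewrite big_ord0.
have [pJ|] := pselect (is_prime J).
  apply: bJ; exists [:: J]; split=> [[|i]|f H] //=; first by move=> _; split.
  by rewrite big_ord_recl big_ord0 mulr1; apply: (H 0%N).
move=> /not_andP[//|/existsNP[x /existsNP[y /not_implyP[Jxy /not_orP[Jx Jy]]]]].
have /contrapT[ps [psP psM]] := good _ (properI (@iadd1L _ J x) (@iadd1R _ J x) Jx).
have /contrapT[qs [qsP qsM]] := good _ (properI (@iadd1L _ J y) (@iadd1R _ J y) Jy).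
apply: bJ; exists (ps ++ qs); split=> [i|f H].
  rewrite size_cat nth_cat; case: (ltnP i (size ps)) => [li _|li ii].
    by have [? H] := psP _ li; split=> //; apply: subset_trans H; apply: iadd1L.
  have [|? H] := qsP (i - size ps)%N; first by rewrite ltn_subLR.
  by split=> //; apply: subset_trans H; apply: iadd1L.
rewrite size_cat big_split_ord /=.
have /psM/iadd1P[r [j [Jj ->]]] : forall i, (i < size ps)%N -> nth I ps i (f i).
  move=> i li; have := H i; rewrite size_cat nth_cat li; apply; exact: ltn_addr.
have /(qsM (fun i => f (size ps + i)%N))/iadd1P[q [j' [Jj' ->]]] :
    forall i, (i < size qs)%N -> nth I qs i (f (size ps + i)%N).
  move=> i li; have := H (size ps + i)%N; rewrite size_cat nth_cat.
  have -> : (size ps + i < size ps)%N = false by rewrite ltnNge leq_addr.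
  by rewrite addKn ltn_add2l; apply.
rewrite mulrDl; apply: idealD; first exact: idealMl.
rewrite mulrDr; apply: idealD; first exact: idealM.
by rewrite mulrACA; apply: idealM.
Qed.

Lemma prime_prodP P n (f : nat -> R) : is_prime P -> P (\prod_(i < n) f i) ->
  exists2 i, (i < n)%N & P (f i).
Proof.
move=> pP; elim: n => [|n IH]; first by rewrite big_ord0; case: pP.
rewrite big_ord_recr => /pP.2[/IH[i ii Pi]|Pn]; last by exists n.
by exists i => //; apply: ltnW.
Qed.

Lemma prime_contains (ps : seq (ideal R)) I P :
  (forall f : nat -> R, (forall i, (i < size ps)%N -> (nth I ps i) (f i)) ->
    I (\prod_(i < size ps) f i)) -> is_prime P -> I `<=` P ->
  exists2 i, (i < size ps)%N & nth I ps i `<=` P.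
Proof.
move=> psM pP IP; apply: contrapT => no.
have H i : exists x, (i < size ps)%N -> nth I ps i x /\ ~ P x.
  have [li|] := ltnP i (size ps); last by exists 0.
  have : ~ (nth I ps i `<=` P) by move=> H; apply: no; exists i.
  by move=> /existsNP[x /not_implyP[? ?]]; exists x.
have [f fP] := choice H.
have /(prime_prodP pP)[i li Pi] := IP _ (psM f (fun i li => (fP i li).1)).
by case: (fP i li).
Qed.

Lemma min_prime_below I P : is_prime P -> I `<=` P -> exists2 Q, min_over Q I & Q `<=` P.
Proof.
move=> pP IP; have [ps [psP psM]] := prime_prod I.
pose F i := [/\ (i < size ps)%N & nth I ps i `<=` P].
have [i0 li0 i0P] := prime_contains psM pP IP.
(* Among the listed primes inside P, one that contains the fewest listed primes is minimal. *)
pose cnt i := #|[set j : 'I_(size ps) | `[< nth I ps j `<=` nth I ps i >]]%SET|.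
have [i [[li iP] imin]] : exists i, F i /\ forall j, F j -> (cnt i <= cnt j)%N.
  have : exists i, F i by exists i0.
  move=> [i Fi]; have [m] := ubnP (cnt i); elim: m i Fi => // m IH i Fi cm.
  have [H|] := pselect (forall j, F j -> (cnt i <= cnt j)%N); first by exists i.
  move=> /existsNP[j /not_implyP[Fj /negP]]; rewrite -ltnNge => ji.
  by apply: (IH j) => //; apply: leq_trans ji _.
exists (nth I ps i) => //; split; [exact: (psP i li).1|exact: (psP i li).2|].
move=> Q pQ IQ Qi; have [j lj jQ] := prime_contains psM pQ IQ.
suff ij : nth I ps i `<=` nth I ps j by apply: subset_trans ij jQ.
apply: contrapT => nij.
have ji := subset_trans jQ Qi.
have : (cnt j < cnt i)%N.
  apply/proper_card/properP; split.
    apply/fintype.subsetP => l; rewrite !finset.in_set => /asboolP lj'; apply/asboolP => z /lj' jz; exact: ji jz.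
  by exists (Ordinal li); rewrite finset.in_set; [apply/asboolP|apply/asboolPn].
by rewrite ltnNge imin //; split=> //; apply: subset_trans iP.
Qed.

Lemma ipow_fg_nil I J : (forall x, J x -> exists n, I (x ^+ n)) ->
  exists n, ipow J n `<=` I.
Proof.
move=> nil; have [s sE] := noeth_fg J.
have [k kI] : exists k, forall x, x \in s -> I (x ^+ k).
  have : forall x, x \in s -> exists n, I (x ^+ n) by move=> x /igen_mem/sE/nil.
  elim: s {sE} => [|a s IH] H; first by exists 0%N.
  have [x xs|n Hn] := IH; first by apply: H; rewrite inE xs orbT.
  have [|m Jm] := H a; first by rewrite mem_head.
  exists (m + n)%N => x; rewrite inE exprD => /orP[/eqP ->|/Hn xn]; first exact: idealMl.
  exact: idealM.
(* By linearity only monomials in the generators matter; the induction splits off one generator by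
   passing from L to a colon ideal. *)
have gen n (L : ideal R) (e : nat) : (forall m : nat -> nat, (\sum_(i < size s) m i = n)%N ->
    L (\prod_(i < size s) s`_i ^+ m i)) -> ipow J n `<=` L.
  elim: n L => [|n IH] L H.
    have := H (fun=> 0%N); rewrite big1 // big1 => [/(_ erefl) L1 x _|i _]; last by rewrite expr0.
    by rewrite -[x]mulr1; apply: idealM.
  apply: imul_sub => x y /sE/igenP[c ->] yn; rewrite mulr_suml; apply: idealS => i _.
  rewrite -mulrA; apply: idealM; apply: (IH (colon L s`_i)) yn => m mn /=.
  have := H (fun j => m j + (j == i))%N.
  rewrite big_split /= mn (bigD1 i) //= eqxx big1 ?addn0 ?addn1 => [/(_ erefl)|j]; last first.
    by rewrite -val_eqE /= => /negPf ->.
  rewrite (bigD1 i) //= eqxx addn1 exprS -mulrA [X in _ -> L (_ * X)](bigD1 i) //=.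
  rewrite (eq_bigr (fun j : 'I__ => s`_j ^+ m j)) // => j; rewrite -val_eqE /= => /negPf ->.
  by rewrite addn0.
(* Pigeonhole: a monomial of this degree has some exponent at least k. *)
exists (size s * k).+1; apply: gen => // m msum.
have [i ki] : exists i : 'I_(size s), (k <= m i)%N.
  apply: contrapT => no; have : (\sum_(i < size s) m i <= \sum_(i < size s) k)%N.
    apply: leq_sum => i _; rewrite leqNgt; apply/negP => ki; apply: no; exists i; exact: ltnW.
  by rewrite msum sum_nat_const card_ord ltnn.
rewrite (bigD1 i) //= -(subnK ki) exprD -mulrA mulrCA; apply/idealMl/kI.
exact: mem_nth.
Qed.

(* Weak Artin-Rees: choose L maximal with L `&` U = K, then I ^ j lies in L. *)
Lemma artin_rees I U K : K `<=` U -> (forall a x, I a -> U x -> exists m, K (a ^+ m * x)) ->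
  exists j, forall x, ipow I j x -> U x -> K x.
Proof.
move=> KU IUK.
have [L [[KL LU] _ Lmax]] := @noeth_max (fun L => K `<=` L /\ forall x, L x -> U x -> K x) K
  (conj (@subset_refl _ _) (fun x Kx _ => Kx)).
have pow a : I a -> exists n, L (a ^+ n).
  move=> Ia; have [m mP] := @acc (fun m => colon L (a ^+ m))
    (fun n x => ltac:(by move=> /= Lx; rewrite exprS -mulrA; apply: idealM)).
  exists m; apply: (Lmax (iadd1 L (a ^+ m))); last exact: iadd1R.
    split=> [|x /iadd1P[r [l [Ll xE]]] Ux]; first exact: subset_trans KL (@iadd1L _ _ _).
    apply: LU => //; rewrite xE; apply: idealD => //.
    have [e Ke] := IUK _ _ Ia Ux.
    have: colon L (a ^+ (e + m)) r.
      rewrite /= exprD -mulrA (mulrC (a ^+ m)); have := KL _ Ke.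
      by rewrite xE mulrDr => /idealB/(_ (idealM (a ^+ e) Ll)); rewrite addrAC subrr add0r.
    by move/(mP _) => /=; rewrite mulrC.
  exact: iadd1L.
have [j jL] := ipow_fg_nil pow.
by exists j => x /jL Lx Ux; apply: LU.
Qed.

(** Artin-Rees for K + I x inside K + (x) turns the hypothesis into x in K + I x; a unit 1 - r then
    removes the second term. *)
Lemma krull_cap I K x : (forall n, isum (ipow I n) K x) ->
  (forall a, I a -> is_unit (1 - a)) -> K x.
Proof.
move=> xI jac.
pose U := isum K (igen [:: x]).
have [|a y Ia|j jP] := @artin_rees I U (isum K (ideal_mul I U)).
- apply: isum_sub; first exact: isumL.
  by apply: imul_sub => a b _; apply: idealM.
- by move=> Uy; exists 1%N; apply/isumR/imul_mem.
have [a [b [aj Kb xE]]] := xI j.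
have Ux : U x by apply/isumR/igen_mem; rewrite mem_head.
have : isum K (ideal_mul I U) a.
  by apply: jP => //; rewrite -[a](addrK b) -xE; apply: idealB => //; apply: isumL.
move=> [c [d [Kc dIU aE]]].
have [r [k [Ir Kk dE]]] : exists r k, [/\ I r, K k & d = r * x + k].
  have : (isum (ideal_mul I (igen [:: x])) K) d.
    move: d dIU {aE}; apply: imul_sub => p _ Ip [k [_ [Kk /igen1[q ->] ->]]].
    rewrite mulrDr; apply: idealD; first by apply/isumR/idealM.
    by apply/isumL/imul_mem => //; apply/igen1; exists q.
  move=> [p [k [pI Kk ->]]].
  have [r Ir ->] := ideal_mul1 pI.
  by exists r, k.
have [v uv] := jac _ Ir.
suff : K (v * ((1 - r) * x)) by rewrite mulrA (mulrC v) uv mul1r.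
apply: idealM; have -> : (1 - r) * x = c + k + b by rewrite mulrBl mul1r {1}xE aE dE; ring.
by apply: idealD => //; apply: idealD.
Qed.

(** Nakayama for the localisation at P. Finite generation of L lets a single denominator t serve all
    its elements; the induction solves for one generator at a time, its coefficient t - p being
    outside P. *)
Lemma nakayama_at P (pP : is_prime P) K L :
  (forall x, L x -> sat pP (isum K (ideal_mul P L)) x) -> exists2 t, ~ P t & forall x, L x -> K (t * x).
Proof.
move=> H; have [s sE] := noeth_fg L.
suff [t Pt tK] : exists2 t, ~ P t & forall x, igen s x -> K (t * x).
  by exists t => // x /sE; apply: tK.
have {H} : forall x, igen s x -> sat pP (isum K (ideal_mul P (igen s))) x.
  move=> x /sE/H; apply/sat_mono/isum_sub; first exact: isumL.
  by apply: imul_sub => p y Pp /sE ys; apply/isumR/imul_mem.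
elim: s {L sE} => [|a s IH] H.
  by exists 1 => [|x /igen_nil ->]; [exact: (pP.1)|rewrite mulr0].
have mulE x : isum K (ideal_mul P (igen (a :: s))) x ->
    exists p y, [/\ P p, isum K (ideal_mul P (igen s)) y & x = p * a + y].
  move=> [k [z [Kk zP ->]]].
  have [p [y [Pp ys ->]]] : exists p y, [/\ P p, ideal_mul P (igen s) y & z = p * a + y].
    have : isum (ideal_mul P (igen [:: a])) (ideal_mul P (igen s)) z.
      move: z zP; apply: imul_sub => p _ Pp /igen_cons[r [y [sy ->]]].
      rewrite mulrDr; apply: idealD; last by apply/isumR/imul_mem.
      by apply/isumL/imul_mem => //; apply/igen1; exists r.
    move=> [w [y [wP ys ->]]].
    by have [p Pp ->] := ideal_mul1 wP; exists p, y.
  exists p, (y + k); split=> //; last by ring.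
  by apply: idealD; [apply: isumR|apply: isumL].
have [t Pt /mulE[p [y [Pp yK taE]]]] := H a (igen_mem (mem_head _ _)).
have tp : ~ P (t - p) by move=> /idealD/(_ Pp); rewrite subrK.
have tpa : (t - p) * a = y by rewrite mulrBl taE addrAC subrr add0r.
have [|u Pu uK] := IH.
  move=> x sx; have [|v Pv /mulE[q [w [Pq wK vxE]]]] := H x.
    by move: x sx; apply: igen_sub => x xs; apply: igen_mem; rewrite inE xs orbT.
  exists ((t - p) * v); first by case/pP.2.
  rewrite -mulrA vxE mulrDr mulrCA tpa; apply: idealD; exact: idealM.
exists (u * (t - p)) => [|x /igen_cons[r [z [sz ->]]]]; first by case/pP.2.
rewrite mulrDr; apply: idealD; last by rewrite mulrAC; apply/idealMl/uK.
rewrite mulrCA -mulrA tpa; apply: idealM.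
have: isum K (colon K u) y.
  move: y yK {taE tpa}; apply: isum_sub; first exact: isumL.
  by apply: imul_sub => c d _ sd; apply: idealM; apply: isumR; apply: uK.
by move=> [c [d [Kc Kd ->]]]; rewrite mulrDr; apply: idealD => //; apply: idealM.
Qed.

End Noetherian.

(** * Prime avoidance *)

Lemma In_nth (T : Type) (x0 : T) (s : seq T) i : (i < size s)%N -> List.In (nth x0 s i) s.
Proof. by elim: s i => [|a s IH] [|i] //= li; [left|right; apply: IH]. Qed.

Lemma nth_In (T : Type) (x0 : T) (s : seq T) x :
  List.In x s -> exists2 i, (i < size s)%N & nth x0 s i = x.
Proof.
elim: s => [|a s IH] //= [->|/IH[i li ix]]; first by exists 0%N.
by exists i.+1.
Qed.

Section Avoidance.
Variable R : comPzRingType.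
Implicit Types (I J K L P Q : ideal R) (s : seq R) (a b t u x y z : R) (ps : seq (ideal R)).

Lemma prod_outside P n (f : nat -> R) : is_prime P -> (forall i, (i < n)%N -> ~ P (f i)) ->
  ~ P (\prod_(i < n) f i).
Proof.
move=> pP; elim: n => [|n IH] H; first by rewrite big_ord0; case: pP.
by rewrite big_ord_recr => /pP.2[/IH|/H]; apply=> // i li; apply/H/ltnW.
Qed.

(* K is either empty, or a proper ideal that need not be prime. *)
Lemma prime_avoidance (K : set R) (Y : ideal R) J ps :
  (forall a y, ~ K a -> Y y -> ~ K (a + y)) -> (exists2 a, J a & ~ K a) ->
  (forall p, List.In p ps -> [/\ is_prime p, ~ (J `<=` p) & ~ (Y `<=` p)]) ->
  exists a, [/\ J a, ~ K a & forall p, List.In p ps -> ~ p a].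
Proof.
move=> KY [a0 Ja0 Ka0]; have [n] := ubnP (size ps); elim: n ps => // n IH [|p ps] ln H.
  by exists a0; split.
have [[q qs qp]|noq] := pselect (exists2 q, List.In q ps & q `<=` p).
  have [l1 [l2 E]] := List.in_split _ _ qs.
  have [||a [Ja Ka aP]] := IH (p :: l1 ++ l2).
  - by move: ln; rewrite /= E /= !size_cat /= addnS.
  - move=> r /= [<-|/List.in_app_iff rl]; first by apply: H; left.
    by apply: H; right; rewrite E; apply/List.in_app_iff; case: rl; [left|right; right].
  exists a; split=> // r /= [<-|]; first by apply: aP; left.
  rewrite E => /List.in_app_iff[rl|[<-|rl]].
  - by apply: aP; right; apply/List.in_app_iff; left.
  - by move=> /qp; apply: aP; left.
  - by apply: aP; right; apply/List.in_app_iff; right.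
have [||a [Ja Ka aP]] := IH ps; [exact: ln|by move=> r rs; apply: H; right|].
have [pp Jp Yp] := H _ (or_introl erefl).
have [pa|pa] := pselect (p a); last by exists a; split=> // r /= [<-|/aP].
have [f fP] : exists f : nat -> R, forall i, (i < size ps)%N -> nth J ps i (f i) /\ ~ p (f i).
  suff /choice[f fP] : forall i, exists x, (i < size ps)%N -> nth J ps i x /\ ~ p x by exists f.
  move=> i; have [li|] := ltnP i (size ps); last by exists 0.
  have /existsNP[x /not_implyP[? ?]] : ~ (nth J ps i `<=` p).
    by move=> H'; apply: noq; exists (nth J ps i) => //; apply: In_nth.
  by exists x.
have /existsNP[j /not_implyP[Jj pj]] := Jp; have /existsNP[k /not_implyP[Yk pk]] := Yp.
pose y := k * (j * \prod_(i < size ps) f i).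
have py : ~ p y.
  move=> /pp.2[//|/pp.2[//|]]; apply: prod_outside => // i li; exact: (fP i li).2.
have psy r : List.In r ps -> r y.
  move=> /(nth_In J)[i li <-]; apply/idealM/idealM.
  by rewrite (bigD1 (Ordinal li)) //=; apply: idealMl; apply: (fP i li).1.
exists (a + y); split=> [||r /= [<-|rs]].
- by apply: idealD => //; apply/idealM/idealMl.
- by apply: KY => //; apply: idealMl.
- by move=> /idealB/(_ pa); rewrite addrC addKr.
- by move=> /idealB/(_ (psy _ rs)); rewrite addrK; apply: aP.
Qed.

Lemma prime_avoidance0 J ps :
  (forall p, List.In p ps -> is_prime p /\ ~ (J `<=` p)) ->
  exists2 a, J a & forall p, List.In p ps -> ~ p a.
Proof.
move=> H; have [|||a [Ja _ aP]] := @prime_avoidance set0 (idealT R) J ps.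
- by [].
- by exists 0; [|].
- by move=> p /H[pp Jp]; split=> // /(_ 1 I); apply: pp.1.
- by exists a.
Qed.

End Avoidance.

(** * Krull's principal ideal and height theorems *)

Section Heights.
Variable R : comPzRingType.
Hypothesis noeth : noetherian R.
Implicit Types (I J K L P Q : ideal R) (s : seq R) (a b t u x y z : R).

Lemma primes_over I : exists ps : seq (ideal R),
  (forall p, List.In p ps -> is_prime p /\ I `<=` p) /\
  forall Q, is_prime Q -> I `<=` Q -> exists2 p, List.In p ps & p `<=` Q.
Proof.
have [ps [psP psM]] := prime_prod noeth I; exists ps; split.
  by move=> p /(nth_In I)[i li <-]; apply: psP.
move=> Q pQ IQ; have [i li iQ] := prime_contains psM pQ IQ.
by exists (nth I ps i) => //; apply: In_nth.
Qed.

Definition psat P I := forall t x, ~ P t -> I (t * x) -> I x.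

(** The localisation of R/I at P is Artinian: its ideals correspond to the P-saturated ideals above
    I. *)
Definition dcc_at P I := forall J : nat -> ideal R, (forall n, J n.+1 `<=` J n) ->
  (forall n, I `<=` J n) -> (forall n, psat P (J n)) ->
  exists n, forall m, (n <= m)%N -> J n `<=` J m.

Lemma decr_le (J : nat -> ideal R) (mono : forall n, J n.+1 `<=` J n) m n :
  (m <= n)%N -> J n `<=` J m.
Proof. by move=> /subnK <-; elim: (n - m)%N => // k IH x /mono/IH. Qed.

Lemma dcc_mono P I J : I `<=` J -> dcc_at P I -> dcc_at P J.
Proof. by move=> IJ H F dF JF; apply: H => // n x /IJ/JF. Qed.

(** Since P a lies in I, the quotient of I + (a) by I has length at most one at P. Once a has left
    the chain, stationarity modulo a implies stationarity. *)
Lemma dcc_step P I a : is_prime P -> (forall p, P p -> I (p * a)) ->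
  dcc_at P (iadd1 I a) -> dcc_at P I.
Proof.
move=> pP Pa H J dJ IJ sJ.
pose J' n := sat pP (iadd1 (J n) a).
have [|||n nP] := H J'.
- move=> n; apply/sat_mono/iadd1_sub; last exact: iadd1R.
  by move=> x /dJ; apply: iadd1L.
- move=> n x xI; apply: sat_sub; apply: iadd1_sub xI; last exact: iadd1R.
  by move=> y /(IJ n); apply: iadd1L.
- by move=> n t x Pt /sat_sat; apply.
have [allJ|/existsNP[k kP]] := pselect (forall n, J n a).
  exists n => m nm x Jx; have [|t Pt] := nP _ nm x; first exact/sat_sub/iadd1L.
  by move=> tx; apply: (sJ m t) => //; apply: (iadd1_sub (@subset_refl _ _) (allJ m)).
exists (maxn n k) => m; rewrite geq_max => /andP[nm km] x Jx.
have [|t Pt /iadd1P[r [y [Jy txE]]]] := nP _ nm x.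
  by apply/sat_sub/iadd1L; apply: (decr_le dJ) Jx; apply: leq_maxl.
apply: (sJ m t) => //; rewrite txE; apply: idealD => //.
have [Pr|Pr] := pselect (P r); first by apply: IJ; apply: Pa.
exfalso; apply: kP; apply: (decr_le dJ (leq_maxr n k)).
apply: (sJ _ r) => //; have -> : r * a = t * x - y by rewrite txE addrAC subrr add0r.
apply: idealB; first exact: idealM.
by apply: (decr_le dJ) Jy; rewrite geq_max nm km.
Qed.

Lemma dcc_seq P I s : is_prime P -> (forall a p, a \in s -> P p -> I (p * a)) ->
  dcc_at P (isum I (igen s)) -> dcc_at P I.
Proof.
move=> pP; elim: s I => [|a s IH] I Ps H.
  by apply: dcc_mono H; apply: isum_sub => // x /igen_nil ->.
apply: (@dcc_step _ _ a) => // [p|]; first by apply: Ps; rewrite mem_head.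
apply: IH => [b p bs Pp|]; first by apply/iadd1L/Ps => //; rewrite inE bs orbT.
apply: dcc_mono H; apply: isum_sub => [x Ix|x /igen_cons[r [y [sy ->]]]].
  exact/isumL/iadd1L.
by apply: idealD; [apply/isumL/idealM/iadd1R|apply: isumR].
Qed.

Lemma dcc_pow P I k : is_prime P -> ipow P k `<=` I -> dcc_at P I.
Proof.
move=> pP kI; suff : dcc_at P (isum I (ipow P k)).
  by apply/dcc_mono/isum_sub.
elim: k {kI} => [|k IH].
  move=> J dJ IJ sJ; exists 0%N => m _ x _; rewrite -[x]mulr1; apply: idealM.
  by apply/IJ/isumR/ipow0.
have [s sE] := noeth_fg noeth (ipow P k).
apply: (@dcc_seq _ _ s) => // [a p as_ Pp|].
  by apply/isumR/ipowS => //; apply/sE/igen_mem.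
apply: dcc_mono IH; apply: isum_sub => [x Ix|x /sE]; first exact/isumL/isumL.
exact: isumR.
Qed.

(** Krull's principal ideal theorem modulo Q0. The symbolic powers [S n] of Q become stationary
    modulo a, because R/(Q0, a) is Artinian at P; Nakayama at P removes a, and Nakayama at Q turns
    the equality of [S n] and [S n.+1] into Q^n inside Q0 up to a factor outside Q. The element y
    witnesses that Q differs from P. *)
Lemma pit Q0 Q P a y : is_prime Q0 -> is_prime Q -> Q0 `<=` Q -> Q `<=` P -> P y -> ~ Q y ->
  min_over P (iadd1 Q0 a) -> Q `<=` Q0.
Proof.
move=> pQ0 pQ Q0Q QP Py Qy mP; have [pP aP Pmin] := mP.
have Qa : ~ Q a.
  move=> Qa; apply: Qy; apply: (Pmin Q) => //; exact: iadd1_sub.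
pose S n := sat pQ (isum Q0 (ipow Q n)).
have dS n : S n.+1 `<=` S n.
  apply/sat_mono/isum_sub => [x|x /ipowS_sub]; [exact: isumL|exact: isumR].
pose J n := sat pP (iadd1 (S n) a).
have [k kI] : exists k, ipow P k `<=` sat pP (iadd1 Q0 a).
  apply: ipow_fg_nil => // x /(min_over_nil noeth mP)[t [n [Pt tx]]].
  by exists n; exists t.
have [|||n nP] := dcc_pow pP kI (J := J).
- move=> n; apply: sat_mono; apply: iadd1_sub; last exact: iadd1R.
  by move=> x /dS; apply: iadd1L.
- move=> n; apply/sat_mono/iadd1_sub; last exact: iadd1R.
  by move=> x Qx; apply/iadd1L/sat_sub/isumL.
- by move=> n t x Pt /sat_sat; apply.
have SS : S n `<=` S n.+1.
  have [|t Pt tS] := @nakayama_at _ noeth _ pP (S n.+1) (S n).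
    move=> x Sx; have [|t Pt /iadd1P[r [z [Sz tE]]]] := nP n.+1 (leqnSn n) x.
      exact/sat_sub/iadd1L.
    exists t => //; rewrite tE; apply: idealD; first exact: isumL.
    apply: isumR; rewrite mulrC; apply: imul_mem; first by apply/aP/iadd1R.
    apply: (@sat_sat _ _ pQ _ a) => //.
    have -> : a * r = t * x - z by rewrite tE mulrC addrAC subrr add0r.
    by apply: idealB; [apply: idealM|apply: dS].
  by move=> x Sx; apply: (@sat_sat _ _ pQ _ t) (tS x Sx) => /QP.
have [|u Qu uQ] := @nakayama_at _ noeth _ pQ Q0 (ipow Q n).
  move=> x xn; exact/SS/sat_sub/isumR.
move=> x Qx; have := uQ _ (ipowX n Qx).
by move=> /pQ0.2[/Q0Q//|]; apply: prime_exp.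
Qed.

(** The height of P/I is at least d. Heights are handled through such lower bounds and their
    negations, so that no supremum has to be formed. *)
Definition ht_ge I P d := exists2 c : nat -> Spec R,
  prime_chain d c & I `<=` c 0%N /\ ideal_set (c d) = P.

Lemma ht_ge_prime I P d : ht_ge I P d -> is_prime P.
Proof. by move=> [c _ [_ cP]]; have <- := ideal_eq cP; apply: Defs.primeP. Qed.

Lemma ht_ge0 I P : is_prime P -> I `<=` P -> ht_ge I P 0.
Proof. by move=> pP IP; exists (fun=> PrimeIdeal pP). Qed.

Lemma ht_geS I P Q d : is_prime Q -> ht_ge I P d -> P `<` Q -> ht_ge I Q d.+1.
Proof.
move=> pQ [c cd [cI cP]] PQ; exists (fun i => if (i <= d)%N then c i else PrimeIdeal pQ).
  move=> i; rewrite ltnS => id; rewrite id; move: id.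
  rewrite leq_eqVlt => /orP[/eqP ->|id]; first by rewrite ltnn cP.
  by rewrite id; apply: cd.
by rewrite ltnn.
Qed.

Lemma ht_ge1 P Q : is_prime P -> is_prime Q -> P `<` Q -> ht_ge P Q 1.
Proof. by move=> pP pQ; apply/ht_geS/ht_ge0. Qed.

Lemma ht_ge_cat I P Q d e : ht_ge I P d -> ht_ge P Q e -> ht_ge I Q (d + e).
Proof.
move=> Pd; elim: e Q => [|e IH] Q [c cd [cP cQ]].
  have PQ : P `<=` Q by rewrite -cQ.
  have pQ : is_prime Q by have <- := ideal_eq cQ; apply: Defs.primeP.
  (* For e = 0 the primes P and Q may still differ; then the last member of the chain is moved up
     from P to Q. *)
  rewrite addn0; have [QP|QP] := pselect (Q `<=` P).
    by have -> : Q = P by apply/ideal_eq/seteqP.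
  have [c' cd' [cI' cP']] := Pd.
  exists (fun i => if (i < d)%N then c' i else PrimeIdeal pQ); last first.
    by rewrite ltnn; split=> //; case: d cI' cP' {Pd cd'} => [cI' cP'|//] x /cI'; rewrite cP'; apply: PQ.
  move=> i id /=; rewrite id; case: ltnP => [|di]; first by move=> id'; apply: cd'.
  have [ciP Pci] := cd' i id; have E : i.+1 = d by apply/eqP; rewrite eqn_leq id di.
  rewrite E cP' in ciP Pci; split=> [x /ciP/PQ//|H].
  by apply: Pci => x /PQ/H.
rewrite addnS; apply: (@ht_geS _ (c e)); first by have <- := ideal_eq cQ; apply: Defs.primeP.
  by apply: IH; exists c => // i ie; apply/cd/ltnW.
by rewrite -cQ; apply: cd.
Qed.

Lemma ht_ge_sub I P Q d : is_prime Q -> ht_ge I P d -> P `<=` Q -> ht_ge I Q d.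
Proof. by move=> pQ Pd PQ; rewrite -[d]addn0; apply: ht_ge_cat Pd (ht_ge0 pQ PQ). Qed.

Lemma ht_ge_I I P d : ht_ge I P d -> I `<=` P.
Proof.
move=> [c cd [cI <-]]; apply: (subset_trans cI).
elim: d cd => [_ x //|d IH cd x c0]; have [H _] := cd d (ltnSn d); apply: H.
by apply: IH c0 => i id; apply/cd/ltnW.
Qed.

Lemma ht_ge_pred I P d : ht_ge I P d.+1 -> exists2 Q, ht_ge I Q d & Q `<` P.
Proof.
move=> [c cd [cI <-]]; exists (c d); last exact: cd.
by exists c => // i id; apply/cd/ltnW.
Qed.

Lemma ht_ge_le I P d e : (e <= d)%N -> ht_ge I P d -> ht_ge I P e.
Proof.
move=> /subnK <-; elim: (d - e)%N => // k IH.
rewrite addSn => H; apply: IH; have [Q Qd QP] := ht_ge_pred H.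
by apply: (ht_ge_sub (ht_ge_prime H) Qd); case: QP.
Qed.

Lemma ht_ge_mono I J P d : I `<=` J -> ht_ge J P d -> ht_ge I P d.
Proof. by move=> IJ [c cd [cJ cP]]; exists c => //; split=> // x /IJ/cJ. Qed.

(** Choose Q maximal among the primes strictly below P that contain the chain below P. Some
    generator a misses Q, so P is minimal over Q + (a). Up to powers and factors outside P, the
    other generators can be replaced modulo a by elements of Q, and [pit] makes Q minimal over I and
    these. *)
Lemma height_le I s P d : min_over P (isum I (igen s)) -> ht_ge I P d -> (d <= size s)%N.
Proof.
have [n] := ubnP (size s); elim: n s P d => // n IH s P [|d] // sn mP hP.
have [pP sP Pmin] := mP.
have [Q0 hQ0 Q0P] := ht_ge_pred hP.
have [Q [[pQ QP nPQ] Q0Q Qmax]] := noeth_max noeth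
  (F := fun Q => [/\ is_prime Q, Q `<=` P & ~ (P `<=` Q)])
  (And3 (ht_ge_prime hQ0) Q0P.1 Q0P.2).
have hQ := ht_ge_sub pQ hQ0 Q0Q.
have IQ := ht_ge_I hQ.
have [a as_ Qa] : exists2 a, a \in s & ~ Q a.
  apply: contrapT => no; apply/nPQ/Pmin => //; apply: isum_sub => //.
  by apply: igen_sub => x xs; apply: contrapT => Qx; apply: no; exists x.
have mPQ : min_over P (iadd1 Q a).
  split=> // [|Q' pQ' QQ' Q'P]; first by apply: iadd1_sub => //; apply/sP/isumR/igen_mem.
  apply: contrapT => PQ'; apply: Qa; apply: (Qmax Q'); last by apply/QQ'/iadd1R.
    by split.
  by move=> x Qx; apply/QQ'/iadd1L.
have /choice[g gP] : forall b, exists q, P b -> exists t k r, [/\ ~ P t, t * b ^+ k = q + r * a & Q q].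
  move=> b; have [Pb|] := pselect (P b); last by exists 0.
  have [t [k [Pt /iadd1P[r [q [Qq E]]]]]] := min_over_nil noeth mPQ Pb.
  by exists q => _; exists t, k, r.
have [s1 [s2 sE]] : exists s1 s2, s = s1 ++ a :: s2 by case/splitPr: as_ => s1 s2; exists s1, s2.
have mQ : min_over Q (isum I (igen (map g (s1 ++ s2)))).
  have inP b : b \in s1 ++ s2 -> P b.
    move=> bs; apply/sP/isumR/igen_mem; rewrite sE; move: bs; rewrite !mem_cat inE.
    by case/orP=> ->; rewrite ?orbT.
  split=> // [|Q1 pQ1 gQ1 Q1Q].
    by apply: isum_sub => //; apply: igen_sub => _ /mapP[b /inP/gP[t [k [r [_ _ Qq]]]] ->].
  have [y Py Qy] : exists2 y, P y & ~ Q y.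
    by apply: contrapT => no; apply: nPQ => x Px; apply: contrapT => Qx; apply: no; exists x.
  apply: (@pit Q1 Q P a y) => //; split=> //.
    by apply: iadd1_sub => [x /Q1Q/QP//|]; apply/sP/isumR/igen_mem.
  move=> Q2 pQ2 Q12 Q2P; apply: Pmin => //; apply: isum_sub.
    by move=> x Ix; apply/Q12/iadd1L/gQ1/isumL.
  apply: igen_sub => b bs.
  have [->|ba] := eqVneq b a; first by apply/Q12/iadd1R.
  have bs' : b \in s1 ++ s2.
    by move: bs; rewrite sE !mem_cat inE (negPf ba).
  have [t [k [r [Pt E _]]]] := gP _ (inP _ bs').
  have : Q2 (t * b ^+ k).
    rewrite E; apply: idealD; last by apply/idealM/Q12/iadd1R.
    by apply/Q12/iadd1L/gQ1/isumR/igen_mem/map_f.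
  by move=> /pQ2.2[/Q2P//|]; apply: prime_exp.
have := IH _ Q d _ mQ hQ; rewrite size_map size_cat sE size_cat /= addnS ltnS; apply.
by move: sn; rewrite sE !size_cat /= addnS ltnS.
Qed.

(** Parameters are added one by one, each avoiding the primes of a finite list that do not contain
    P. *)
Lemma height_params I P r : is_prime P -> I `<=` P -> ~ ht_ge I P r.+1 ->
  exists s, [/\ (size s <= r)%N, forall x, x \in s -> P x & min_over P (isum I (igen s))].
Proof.
move=> pP IP nP.
(* Either P is already minimal over I and fewer than i elements, or every minimal prime of I + (s)
   below P has height at least i over I. The second alternative is impossible for i = r + 1. *)
have : forall i, (exists s, [/\ (size s < i)%N, forall x, x \in s -> P x & min_over P (isum I (igen s))]) \/
  exists s, [/\ size s = i, forall x, x \in s -> P x &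
    forall Q, min_over Q (isum I (igen s)) -> Q `<=` P -> ht_ge I Q i].
  elim=> [|i [[s [ls sP sM]]|[s [ls sP sM]]]].
  - right; exists [::]; split=> // Q [pQ IQ _] _; apply: ht_ge0 => // x Ix; exact/IQ/isumL.
  - by left; exists s; split=> //; apply: ltnW.
  have [mP|nmP] := pselect (min_over P (isum I (igen s))); first by left; exists s; rewrite ls; split.
  right; have [ps [psP psM]] := primes_over (isum I (igen s)).
  have [qs qsE] : exists qs, forall p, List.In p qs <-> List.In p ps /\ ~ (P `<=` p).
    elim: ps {psP psM} => [|p ps [qs qsE]]; first by exists [::] => p /=; tauto.
    have [Pp|Pp] := pselect (P `<=` p).
      by exists qs => q; rewrite qsE /=; split=> [[? ?]|[[<-|?] ?]]; tauto.
    exists (p :: qs) => q /=; rewrite qsE; split=> [[<-|[? ?]]|[[<-|?] ?]]; tauto.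
  have [|a Pa aP] := @prime_avoidance0 _ P qs.
    by move=> p /qsE[pps Pp]; split=> //; case: (psP _ pps).
  exists (a :: s); split=> [|x|Q mQ QP]; first by rewrite /= ls.
    by rewrite inE => /predU1P[->|/sP].
  have [pQ asQ _] := mQ.
  have sQ : isum I (igen s) `<=` Q.
    apply: isum_sub => [x Ix|]; first exact/asQ/isumL.
    by apply: igen_sub => x xs; apply/asQ/isumR/igen_mem; rewrite inE xs orbT.
  have [Q' mQ' Q'Q] := min_prime_below noeth pQ sQ.
  have Q'P : Q' `<=` P by move=> x /Q'Q/QP.
  apply: (ht_geS pQ (sM _ mQ' Q'P)); apply: (@properI _ _ _ a) => //.
    by apply/asQ/isumR/igen_mem; rewrite mem_head.
  have [pQ' sQ' Q'min] := mQ'.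
  have [p pps pQ'0] := psM _ pQ' sQ'.
  have [pp sp] := psP _ pps.
  have Q'p := Q'min _ pp sp pQ'0.
  have [Pp|Pp] := pselect (P `<=` p).
    exfalso; apply: nmP; split=> // [|Q1 pQ1 sQ1 Q1P]; first by apply: isum_sub => //; apply: igen_sub.
    move=> x /Pp/pQ'0; apply: Q'min => // z /Q1P/Pp/pQ'0 //.
  by move=> /Q'p; apply/aP/qsE.
move=> /(_ r.+1)[[s [ls sP sM]]|[s [ls sP sM]]]; first by exists s; split.
have [Q mQ QP] := min_prime_below noeth pP (isum_sub IP (igen_sub sP)).
by case: nP; apply: ht_ge_sub (sM _ mQ QP) QP.
Qed.

End Heights.

(** * Regularity of localisations, expressed inside the ring *)

Section Regular.
Variable R : comPzRingType.
Hypothesis noeth : noetherian R.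
Implicit Types (I J K L P Q : ideal R) (s : seq R) (a b t u x y z : R).

Definition nzd I x := forall y, I (x * y) -> I y.

(* The local ring of R/I at P is regular of dimension d. *)
Definition regat I P d := is_prime P /\ exists s, [/\ size s = d, forall x, x \in s -> P x,
  forall x, P x -> exists2 t, ~ P t & isum I (igen s) (t * x) & ht_ge I P d].

Lemma min_over_local I P s : is_prime P -> I `<=` P -> (forall x, x \in s -> P x) ->
  (forall x, P x -> exists2 t, ~ P t & isum I (igen s) (t * x)) -> min_over P (isum I (igen s)).
Proof.
move=> pP IP sP H; split=> // [|Q pQ IsQ QP x Px]; first by apply: isum_sub => //; apply: igen_sub.
by have [t Pt /IsQ/pQ.2[/QP//|]] := H _ Px.
Qed.

Lemma isum_iadd1 I a s x : isum (iadd1 I a) (igen s) x <-> isum I (igen (a :: s)) x.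
Proof.
split; last move=> [i [y [Ii /igen_cons[r [z [sz ->]]] ->]]].
  apply: isum_sub; first (apply: iadd1_sub => [y|]; first exact: isumL).
    by apply/isumR/igen_mem; rewrite mem_head.
  by apply: igen_sub => y ys; apply/isumR/igen_mem; rewrite inE ys orbT.
by rewrite addrA; apply: idealD; [apply/isumL/iadd1P; exists r, i|apply: isumR].
Qed.

Lemma isum_mono I I' J J' : I `<=` I' -> J `<=` J' -> isum I J `<=` isum I' J'.
Proof. by move=> II JJ; apply: isum_sub => x => [/II|/JJ]; [apply: isumL|apply: isumR]. Qed.

(** Parameters for P modulo x, together with x, are parameters for P modulo I. *)
Lemma dim_quot I P d x : ht_ge I P d.+1 -> P x -> ht_ge (iadd1 I x) P d.
Proof.
move=> hP Px; have pP := ht_ge_prime hP; have IP := ht_ge_I hP.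
have IxP : iadd1 I x `<=` P by apply: iadd1_sub.
case: d hP => [|d] hP; first exact: ht_ge0.
apply: contrapT => /(height_params noeth pP IxP)[s [ls sP [_ sIP mP]]].
suff mP' : min_over P (isum I (igen (x :: s))).
  by have := height_le noeth mP' hP; rewrite ltnNge /= ltnS ls.
split=> // [z /isum_iadd1/sIP//|Q pQ IQ QP].
by apply: mP => // z /isum_iadd1/IQ.
Qed.

Lemma ht_ge_nzd I P d x : nzd I x -> ht_ge (iadd1 I x) P d -> ht_ge I P d.+1.
Proof.
move=> nx [c cd [cI cP]].
have [Q mQ Qc] := min_prime_below noeth (Defs.primeP (c 0%N)) (fun z Iz => cI z (iadd1L x Iz)).
have [pQ IQ _] := mQ.
have Qx : ~ Q x.
  move=> /(min_over_nil noeth mQ)[t [n [Qt]]]; apply: contra_not Qt.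
  by elim: n => [|n IH]; rewrite ?mulr1 ?exprS 1?mulrCA; [apply: IQ|move=> /nx].
have Qc0 : Q `<` c 0%N by apply: (@properI _ _ _ x) => //; apply/cI/iadd1R.
have h0 : ht_ge I (c 0%N) 1.
  by apply: ht_geS (ht_ge0 pQ IQ) Qc0; apply: Defs.primeP.
by rewrite -add1n; apply: (ht_ge_cat h0); exists c => //; split=> // z.
Qed.

Lemma regat_ht I P d e : regat I P d -> ht_ge I P e -> (e <= d)%N.
Proof.
move=> [pP [s [<- sP sg hd]]] he; apply: height_le he => //.
exact: (min_over_local pP (ht_ge_I hd) sP sg).
Qed.

(** Steinitz exchange in P/P^2: an element outside P^2 has a coefficient outside P on some generator
    a, which it can therefore replace. *)
Lemma exchange I P s x : is_prime P -> (forall y, y \in s -> P y) -> isum I (igen s) x ->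
  ~ isum I (ideal_mul P P) x -> exists s1 a s2, s = s1 ++ a :: s2 /\
    exists2 t, ~ P t & isum (iadd1 I x) (igen (s1 ++ s2)) (t * a).
Proof.
move=> pP; elim: s x => [|a s IH] x sP [i [y [Ii sy xE]]] nx.
  by case: nx; rewrite xE ((igen_nil y).1 sy) addr0; apply: isumL.
have [r [z [sz yE]]] := (igen_cons _ _ _).1 sy.
have [Pr|Pr] := pselect (P r); last first.
  exists [::], a, s; split=> //; exists r => //.
  have -> : r * a = (x - i) - z by rewrite xE yE; ring.
  apply: idealB; last exact: isumR.
  by apply/isumL/idealB; [apply: iadd1R|apply: iadd1L].
have sP' b : b \in s -> P b by move=> bs; apply: sP; rewrite inE bs orbT.
have [||s1 [b [s2 [sE [t Pt tb]]]]] := IH (i + z) sP'.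
- by exists i, z.
- move=> [j [w [Ij Pw E]]]; apply: nx; exists j, (r * a + w); split=> //.
    by apply: idealD => //; apply: imul_mem => //; apply: sP; rewrite mem_head.
  by rewrite xE yE addrCA E addrCA.
exists (a :: s1), b, s2; split; first by rewrite sE.
exists t => //; move: tb; apply: isum_sub; last first.
  by apply: igen_sub => c cs; apply/isumR/igen_mem; rewrite inE cs orbT.
apply: iadd1_sub => [c Ic|]; first exact/isumL/iadd1L.
have -> : i + z = x - r * a by rewrite xE yE; ring.
apply: idealB; first exact/isumL/iadd1R.
by apply/isumR/idealM/igen_mem; rewrite mem_head.
Qed.

Lemma regat_quot I P d x : regat I P d.+1 -> P x ->
  (forall t, ~ P t -> ~ isum I (ideal_mul P P) (t * x)) -> regat (iadd1 I x) P d.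
Proof.
move=> [pP [s [ls sP sg hd]]] Px nx.
have [t Pt tx] := sg _ Px.
have [s1 [a [s2 [sE [u Pu ua]]]]] := exchange pP sP tx (nx t Pt).
have s12 y : y \in s1 ++ s2 -> y \in s.
  by rewrite sE !mem_cat inE => /orP[->|->]; rewrite ?orbT.
split=> //; exists (s1 ++ s2); split.
- by move: ls; rewrite sE !size_cat /= addnS => -[].
- by move=> y /s12/sP.
- move=> y Py; have [v Pv vy] := sg _ Py; exists (u * v); first by case/pP.2.
  rewrite -mulrA; move: (v * y) vy.
  change (isum I (igen s) `<=` colon (isum (iadd1 I x) (igen (s1 ++ s2))) u); apply: isum_sub.
    by move=> z Iz; have H : isum (iadd1 I x) (igen (s1 ++ s2)) (u * z) by apply/idealM/isumL/iadd1L.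
  apply: igen_sub => z; rewrite sE mem_cat inE => zs.
  suff : isum (iadd1 I x) (igen (s1 ++ s2)) (u * z) by [].
  have [->|za] := eqVneq z a; last first.
    by apply/idealM/isumR/igen_mem; move: zs; rewrite (negPf za) mem_cat.
  move: ua; apply: isum_mono => // w; apply: iadd1_sub => [y'|]; first exact: iadd1L.
  by apply/idealM/iadd1R.
exact: dim_quot.
Qed.

Lemma filter_In (ps : seq (ideal R)) (F : ideal R -> Prop) :
  exists qs, forall p, List.In p qs <-> List.In p ps /\ F p.
Proof.
elim: ps => [|p ps [qs qsE]]; first by exists [::] => p /=; tauto.
have [Fp|Fp] := pselect (F p).
  by exists (p :: qs) => q /=; rewrite qsE; split=> [[<-|[? ?]]|[[<-|?] ?]]; tauto.
by exists qs => q; rewrite qsE /=; split=> [[? ?]|[[<-|?] ?]]; tauto.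
Qed.

Lemma regat_notmin I P d : regat I P d.+1 -> ~ min_over P I.
Proof.
move=> [pP [s [_ _ _ hd]]] mP; suff : min_over P (isum I (igen [::])).
  by move=> /(height_le noeth)/(_ hd).
have E z : isum I (igen [::]) z <-> I z.
  split; last exact: isumL.
  by apply: isum_sub => // w /igen_nil ->.
have [_ IP Pm] := mP; split=> // [z /E/IP//|Q pQ IQ]; apply: Pm => // z /E/IQ //.
Qed.

(** Prime avoidance in which one excluded set is I + P^2 localised, an ideal that need not be prime.
    It differs from P by Nakayama, because P is not minimal over I. *)
Lemma regat_param I P d : regat I P d.+1 ->
  exists x, [/\ P x, forall t, ~ P t -> ~ isum I (ideal_mul P P) (t * x) &
    forall Q, min_over Q I -> Q `<=` P -> ~ Q x].
Proof.
move=> rP; have nmP := regat_notmin rP; have [pP [s [_ _ _ hd]]] := rP.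
have IP := ht_ge_I hd.
pose K := sat pP (isum I (ideal_mul P P)).
have PP y : P y -> ideal_mul P P (y * y) by move=> Py; apply: imul_mem.
have [x0 Px0 Kx0] : exists2 x, P x & ~ K x.
  apply: contrapT => no; have [|t Pt tP] := @nakayama_at _ noeth _ pP I P.
    by move=> x Px; apply: contrapT => Kx; apply: no; exists x.
  apply: nmP; split=> // Q pQ IQ QP x Px.
  by have /IQ/pQ.2[/QP//|] := tP _ Px.
have [ps [psP psM]] := primes_over noeth I.
have [qs qsE] := filter_In ps (fun p => ~ (P `<=` p)).
have [|||x [Px Kx xqs]] := @prime_avoidance _ K K P qs.
- by move=> a y Ka Ky /idealB/(_ Ky); rewrite addrK.
- by exists x0.
- move=> p /qsE[pps Pp]; have [pp _] := psP _ pps; split=> // Kp; apply: Pp => y Py.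
  by have /Kp/pp.2[] : K (y * y) by apply/sat_sub/isumR/PP.
exists x; split=> // [t Pt tx|Q mQ QP Qx]; first by apply: Kx; exists t.
have [pQ IQ Qm] := mQ; have [p pps pQ'] := psM _ pQ IQ; have [pp Ip] := psP _ pps.
have Qp := Qm _ pp Ip pQ'.
apply: (xqs p) (Qp _ Qx); apply/qsE; split=> // Pp; apply: nmP; split=> // Q1 pQ1 IQ1 Q1P y Py.
apply: (Qm Q1) => // [z /Q1P/Pp/pQ'//|]; exact/pQ'/Pp.
Qed.

(** Regular local rings are domains. By induction the quotient by a parameter x is one; a minimal
    prime q inside its kernel misses x, so q = x q locally, and Nakayama kills q. *)
Lemma regat_sat_prime I P d (pP : is_prime P) : regat I P d -> is_prime (sat pP I).
Proof.
elim: d I => [|d IH] I rP.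
  have [_ [s [/size0nil -> _ sg hd]]] := rP; have IP := ht_ge_I hd.
  have E x : sat pP I x <-> P x.
    split=> [[t Pt /IP/pP.2[]//]|/sg[t Pt [i [y [Ii /igen_nil y0 E]]]]]; exists t => //.
    by rewrite E y0 addr0.
  by split=> [/E/pP.1//|x y /E/pP.2[/E|/E]]; [left|right].
have [x [Px nx xmin]] := regat_param rP.
have [_ [s [_ _ _ hd]]] := rP; have IP := ht_ge_I hd.
have := IH _ (regat_quot rP Px nx); set S := sat pP _ => pS.
have IS : I `<=` S by move=> y Iy; apply/sat_sub/iadd1L.
have SP : S `<=` P by move=> y [t Pt /(iadd1_sub IP Px)/pP.2[]].
have [q mq qS] := min_prime_below noeth pS IS.
have [pq Iq _] := mq.
have qP : q `<=` P by move=> y /qS/SP.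
have qx := xmin _ mq qP.
have [|t Pt tq] := @nakayama_at _ noeth _ pP I q.
  move=> y qy; have [t Pt /iadd1P[r [i [Ii E]]]] := qS _ qy; exists t => //.
  rewrite E; apply: idealD; first exact: isumL.
  apply: isumR; rewrite mulrC; apply: imul_mem => //.
  have /pq.2[//|//] : q (r * x).
  have -> : r * x = t * y - i by rewrite E addrAC subrr add0r.
  by apply: idealB; [apply: idealM|apply: Iq].
have E y : sat pP I y <-> q y.
  split=> [[u Pu /Iq/pq.2[/qP//|//]]|qy]; exists t => //; exact: tq.
by split=> [/E/pq.1//|y z /E/pq.2[/E|/E]]; [left|right].
Qed.

Lemma regat_nzd I P d x : P x -> nzd I x -> regat (iadd1 I x) P d -> regat I P d.+1.
Proof.
move=> Px nx [pP [s [ls sP sg hd]]]; split=> //; exists (x :: s); split.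
- by rewrite /= ls.
- by move=> y; rewrite inE => /predU1P[->|/sP].
- by move=> y /sg[t Pt /isum_iadd1 ty]; exists t.
- exact: ht_ge_nzd nx hd.
Qed.

(** Here f is a common denominator expressing P through its local parameters. Away from f,
    parameters of P followed by parameters of Q/P are parameters of Q. *)
Lemma regat_ext I P r : regat I P r ->
  exists2 f, ~ P f & forall Q d, ~ Q f -> regat P Q d -> regat I Q (r + d).
Proof.
move=> [pP [s [ls sP sg hr]]].
have [|f Pf fP] := @nakayama_at _ noeth _ pP (isum I (igen s)) P.
  by move=> x /sg[t Pt tx]; exists t => //; apply: isumL.
exists f => // Q d Qf [pQ [s' [ls' sQ sg' hd]]]; have PQ := ht_ge_I hd.
split=> //; exists (s ++ s'); split; last exact: ht_ge_cat hr hd.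
- by rewrite size_cat ls ls'.
- by move=> x; rewrite mem_cat => /orP[/sP/PQ|/sQ].
- move=> x Qx; have [t Qt [p [y [Pp sy E]]]] := sg' _ Qx; exists (f * t); first by case/pQ.2.
  rewrite -mulrA E mulrDr; apply: idealD; last first.
    apply/isumR/idealM; move: y sy {E}; apply: igen_sub => z zs; apply: igen_mem.
    by rewrite mem_cat zs orbT.
  move: (fP _ Pp); apply: isum_mono => //; apply: igen_sub => z zs; apply: igen_mem.
  by rewrite mem_cat zs.
Qed.

End Regular.

(** * Depth, and the dimension formula in regular local rings *)

Section CohenMacaulay.
Variable R : comPzRingType.
Hypothesis noeth : noetherian R.
Variables (M : ideal R) (pM : is_prime M).
Implicit Types (I J K L P Q : ideal R) (s : seq R) (a b t u v w x y z : R).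

(** Saturating after each element of a regular sequence keeps every ideal in sight an ideal of the
    localisation at M. *)
Definition nx I x := sat pM (iadd1 I x).

Lemma nx_psat I x : psat M (nx I x).
Proof. by move=> t y Mt /sat_sat; apply. Qed.

Lemma nxL I x y : I y -> nx I x y.
Proof. by move=> Iy; apply/sat_sub/iadd1L. Qed.

Lemma nxR I x : nx I x x.
Proof. exact/sat_sub/iadd1R. Qed.

Lemma nx_sub I x J : psat M J -> I `<=` J -> J x -> nx I x `<=` J.
Proof. by move=> sJ IJ Jx y [t Mt /(iadd1_sub IJ Jx)]; apply: sJ. Qed.

Lemma nxC I x y : nx (nx I x) y `<=` nx (nx I y) x.
Proof.
apply: nx_sub; first exact: nx_psat.
  apply: nx_sub; first exact: nx_psat.
    by move=> z Iz; apply/nxL/nxL.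
  exact: nxR.
exact/nxL/nxR.
Qed.

Definition icolon I P : ideal R.
Proof.
exists [set u | forall p, P p -> I (p * u)].
- by move=> p _; rewrite mulr0.
- by move=> u v Uu Uv p Pp; rewrite mulrDr; apply: idealD; [apply: Uu|apply: Uv].
- by move=> a u Uu p Pp; rewrite mulrCA; apply/idealM/Uu.
Defined.

(** Depth at least n at M, as the existence of a regular sequence of length n in M modulo I. *)
Fixpoint dep n I := if n is n'.+1 then exists x, [/\ M x, nzd I x & dep n' (nx I x)]
  else I `<=` M.

Lemma dep_ext n I J : (forall x, I x <-> J x) -> dep n I -> dep n J.
Proof.
by move=> IJ; have -> // : I = J by apply/ideal_eq/ideal_ext.
Qed.

(** The annihilator of y modulo I is as large as possible, hence an associated prime of R/I. *)
Definition maxcolon I y := ~ I y /\ forall z, ~ I z -> colon I y `<=` colon I z -> colon I z `<=` colon I y.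

Lemma maxcolon_above I y : ~ I y -> exists2 z, maxcolon I z & colon I y `<=` colon I z.
Proof.
move=> Iy; have [L [[z Iz LE] yL Lm]] := noeth_max noeth
  (F := fun L => exists2 z, ~ I z & forall x, L x <-> colon I z x)
  (ex_intro2 _ _ y Iy (fun x => iff_refl _)).
exists z; last by move=> x /yL/LE.
split=> // w Iw zw x wx; apply/LE; apply: (Lm (colon I w)) => //; first by exists w.
by move=> v /LE/zw.
Qed.

Lemma maxcolon_prime I y : maxcolon I y -> is_prime (colon I y).
Proof.
move=> [Iy ym]; split; first by rewrite /= mulr1.
move=> a b /= Iyab; apply: contrapT => /not_orP[na nb].
apply: nb; apply: (ym (y * a)) => //= [x|].
  by rewrite /= => Iyx; rewrite mulrAC; apply: idealMl.
by rewrite -mulrA.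
Qed.

(** The list is chosen so that it generates with I the largest possible ideal, which then contains
    every z with [maxcolon I z]. If no [colon I y] contained the prime [colon I z], a product of
    elements killing the various y but lying outside that prime would kill z. *)
Lemma maxcolon_list I : exists ys : seq R, (forall y, y \in ys -> maxcolon I y) /\
  forall z, maxcolon I z -> exists2 y, y \in ys & colon I z `<=` colon I y.
Proof.
have F0 : exists2 ys : seq R, (forall y, y \in ys -> maxcolon I y) &
    forall x, isum I (igen [::]) x <-> isum I (igen ys) x by exists [::].
have [L [[ys ysm LE] _ Lm]] := noeth_max noeth
  (F := fun L => exists2 ys : seq R, (forall y, y \in ys -> maxcolon I y) &
     forall x, L x <-> isum I (igen ys) x)
  F0.
exists ys; split=> // z mz; apply: contrapT => no.
have pz := maxcolon_prime mz.
have Lz : isum I (igen ys) z.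
  apply/LE; apply: (Lm (isum I (igen (z :: ys)))); last first.
  - by apply/isumR/igen_mem; rewrite mem_head.
  - move=> x /LE; apply: isum_mono => //; apply: igen_sub => y yy; apply: igen_mem.
    by rewrite inE yy orbT.
  - by exists (z :: ys) => // y; rewrite inE => /predU1P[->|/ysm].
have {LE Lm} out y : y \in ys -> exists2 a, I (y * a) & ~ colon I z a.
  move=> yy; apply: contrapT => H; apply: no; exists y => //.
  by apply: (ysm y yy).2; [case: mz|move=> a ya; apply: contrapT => za; apply: H; exists a].
suff [a Iza pa] : exists2 a, I (z * a) & ~ colon I z a by [].
move: Lz => [i [w [Ii sw zE]]].
suff [a Iwa pa] : exists2 a, I (w * a) & ~ colon I z a.
  by exists a => //; rewrite zE mulrDl; apply: idealD => //; apply: idealMl.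
elim: ys w sw out {ysm no zE} => [|y ys IH] w.
  by move=> /igen_nil -> _; exists 1; [rewrite mul0r|case: pz].
move=> /igen_cons[r [v [sv ->]]] out.
have [|a Iva pa] := IH v sv; first by move=> x xs; apply: out; rewrite inE xs orbT.
have [|b Iyb pb] := out y; first by rewrite mem_head.
exists (a * b); last by case/pz.2.
have -> : (r * y + v) * (a * b) = r * a * (y * b) + b * (v * a) by ring.
by apply: idealD; apply: idealM.
Qed.

Lemma not_nzd I x : ~ nzd I x -> exists2 z, maxcolon I z & colon I z x.
Proof.
move=> /existsNP[y /not_implyP[Ixy Iy]]; have [z mz yz] := maxcolon_above Iy.
by exists z => //; apply: yz; rewrite /= mulrC.
Qed.

Lemma common_nzd (Is : seq (ideal R)) J :
  (forall I, List.In I Is -> forall y, ~ I y -> ~ (J `<=` colon I y)) ->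
  exists2 z, J z & forall I, List.In I Is -> nzd I z.
Proof.
move=> H.
have [ps [psP psM]] : exists ps : seq (ideal R), (forall p, List.In p ps -> is_prime p /\ ~ (J `<=` p)) /\
    forall I, List.In I Is -> forall z, maxcolon I z -> exists2 p, List.In p ps & colon I z `<=` p.
  elim: Is H => [|I Is IH] H; first by exists [::]; split.
  have [|ps [psP psM]] := IH; first by move=> K KI; apply: H; right.
  have [ys [ym yM]] := maxcolon_list I.
  exists (map (colon I) ys ++ ps); split.
    move=> p /List.in_app_iff[|/psP//]; elim: ys ym {yM} => [|y ys IHy] ym //= [<-|].
      have my := ym _ (mem_head _ _); split; first exact: maxcolon_prime.
      by apply: H; [left|case: my].
    by apply: IHy => z zy; apply: ym; rewrite inE zy orbT.
  move=> K /= [<-|KI] z mz; last first.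
    by have [p pps zp] := psM _ KI _ mz; exists p => //; apply/List.in_app_iff; right.
  have [y yy zy] := yM _ mz; exists (colon I y) => //; apply/List.in_app_iff; left.
  by elim: ys yy {ym yM} => [|w ys IHy] //; rewrite inE => /predU1P[->|/IHy]; [left|right].
have [z Jz zps] := prime_avoidance0 psP.
exists z => // I II; apply: contrapT => /not_nzd[y my yz].
by have [p pps yp] := psM _ II _ my; apply: (zps p) (yp _ yz).
Qed.

Lemma nzd_colon I x : M x -> nzd I x -> forall y, ~ I y -> ~ (M `<=` colon I y).
Proof. by move=> Mx nxx y Iy /(_ _ Mx) /=; rewrite mulrC => /nxx. Qed.

(** The half of the permutability of regular sequences that does not require Nakayama. *)
Lemma nzd_swap I x z : psat M I -> nzd I x -> nzd (nx I x) z -> nzd (nx I z) x.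
Proof.
move=> sI Ix xz u [t Mt /iadd1P[v [i [Ii E]]]].
have [t' Mt' /iadd1P[w [i' [Ii' E']]]] : nx I x v.
  apply: xz; exists 1; first by case: pM.
  rewrite mul1r; apply/iadd1P; exists (t * u), (- i); split; first exact: idealN.
  by rewrite mulrC addrC; apply/eqP; rewrite eq_sym subr_eq addrC -E mulrA mulrAC.
exists (t' * t); first by case/pM.2.
apply/iadd1P; exists w, (t' * t * u - w * z); split; last by rewrite subrK.
apply: Ix; have -> : x * (t' * t * u - w * z) = t' * (t * (x * u)) - (w * x) * z by ring.
rewrite E; have -> : t' * (i + v * z) - w * x * z = t' * i + (t' * v - w * x) * z by ring.
by rewrite E' addrK; apply: idealD; [apply: idealM|apply: idealMl].
Qed.

(** An equation u x = v y modulo I matches elements killed by M modulo y with elements killed by M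
    modulo x. As z kills nothing modulo x, M kills nothing modulo y. *)
Lemma exch_base I x y z : psat M I -> M x -> M y -> nzd I x -> nzd I y -> M z -> nzd (nx I x) z ->
  forall u, ~ nx I y u -> ~ (M `<=` colon (nx I y) u).
Proof.
move=> sI Mx My Ix Iy Mz xz u yu H.
have [t Mt /iadd1P[v [i [Ii E]]]] := H _ Mx.
have xv : ~ nx I x v.
  move=> [t' Mt' /iadd1P[w [i' [Ii' E']]]]; apply: yu; exists (t' * t); first by case/pM.2.
  apply/iadd1P; exists w, (t' * t * u - w * y); split; last by rewrite subrK.
  apply: Ix; have -> : x * (t' * t * u - w * y) = t' * (t * (u * x)) - (w * x) * y by ring.
  rewrite E; have -> : t' * (i + v * y) - w * x * y = t' * i + (t' * v - w * x) * y by ring.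
  by rewrite E' addrK; apply: idealD; [apply: idealM|apply: idealMl].
apply/xv/xz; have [t' Mt' /iadd1P[r [i' [Ii' E']]]] := H _ Mz.
exists t' => //; apply/iadd1P; exists (t * r), (t' * (z * v) - t * r * x); split; last by rewrite subrK.
apply: Iy; have -> : y * (t' * (z * v) - t * r * x) = t' * z * (v * y) - t * r * x * y by ring.
have -> : v * y = t * (u * x) - i by rewrite E addrAC subrr add0r.
have -> : t' * z * (t * (u * x) - i) - t * r * x * y = t * x * (t' * (u * z)) - t' * z * i - t * r * x * y by ring.
rewrite E'; have -> : t * x * (i' + r * y) - t' * z * i - t * r * x * y = t * x * i' - t' * z * i by ring.
by apply: idealB; apply: idealM.
Qed.

(** Any nonzerodivisor y in M can start a regular sequence of the given length: a common
    nonzerodivisor w modulo I, I + (x) and I + (y) is put in front of x and of y, and the induction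
    hypothesis compares the two. *)
Lemma dep_exch n I y : psat M I -> dep n.+1 I -> M y -> nzd I y -> dep n (nx I y).
Proof.
elim: n I y => [|n IH] I y sI [x [Mx Ix dx]] My Iy.
  apply: nx_sub My; last by move=> z Iz; apply/dx/nxL.
  by move=> t z Mt /pM.2[].
have [z [Mz xz dz]] := dx.
have [|w Mw Hw] := @common_nzd [:: I; nx I x; nx I y] M.
  move=> K /= [<-|[<-|[<-|//]]]; [exact: nzd_colon Ix|exact: nzd_colon xz|].
  exact: (exch_base sI Mx My Ix Iy Mz xz).
have [Iw xw yw] : [/\ nzd I w, nzd (nx I x) w & nzd (nx I y) w].
  by split; apply: Hw => /=; tauto.
have d1 : dep n (nx (nx I x) w) by apply: IH => //; apply: nx_psat.
have d2 : dep n.+1 (nx I w).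
  exists x; split=> //; first exact: nzd_swap xw.
  by apply: dep_ext d1 => v; split; apply: nxC.
exists w; split=> //; have : dep n (nx (nx I w) y).
  by apply: IH => //; [apply: nx_psat|apply: nzd_swap yw].
by apply: dep_ext => v; split; apply: nxC.
Qed.

(** Associated primes have coheight at least the depth. With U = (I : P), Nakayama gives an element
    of U that is nonzero modulo a nonzerodivisor x; its annihilator modulo x contains P and x, so it
    lies in an associated prime modulo x strictly above P. *)
Lemma dep_assoc n I P y : psat M I -> dep n I -> is_prime P -> ~ I y -> P `<=` colon I y ->
  (forall x, nzd I x -> ~ P x) -> ht_ge P M n.
Proof.
elim: n I P y => [|n IH] I P y sI dI pP Iy Py _.
  apply: ht_ge0 => // x Px; apply: contrapT => Mx; apply: Iy; apply: sI Mx _.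
  by rewrite mulrC; apply: Py.
have [x [Mx Ix dx]] := dI.
have Px : ~ P x by move=> /Py /=; rewrite mulrC => /Ix.
pose U := icolon I P.
have [u Uu xu] : exists2 u, U u & ~ nx I x u.
  apply: contrapT => no; have [|t Mt tU] := @nakayama_at _ noeth _ pM I U.
    move=> u Uu; have [t Mt /iadd1P[r [i [Ii E]]]] : nx I x u.
      by apply: contrapT => xu; apply: no; exists u.
    exists t => //; rewrite E; apply: idealD; first exact: isumL.
    apply: isumR; rewrite mulrC; apply: imul_mem => // p Pp.
    apply: Ix; have -> : x * (p * r) = p * (i + r * x) - p * i by ring.
    by rewrite -E; apply: idealB; [rewrite mulrCA; apply/idealM/Uu|apply: idealM].
  apply: Iy; apply: sI Mt _; apply: tU => p Pp; rewrite mulrC; exact: Py.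
have [w mw uw] := maxcolon_above xu.
have pw := maxcolon_prime mw.
have hw : ht_ge (colon (nx I x) w) M n.
  apply: (IH _ _ w (@nx_psat _ _) dx pw mw.1 (@subset_refl _ _)) => z zz /=.
  by rewrite mulrC => /zz; case: mw.
rewrite -add1n; apply: ht_ge_cat hw; apply: ht_geS (ht_ge0 pP (@subset_refl _ _)) _ => //.
apply: (@properI _ _ _ x) => //; last by have H : nx I x (w * x) by apply/idealM/nxR.
by move=> p Pp; apply: uw => /=; apply/nxL; rewrite mulrC; apply: Uu.
Qed.

(** Each nonzerodivisor found in P contributes one step below P. When none is left, P lies in an
    associated prime, whose coheight provides the steps above. *)
Lemma dep_dim n I P : psat M I -> dep n I -> is_prime P -> I `<=` P -> P `<=` M ->
  exists2 k, (k <= n)%N & ht_ge I P k /\ ht_ge P M (n - k).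
Proof.
elim: n I => [|n IH] I sI dI pP IP PM.
  by exists 0%N => //; split; apply: ht_ge0.
have [[y Py Iy]|no] := pselect (exists2 y, P y & nzd I y).
  have dy := dep_exch sI dI (PM _ Py) Iy.
  have yP : nx I y `<=` P by apply: nx_sub => // t z Mt /pP.2[/PM//|].
  have [k kn [h1 h2]] := IH _ (@nx_psat _ _) dy pP yP PM.
  exists k.+1 => //; split; last by rewrite subSS.
  by apply: (ht_ge_nzd noeth Iy); apply: ht_ge_mono h1 => z yz; apply: sat_sub.
exists 0%N => //; split; first exact: ht_ge0.
have [z mz Pz] : exists2 z, maxcolon I z & P `<=` colon I z.
  apply: contrapT => H; have [|z Pz zI] := @common_nzd [:: I] P.
    move=> K /= [<-|//] y Iy Py; apply: H; have [z mz yz] := maxcolon_above Iy.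
    by exists z => // x /Py/yz.
  by apply: no; exists z => //; apply: zI; left.
have := dep_assoc sI dI (maxcolon_prime mz) mz.1 (@subset_refl _ _).
rewrite subn0 => /(_ _)/ht_ge_mono; apply=> // x Ix /=.
by rewrite mulrC => /Ix; case: mz.
Qed.

Lemma regat_dep n I : regat I M n -> dep n (sat pM I).
Proof.
elim: n I => [|n IH] I rI.
  have [_ [s [_ _ _ hd]]] := rI; have IM := ht_ge_I hd.
  by move=> x [t Mt /IM/pM.2[]].
have [x [Mx ox _]] := regat_param noeth rI.
have pI := regat_sat_prime noeth pM rI.
exists x; split=> //.
  move=> y /pI.2[[t Mt tx]|//]; case: (ox t Mt); exact: isumL.
have := IH _ (regat_quot noeth rI Mx ox); apply: dep_ext => y; split.
  by apply: nx_sub; [apply: nx_psat|move=> z Iz; apply/nxL/sat_sub|apply: nxR].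
apply: nx_sub; first by move=> t z Mt /sat_sat; apply.
  by apply: sat_mono => z; apply: iadd1L.
exact/sat_sub/iadd1R.
Qed.

Theorem regat_dim n I P : regat I M n -> is_prime P -> I `<=` P -> P `<=` M ->
  exists2 k, (k <= n)%N & ht_ge I P k /\ ht_ge P M (n - k).
Proof.
move=> rI pP IP PM; have sI : psat M (sat pM I) by move=> t z Mt /sat_sat; apply.
have IP' : sat pM I `<=` P by move=> x [t Mt /IP/pP.2[/PM//|]].
have [k kn [h1 h2]] := dep_dim sI (regat_dep rI) pP IP' PM.
by exists k => //; split=> //; apply: ht_ge_mono h1 => x; apply: sat_sub.
Qed.

End CohenMacaulay.

(** * Syzygies and projective dimension modulo an ideal, by matrices *)

Section MatrixIdeal.
Variable R : comPzRingType.
Implicit Types (I J : ideal R).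

Definition matI I m n (A : 'M[R]_(m, n)) := forall i j, I (A i j).

Lemma matI0 I m n : matI I (0 : 'M_(m, n)).
Proof. by move=> i j; rewrite mxE. Qed.

Lemma matID I m n (A B : 'M_(m, n)) : matI I A -> matI I B -> matI I (A + B).
Proof. by move=> HA HB i j; rewrite mxE; apply: idealD. Qed.

Lemma matIN I m n (A : 'M_(m, n)) : matI I A -> matI I (- A).
Proof. by move=> HA i j; rewrite mxE; apply: idealN. Qed.

Lemma matIB I m n (A B : 'M_(m, n)) : matI I A -> matI I B -> matI I (A - B).
Proof. by move=> HA HB; apply: matID => //; apply: matIN. Qed.

Lemma matIM I m n p (A : 'M_(m, n)) (B : 'M_(n, p)) : matI I B -> matI I (A *m B).
Proof. by move=> HB i j; rewrite mxE; apply: idealS => k _; apply: idealM. Qed.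

Lemma matIMl I m n p (A : 'M_(m, n)) (B : 'M_(n, p)) : matI I A -> matI I (A *m B).
Proof. by move=> HA i j; rewrite mxE; apply: idealS => k _; apply: idealMl. Qed.

Lemma matIZ I m n a (A : 'M_(m, n)) : matI I A -> matI I (a *: A).
Proof. by move=> HA i j; rewrite mxE; apply: idealM. Qed.

Lemma matIZl I m n a (A : 'M_(m, n)) : I a -> matI I (a *: A).
Proof. by move=> Ia i j; rewrite mxE; apply: idealMl. Qed.

Lemma matI_sub I J m n (A : 'M_(m, n)) : I `<=` J -> matI I A -> matI J A.
Proof. by move=> IJ HA i j; apply/IJ/HA. Qed.

Lemma matI_eqM I m n p (C : 'M_(m, n)) (A B : 'M_(n, p)) : matI I (A - B) -> matI I (C *m A) -> matI I (C *m B).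
Proof.
move=> AB CA; have -> : B = A - (A - B) by rewrite opprB addrC subrK.
by rewrite mulmxBr; apply: matIB => //; apply: matIM.
Qed.

Lemma matI_eq I m n (A B : 'M_(m, n)) : matI I (A - B) -> matI I A <-> matI I B.
Proof.
move=> AB; split=> H; last by rewrite -[A](subrK B); apply: matID.
have -> : B = A - (A - B) by rewrite opprB addrC subrK.
exact: matIB.
Qed.

Lemma matI_row I m n (A : 'M_(m, n)) : (forall i, matI I (row i A)) -> matI I A.
Proof. by move=> H i j; have := H i 0 j; rewrite mxE. Qed.

Lemma matI_ofrow I m n (A : 'M_(m, n)) i : matI I A -> matI I (row i A).
Proof. by move=> H j k; rewrite mxE. Qed.

Lemma matI_col_mx I m n p (A : 'M_(m, n)) (B : 'M_(p, n)) : matI I A -> matI I B -> matI I (col_mx A B).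
Proof. by move=> HA HB i j; rewrite mxE; case: splitP. Qed.

Lemma matI_row_mx I m n p (A : 'M_(m, n)) (B : 'M_(m, p)) :
  matI I (row_mx A B) <-> matI I A /\ matI I B.
Proof.
split=> [H|[HA HB] i j]; last by rewrite mxE; case: splitP.
by split=> i j; [have := H i (lshift p j); rewrite row_mxEl|have := H i (rshift n j); rewrite row_mxEr].
Qed.

Lemma matI_iadd1 I x m n (A : 'M_(m, n)) : matI (iadd1 I x) A -> exists B, matI I (A - x *: B).
Proof.
move=> H; have /choice[f fP] : forall ij : 'I_m * 'I_n, exists r, I (A ij.1 ij.2 - x * r).
  by move=> [i j]; have /iadd1P[r [y [Iy ->]]] := H i j; exists r; rewrite /= mulrC addrK.
by exists (\matrix_(i, j) f (i, j)) => i j; rewrite !mxE; apply: fP (i, j).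
Qed.

(* The rows of K generate the relations between the rows of A modulo I. *)
Definition gensker I a b c (A : 'M[R]_(a, b)) (K : 'M[R]_(c, a)) :=
  matI I (K *m A) /\ forall u : 'rV_a, matI I (u *m A) -> exists w : 'rV_c, matI I (u - w *m K).

Lemma rows_choice I a b m (P : 'rV[R]_a -> 'rV[R]_b -> Prop) (U : 'M_(m, a)) :
  (forall i, exists w, P (row i U) w) -> exists W : 'M_(m, b), forall i, P (row i U) (row i W).
Proof.
move=> /choice[f fP]; exists (\matrix_i f i) => i; by rewrite rowK.
Qed.

Lemma genskerM I a b c m (A : 'M[R]_(a, b)) (K : 'M[R]_(c, a)) (U : 'M_(m, a)) :
  gensker I A K -> matI I (U *m A) -> exists W : 'M_(m, c), matI I (U - W *m K).
Proof.
move=> [_ gK] UA; have [|W WP] := @rows_choice I a c m (fun u w => matI I (u - w *m K)) U.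
  by move=> i; apply: gK; rewrite -row_mul; apply: matI_ofrow.
exists W; apply: matI_row => i; have := WP i; rewrite -row_mul.
by move=> H j k; have := H j k; rewrite !mxE.
Qed.

(** Induction on the number of coordinates: the first coordinates form a finitely generated ideal,
    and subtracting lifts of its generators leaves vectors supported on the other coordinates. *)
Lemma fg_submodule (noeth : noetherian R) a (N : 'rV[R]_a -> Prop) : N 0 ->
  (forall u v, N u -> N v -> N (u + v)) -> (forall r u, N u -> N (r *: u)) ->
  exists c (K : 'M_(c, a)), forall u, N u <-> exists w : 'rV_c, u = w *m K.
Proof.
elim: a N => [|a IH] N N0 ND NZ.
  exists 0%N, 0 => u; split=> [_|[w ->]]; last by rewrite mulmx0.
  by exists 0; rewrite mulmx0; apply/matrixP => i [].
have [|u v|r u|c [K KP]] := IH (fun v => N (row_mx (0 : 'rV_1) v)).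
- by rewrite row_mx0.
- move=> Nu Nv; have -> : row_mx 0 (u + v) = (row_mx 0 u + row_mx 0 v) :> 'rV_(1 + a).
    by rewrite add_row_mx addr0.
  exact: ND.
- by move=> Nu; have := NZ r _ Nu; rewrite (@scale_row_mx _ 1 1 a) scaler0.
have p0 : [set x | exists2 u, N u & u 0 0 = x] 0 by exists 0; rewrite ?mxE.
have pD x y : [set x | exists2 u, N u & u 0 0 = x] x -> [set x | exists2 u, N u & u 0 0 = x] y ->
    [set x | exists2 u, N u & u 0 0 = x] (x + y).
  by move=> [u Nu <-] [v Nv <-]; exists (u + v); rewrite ?mxE //; apply: ND.
have pZ r x : [set x | exists2 u, N u & u 0 0 = x] x -> [set x | exists2 u, N u & u 0 0 = x] (r * x).
  by move=> [u Nu <-]; exists (r *: u); rewrite ?mxE //; apply: NZ.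
have [s sE] := noeth_fg noeth (Ideal p0 pD pZ).
have /choice[f fP] : forall i : 'I_(size s), exists u, N u /\ u 0 0 = s`_i.
  by move=> i; have /sE[u Nu uE] := igen_mem (mem_nth 0 (ltn_ord i)); exists u.
have NS (T : Type) (r : seq T) (F : T -> 'rV_a.+1) : (forall i, N (F i)) -> N (\sum_(i <- r) F i).
  by move=> NF; elim/big_ind: _.
exists (size s + c)%N, (col_mx (\matrix_i f i) (row_mx (0 : 'cV_c) K)) => u; split=> [Nu|[w ->]]; last first.
  rewrite -[w]hsubmxK mul_row_col; apply: ND; last first.
    have -> : rsubmx w *m row_mx 0 K = row_mx 0 (rsubmx w *m K) :> 'rV_(1 + a).
      by rewrite mul_mx_row mulmx0.
    by apply/KP; exists (rsubmx w).
  by rewrite mulmx_sum_row; apply: NS => i; apply: NZ; rewrite rowK; apply: (fP i).1.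
have /sE/igenP[d dE] : Ideal p0 pD pZ (u 0 0) by exists u.
pose w1 : 'rV[R]_(size s) := \row_i d i.
pose u1 : 'rV[R]_(1 + a) := u - w1 *m (\matrix_i f i).
have Nu1 : N u1.
  apply: (ND _ _ Nu); rewrite -scaleN1r; apply: (NZ _ _); rewrite mulmx_sum_row; apply: NS => i; apply: (NZ _ _).
  by rewrite rowK; apply: (fP i).1.
have u1E : u1 = row_mx (0 : 'rV_1) (rsubmx u1).
  rewrite -[LHS]hsubmxK; congr row_mx; apply/matrixP => i j; rewrite !ord1 !mxE.
  have -> : lshift a (0 : 'I_1) = 0 by apply/val_inj.
  rewrite dE; apply/eqP; rewrite subr_eq0; apply/eqP/eq_bigr => k _.
  by rewrite !mxE (fP k).2.
have [w2 w2E] : exists w : 'rV_c, rsubmx u1 = w *m K by apply/KP; rewrite -u1E.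
have E : w2 *m row_mx 0 K = u1 :> 'rV_(1 + a) by rewrite mul_mx_row mulmx0 -w2E -u1E.
by exists (row_mx w1 w2); rewrite mul_row_col E /u1 addrC subrK.
Qed.

Lemma exists_gensker (noeth : noetherian R) I a b (A : 'M[R]_(a, b)) :
  exists c (K : 'M_(c, a)), gensker I A K.
Proof.
have [|u v|r u|c [K KP]] := @fg_submodule noeth a (fun u => matI I (u *m A)).
- by rewrite mul0mx; apply: matI0.
- by rewrite mulmxDl; apply: matID.
- by rewrite -scalemxAl; apply: matIZ.
exists c, K; split=> [|u /KP[w ->]]; last by exists w; rewrite subrr; apply: matI0.
by apply: matI_row => i; rewrite row_mul; apply/KP; exists (delta_mx 0 i); rewrite rowE.
Qed.

(* Projective dimension at most n, relative to I, of the module spanned by the rows of A. *)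
Fixpoint ffr n I a b (A : 'M[R]_(a, b)) {struct n} : Prop :=
  if n is n'.+1 then exists c (K : 'M_(c, a)), gensker I A K /\ ffr n' I K
  else forall u : 'rV_a, matI I (u *m A) -> matI I u.

(** Differs from [ffr] at the last step only: E splits the map onto the row module, which is thus
    projective rather than free on the given rows. Projectivity, unlike freeness, passes to
    retracts. *)
Fixpoint pdim n I a b (A : 'M[R]_(a, b)) {struct n} : Prop :=
  if n is n'.+1 then exists c (K : 'M_(c, a)), gensker I A K /\ pdim n' I K
  else exists E : 'M_a, matI I (E *m A - A) /\ forall u : 'rV_a, matI I (u *m A) -> matI I (u *m E).

Lemma row_imp I a b c (X : 'M[R]_(a, b)) (Y : 'M[R]_(a, c)) :
  (forall u : 'rV_a, matI I (u *m X) -> matI I (u *m Y)) ->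
  forall m (U : 'M_(m, a)), matI I (U *m X) -> matI I (U *m Y).
Proof.
move=> H m U UX; apply: matI_row => i; rewrite row_mul; apply: H.
by rewrite -row_mul; apply: matI_ofrow.
Qed.

Lemma ffr_pdim n I a b (A : 'M[R]_(a, b)) : ffr n I A -> pdim n I A.
Proof.
elim: n a b A => [|n IH] a b A /=; last by move=> [c [K [gK /IH]]]; exists c, K.
move=> H; exists 1%:M; split=> [|u /H uI]; first by rewrite mul1mx subrr; apply: matI0.
by rewrite mulmx1.
Qed.

Lemma ffr_congr n I a b (A B : 'M[R]_(a, b)) : matI I (A - B) -> ffr n I A -> ffr n I B.
Proof.
move=> AB; have E c (u : 'M_(c, a)) : matI I (u *m A) <-> matI I (u *m B).
  by apply: matI_eq; rewrite -mulmxBr; apply: matIM.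
case: n => [|n] /=; first by move=> H u /E/H.
by move=> [c [K [[KA gK] fK]]]; exists c, K; split=> //; split=> [|u /E/gK//]; apply/E.
Qed.

Lemma pd_row0 n I a b q (A : 'M[R]_(a, b)) : pdim n I A -> pdim n I (row_mx A (0 : 'M_(a, q))).
Proof.
have E c (U : 'M_(c, a)) : matI I (U *m row_mx A (0 : 'M_(a, q))) <-> matI I (U *m A).
  by rewrite mul_mx_row mulmx0; split=> [/matI_row_mx[]//|H]; apply/matI_row_mx; split=> //; apply: matI0.
case: n => [|n] /= [].
  move=> F [FA Fk]; exists F; split=> [|u /E/Fk//].
  by rewrite mul_mx_row mulmx0 opp_row_mx add_row_mx subr0; apply/matI_row_mx; split=> //; apply: matI0.
move=> c [K [[KA gK] pK]]; exists c, K; split=> //; split=> [|u /E/gK//]; exact/E.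
Qed.

Lemma pd_free n I a b q (A : 'M[R]_(a, b)) : pdim n I A -> pdim n I (block_mx A 0 0 (1%:M : 'M_q)).
Proof.
have E c (U : 'M_(c, a + q)) : matI I (U *m block_mx A 0 0 1%:M) <->
    matI I (lsubmx U *m A) /\ matI I (rsubmx U).
  rewrite -[in X in X <-> _](hsubmxK U) mul_row_block !mulmx0 addr0 add0r mulmx1.
  exact: matI_row_mx.
case: n => [|n] /= [].
  move=> F [FA Fk]; exists (block_mx F 0 0 1%:M); split=> [|u /E[uA ru]].
    rewrite mulmx_block !mulmx0 !mul0mx !addr0 !add0r mulmx1 opp_block_mx add_block_mx !subrr.
    by apply: matI_col_mx; apply/matI_row_mx; split=> //; apply: matI0.
  rewrite -(hsubmxK u) mul_row_block !mulmx0 addr0 add0r mulmx1.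
  by apply/matI_row_mx; split=> //; apply: Fk.
move=> c [K [[KA gK] pK]]; exists c, (row_mx K 0); split; last exact: pd_row0.
split; first by apply/E; rewrite row_mxKl row_mxKr; split=> //; apply: matI0.
move=> u /E[/gK[w wP] ru]; exists w; rewrite -(hsubmxK u) mul_mx_row mulmx0 opp_row_mx add_row_mx subr0.
exact/matI_row_mx.
Qed.

Lemma zmod_id (V : zmodType) (a1 a2 a3 a4 k : V) :
  a1 + a2 - k = - (a3 - a1) - (a4 - a3) - (k - a4 - a2).
Proof.
rewrite !opprB; have -> : a1 - a3 + (a3 - a4) = a1 - a4 by rewrite addrA subrK.
by rewrite [a2 + _]addrCA subrKA addrA.
Qed.

(** F and G exhibit the row module of B as a retract of that of A. The syzygies of B are then a
    retract of those of A enlarged by a free summand; this replaces Schanuel's lemma. *)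
Lemma pd_retract (noeth : noetherian R) n I a b c d (A : 'M[R]_(a, b)) (B : 'M[R]_(c, d))
    (F : 'M_(c, a)) (G : 'M_(a, c)) :
  (forall u : 'rV_c, matI I (u *m B) -> matI I (u *m (F *m A))) ->
  (forall v : 'rV_a, matI I (v *m A) -> matI I (v *m (G *m B))) ->
  matI I (F *m (G *m B) - B) -> pdim n I A -> pdim n I B.
Proof.
elim: n a b c d A B F G => [|n IH] a b c d A B F G FP GP FGB.
  move=> [E [EA Ek]]; exists (F *m E *m G); split=> [|u uB]; last first.
    by rewrite !mulmxA; apply/matIMl/Ek; rewrite -mulmxA; apply: FP.
  have H : matI I ((E - 1%:M) *m (G *m B)).
    by apply: (row_imp GP); rewrite mulmxBl mul1mx.
  have -> : F *m E *m G *m B - B = F *m ((E - 1%:M) *m (G *m B)) + (F *m (G *m B) - B).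
    by rewrite mulmxBl mul1mx mulmxBr addrA subrK !mulmxA.
  by apply: matID => //; apply: matIM.
move=> [e [K [gK pK]]]; have [f [KB gB]] := exists_gensker noeth I B.
exists f, KB; split=> //.
have [W1 W1P] : exists W, matI I (KB *m F - W *m K).
  by apply: (genskerM gK); rewrite -mulmxA; apply: (row_imp FP); case: gB.
have [W2 W2P] : exists W, matI I (K *m G - W *m KB).
  by apply: (genskerM gB); rewrite -mulmxA; apply: (row_imp GP); case: gK.
(* On generators, F G differs from the identity by relations of B; the added free block absorbs this
   error. *)
have [W3 W3P] : exists W, matI I ((1%:M - F *m G) - W *m KB).
  by apply: (genskerM gB); rewrite mulmxBl mul1mx -mulmxA -opprB; apply: matIN.
apply: (IH _ _ _ _ (block_mx K 0 0 (1%:M : 'M_c)) KB (row_mx W1 KB) (col_mx W2 W3)); last exact: pd_free.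
- move=> u uKB; rewrite mul_row_block !mulmx0 addr0 add0r mulmx1 mul_mx_row.
  apply/matI_row_mx; split=> //; by apply: (matI_eqM W1P); rewrite mulmxA; apply: matIMl.
- move=> v; rewrite -(hsubmxK v); set v1 := lsubmx v; set v2 := rsubmx v.
  rewrite mul_row_block !mulmx0 addr0 add0r mulmx1 => /matI_row_mx[v1K v2I].
  rewrite mul_col_mx mul_row_col; apply: matID; last exact: matIMl.
  by apply: (matI_eqM W2P); rewrite mulmxA; apply: matIMl.
rewrite mul_col_mx mul_row_col.
have -> : W1 *m (W2 *m KB) + KB *m (W3 *m KB) - KB =
  - (W1 *m (K *m G - W2 *m KB)) - (KB *m F - W1 *m K) *m G - KB *m ((1%:M - F *m G) - W3 *m KB).
  by rewrite !mulmxBr !mulmxBl !mulmx1 !mulmxA; apply: zmod_id.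
apply: matIB; first apply: matIB; first apply: matIN.
- exact: matIM.
- exact: matIMl.
- exact: matIM.
Qed.

Lemma pd_indep (noeth : noetherian R) n I a b c (A : 'M[R]_(a, b)) (B : 'M[R]_(c, b)) X Y :
  matI I (B - X *m A) -> matI I (A - Y *m B) -> pdim n I A -> pdim n I B.
Proof.
move=> BX AY; apply: (@pd_retract noeth _ _ _ _ _ _ _ _ X Y) => [u|v|].
- exact: matI_eqM.
- exact: matI_eqM.
have -> : X *m (Y *m B) - B = - (X *m (A - Y *m B)) - (B - X *m A).
  by rewrite mulmxBr !opprB addrA subrK.
by apply: matIB => //; apply/matIN/matIM.
Qed.

Lemma gensker_indep (noeth : noetherian R) n I a b c d (A : 'M[R]_(a, b)) (K : 'M[R]_(c, a)) (K' : 'M[R]_(d, a)) :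
  gensker I A K -> gensker I A K' -> pdim n I K -> pdim n I K'.
Proof.
move=> gK gK'; have [X XP] := genskerM gK gK'.1; have [Y YP] := genskerM gK' gK.1.
exact: pd_indep XP YP.
Qed.

End MatrixIdeal.

Lemma quot_eqP R (I : ideal R) x y : quotient_map I x = quotient_map I y <-> I (x - y).
Proof. exact: cs_piP. Qed.

(** * The theorem of Auslander, Buchsbaum and Serre *)

Section LocalMatrix.
Variable R : comPzRingType.
Hypothesis noeth : noetherian R.
Variables (M : ideal R) (pM : is_prime M) (unitM : forall x, ~ M x -> is_unit x).
Implicit Types (I J : ideal R).

Lemma unit1B x : M x -> is_unit (1 - x).
Proof. by move=> Mx; apply: unitM => /idealD/(_ Mx); rewrite subrK; apply: pM.1. Qed.

Lemma psatM I : psat M I.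
Proof. by move=> t x /unitM[u tu] /(idealM u); rewrite mulrA (mulrC u) tu mul1r. Qed.

Lemma inv1mx n (D : 'M[R]_n) : matI M (D - 1%:M) -> exists D' : 'M_n, D' *m D = 1%:M /\ D *m D' = 1%:M.
Proof.
move=> DM; have [|u uD] := @unitM (\det D).
  move=> dM; have : quotient_map M (\det D) = quotient_map M 0 by apply/quot_eqP; rewrite subr0.
  rewrite rmorph0 -det_map_mx; have -> : map_mx (quotient_map M) D = 1%:M.
    rewrite -(map_mx1 (quotient_map M)); apply/matrixP => i j; rewrite !mxE; apply/quot_eqP.
    by have := DM i j; rewrite !mxE.
  rewrite det1 -(rmorph1 (quotient_map M)) -(rmorph0 (quotient_map M)) => /quot_eqP.
  by rewrite subr0; apply: pM.1.
by exists (u *: \adj D); rewrite -scalemxAl -scalemxAr mul_adj_mx mul_mx_adj scale_scalar_mx mulrC uD.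
Qed.

(** No relation has an invertible coefficient: the rows generate their module minimally. *)
Definition minrows I a b (A : 'M[R]_(a, b)) := forall w : 'rV_a, matI I (w *m A) -> matI M w.

Lemma drop_row I a b (A : 'M[R]_(a.+1, b)) (w : 'rV_a.+1) k : matI I (w *m A) -> ~ M (w 0 k) ->
  exists Y, matI I (A - Y *m row' k A).
Proof.
move=> wA /unitM[v wv].
exists (\matrix_i if unlift k i is Some j then delta_mx 0 j else - v *: col' k w).
apply: matI_row => i; rewrite linearB /= row_mul rowK.
case: unliftP => [j ->|->].
  by rewrite -rowE => j' l; rewrite !mxE subrr.
suff -> : row k A - - v *: col' k w *m row' k A = v *: (w *m A) by apply: matIZ.
apply/matrixP => i' j; rewrite (ord1 i') !mxE (bigD1_ord k) //= mulrDr mulrA (mulrC v) wv mul1r.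
by congr (_ + _); rewrite mulr_sumr -sumrN; apply: eq_bigr => l _; rewrite !mxE mulNr mulNr opprK mulrA.
Qed.

Lemma exists_minrows I a b (A : 'M[R]_(a, b)) : exists c (B : 'M_(c, b)) X Y,
  [/\ matI I (B - X *m A), matI I (A - Y *m B) & minrows I B].
Proof.
elim: a A => [|a IH] A.
  by exists 0%N, A, 0, 0; split=> [[]|[]|w _ i []].
have [mA|] := pselect (minrows I A).
  by exists a.+1, A, 1%:M, 1%:M; rewrite mul1mx subrr; split=> //; apply: matI0.
move=> /existsNP[w /not_implyP[wA /existsNP[i /existsNP[k]]]]; rewrite (ord1 i) => wk.
have [Y YP] := drop_row wA wk; have [c [B [X [Y' [BX AY mB]]]]] := IH (row' k A).
exists c, B, (X *m row' k 1%:M), (Y *m Y'); split=> //.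
  by rewrite -mulmxA; have -> : row' k 1%:M *m A = row' k A
    by apply/matrixP => i' j; rewrite !mxE (bigD1 (lift k i')) //= !mxE eqxx mul1r big1 ?addr0 // => l nl;
       rewrite !mxE eq_sym (negPf nl) mul0r.
have -> : A - Y *m Y' *m B = (A - Y *m row' k A) + Y *m (row' k A - Y' *m B).
  by rewrite mulmxBr addrA subrK mulmxA.
by apply: matID => //; apply: matIM.
Qed.

(** When x is a nonzerodivisor modulo I, this says that x is a nonzerodivisor on the cokernel of
    K. *)
Definition lifts x I c a (K : 'M[R]_(c, a)) := forall u : 'rV_c, matI (iadd1 I x) (u *m K) ->
  exists2 v : 'rV_c, matI I (v *m K) & matI (iadd1 I x) (u - v).

Lemma gensker_lifts x I a b c (A : 'M[R]_(a, b)) (K : 'M[R]_(c, a)) :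
  nzd I x -> gensker I A K -> lifts x I K.
Proof.
move=> nx [KA gK] u /matI_iadd1[w wP].
have [|v vP] := gK w.
  have : matI I (x *: (w *m A)).
    rewrite scalemxAl; apply/(matI_eq (B := u *m K *m A)); last by rewrite -mulmxA; apply: matIM.
    by rewrite -mulmxBl; apply: matIMl; rewrite -opprB; apply: matIN.
  by move=> H i j; apply: nx; have := H i j; rewrite mxE.
exists (u - x *: v).
  rewrite mulmxBl -scalemxAl.
  have -> : u *m K - x *: (v *m K) = (u *m K - x *: w) + x *: (w - v *m K).
    by rewrite scalerBr addrA subrK.
  by apply: matID => //; apply: matIZ.
by rewrite opprB addrCA subrr addr0; apply/matIZl/iadd1R.
Qed.

Lemma krull_vec I a (u : 'rV[R]_a) : (forall k, exists v w : 'rV_a, [/\ matI I w, matI (ipow M k) v & u = v + w]) ->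
  matI I u.
Proof.
move=> H i j; apply: (@krull_cap _ noeth M) => [k|]; last exact: unit1B.
by have [v [w [Iw Mv ->]]] := H k; rewrite mxE; exists (v i j), (w i j).
Qed.

(** Generators of the relations modulo x are lifted to relations modulo I, and Nakayama shows that
    the lifts still generate. *)
Lemma ffr_lift x I n a b (K : 'M[R]_(a, b)) : M x -> nzd I x -> lifts x I K ->
  ffr n (iadd1 I x) K -> ffr n I K.
Proof.
move=> Mx nx; elim: n a b K => [|n IH] a b K lK.
  move=> H u uK; apply: krull_vec => k.
  (* At the end of the resolution a relation vanishes modulo x, so it is x times another relation.
     Iterating puts it in every power of M. *)
  suff [v [w [Iw vK ->]]] : exists v w : 'rV_a, [/\ matI I w, matI I (v *m K) & u = x ^+ k *: v + w].
    by exists (x ^+ k *: v), w; split=> //; apply/matIZl/ipowX.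
  elim: k => [|k [v [w [Iw vK ->]]]]; first by exists u, 0; rewrite expr0 scale1r addr0; split=> //; apply: matI0.
  have /matI_iadd1[v' v'P] := H _ (matI_sub (@iadd1L _ I x) vK).
  exists v', (x ^+ k *: (v - x *: v') + w); split.
  - by apply: matID => //; apply: matIZ.
  - have H' : matI I (x *: (v' *m K)).
      rewrite scalemxAl; apply/(matI_eq (B := v *m K)) => //.
      by rewrite -mulmxBl -opprB; apply/matIMl/matIN.
    by move=> i j; apply: nx; have := H' i j; rewrite mxE.
  - by rewrite exprSr -scalerA scalerBr addrA [_ + (_ - _)]addrCA subrr addr0.
move=> [c [Lb [gLb fLb]]].
have [L [LK LLb]] : exists L : 'M_(c, a), matI I (L *m K) /\ matI (iadd1 I x) (Lb - L).
  have [|L LP] := @rows_choice R I a a c (fun u v => matI I (v *m K) /\ matI (iadd1 I x) (u - v)) Lb.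
    by move=> i; have [|v ? ?] := lK (row i Lb); [rewrite -row_mul; apply/matI_ofrow/gLb.1|exists v].
  exists L; split; apply: matI_row => i; first by rewrite row_mul; apply: (LP i).1.
  by move=> j k; have := (LP i).2 j k; rewrite !mxE.
suff gL : gensker I K L.
  exists c, L; split=> //; apply: IH; first exact: gensker_lifts gL.
  exact: ffr_congr LLb fLb.
split=> //.
have [d [K2 [K2K gK2]]] := exists_gensker noeth I K.
(* matrix Nakayama: K2 = W L + x W' K2 modulo I *)
have [W WP] : exists W : 'M_(d, c), exists V : 'M_(d, d), matI I (K2 - W *m L - x *: (V *m K2)).
  have [|W WP] := genskerM (U := K2) gLb; first exact: matI_sub (@iadd1L _ I x) K2K.
  have : matI (iadd1 I x) (K2 - W *m L).
    have -> : K2 - W *m L = (K2 - W *m Lb) + W *m (Lb - L) by rewrite mulmxBr addrA subrK.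
    by apply: matID => //; apply: matIM.
  move=> /matI_iadd1[U UP]; exists W.
  have UK : matI I (U *m K).
    have H' : matI I (x *: (U *m K)).
      rewrite scalemxAl; apply/(matI_eq (B := (K2 - W *m L) *m K)).
        by rewrite -mulmxBl -opprB; apply/matIMl/matIN.
      by rewrite mulmxBl; apply: matIB => //; rewrite -mulmxA; apply: matIM.
    by move=> i j; apply: nx; have := H' i j; rewrite mxE.
  have [V VP] := genskerM (conj K2K gK2) UK; exists V.
  have -> : K2 - W *m L - x *: (V *m K2) = (K2 - W *m L - x *: U) + x *: (U - V *m K2).
    by rewrite scalerBr addrA subrK.
  by apply: matID => //; apply: matIZ.
have [V VP] := WP.
have [|D [DP _]] := @inv1mx d (1%:M - x *: V).
  by rewrite addrAC subrr add0r; apply/matIN/matIZl.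
have K2L : matI I (K2 - D *m W *m L).
  have -> : K2 - D *m W *m L = D *m (K2 - W *m L - x *: (V *m K2)).
    rewrite -[in LHS](mul1mx K2) -DP -!mulmxA -mulmxBr mulmxBl mul1mx -scalemxAl.
    by rewrite addrAC.
  exact: matIM.
move=> u /gK2[w wP]; exists (w *m (D *m W)).
have -> : u - w *m (D *m W) *m L = (u - w *m K2) + w *m (K2 - D *m W *m L).
  by rewrite mulmxBr addrA subrK !mulmxA.
by apply: matID => //; apply: matIM.
Qed.

Lemma regat_nzd_local I d : regat I M d -> forall x, ~ I x -> nzd I x.
Proof.
move=> rI x Ix y; have pI := regat_sat_prime noeth pM rI.
have E z : sat pM I z <-> I z by split=> [[t Mt]|Iz]; [apply: psatM|apply: sat_sub].
by move=> /E/pI.2[/E//|/E].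
Qed.

Lemma minker I a b (A : 'M[R]_(a, b)) : exists c (K : 'M_(c, a)), gensker I A K /\ minrows I K.
Proof.
have [d [L gL]] := exists_gensker noeth I A.
have [c [K [X [Y [KX LY mK]]]]] := exists_minrows I L.
exists c, K; split=> //; split=> [|u /gL.2[w wP]].
  apply/(matI_eq (B := X *m L *m A)); first by rewrite -mulmxBl; apply: matIMl.
  by rewrite -mulmxA; apply: matIM; case: gL.
exists (w *m Y); have -> : u - w *m Y *m K = (u - w *m L) + w *m (L - Y *m K).
  by rewrite mulmxBr addrA subrK mulmxA.
by apply: matID => //; apply: matIM.
Qed.

(** Induction on d, dividing by a parameter x. One step of the resolution is spent on replacing A by
    its relations K, for which relations modulo x lift. For d = 0 the minimal relations K are free
    because M lies in I. *)
Theorem regular_ffr I d : regat I M d -> forall a b (A : 'M[R]_(a, b)), ffr d.+1 I A.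
Proof.
elim: d I => [|d IH] I rI a b A; have [c [K [gK mK]]] := minker I A; exists c, K; split=> //.
  have [_ [s [/size0nil -> _ sg hd]]] := rI.
  move=> u /mK uM i j; have [t Mt [y [z [Iy /igen_nil z0 E]]]] := sg _ (uM i j).
  by apply: (psatM Mt); rewrite E z0 addr0.
have [x [Mx ox _]] := regat_param noeth rI.
have nx : nzd I x.
  apply: (regat_nzd_local rI) => Ix; apply: (ox 1 pM.1); rewrite mul1r; exact: isumL.
apply: (ffr_lift Mx nx (gensker_lifts nx gK)).
exact: (IH _ (regat_quot noeth rI Mx ox)).
Qed.

Lemma pd_mod x I n a b (K : 'M[R]_(a, b)) : nzd I x -> lifts x I K -> pdim n I K ->
  pdim n (iadd1 I x) K.
Proof.
move=> nx; elim: n a b K => [|n IH] a b K lK.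
  move=> [E [EK Ek]]; exists E; split; first exact: matI_sub (@iadd1L _ I x) EK.
  move=> u /lK[v /Ek vE uv]; apply/(matI_eq (B := v *m E)); last exact: matI_sub (@iadd1L _ I x) vE.
  by rewrite -mulmxBl; apply: matIMl.
move=> [c [L [gL pL]]]; exists c, L; split; last by apply: IH => //; apply: gensker_lifts gL.
split=> [|u /lK[v vK uv]]; first exact: matI_sub (@iadd1L _ I x) gL.1.
have [w wP] := gL.2 _ vK; exists w.
have -> : u - w *m L = (u - v) + (v - w *m L) by rewrite addrA subrK.
by apply: matID => //; apply: matI_sub wP; apply: iadd1L.
Qed.

Lemma minrows_ent I a b c (A : 'M[R]_(a, b)) (K : 'M_(c, a)) : minrows I A -> matI I (K *m A) -> matI M K.
Proof. by move=> mA KA; apply: matI_row => i; apply: mA; rewrite -row_mul; apply: matI_ofrow. Qed.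

Lemma pd0_free I a b (A : 'M[R]_(a, b)) : minrows I A -> pdim 0 I A ->
  forall u : 'rV_a, matI I (u *m A) -> matI I u.
Proof.
move=> mA [E [EA Ek]] u /Ek uE; have [|D [_ DE]] := @inv1mx a E.
  by apply: (minrows_ent mA); rewrite mulmxBl mul1mx.
by rewrite -[u]mulmx1 -DE mulmxA; apply: matIMl.
Qed.

(** Auslander-Buchsbaum in depth zero. Relations between minimal generators have entries in M, so y
    times a basis vector is a relation between the rows of K; as these are independent, K must be
    empty. *)
Lemma depth0_free I y n a b (A : 'M[R]_(a, b)) : ~ I y -> (forall m, M m -> I (y * m)) ->
  minrows I A -> pdim n I A -> forall u : 'rV_a, matI I (u *m A) -> matI I u.
Proof.
move=> Iy yM; elim: n a b A => [|n IH] a b A mA; first exact: pd0_free.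
move=> [c0 [K0 [gK0 pK0]]]; have [c [K [gK mK]]] := minker I A.
have kK := IH _ _ K mK (gensker_indep noeth gK0 gK pK0).
have KM := minrows_ent mA gK.1.
case: c K gK mK kK KM => [|c] K gK mK kK KM u /gK.2[w wP].
  by move: wP; rewrite [w]thinmx0 mul0mx subr0.
case: Iy; have := kK (y *: delta_mx 0 0) _ 0 0; rewrite !mxE mulr1; apply.
by rewrite -scalemxAl -rowE => i j; rewrite !mxE; apply/yM/KM.
Qed.

Definition gensM I e (A : 'M[R]_(e, 1)) := matI M A /\
  forall x, M x -> exists u : 'rV_e, matI I (x%:M - u *m A).

Lemma regat0 I : I `<=` M -> M `<=` I -> regat I M 0.
Proof.
move=> IM MI; split=> //; exists [::]; split=> //; last exact: ht_ge0.
by move=> x /MI Ix; exists 1; [apply: pM.1|rewrite mul1r; apply: isumL].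
Qed.

(** In depth 0 the maximal ideal is free and killed by y, hence zero modulo I. Otherwise some
    nonzerodivisor x of M lies outside M^2, and M/(x) is a retract of the first syzygies of M taken
    modulo x; so the projective dimension drops by one over R/(x). *)
Lemma finite_pd_regular n I e (A : 'M[R]_(e, 1)) : I `<=` M -> gensM I A -> pdim n I A ->
  exists d, regat I M d.
Proof.
elim: n I e A => [|n IH] I e0 A0 IM gA0 pA0.
all: have [MI|MI] := pselect (M `<=` I); first by exists 0%N; apply: regat0.
all: have [e [A [X [Y [AX AY mA]]]]] := exists_minrows I A0.
all: have pA := pd_indep noeth AX AY pA0.
all: have gA : gensM I A.
1,3: split; last (move=> x /gA0.2[u uP]; exists (u *m Y)).
1,3: apply/(matI_eq (B := X *m A0)); first exact: matI_sub IM AX.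
1,2: by apply: matIM; case: gA0.
1,2: have -> : x%:M - u *m Y *m A = (x%:M - u *m A0) + u *m (A0 - Y *m A) by rewrite mulmxBr addrA subrK mulmxA.
1,2: by apply: matID => //; apply: matIM.
  have kA := pd0_free mA pA.
  case: e A {X Y AX AY} mA pA gA kA => [|e] A mA pA gA kA.
    by exists 0%N; apply: regat0 => // x /gA.2[u] /(_ 0 0); rewrite [u]thinmx0 mul0mx subr0 mxE eqxx mulr1n.
  pose x := A 0 0.
  have nx : nzd I x.
    move=> y xy; have := kA (y *: delta_mx 0 0) _ 0 0; rewrite !mxE mulr1; apply.
    by rewrite -scalemxAl -rowE => i j; rewrite !mxE (ord1 j) mulrC.
  have Ix : ~ I x.
    move=> Ix; have := mA (delta_mx 0 0) _ 0 0; rewrite mxE => /(_ _)/pM.1; apply.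
    by rewrite -rowE => i j; rewrite !mxE (ord1 j).
  exists 1%N; apply: (@regat_nzd _ noeth I M 0 x) => //; first exact: gA.1.
  apply: regat0; first by apply: iadd1_sub => //; apply: gA.1.
  move=> y /gA.2[u] /(_ 0 0); rewrite !mxE eqxx mulr1n big_ord_recl /= => yE.
  apply/iadd1P; exists (u 0 0), (y - u 0 0 * x); split; last by rewrite subrK.
  rewrite big1 ?addr0 // in yE => i _; have [->|Ai0] := pselect (A (lift 0 i) 0 = 0); first by rewrite mulr0.
  (* Two generators always satisfy the Koszul relation; between free generators it forces x into
     I. *)
  exfalso; apply: Ix; have := kA (A (lift 0 i) 0 *: delta_mx 0 0 - x *: delta_mx 0 (lift 0 i)) _ 0 (lift 0 i).
  rewrite !mxE !eqxx [lift 0 i == 0]eq_sym (negPf (neq_lift _ _)) /= mulr0 mulr1 add0r.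
  move=> /(_ _)/idealN; rewrite opprK; apply.
  by rewrite mulmxBl -!scalemxAl -!rowE => i' j; rewrite !mxE (ord1 j) mulrC subrr.
have [[y Iy yM]|nd] := pselect (exists2 y, ~ I y & forall m, M m -> I (y * m)).
  have kA := depth0_free Iy yM mA pA; case: e A {X Y AX AY} mA pA gA kA => [|e] A mA pA gA kA.
    by exists 0%N; apply: regat0 => // x /gA.2[u] /(_ 0 0); rewrite [u]thinmx0 mul0mx subr0 mxE eqxx mulr1n.
  case: Iy; have := kA (y *: delta_mx 0 0) _ 0 0; rewrite !mxE mulr1; apply.
  by rewrite -scalemxAl -rowE => i j; rewrite !mxE (ord1 j); apply/yM/gA.1.
pose K2 := isum I (ideal_mul M M).
have [ys [ym yM]] := maxcolon_list noeth I.
have [ps psE] : exists ps : seq (ideal R), forall p, List.In p ps <-> exists2 y, y \in ys & p = colon I y.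
  exists (map (colon I) ys) => p; elim: ys {ym yM} => [|y ys IHy] /=; first by split=> // -[].
  split=> [[<-|/IHy[z zs ->]]|[z]]; [by exists y; rewrite ?mem_head|by exists z; rewrite // inE zs orbT|].
  by rewrite inE => /predU1P[-> ->|zs pE]; [left|right; apply/IHy; exists z].
have Mcol y : maxcolon I y -> ~ (M `<=` colon I y).
  by move=> [Iy _] My; apply: nd; exists y.
have [|||x [Mx K2x xps]] := @prime_avoidance _ K2 K2 M ps.
- by move=> a y Ka Ky /idealB/(_ Ky); rewrite addrK.
- apply: contrapT => no; apply: MI => x Mx.
  have [|t Mt tM] := @nakayama_at _ noeth _ pM I M; last exact/(psatM Mt)/tM.
  by move=> z Mz; apply: sat_sub; apply: contrapT => Kz; apply: no; exists z.
- move=> p /psE[y yy ->]; have my := ym _ yy; have py := maxcolon_prime my; split=> //; first exact: Mcol.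
  move=> Ky; apply: (Mcol _ my) => z Mz; have /Ky/py.2[] // : K2 (z * z).
  by apply/isumR/imul_mem.
have nx : nzd I x.
  apply: contrapT => /not_nzd[//|z mz zx]; have [y yy zy] := yM _ mz.
  by apply: (xps (colon I y)) (zy _ zx); apply/psE; exists y.
have [a aP] := gA.2 _ Mx.
have [k /unitM[v av]] : exists k, ~ M (a 0 k).
  apply: contrapT => /forallNP aM; apply: K2x.
  have := aP 0 0; rewrite !mxE eqxx mulr1n => H; rewrite -[x](subrK (\sum_j a 0 j * A j 0)).
  apply: idealD; first exact: isumL.
  apply: idealS => j _; apply/isumR/imul_mem; last exact: gA.1.
  by apply: contrapT; apply: aM.
have [c [K [gK pK]]] := pA.
(* Because a A = x, the matrix A a - x annihilates A, so its rows are combinations of the relations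
   K. *)
have [F FP] : exists F, matI I (A *m a - x%:M - F *m K).
  apply: (genskerM gK); rewrite mulmxBl mul_scalar_mx -mulmxA.
  have -> : A *m (a *m A) - x *: A = - (A *m (x%:M - a *m A)) by rewrite mulmxBr mul_mx_scalar opprB.
  by apply/matIN/matIM.
have FJ : matI (iadd1 I x) (A *m a - F *m K).
  have -> : A *m a - F *m K = (A *m a - x%:M - F *m K) + x%:M by rewrite addrAC subrK.
  by apply: matID; [apply: matI_sub FP; apply: iadd1L|rewrite -scalemx1; apply/matIZl/iadd1R].
have KM := minrows_ent mA gK.1.
(* Coordinates of minimal relations lie in M. Projecting to the coordinate k, where x has an
   invertible coefficient with inverse v, gives the retraction onto M/(x). *)
have [G GP] : exists G : 'M_(c, e), matI I (v *: col k K - G *m A).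
  have [|G GP] := @rows_choice R I 1 e c (fun w u => matI I (w - u *m A)) (v *: col k K).
    move=> i; have [|u uP] := gA.2 (v * K i k); first by apply/idealM/KM.
    exists u; have -> // : row i (v *: col k K) = (v * K i k)%:M.
    by apply/matrixP => p q; rewrite !mxE !ord1 eqxx mulr1n.
  exists G; apply: matI_row => i; have := GP i; rewrite -row_mul => H p q; have := H p q; by rewrite !mxE.
have GJ := matI_sub (@iadd1L _ I x) GP.
have pJ : pdim n (iadd1 I x) A.
  apply: (pd_retract noeth (A := K) (F := F) (G := G)); last exact: pd_mod (gensker_lifts nx gK) pK.
  - by move=> u uA; apply: (matI_eqM FJ); rewrite mulmxA; apply: matIMl.
  - move=> w wK; apply: (matI_eqM GJ).
    rewrite -scalemxAr; apply: matIZ => i j; have := wK i k; rewrite !mxE.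
    by under [in X in _ -> X]eq_bigr do rewrite mxE.
  - have -> : F *m (G *m A) - A = - (F *m (v *: col k K - G *m A)) - v *: col k (A *m a - F *m K).
      have E : v *: col k (A *m a) = A.
        apply/matrixP => i j; rewrite !mxE big_ord1 (ord1 j) mulrC -mulrA av mulr1 //.
      have E' : F *m (v *: col k K) = v *: col k (F *m K).
        by rewrite -scalemxAr; congr (_ *: _); apply/matrixP => i j; rewrite !mxE; apply: eq_bigr => l _; rewrite mxE.
      have -> : col k (A *m a - F *m K) = col k (A *m a) - col k (F *m K).
        by apply/matrixP => i j; rewrite !mxE.
      rewrite mulmxBr E' scalerBr E !opprB addrA subrK //.
    apply: matIB; first by apply/matIN/matIM.
    by apply: matIZ => i j; have := FJ i k; rewrite !mxE.
have IJM : iadd1 I x `<=` M by apply: iadd1_sub.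
have [|d rd] := IH _ _ A IJM _ pJ.
  split=> [|y /gA.2[u uP]]; first exact: gA.1.
  by exists u; apply: matI_sub uP; apply: iadd1L.
by exists d.+1; apply: regat_nzd nx rd.
Qed.

End LocalMatrix.

(** * Contraction of ideals and transfer along localisations *)

Section Preimage.
Variables (R S : comPzRingType) (f : {rmorphism R -> S}).

Definition ipre (J : ideal S) : ideal R.
Proof.
exists [set x | J (f x)].
- by rewrite /mkset rmorph0.
- by move=> x y Jx Jy; rewrite /mkset rmorphD; apply: idealD.
- by move=> a x Jx; rewrite /mkset rmorphM; apply: idealM.
Defined.

Lemma ipre_prime J : is_prime J -> is_prime (ipre J).
Proof. by move=> pJ; split=> [|x y] /=; rewrite ?rmorph1 ?rmorphM; [apply: pJ.1|apply: pJ.2]. Qed.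

Lemma is_unit_rmorph x : is_unit x -> is_unit (f x).
Proof. by move=> [y xy]; exists (f y); rewrite -rmorphM xy rmorph1. Qed.

Lemma rmorph_igen s x : igen s x -> igen (map f s) (f x).
Proof.
have H : igen s `<=` ipre (igen (map f s)) by apply: igen_sub => y ys; apply/igen_mem/map_f.
exact: H.
Qed.

Lemma rmorph_pow (I : ideal R) (J : ideal S) n x : (forall y, I y -> J (f y)) ->
  ipow I n x -> ipow J n (f x).
Proof.
move=> IJ; have H : ipow I n `<=` ipre (ipow J n); last exact: H.
elim: n => [y _|n IH]; first exact: ipow0.
apply: imul_sub => a b /IJ Ja /IH Jb /=.
by rewrite rmorphM; apply: ipowS.
Qed.

End Preimage.

Section Localize.
Variables (R L : comPzRingType) (Q : ideal R) (f : {rmorphism R -> L}).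
Hypothesis pQ : is_prime Q.

Definition is_loc := [/\ forall s, ~ Q s -> is_unit (f s),
  forall z, exists r s, ~ Q s /\ f s * z = f r & forall r, f r = 0 -> exists2 s, ~ Q s & s * r = 0].

Hypothesis fL : is_loc.

Lemma loc_unit s : ~ Q s -> is_unit (f s). Proof. by case: fL => H _ _; apply: H. Qed.
Lemma loc_frac z : exists r s, ~ Q s /\ f s * z = f r. Proof. by case: fL. Qed.
Lemma loc_zero r : f r = 0 -> exists2 s, ~ Q s & s * r = 0. Proof. by case: fL => _ _; apply. Qed.

Definition lext (I : ideal R) : ideal L.
Proof.
exists [set z | exists r s, [/\ I r, ~ Q s & f s * z = f r]].
- by exists 0, 1; split; [|apply: pQ.1|rewrite mulr0 rmorph0].
- move=> z w [r [s [Ir Qs sz]]] [r' [s' [Ir' Qs' sw]]].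
  exists (s' * r + s * r'), (s * s'); split; [by apply: idealD; apply: idealM|by case/pQ.2|].
  by rewrite rmorphD !rmorphM -sz -sw; ring.
- move=> w z [r [s [Ir Qs sz]]]; have [r' [s' [Qs' sw]]] := loc_frac w.
  exists (r' * r), (s' * s); split; [exact: idealM|by case/pQ.2|].
  by rewrite !rmorphM -sz -sw; ring.
Defined.

Lemma lextP (I : ideal R) r : I r -> lext I (f r).
Proof. by move=> Ir; exists r, 1; rewrite rmorph1 mul1r; split=> //; apply: pQ.1. Qed.

Lemma lext_pre (P : ideal R) x : is_prime P -> P `<=` Q -> lext P (f x) <-> P x.
Proof.
move=> pP PQ; split; last exact: lextP.
move=> [r [s [Pr Qs /eqP]]]; rewrite -rmorphM -subr_eq0 -rmorphB => /eqP/loc_zero[t Qt E].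
have : P (t * (s * x)) by rewrite -[_ * _](subrK (t * r)) -mulrBr E add0r; apply: idealM.
by move=> /pP.2[/PQ//|/pP.2[/PQ//|]].
Qed.

Lemma lext_prime (P : ideal R) : is_prime P -> P `<=` Q -> is_prime (lext P).
Proof.
move=> pP PQ; split; first by rewrite -(rmorph1 f) => /(lext_pre _ pP PQ)/pP.1.
move=> z w [r [s [Pr Qs E]]]; have [a [u [Qu uz]]] := loc_frac z; have [b [v [Qv vw]]] := loc_frac w.
have : P (s * (a * b)).
  apply/(lext_pre _ pP PQ); rewrite !rmorphM -uz -vw.
  have -> : f s * (f u * z * (f v * w)) = f u * f v * (f s * (z * w)) by ring.
  by rewrite E -!rmorphM; apply: lextP; apply: idealM.
by move=> /pP.2[/PQ//|/pP.2[Pa|Pb]]; [left; exists a, u|right; exists b, v].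
Qed.

Lemma lext_ipre (J : ideal L) z : lext (ipre f J) z <-> J z.
Proof.
split=> [[r [s [/= Jr Qs E]]]|Jz].
  by have [v sv] := loc_unit Qs; rewrite -[z]mul1r -sv mulrAC E; apply: idealMl.
by have [r [s [Qs E]]] := loc_frac z; exists r, s; split=> //=; rewrite -E; apply: idealM.
Qed.

Lemma ipre_sub (J : ideal L) : is_prime J -> ipre f J `<=` Q.
Proof. by move=> pJ x Jx; apply: contrapT => /loc_unit/unit_ideal/(_ Jx)/pJ.1. Qed.

Lemma loc_noeth : noetherian R -> noetherian L.
Proof.
move=> noeth J; have [s sE] := noeth_fg noeth (ipre f J); exists (map f s).
apply: ideal_ext => z; split=> [/lext_ipre[r [t [/sE sr Qt E]]]|].
  have [v tv] := loc_unit Qt; rewrite -[z]mul1r -tv mulrAC E; apply: idealMl.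
  exact: rmorph_igen.
by apply: igen_sub => _ /mapP[x /igen_mem/sE xs ->].
Qed.

Lemma loc_maximal_unit z : ~ lext Q z -> is_unit z.
Proof.
have [r [s [Qs E]]] := loc_frac z => Qz.
have /loc_unit[v rv] : ~ Q r by move=> Qr; apply: Qz; exists r, s.
by exists (f s * v); rewrite mulrA (mulrC z) E.
Qed.

Lemma ht_ge_ipre (J : ideal L) d : ht_ge (izero L) J d -> ht_ge (izero R) (ipre f J) d.
Proof.
move=> [c cd [_ cJ]]; exists (fun i => PrimeIdeal (ipre_prime f (Defs.primeP (c i)))).
  move=> i /cd[H1 H2]; split=> [x|H]; first exact: H1.
  by apply: H2 => z /lext_ipre[r [s [/H /= zr Qs E]]]; apply/lext_ipre; exists r, s.
by split=> [x ->|]; [exact: (ideal0 (ipre f (c 0%N)))|rewrite -(ideal_eq cJ)].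
Qed.

Lemma ht_ge_lext (P : ideal R) d : is_prime P -> P `<=` Q -> ht_ge (izero R) P d ->
  ht_ge (izero L) (lext P) d.
Proof.
move=> pP PQ; elim: d P pP PQ => [|d IH] P pP PQ hP.
  by apply: ht_ge0; [apply: lext_prime|move=> z ->].
have [P' hP' P'P] := ht_ge_pred hP; have pP' := ht_ge_prime hP'.
have P'Q : P' `<=` Q by move=> x; move/(P'P.1); apply: PQ.
apply: ht_geS (IH _ pP' P'Q hP') _; first exact: lext_prime.
have [H1 H2] := P'P; split=> [z [r [s [/H1 Pr Qs E]]]|H]; first by exists r, s.
by apply: H2 => x /lextP/H/(lext_pre _ pP' P'Q).
Qed.

Lemma common_denom (T : eqType) (F : T -> L) (l : seq T) :
  exists2 s, ~ Q s & forall x, x \in l -> exists r, f s * F x = f r.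
Proof.
elim: l => [|a l [s Qs sP]]; first by exists 1; [apply: pQ.1|].
have [r [t [Qt E]]] := loc_frac (F a); exists (t * s); first by case/pQ.2.
move=> x; rewrite inE rmorphM => /orP[/eqP ->|/sP[r' E']].
  by exists (s * r); rewrite rmorphM -E; ring.
by exists (t * r'); rewrite rmorphM -E' mulrA.
Qed.

Lemma common_kill (T : eqType) (G : T -> R) (l : seq T) : (forall x, x \in l -> f (G x) = 0) ->
  exists2 s, ~ Q s & forall x, x \in l -> s * G x = 0.
Proof.
elim: l => [|a l IH] H; first by exists 1; [apply: pQ.1|].
have [|s Qs sP] := IH; first by move=> x xl; apply: H; rewrite inE xl orbT.
have [t Qt tP] := loc_zero (H _ (mem_head _ _)); exists (t * s); first by case/pQ.2.
by move=> x; rewrite inE => /predU1P[->|/sP sx]; [rewrite mulrAC tP mul0r|rewrite -mulrA sx mulr0].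
Qed.

Lemma loc_igen s z : igen (map f s) z -> exists r t, [/\ igen s r, ~ Q t & f t * z = f r].
Proof.
have H : igen (map f s) `<=` lext (igen s) by apply: igen_sub => _ /mapP[x /igen_mem xs ->]; apply: lextP.
by move=> /H.
Qed.

Lemma regat_lext (P : ideal R) d : is_prime P -> P `<=` Q -> regat (izero R) P d ->
  regat (izero L) (lext P) d.
Proof.
move=> pP PQ [_ [s [ls sP sg hd]]]; split; first exact: lext_prime.
exists (map f s); split; first by rewrite size_map.
- by move=> _ /mapP[x /sP Px ->]; apply: lextP.
- move=> z [r [u [/sg[t Pt [o [y [o0 sy E]]]] Qu E']]]; exists (f (t * u)).
    by move=> /(lext_pre _ pP PQ)/pP.2[//|/PQ].
  apply: isumR; rewrite rmorphM -mulrA E' -rmorphM E o0 add0r; exact: rmorph_igen.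
- exact: ht_ge_lext.
Qed.

Lemma regat_ipre (J : ideal L) d : regat (izero L) J d -> regat (izero R) (ipre f J) d.
Proof.
move=> [pJ [s [ls sJ sg hd]]]; have pP := ipre_prime f pJ; split=> //.
have [t Qt tP] := common_denom id s.
have /choice[g gP] : forall x, exists r, x \in s -> f t * x = f r.
  move=> x; have [/tP[r E]|] := boolP (x \in s); last by exists 0.
  by exists r.
have ss x : igen s x -> igen (map f (map g s)) x.
  apply: igen_sub => y ys; have [v tv] := loc_unit Qt.
  rewrite -[y]mul1r -tv mulrAC (gP _ ys); apply/idealMl/igen_mem; rewrite -map_comp.
  by apply/mapP; exists y.
exists (map g s); split; first by rewrite size_map.
- by move=> _ /mapP[x xs ->] /=; rewrite -gP //; apply/idealM/sJ.
- move=> x /sg[w Jw [o [y [-> /ss/loc_igen[r [u [sr Qu E]]] E']]]].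
  have [a [b [Qb E2]]] := loc_frac w.
  have Ja : ~ J (f a).
    rewrite -E2 => /pJ.2[Jb|//]; apply: pJ.1; exact: unit_ideal (loc_unit Qb) Jb.
  have : f (u * (a * x) - b * r) = 0.
    by rewrite rmorphB !rmorphM -E2 -E -mulrA E' add0r; ring.
  move=> /loc_zero[c Qc /eqP]; rewrite mulrBr subr_eq0 => /eqP E3.
  exists (c * u * a).
    rewrite /= !rmorphM => /pJ.2[/pJ.2[]|//]; by apply/contra_not: pJ.1; apply/unit_ideal/loc_unit.
  by apply: isumR; rewrite -!mulrA E3; do 2 apply: idealM.
- exact: ht_ge_ipre.
Qed.

Lemma mat_frac m n (Z : 'M[L]_(m, n)) : exists s r, ~ Q s /\ f s *: Z = map_mx f r.
Proof.
have [s Qs sP] := common_denom (fun ij => Z ij.1 ij.2) (enum {: 'I_m * 'I_n}).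
have /choice[g gP] : forall ij : 'I_m * 'I_n, exists r, f s * Z ij.1 ij.2 = f r.
  by move=> ij; apply: sP; rewrite mem_enum.
by exists s, (\matrix_(i, j) g (i, j)); split=> //; apply/matrixP => i j; rewrite !mxE -gP.
Qed.

Lemma mat_kill m n (A : 'M[R]_(m, n)) : map_mx f A = 0 -> exists2 s, ~ Q s & s *: A = 0.
Proof.
move=> /matrixP A0; have [ij _|s Qs sP] := @common_kill _ (fun ij => A ij.1 ij.2) (enum {: 'I_m * 'I_n}).
  by have := A0 ij.1 ij.2; rewrite !mxE.
exists s => //; apply/matrixP => i j; rewrite !mxE; apply: (sP (i, j)); exact: mem_enum.
Qed.

Lemma matI_zero (K : comPzRingType) m n (A : 'M[K]_(m, n)) : matI (izero K) A <-> A = 0.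
Proof. by split=> [H|-> i j]; [apply/matrixP => i j; rewrite mxE; apply: H|rewrite mxE]. Qed.

Lemma loc_rel a b (A : 'M[R]_(a, b)) (u : 'rV[L]_a) : u *m map_mx f A = 0 ->
  exists s r, [/\ ~ Q s, f s *: u = map_mx f r & r *m A = 0].
Proof.
move=> uA; have [s [r [Qs E]]] := mat_frac u.
have [|t Qt tr] := @mat_kill _ _ (r *m A).
  by rewrite map_mxM -E -scalemxAl uA scaler0.
exists (t * s), (t *: r); split; first by case/pQ.2.
  by rewrite rmorphM -scalerA E map_mxZ.
by rewrite -scalemxAl.
Qed.

Lemma pd_loc n a b (A : 'M[R]_(a, b)) : pdim n (izero R) A -> pdim n (izero L) (map_mx f A).
Proof.
elim: n a b A => [|n IH] a b A.
  move=> [E [/matI_zero EA Ek]]; exists (map_mx f E); split.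
    by apply/matI_zero; rewrite -map_mxM -map_mxB EA map_mx0.
  move=> u /matI_zero/loc_rel[s [r [Qs E1 /matI_zero/Ek/matI_zero rE]]]; apply/matI_zero.
  have [v sv] := loc_unit Qs; rewrite -[u]scale1r -sv mulrC -scalerA E1 -scalemxAl -map_mxM rE.
  by rewrite map_mx0 scaler0.
move=> [c [K [[/matI_zero KA gK] /IH pK]]]; exists c, (map_mx f K); split=> //; split.
  by apply/matI_zero; rewrite -map_mxM KA map_mx0.
move=> u /matI_zero/loc_rel[s [r [Qs E1 /matI_zero/gK[w /matI_zero/eqP]]]].
rewrite subr_eq0 => /eqP E2; have [v sv] := loc_unit Qs; exists (v *: map_mx f w); apply/matI_zero.
by rewrite -scalemxAl -map_mxM -E2 -E1 scalerA mulrC sv scale1r subrr.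
Qed.

End Localize.

Lemma localization_isloc R (P : Spec R) : is_loc P (localization_map P).
Proof.
split=> [s Ps|z|r].
- have sP : s \notin ideal_set P by rewrite notin_setE.
  exists (cs_pi ((1, Sub s sP) : localization_setoid P)).
  rewrite -[LHS]cs_piM -[RHS]cs_pi1; apply/cs_piP/frac_eqE => /=.
  by rewrite mul1r !mulr1 mul1r.
- rewrite -(cs_reprK z); case: (cs_repr z) => a [s sP]; exists a, s; split; first by rewrite -notin_setE.
  rewrite -[LHS]cs_piM; apply/cs_piP/frac_eqE => /=.
  by rewrite !mul1r mulr1 mulrC.
- rewrite -[RHS]cs_pi0 => /cs_piP[[t tP] /=]; rewrite mul0r subr0 mulr1 => E; exists t => //.
  by rewrite -notin_setE.
Qed.

(** * Regularity passes to localisations *)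

Section Serre.
Variable R : comPzRingType.
Hypothesis noeth : noetherian R.

(** Generators of Q have a finite resolution over the regular local ring R. It stays finite after
    localisation, and finite projective dimension of the maximal ideal there implies regularity. *)
Theorem serre_local (M Q : ideal R) (L : comPzRingType) (f : {rmorphism R -> L}) d :
  is_prime M -> (forall x, ~ M x -> is_unit x) -> regat (izero R) M d -> is_prime Q ->
  is_loc Q f -> exists e, regat (izero R) Q e.
Proof.
move=> pM uM rM pQ fL.
have nL := loc_noeth pQ fL noeth.
have pQL := lext_prime pQ fL pQ (@subset_refl _ Q).
have [s sE] := noeth_fg noeth Q.
pose A : 'M[R]_(size s, 1) := \matrix_(i, j) s`_i.
have pA := pd_loc pQ fL (ffr_pdim (regular_ffr noeth pM uM rM A)).
have H0 : izero L `<=` lext pQ fL Q by move=> z ->.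
have gA : gensM (lext pQ fL Q) (izero L) (map_mx f A).
  split=> [i j|z [r [t [/sE/igenP[c rE] Qt E]]]].
    by rewrite !mxE; apply: lextP; apply/sE/igen_mem/mem_nth.
  have [v tv] := loc_unit fL Qt; exists (v *: map_mx f (\row_i c i)); apply/matI_zero/matrixP => i j.
  rewrite -scalemxAl -map_mxM !mxE !ord1 eqxx mulr1n.
  have -> : z = v * f r by rewrite -E mulrA (mulrC v) tv mul1r.
  rewrite rE; apply/eqP; rewrite subr_eq0; apply/eqP; congr (_ * f _); apply: eq_bigr => k _.
  by rewrite !mxE.
have [e re] := finite_pd_regular nL pQL (@loc_maximal_unit _ _ _ _ pQ fL) H0 gA pA.
exists e; have := regat_ipre pQ fL re; rewrite (_ : ipre f _ = Q) //.
by apply/ideal_eq/ideal_ext => x; apply: (lext_pre pQ fL).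
Qed.

Lemma local_ringP S (N : ideal S) : noetherian S -> is_prime N ->
  (forall x, ~ N x -> is_unit x) -> local_ring N.
Proof.
move=> nS pN uN; split=> //.
  by split=> [|J J1 _]; [exact: pN.1|exact: local_sub].
move=> N' [N'1 N'm]; have N'N : N' `<=` N by apply: local_sub.
by apply/seteqP; split=> //; apply: N'm => //; apply: pN.1.
Qed.

Lemma local_unit S (N : ideal S) : local_ring N -> is_prime N /\ forall x, ~ N x -> is_unit x.
Proof.
move=> [nS [N1 Nm] uN].
have H x : ~ N x -> is_unit x.
  move=> Nx; apply: contrapT => nu.
  have [|P [pP mP xP]] := @maximal_above _ nS (igen [:: x]).
    by move=> /igen1[r E]; apply: nu; exists r; rewrite mulrC.
  by apply: Nx; rewrite -(uN _ mP); apply/xP/igen_mem/mem_head.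
split=> //; split=> // x y Nxy; apply: contrapT => /not_orP[/H xu /H yu].
by apply: N1; apply: unit_ideal Nxy; apply: unitM.
Qed.

(** The bridge between regularity of the ring of fractions and [regat], which speaks of R alone. *)
Lemma regularP (P : Spec R) : regular_local_ring (localization P) <-> exists d, regat (izero R) P d.
Proof.
have fL := localization_isloc P; have pP := Defs.primeP P.
have nL := loc_noeth pP fL noeth.
split=> [[N [d [lN [[c cd] _] [s [ls sE]]]]]|[d rP]].
  have [pN uN] := local_unit lN.
  exists d; have -> : (P : ideal R) = ipre (localization_map P) N.
    apply/ideal_eq/seteqP; split; last exact: ipre_sub fL _ pN.
    move=> x Px /=; apply: contrapT => /uN[y E].
    by apply: (lext_prime pP fL pP (@subset_refl _ P)).1; rewrite -E; apply/idealMl/lextP.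
  apply: (regat_ipre pP fL); split=> //; exists s; split=> //.
  - by move=> x /igen_mem xs; rewrite sE.
  - by move=> x Nx; exists 1; [exact: pN.1|rewrite mul1r; apply: isumR; move: Nx; rewrite sE].
  - have H : ht_ge (izero (localization P)) (c d) d by exists c => //; split=> // z ->.
    apply: (ht_ge_sub pN H) => z cz; apply: contrapT => /uN zu.
    by apply: (Defs.primeP (c d)).1; apply: unit_ideal zu cz.
have rL := regat_lext pP fL pP (@subset_refl _ P) rP.
have [pL [s [ls sP sg hd]]] := rL; have uL := @loc_maximal_unit _ _ _ _ pP fL.
exists (lext pP fL P), d; split; first exact: local_ringP.
  split=> [|[c cd]]; first by have [c cd _] := hd; exists c.
  suff : ht_ge (izero _) (lext pP fL P) d.+1 by move=> /(regat_ht nL rL); rewrite ltnn.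
  have H : ht_ge (izero (localization P)) (c d.+1) d.+1 by exists c => //; split=> // z ->.
  apply: (ht_ge_sub pL H) => z cz; apply: contrapT => /uL zu.
  by apply: (Defs.primeP (c d.+1)).1; apply: unit_ideal zu cz.
exists s; split=> //; apply: ideal_ext => z; split; last exact: igen_sub.
move=> /sg[t /uL[v tv] [o [y [-> sy E]]]]; rewrite add0r in E.
by rewrite -[z]mul1r -tv mulrAC E; apply: idealMl.
Qed.

End Serre.

(** As R need not be local, [serre_local] is applied to the localisation at P. *)
Theorem serre R (noeth : noetherian R) (P Q : ideal R) d : is_prime Q -> Q `<=` P -> regat (izero R) P d ->
  exists e, regat (izero R) Q e.
Proof.
move=> pQ QP rP; have pP := rP.1; pose PS := PrimeIdeal pP.
have fL : is_loc P (localization_map PS) := localization_isloc PS.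
have nL := loc_noeth pP fL noeth.
have rL := regat_lext pP fL pP (@subset_refl _ P) rP.
have pQL := lext_prime pP fL pQ QP.
pose QS := PrimeIdeal pQL.
have [e re] : exists e, regat (izero _) (lext pP fL Q) e.
  apply: (serre_local nL (lext_prime pP fL pP (@subset_refl _ P)) (@loc_maximal_unit _ _ _ _ pP fL) rL pQL).
  exact: localization_isloc QS.
exists e; have := regat_ipre pP fL re; rewrite (_ : ipre _ _ = Q) //.
by apply/ideal_eq/ideal_ext => x; apply: (lext_pre pP fL).
Qed.

(** * Transfer along surjections *)

Section Surjection.
Variables (R S : comPzRingType) (f : {rmorphism R -> S}).
Hypothesis fS : forall y, exists x, f x = y.

Definition iimg (J : ideal R) : ideal S.
Proof.
exists [set y | exists2 x, J x & f x = y].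
- by exists 0; [|rewrite rmorph0].
- by move=> _ _ [x Jx <-] [y Jy <-]; exists (x + y); [apply: idealD|rewrite rmorphD].
- move=> a _ [x Jx <-]; have [b <-] := fS a.
  by exists (b * x); [apply: idealM|rewrite rmorphM].
Defined.

Notation ker := (ipre f (izero S)).

Lemma iimgP (J : ideal R) x : ker `<=` J -> iimg J (f x) <-> J x.
Proof.
move=> kJ; split=> [[y Jy E]|Jx]; last by exists x.
by rewrite -[x](subrK y); apply: idealD => //; apply: kJ; rewrite /= /mkset rmorphB E subrr.
Qed.

Lemma ker_ipre (J : ideal S) : ker `<=` ipre f J.
Proof. by move=> x /= ->. Qed.

Lemma ipre_inj (J K : ideal S) : ipre f J `<=` ipre f K -> J `<=` K.
Proof. by move=> H y; have [x <-] := fS y; apply: H. Qed.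

Lemma iimg_prime (J : ideal R) : ker `<=` J -> is_prime J -> is_prime (iimg J).
Proof.
move=> kJ pJ; split; first by rewrite -(rmorph1 f) => /(iimgP _ kJ)/pJ.1.
move=> x y; have [a <-] := fS x; have [b <-] := fS y; rewrite -rmorphM.
by move=> /(iimgP _ kJ)/pJ.2[H|H]; [left|right]; apply/iimgP.
Qed.

Lemma noeth_surj : noetherian R -> noetherian S.
Proof.
move=> noeth J; have [s sE] := noeth_fg noeth (ipre f J); exists (map f s).
apply: ideal_ext => y; split.
  by have [x <-] := fS y => Jx; apply/rmorph_igen/sE.
by apply: igen_sub => _ /mapP[x /igen_mem/sE xs ->].
Qed.

Lemma ht_ge_surj (I P : ideal S) d : ht_ge I P d <-> ht_ge (ipre f I) (ipre f P) d.
Proof.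
split=> [[c cd [cI cP]]|H].
  exists (fun i => PrimeIdeal (ipre_prime f (Defs.primeP (c i)))).
    move=> i /cd[H1 H2]; split=> [x|H]; first exact: H1.
    by apply/H2/ipre_inj.
  by split=> [x /= /cI|] //; rewrite -(ideal_eq cP).
have pP : is_prime P.
  have pp := ht_ge_prime H; split=> [P1|x y]; first by apply: pp.1; rewrite /= rmorph1.
  have [a <-] := fS x; have [b <-] := fS y; rewrite -rmorphM; exact: (pp.2 a b).
have IP : I `<=` P by apply: ipre_inj; apply: ht_ge_I H.
elim: d P pP IP H => [|d IH] P pP IP H; first exact: ht_ge0.
have [Q hQ QP] := ht_ge_pred H; have pQ := ht_ge_prime hQ; have IQ := ht_ge_I hQ.
have kQ : ker `<=` Q by move=> x /ker_ipre/IQ.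
have E : ipre f (iimg Q) = Q by apply/ideal_eq/ideal_ext => x; apply: iimgP.
apply: (@ht_geS _ _ (iimg Q)) => //; last first.
  by have [H1 H2] := QP; split=> [y [x /H1 Px <-]//|H3]; apply: H2 => x /H3/(iimgP _ kQ).
apply: IH; rewrite ?E //; first exact: iimg_prime.
by move=> y; have [x <-] := fS y => Ix; apply/(iimgP _ kQ)/IQ.
Qed.

Lemma regat_surj (I P : ideal S) d : regat I P d <-> regat (ipre f I) (ipre f P) d.
Proof.
split=> [[pP [s [ls sP sg hd]]]|[pP [s [ls sP sg hd]]]].
  split; first exact: ipre_prime.
  have /choice[g gP] := fS.
  exists (map g s); split; first by rewrite size_map.
  - by move=> _ /mapP[x /sP Px ->] /=; rewrite gP.
  - move=> x /sg[t Pt [i [y [Ii sy E]]]]; exists (g t); first by rewrite /= gP.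
    have [i' Ei] := fS i.
    have : forall z, igen s z -> exists2 w, igen (map g s) w & f w = z.
      move=> z sz; have : igen (map f (map g s)) z.
        by rewrite -map_comp (eq_map (g := id)) ?map_id // => w /=; rewrite gP.
      have H : igen (map f (map g s)) `<=` iimg (igen (map g s)).
        by apply: igen_sub => _ /mapP[w wg ->]; exists w => //; apply: igen_mem.
      by move=> /H[w wg wE]; exists w.
    move=> /(_ y sy)[y' sy' Ey]; exists (g t * x - y'), y'; split=> //; last by rewrite subrK.
    by rewrite /= rmorphB rmorphM gP E Ey addrK.
  - exact/ht_ge_surj.
have pP' : is_prime P.
  have pp := pP; split=> [P1|x y]; first by apply: pp.1; rewrite /= rmorph1.
  have [a <-] := fS x; have [b <-] := fS y; rewrite -rmorphM; exact: (pp.2 a b).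
split=> //; exists (map f s); split; first by rewrite size_map.
- by move=> _ /mapP[x /sP Px ->].
- move=> y; have [x <-] := fS y => /(sg x)[t Pt [i [z [Ii sz E]]]]; exists (f t) => //.
  by rewrite -rmorphM E rmorphD; exists (f i), (f z); split=> //; apply: rmorph_igen.
- exact/ht_ge_surj.
Qed.

End Surjection.

Lemma quot_surj R (I : ideal R) y : exists x, quotient_map I x = y.
Proof. by exists (cs_repr y); apply: (cs_reprK y). Qed.

Lemma quot_eq0 R (I : ideal R) x : quotient_map I x = 0 <-> I x.
Proof. by rewrite -(rmorph0 (quotient_map I)) quot_eqP subr0. Qed.

Lemma quot_dom R (P : ideal R) : is_prime P -> is_prime (izero (quotient_ring P)).
Proof.
move=> pP; split=> [/(quot_eq0 P 1)/pP.1 //|x y].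
have [a <-] := quot_surj x; have [b <-] := quot_surj y.
by rewrite -rmorphM => /quot_eq0/pP.2[H|H]; [left|right]; apply/quot_eq0.
Qed.

Lemma finite_type_comp (A B C : comPzRingType) (f : {rmorphism A -> B}) (g : {rmorphism B -> C}) :
  (forall y, exists x, g x = y) -> finite_type f -> finite_type (g \o f).
Proof.
move=> gS [s sP]; exists (map g s) => S SA Ss SD SM y; have [x <-] := gS y.
apply: (sP [set x | S (g x)]) => [a|b bs|b c Sb Sc|b c Sb Sc]; rewrite /mkset.
- exact: SA.
- by apply/Ss/map_f.
- by rewrite rmorphD; apply: SD.
- by rewrite rmorphM; apply: SM.
Qed.

Lemma ipre_quot R (P : ideal R) : ipre (quotient_map P) (izero (quotient_ring P)) = P.
Proof. by apply/ideal_eq/ideal_ext => x; apply: quot_eq0. Qed.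

Lemma ipre_iimg_quot R (P Q : ideal R) : P `<=` Q ->
  ipre (quotient_map P) (iimg (@quot_surj R P) Q) = Q.
Proof. by move=> PQ; apply/ideal_eq/ideal_ext => x; apply: iimgP; rewrite ipre_quot. Qed.

(** * Subrings and adjunction of elements *)

Section Subring.
Variable R : comPzRingType.

Record subring := Subring {
  sr_set :> set R;
  sr1 : sr_set 1;
  srB : forall x y, sr_set x -> sr_set y -> sr_set (x - y);
  srM : forall x y, sr_set x -> sr_set y -> sr_set (x * y)
}.

Variable S : subring.
Lemma sr0 : S 0. Proof. by rewrite -(subrr 1); apply: srB; apply: sr1. Qed.
#[local] Hint Resolve sr0 sr1 : core.
Lemma srN x : S x -> S (- x). Proof. by rewrite -sub0r; apply: srB. Qed.
Lemma srD x y : S x -> S y -> S (x + y).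
Proof. by move=> Sx Sy; rewrite -[y]opprK; apply: srB => //; apply: srN. Qed.
Lemma srX x n : S x -> S (x ^+ n).
Proof. by move=> Sx; elim: n => [|n IH]; rewrite ?exprS; [apply: sr1|apply: srM]. Qed.
Lemma srS (T : Type) (r : seq T) (p : pred T) (F : T -> R) :
  (forall i, p i -> S (F i)) -> S (\sum_(i <- r | p i) F i).
Proof. by move=> SF; elim/big_rec: _ => [|i x /SF]; [|apply: srD]. Qed.
Lemma sr_nat n : S n%:R. Proof. by elim: n => [|n IH] //; rewrite -addn1 natrD; apply: srD. Qed.

Definition sr_pred : {pred R} := fun x => `[< S x >].
Lemma sr_closed : subring_closed sr_pred.
Proof.
split=> [|x y /asboolP Sx /asboolP Sy|x y /asboolP Sx /asboolP Sy]; apply/asboolP => //; [exact: srB|exact: srM].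
Qed.
HB.instance Definition _ := GRing.isSubringClosed.Build R sr_pred sr_closed.

Definition srT := {x : R | x \in sr_pred}.
HB.instance Definition _ := SubChoice.on srT.
HB.instance Definition _ := GRing.SubChoice_isSubComPzRing.Build R sr_pred srT (GRing.subringClosedP sr_pred).

Definition mksr x (Sx : S x) : srT := exist _ x (asboolT Sx).
Definition sr_ring : comPzRingType := srT.

Definition sr_val (x : sr_ring) : R := val (x : srT).
Lemma sr_val_zmod : zmod_morphism sr_val. Proof. by []. Qed.
Lemma sr_val_monoid : monoid_morphism sr_val. Proof. by []. Qed.
HB.instance Definition _ := GRing.isZmodMorphism.Build sr_ring R sr_val sr_val_zmod.
HB.instance Definition _ := GRing.isMonoidMorphism.Build sr_ring R sr_val sr_val_monoid.

Lemma sr_val_inj : injective sr_val. Proof. exact: val_inj. Qed.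
Lemma sr_valP x : S (sr_val x). Proof. exact/asboolP/(valP (x : srT)). Qed.
Lemma sr_lift x : S x -> exists y : sr_ring, sr_val y = x.
Proof. by move=> Sx; exists (mksr Sx). Qed.

End Subring.
#[local] Hint Resolve sr0 sr1 : core.

Section SubringMorphism.
Variables (R K : comPzRingType) (S : subring R) (f : {rmorphism K -> R}).
Hypothesis fS : forall x, S (f x).

Definition sr_cor (x : K) : sr_ring S := mksr (fS x).
Lemma sr_cor_zmod : zmod_morphism sr_cor.
Proof. by move=> x y; apply: sr_val_inj; rewrite /sr_val /= rmorphB. Qed.
Lemma sr_cor_monoid : monoid_morphism sr_cor.
Proof.
by split=> [|x y]; apply: sr_val_inj; rewrite /sr_val /= ?rmorph1 ?rmorphM.
Qed.
Definition sr_corestr : {rmorphism K -> sr_ring S} := HB.pack sr_cor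
  (GRing.isZmodMorphism.Build K (sr_ring S) sr_cor sr_cor_zmod)
  (GRing.isMonoidMorphism.Build K (sr_ring S) sr_cor sr_cor_monoid).
Lemma sr_corestrE x : sr_val (sr_corestr x) = f x. Proof. by []. Qed.
End SubringMorphism.

Section Adjoin.
Variables (R : comPzRingType).

Definition rimage (K : comPzRingType) (f : {rmorphism K -> R}) : subring R.
Proof.
exists [set y | exists x, f x = y].
- by exists 1; rewrite rmorph1.
- by move=> _ _ [x <-] [y <-]; exists (x - y); rewrite rmorphB.
- by move=> _ _ [x <-] [y <-]; exists (x * y); rewrite rmorphM.
Defined.

Variables (S : subring R) (b : R).

Definition adj_set : set R := [set x | exists n (c : nat -> R), (forall i, S (c i)) /\
  x = \sum_(i < n) c i * b ^+ i].

Lemma adj_pad n (c : nat -> R) m : (forall i, S (c i)) -> (n <= m)%N ->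
  exists c' : nat -> R, (forall i, S (c' i)) /\ \sum_(i < n) c i * b ^+ i = \sum_(i < m) c' i * b ^+ i.
Proof.
move=> Sc nm; exists (fun i => if (i < n)%N then c i else 0); split.
  by move=> i; case: ifP => // _; apply: sr0.
rewrite (big_ord_widen _ (fun i => c i * b ^+ i) nm) big_mkcond.
by apply: eq_bigr => i _; case: ifP => // _; rewrite mul0r.
Qed.

Lemma adjD x y : adj_set x -> adj_set y -> adj_set (x + y).
Proof.
move=> [n [c [Sc ->]]] [m [d [Sd ->]]].
have [c' [Sc' ->]] := adj_pad Sc (leq_maxl n m); have [d' [Sd' ->]] := adj_pad Sd (leq_maxr n m).
exists (maxn n m), (fun i => c' i + d' i); split=> [i|]; first exact: srD.
by rewrite -big_split; apply: eq_bigr => i _; rewrite /= mulrDl.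
Qed.

Lemma adjZ a x : S a -> adj_set x -> adj_set (a * x).
Proof.
move=> Sa [n [c [Sc ->]]]; exists n, (fun i => a * c i); split=> [i|]; first exact: srM.
by rewrite mulr_sumr; apply: eq_bigr => i _; rewrite mulrA.
Qed.

Lemma adjX n x : adj_set x -> adj_set (b ^+ n * x).
Proof.
elim: n x => [|n IH] x; first by rewrite expr0 mul1r.
move=> [m [c [Sc ->]]]; rewrite exprSr -mulrA; apply: IH.
exists m.+1, (fun i => if i is j.+1 then c j else 0); split=> [[|i] //|].
rewrite big_ord_recl mul0r add0r mulr_sumr; apply: eq_bigr => i _.
by rewrite /bump /= exprS mulrCA.
Qed.

Lemma adj_incl x : S x -> adj_set x.
Proof. by move=> Sx; exists 1%N, (fun=> x); split=> //; rewrite big_ord1 expr0 mulr1. Qed.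

Lemma adjM x y : adj_set x -> adj_set y -> adj_set (x * y).
Proof.
move=> [n [c [Sc ->]]] Ay; rewrite mulr_suml; apply: big_ind => [|u v|i _].
- exact/adj_incl/sr0.
- exact: adjD.
- by rewrite -mulrA; apply: adjZ => //; apply: adjX.
Qed.

Definition adj : subring R.
Proof.
exists adj_set; first exact/adj_incl/sr1; last exact: adjM.
by move=> x y Ax Ay; apply: adjD => //; rewrite -mulN1r; apply: adjZ => //; apply/srN/sr1.
Defined.

Lemma adj_gen : adj b.
Proof. by rewrite -[b]mulr1 -[X in X * _]expr1; apply/adjX/adj_incl/sr1. Qed.

Lemma adj_sub (S' : subring R) : S `<=` S' -> S' b -> adj `<=` S'.
Proof.
move=> SS Sb x [n [c [Sc ->]]]; apply: srS => i _; apply: srM; first exact: SS.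
exact: srX.
Qed.

End Adjoin.

(** * The basis theorem for finitely generated algebras *)

Section Hilbert.
Variables (C B : comPzRingType) (g : {rmorphism C -> B}) (b : B).
Hypothesis noeth : noetherian C.

Definition expr_of n x := exists d : nat -> C, x = \sum_(i < n) g (d i) * b ^+ i.

Lemma expr_ofD n x y : expr_of n x -> expr_of n y -> expr_of n (x + y).
Proof.
move=> [c ->] [d ->]; exists (fun i => c i + d i).
by rewrite -big_split; apply: eq_bigr => i _; rewrite /= rmorphD mulrDl.
Qed.
Lemma expr_ofZ n a x : expr_of n x -> expr_of n (g a * x).
Proof.
move=> [d ->]; exists (fun i => a * d i).
by rewrite mulr_sumr; apply: eq_bigr => i _; rewrite rmorphM mulrA.
Qed.
Lemma expr_of0 n : expr_of n 0.
Proof. by exists (fun=> 0); rewrite big1 // => i _; rewrite rmorph0 mul0r. Qed.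
Lemma expr_ofX n k x : expr_of n x -> expr_of (k + n) (b ^+ k * x).
Proof.
move=> [d ->]; exists (fun i => if (i < k)%N then 0 else d (i - k)%N).
rewrite big_split_ord /= [X in _ = X + _]big1 ?add0r => [|i _]; last by rewrite ltn_ord rmorph0 mul0r.
rewrite mulr_sumr; apply: eq_bigr => i _.
by rewrite ltnNge leq_addr /= addKn exprD mulrCA.
Qed.

(** Leading coefficients belong to expressions in b rather than to elements of B: b may be
    algebraic, and an element can then have several expressions. *)
Definition lead_ideal (I : ideal B) (n : nat) : ideal C.
Proof.
exists [set c | exists2 y, expr_of n y & I (g c * b ^+ n + y)].
- by exists 0; [apply: expr_of0|rewrite rmorph0 mul0r addr0].
- move=> c c' [y ey Iy] [y' ey' Iy']; exists (y + y'); first exact: expr_ofD.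
  by rewrite rmorphD mulrDl addrACA; apply: idealD.
- move=> a c [y ey Iy]; exists (g a * y); first exact: expr_ofZ.
  by rewrite rmorphM -mulrA -mulrDr; apply: idealM.
Defined.

Lemma lead_gens (I : ideal B) (n : nat) : exists t : seq B, (forall x, x \in t -> I x) /\
  forall c, lead_ideal I n c -> exists2 y, expr_of n y & igen t (g c * b ^+ n + y).
Proof.
have [s sE] := noeth_fg noeth (lead_ideal I n).
have [t [tI ts]] : exists t : seq B, (forall x, x \in t -> I x) /\
    forall c, c \in s -> exists2 y, expr_of n y & igen t (g c * b ^+ n + y).
  have : forall c, c \in s -> lead_ideal I n c by move=> c /igen_mem/sE.
  elim: s {sE} => [|c s IH] H; first by exists [::].
  have [|t [tI ts]] := IH; first by move=> c' cs; apply: H; rewrite inE cs orbT.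
  have [|y ey Iy] := H c; first by rewrite mem_head.
  exists (g c * b ^+ n + y :: t); split=> [x|c']; first by rewrite inE => /predU1P[->|/tI].
  rewrite inE => /predU1P[->|/ts[y' ey' ty']]; first by exists y => //; apply: igen_mem; rewrite mem_head.
  by exists y' => //; apply: igen_sub ty' => z zt; apply: igen_mem; rewrite inE zt orbT.
exists t; split=> // c /sE; move: c.
have H : igen s `<=` lead_ideal (igen t) n by apply: igen_sub => c /ts.
exact: H.
Qed.

Theorem hilbert_basis : (forall x, exists n, expr_of n x) -> noetherian B.
Proof.
move=> exprB I.
have [|N NP] := @acc _ noeth (lead_ideal I).
  move=> n c [y ey Iy]; exists (b * y); first by rewrite -[b]expr1; apply: (expr_ofX 1).
  by rewrite exprS mulrCA -mulrDr; apply: idealM.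
have /choice[t tP] := lead_gens I.
pose T := flatten [seq t n | n <- iota 0 N.+1].
have tT n x : (n <= N)%N -> igen (t n) x -> igen T x.
  move=> nN; apply: igen_sub => y yt; apply/igen_mem/flattenP; exists (t n) => //.
  by apply/mapP; exists n; rewrite // mem_iota.
exists T; apply: ideal_ext => x; split; last first.
  by apply: igen_sub => y /flattenP[_ /mapP[n _ ->]]; apply: (tP n).1.
have [n nx] := exprB x; elim: n x nx => [|n IH] x [c xE] Ix; first by rewrite xE big_ord0.
rewrite big_ord_recr /= addrC in xE.
have [y [ey Ty]] : exists y, expr_of n y /\ igen T (g (c n) * b ^+ n + y).
  have Ln : lead_ideal I n (c n) by exists (\sum_(i < n) g (c i) * b ^+ i); [exists c|rewrite -xE].
  have [nN|Nn] := leqP n N.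
    by have [y ey ty] := (tP n).2 _ Ln; exists y; split=> //; apply: tT ty.
  have [y ey ty] := (tP N).2 _ (NP _ _ Ln).
  exists (b ^+ (n - N) * y); split.
    by rewrite -[X in expr_of X](subnK (ltnW Nn)); apply: expr_ofX.
  rewrite -[in b ^+ n](subnK (ltnW Nn)) exprD mulrCA -mulrDr; apply: idealM; exact: tT ty.
have -> : x = (g (c n) * b ^+ n + y) + (\sum_(i < n) g (c i) * b ^+ i - y) by rewrite xE; ring.
apply: idealD => //; apply: IH.
  apply: expr_ofD; first by exists c.
  by rewrite -mulN1r -(rmorph1 g) -rmorphN; apply: expr_ofZ.
have -> : \sum_(i < n) g (c i) * b ^+ i - y = x - (g (c n) * b ^+ n + y) by rewrite xE; ring.
apply: idealB => //; move: Ty; apply: igen_sub => z /flattenP[_ /mapP[m _ ->]]; exact: (tP m).1.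
Qed.

End Hilbert.

Lemma noeth_adj R (S : subring R) b :
  noetherian (sr_ring S) -> noetherian (sr_ring (adj S b)).
Proof.
move=> noeth; have SA : forall x : sr_ring S, adj S b (sr_val x) by move=> x; apply/adj_incl/sr_valP.
have [b' bE] := sr_lift (adj_gen S b).
apply: (@hilbert_basis _ _ (sr_corestr SA) b' noeth) => x.
have [n [c [Sc xE]]] := sr_valP x; exists n.
have /choice[c' c'E] : forall i, exists y : sr_ring S, sr_val y = c i by move=> i; apply: sr_lift.
exists c'; apply: sr_val_inj; rewrite xE rmorph_sum; apply: eq_bigr => i _.
by rewrite rmorphM rmorphXn /= sr_corestrE /= c'E bE.
Qed.

Fixpoint adjs R (S : subring R) (s : seq R) : subring R :=
  if s is b :: s' then adjs (adj S b) s' else S.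

Lemma adjs_sub R (S : subring R) s : S `<=` adjs S s /\ forall b, b \in s -> adjs S s b.
Proof.
elim: s S => [|b s IH] S /=; first by split.
have [H1 H2] := IH (adj S b); split.
  by move=> x Sx; apply/H1/adj_incl.
by move=> c; rewrite inE => /predU1P[->|/H2//]; apply/H1/adj_gen.
Qed.

Lemma noeth_adjs R (S : subring R) s :
  noetherian (sr_ring S) -> noetherian (sr_ring (adjs S s)).
Proof. by elim: s S => //= b s IH S nS; apply/IH/noeth_adj. Qed.

Lemma finite_typeP (A B : comPzRingType) (f : {rmorphism A -> B}) : finite_type f ->
  exists s, forall x, adjs (rimage f) s x.
Proof.
move=> [s sP]; exists s; apply: sP.
- by move=> a; apply: (adjs_sub _ s).1; exists a.
- by move=> b /(adjs_sub _ s).2.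
- by move=> *; apply: srD.
- by move=> *; apply: srM.
Qed.

Lemma noeth_finite_type (A B : comPzRingType) (f : {rmorphism A -> B}) :
  noetherian A -> finite_type f -> noetherian B.
Proof.
move=> noeth /finite_typeP[s sB].
apply: (@noeth_surj _ _ (@sr_val _ (adjs (rimage f) s)) (fun y => sr_lift (sB y))).
apply: noeth_adjs; apply: (@noeth_surj _ _ (sr_corestr (S := rimage f) (fun x => ex_intro _ x erefl))) => //.
by move=> y; have [x xE] := sr_valP y; exists x; apply: sr_val_inj.
Qed.

(** * Formal power series in one variable *)

Section PowerSeries.
Variable R : comPzRingType.

Definition pser := nat -> R.
HB.instance Definition _ := gen_eqMixin pser.
HB.instance Definition _ := gen_choiceMixin pser.

Definition ps_add (f g : pser) : pser := fun n => f n + g n.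
Definition ps_opp (f : pser) : pser := fun n => - f n.
Definition ps_mul (f g : pser) : pser := fun n => \sum_(0 <= i < n.+1) f i * g (n - i)%N.
Definition ps_cst (a : R) : pser := fun n => if n is 0%N then a else 0.
Definition ps_X : pser := fun n => if n is 1%N then 1 else 0.

Lemma ps_addA : associative ps_add. Proof. by move=> f g h; apply/funext => n; rewrite /ps_add addrA. Qed.
Lemma ps_addC : commutative ps_add. Proof. by move=> f g; apply/funext => n; rewrite /ps_add addrC. Qed.
Lemma ps_add0 : left_id (ps_cst 0) ps_add.
Proof. by move=> f; apply/funext => -[|n]; rewrite /ps_add /= add0r. Qed.
Lemma ps_addN : left_inverse (ps_cst 0) ps_opp ps_add.
Proof. by move=> f; apply/funext => -[|n]; rewrite /ps_add /ps_opp /= addNr. Qed.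
HB.instance Definition _ := GRing.isZmodule.Build pser ps_addA ps_addC ps_add0 ps_addN.

Lemma triangle_sum N (F : nat -> nat -> R) :
  \sum_(0 <= i < N) \sum_(0 <= j < i.+1) F i j = \sum_(0 <= j < N) \sum_(j <= i < N) F i j.
Proof.
elim: N => [|N IH]; first by rewrite !big_geq.
rewrite big_nat_recr //= IH [in RHS]big_nat_recr //= big_nat1.
rewrite [X in _ + X]big_nat_recr //= addrA; congr (_ + _); rewrite -big_split /=.
by apply: eq_big_nat => j /andP[_ jN]; rewrite big_nat_recr // ltnW.
Qed.

Lemma ps_mulC : commutative ps_mul.
Proof.
move=> f g; apply/funext => n; rewrite /ps_mul big_nat_rev /=.
by apply: eq_big_nat => i /andP[_]; rewrite ltnS => le_in; rewrite add0n subSS subKn // mulrC.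
Qed.

Lemma ps_mulA : associative ps_mul.
Proof.
move=> f g h; apply/funext => n; rewrite {1 3}/ps_mul.
transitivity (\sum_(0 <= i < n.+1) \sum_(0 <= j < i.+1) f j * g (i - j)%N * h (n - i)%N); last first.
  by apply: eq_big_nat => i _; rewrite /ps_mul mulr_suml.
rewrite (triangle_sum _ (fun i j => f j * g (i - j)%N * h (n - i)%N)).
apply: eq_big_nat => j /andP[_]; rewrite ltnS => jn; rewrite /ps_mul mulr_sumr.
rewrite (_ : \sum_(j <= i < n.+1) _ = \sum_(0 + j <= i < n.+1) f j * g (i - j)%N * h (n - i)%N) //.
rewrite big_addn subSn //; apply: eq_big_nat => k _.
by rewrite addnK mulrA [(k + j)%N]addnC subnDA.
Qed.

Lemma ps_mul1 : left_id (ps_cst 1) ps_mul.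
Proof.
move=> f; apply/funext => n; rewrite /ps_mul big_nat_recl //= mul1r subn0.
by rewrite big1 ?addr0 // => i _; rewrite mul0r.
Qed.

Lemma ps_mulD : left_distributive ps_mul ps_add.
Proof.
by move=> f g h; apply/funext => n; rewrite /ps_mul /ps_add -big_split; apply: eq_bigr => i _; rewrite mulrDl.
Qed.
HB.instance Definition _ := GRing.Zmodule_isComPzRing.Build pser ps_mulA ps_mulC ps_mul1 ps_mulD.

Definition pserR : comPzRingType := pser.
Implicit Types (f g h : pserR).

Lemma psD f g n : (f + g) n = f n + g n. Proof. by []. Qed.
Lemma psB f g n : (f - g) n = f n - g n. Proof. by []. Qed.
Lemma psM f g n : (f * g) n = \sum_(0 <= i < n.+1) f i * g (n - i)%N. Proof. by []. Qed.
Lemma ps0 n : (0 : pserR) n = 0. Proof. by case: n. Qed.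
Lemma ps_sum (T : Type) (r : seq T) (p : pred T) (F : T -> pserR) n :
  (\sum_(i <- r | p i) F i) n = \sum_(i <- r | p i) F i n.
Proof. by elim/big_rec2: _ => [|i x y _ <-] //; rewrite ps0. Qed.

Lemma psM0 f g : (f * g) 0%N = f 0%N * g 0%N.
Proof. by rewrite psM big_nat1. Qed.

Lemma psXM f n : ((ps_X : pserR) * f) n = if n is m.+1 then f m else 0.
Proof.
case: n => [|n]; first by rewrite psM0 mul0r.
rewrite psM big_nat_recl // mul0r add0r big_nat_recl //= mul1r subSS subn0.
by rewrite big1 ?addr0 // => i _; rewrite mul0r.
Qed.

Lemma psXnM k f n : ((ps_X : pserR) ^+ k * f) n = if (n < k)%N then 0 else f (n - k)%N.
Proof.
elim: k n => [|k IH] n; first by rewrite mul1r subn0.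
by rewrite exprS -mulrA psXM; case: n => [|n] //; rewrite IH ltnS subSS.
Qed.

Lemma psC f a n : ((ps_cst a : pserR) * f) n = a * f n.
Proof.
rewrite psM big_nat_recl //= subn0 big1 ?addr0 // => i _; by rewrite mul0r.
Qed.

Lemma ps_cst_zmod : zmod_morphism (ps_cst : R -> pserR).
Proof. by move=> a b; apply/funext => -[|n]; rewrite psB //= subr0. Qed.
Lemma ps_cst_monoid : monoid_morphism (ps_cst : R -> pserR).
Proof. by split=> // a b; apply/funext => -[|n]; rewrite psC //= mulr0. Qed.
Definition ps_C : {rmorphism R -> pserR} := HB.pack (ps_cst : R -> pserR)
  (GRing.isZmodMorphism.Build R pserR ps_cst ps_cst_zmod)
  (GRing.isMonoidMorphism.Build R pserR ps_cst ps_cst_monoid).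

Definition ps_ev0 f := f 0%N.
Lemma ps_ev0_zmod : zmod_morphism ps_ev0. Proof. by []. Qed.
Lemma ps_ev0_monoid : monoid_morphism ps_ev0. Proof. by split=> // f g; rewrite /ps_ev0 psM0. Qed.
Definition ps_eval0 : {rmorphism pserR -> R} := HB.pack ps_ev0
  (GRing.isZmodMorphism.Build pserR R ps_ev0 ps_ev0_zmod)
  (GRing.isMonoidMorphism.Build pserR R ps_ev0 ps_ev0_monoid).

Lemma ps_eval0_surj a : exists f, ps_eval0 f = a. Proof. by exists (ps_cst a). Qed.

Lemma ps_shift f : f = ps_cst (f 0%N) + (ps_X : pserR) * (fun n => f n.+1).
Proof. by apply/funext => -[|n]; rewrite psD psXM /= ?addr0 ?add0r. Qed.

Lemma ps_unit f : is_unit (f 0%N) -> is_unit f.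
Proof.
move=> [v fv].
(* Each coefficient of the inverse depends on all earlier ones, so the recursion carries their
   list. *)
pose step (s : seq R) := rcons s (if s is [::] then v else
  - v * \sum_(0 <= i < size s) f i.+1 * s`_(size s - i.+1)).
pose G n := iter n step [::].
have sG n : size (G n) = n by elim: n => //= n IH; rewrite size_rcons IH.
pose g n := (G n.+1)`_n.
have gG n m : (n < m)%N -> (G m)`_n = g n.
  elim: m => // m IH; rewrite ltnS leq_eqVlt => /orP[/eqP -> //|nm].
  by rewrite /= nth_rcons sG nm IH.
have g0 : g 0%N = v by rewrite /g /= .
have gS n : g n.+1 = - v * \sum_(0 <= i < n.+1) f i.+1 * g (n - i)%N.
  rewrite /g; set t := G n.+1; have st : size t = n.+1 by apply: sG.
  have E (s : seq R) : size s = n.+1 ->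
    step s = rcons s (- v * \sum_(0 <= i < size s) f i.+1 * s`_(size s - i.+1)) by case: s.
  have -> : G n.+2 = step t by []; rewrite (E _ st).
  rewrite nth_rcons st ltnn eqxx; congr (_ * _); apply: eq_big_nat => i /andP[_ ilt].
  rewrite subSS /t gG //.
  by rewrite ltnS leq_subr.
exists g; apply/funext => -[|n]; first by rewrite psM0 g0 fv.
rewrite psM big_nat_recl // subn0 gS mulrA mulrN fv mulN1r addrC.
by apply/eqP; rewrite subr_eq0; apply/eqP/eq_big_nat => i _; rewrite subSS.
Qed.

Section Noeth.
Hypothesis noeth : noetherian R.
Variable I : ideal pserR.

Definition low_ideal (n : nat) : ideal R.
Proof.
exists [set c | exists f, [/\ I f, forall i, (i < n)%N -> f i = 0 & f n = c]].
- by exists 0; split=> [|i _|]; rewrite ?ps0 //.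
- move=> _ _ [f [If f0 <-]] [g [Ig g0 <-]]; exists (f + g); split=> [|i ilt|//]; first exact: idealD.
  by rewrite psD f0 // g0 // addr0.
- move=> a _ [f [If f0 <-]]; exists (ps_C a * f); split=> [|i ilt|]; rewrite ?psC //; first exact: idealM.
  by rewrite f0 ?mulr0.
Defined.

Lemma low_gens n : exists t : seq pserR, (forall f, f \in t -> I f /\ forall i, (i < n)%N -> f i = 0) /\
  forall c, low_ideal n c -> exists d : nat -> R, c = \sum_(j < size t) d j * t`_j n.
Proof.
have [s sE] := noeth_fg noeth (low_ideal n).
have /choice[g gP] : forall c, exists f, c \in s -> [/\ I f, forall i, (i < n)%N -> f i = 0 & f n = c].
  move=> c; have [/igen_mem/sE[f fP]|] := boolP (c \in s); last by exists 0.
  by exists f.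
exists (map g s); split=> [_ /mapP[c cs ->]|c /sE/igenP[d ->]]; first by have [? ? ?] := gP _ cs.
exists d; rewrite size_map; apply: eq_bigr => j _; rewrite (nth_map 0) //.
by have [_ _ ->] := gP _ (mem_nth 0 (ltn_ord j)).
Qed.

End Noeth.

(** The ideals of lowest coefficients increase with the order and are stationary from N on. Beyond
    order N every correction uses the same generators [t N] times a power of X, so the infinitely
    many corrections assemble into the finitely many power series [C j]. *)
Lemma ps_noeth : noetherian R -> noetherian pserR.
Proof.
move=> noeth I.
have [|N NP] := @acc _ noeth (low_ideal I).
  move=> n _ [f [If f0 <-]]; exists ((ps_X : pserR) * f); split=> [|[|i] ilt|]; rewrite ?psXM //.
    exact: idealM.
  by apply: f0; rewrite -ltnS.
have /choice[t tP] := low_gens noeth I.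
pose T := flatten [seq t n | n <- iota 0 N.+1].
have tT n f : (n <= N)%N -> igen (t n) f -> igen T f.
  move=> nN; apply: igen_sub => y yt; apply/igen_mem/flattenP; exists (t n) => //.
  by apply/mapP; exists n; rewrite // mem_iota.
have comb_t n (d : nat -> pserR) : igen (t n) (\sum_(j < size (t n)) d j * (t n)`_j).
  by apply/igenP; exists d.
exists T; apply: ideal_ext => f; split; last first.
  apply: igen_sub => y /flattenP[_ /mapP[n _ ->]] yt; exact: ((tP n).1 _ yt).1.
have low n g : I g -> (forall i, (i < n)%N -> g i = 0) -> exists d : nat -> R,
    g n = \sum_(j < size (t n)) d j * (t n)`_j n.
  by move=> Ig g0; apply: (tP n).2; exists g.
have red n : (n <= N)%N -> forall g, I g -> exists2 y, igen T y & forall i, (i < n)%N -> (g - y) i = 0.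
  elim: n => [|n IH] nN g Ig; first by exists 0 => //.
  have [y Ty y0] := IH (ltnW nN) g Ig.
  have Iy : I y by apply: igen_sub Ty => z /flattenP[_ /mapP[m _ ->]] zt; exact: ((tP m).1 _ zt).1.
  have [d dE] := low n _ (idealB Ig Iy) y0.
  exists (y + \sum_(j < size (t n)) ps_C (d j) * (t n)`_j).
    by apply: idealD => //; apply: (tT n); [exact: ltnW|exact: (comb_t n (fun j => ps_C (d j)))].
  move=> i; rewrite ltnS leq_eqVlt opprD addrA => /orP[/eqP ->|ilt].
    rewrite psB dE ps_sum; apply/eqP; rewrite subr_eq0; apply/eqP/eq_bigr => j _.
    by rewrite psC.
  rewrite psB y0 // ps_sum big1 ?subrr // => j _; rewrite psC.
  by rewrite ((tP n).1 _ (mem_nth 0 (ltn_ord j))).2 ?mulr0.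
move=> If; have [y Ty y0] := red N (leqnn N) f If.
have Iy : I y by apply: igen_sub Ty => z /flattenP[_ /mapP[m _ ->]] zt; exact: ((tP m).1 _ zt).1.
rewrite -[f](subrK y); apply: idealD => //; apply: (tT N) => //.
have {If Iy} Ig := idealB If Iy; move: (f - y) y0 Ig => g g0 Ig.
pose ord k (g : pserR) := I g /\ forall i, (i < N + k)%N -> g i = 0.
pose tm (d : nat -> R) k : pserR := \sum_(j < size (t N)) (ps_C (d j) * ps_X ^+ k) * (t N)`_j.
have tmE d k i : tm d k i = if (i < k)%N then 0 else \sum_(j < size (t N)) d j * (t N)`_j (i - k)%N.
  rewrite /tm ps_sum; case: ltnP => ik; [rewrite big1 // => j _|apply: eq_bigr => j _];
    rewrite -mulrA psC psXnM ?ik ?mulr0 //; by rewrite ltnNge ik.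
have step k (h : pserR) : exists d : nat -> R, ord k h -> ord k.+1 (h - tm d k).
  have [[Ih h0]|no] := pselect (ord k h); last by exists (fun=> 0) => /no.
  have [d dE] : exists d : nat -> R, h (N + k)%N = \sum_(j < size (t N)) d j * (t N)`_j N.
    by apply: (tP N).2; apply: (NP (N + k)%N); exists h.
  exists d => _; split.
    apply: idealB => //; apply: idealS => j _; apply: idealM.
    exact: ((tP N).1 _ (mem_nth 0 (ltn_ord j))).1.
  move=> i; rewrite addnS ltnS leq_eqVlt psB tmE => /orP[/eqP ->|ilt].
    by rewrite ltnNge leq_addl /= addnK dE subrr.
  rewrite h0 // sub0r; case: ltnP => ik; first by rewrite oppr0.
  rewrite big1 ?oppr0 // => j _; rewrite ((tP N).1 _ (mem_nth 0 (ltn_ord j))).2 ?mulr0 //.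
  by rewrite ltn_subLR // addnC.
have /choice[D DP] := fun kh : nat * pserR => step kh.1 kh.2.
pose H k := nat_rect (fun=> pserR) g (fun k h => h - tm (D (k, h)) k) k.
have HP k : ord k (H k).
  elim: k => [|k IH]; first by split=> // i; rewrite addn0; apply: g0.
  exact: (DP (k, H k) IH).
have gE k : g = H k + \sum_(0 <= l < k) tm (D (l, H l)) l.
  elim: k => [|k IH]; first by rewrite big_geq ?addr0.
  by rewrite [H k.+1]/= big_nat_recr //= addrACA addNr addr0 -IH.
pose C j : pserR := fun k => D (k, H k) j.
have -> : g = \sum_(j < size (t N)) C j * (t N)`_j; last exact: comb_t.
apply/funext => n; rewrite {1}(gE n.+1) psD (HP n.+1).2 ?add0r; last by rewrite addnS ltnS leq_addl.
rewrite !ps_sum.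
transitivity (\sum_(0 <= l < n.+1) \sum_(j < size (t N)) C j l * (t N)`_j (n - l)%N).
  by apply: eq_big_nat => l; rewrite ltnS /= tmE ltnNge => ->.
by rewrite exchange_big /=; apply: eq_bigr => j _; rewrite psM.
Qed.

Definition ps_max (M : ideal R) : ideal pserR := ipre ps_eval0 M.

Lemma ps_ker f : ipre ps_eval0 (izero R) f <-> iadd1 (izero pserR) ps_X f.
Proof.
split=> [f0|/iadd1P[g [h [-> ->]]]].
  apply/iadd1P; exists (fun n => f n.+1), 0; split=> //; rewrite add0r mulrC {1}(ps_shift f).
  have -> : f 0%N = 0 := f0.
  by rewrite (_ : ps_cst 0 = 0) // add0r.
suff H : ps_eval0 (0 + g * ps_X) = 0 by exact: H.
by rewrite add0r rmorphM mulrC /= /ps_ev0 /= mul0r.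
Qed.

Lemma ps_regular (M : ideal R) d : noetherian R -> regat (izero R) M d ->
  regat (izero pserR) (ps_max M) d.+1.
Proof.
move=> noeth rM; apply: (@regat_nzd _ (ps_noeth noeth) _ _ _ ps_X).
- by rewrite /= /mkset /= /ps_ev0 /=.
- by move=> f /= /(congr1 (fun g : pserR => g \o succn)) E; apply/funext => n;
     have := congr1 (@^~ n) E; rewrite /= psXM !ps0.
have := (regat_surj ps_eval0_surj (izero R) M d).1 rM.
by rewrite (_ : ipre ps_eval0 (izero R) = iadd1 (izero pserR) ps_X) //; apply/ideal_eq/ideal_ext/ps_ker.
Qed.

Lemma ps_local (M : ideal R) : (forall x, ~ M x -> is_unit x) -> forall f, ~ ps_max M f -> is_unit f.
Proof. by move=> uM f /uM; apply: ps_unit. Qed.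

End PowerSeries.

(** * Complete local rings and evaluation of power series *)

Definition conv D (M : ideal D) := forall x : nat -> D,
  (forall n, ipow M n (x n.+1 - x n)) -> exists l, forall n, ipow M n (l - x n).

(** Compared with bijectivity of the completion map, this form passes easily to quotients and yields
    limits approximated at a known rate. *)
Record clocal D (M : ideal D) : Prop := CLocal {
  cl_noeth : noetherian D;
  cl_prime : is_prime M;
  cl_unit : forall x, ~ M x -> is_unit x;
  cl_conv : conv M
}.

Lemma complete_clocal D (M : ideal D) : complete_local_ring M -> clocal M.
Proof.
move=> [lM [g gK Kg]]; have [pM uM] := local_unit lM; split=> //; first by case: lM.
move=> x xP.
have xle i j : (i <= j)%N -> ipow M i (x j - x i).
  move=> /subnK <-; elim: (j - i)%N => [|k IH]; first exact: ideal_sub0.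
  rewrite addSn; apply: ideal_sub_trans IH; apply: ipow_le (xP _); exact: leq_addl.
have xC : cauchy_seq M x.
  move=> k; exists k => i j ki kj.
  by apply: (@ideal_sub_trans _ _ (x k)); [apply: xle|apply/ideal_sub_sym/xle].
have := Kg (cs_pi (mk_cauchy xC : completion_setoid M)); set l := g _ => /cs_piP lE.
exists l => n; have [N NP] := lE n.
apply: (@ideal_sub_trans _ _ (x (maxn N n))); first by have := NP _ (leq_maxl N n).
exact/xle/leq_maxr.
Qed.

Section Complete.
Variables (D : comPzRingType) (M : ideal D).
Hypothesis cM : clocal M.
Let noeth := cl_noeth cM.
Let pM := cl_prime cM.
Let uM := cl_unit cM.

Lemma cl_sub1 a : M a -> is_unit (1 - a).
Proof. exact: unit1B pM uM a. Qed.

Lemma cl_closed (K : ideal D) x : (forall n, isum (ipow M n) K x) -> K x.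
Proof. by move=> H; apply: (krull_cap noeth H); apply: cl_sub1. Qed.

Lemma cl_sep x : (forall n, ipow M n x) -> x = 0.
Proof. by move=> H; apply: (@cl_closed (izero D)) => n; apply: isumL. Qed.

Lemma clocal_surj (E : comPzRingType) (f : {rmorphism D -> E}) (fS : forall y, exists x, f x = y) :
  ipre f (izero E) `<=` M -> clocal (iimg fS M).
Proof.
move=> kM; split.
- exact: noeth_surj fS noeth.
- exact: iimg_prime.
- move=> y; have [x <-] := fS y => H; suff : is_unit x by apply: is_unit_rmorph.
  by apply: uM => Mx; apply/H/iimgP.
move=> y yP.
have powS n : ipow (iimg fS M) n `<=` iimg fS (ipow M n).
  elim: n => [|n IH] z'; first by have [w <-] := fS z' => _; exists w => //; apply: ipow0.
  move: z'; apply: imul_sub => _ b [a Ma <-] /IH[w wn <-].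
  by exists (a * w); [apply: ipowS|rewrite rmorphM].
have powI n z : ipow M n z -> ipow (iimg fS M) n (f z).
  by apply: rmorph_pow => w Mw; exists w.
have /choice[d dP] : forall n, exists w, ipow M n w /\ f w = y n.+1 - y n.
  by move=> n; have [w w1 w2] := powS n _ (yP n); exists w.
have [x0 x0E] := fS (y 0%N).
pose x n := x0 + \sum_(0 <= i < n) d i.
have fx n : f (x n) = y n.
  rewrite /x rmorphD x0E rmorph_sum; under eq_bigr do rewrite (dP _).2.
  by rewrite telescope_sumr // addrC subrK.
have [|l lP] := cl_conv cM (x := x).
  move=> n; rewrite /x big_nat_recr //= addrA [_ + d n]addrC addrK; exact: (dP n).1.
by exists (f l) => n; rewrite -fx -rmorphB; apply: powI.
Qed.

Section Eval.
Variables (R : comPzRingType) (phi : {rmorphism R -> D}) (x : D).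
Hypothesis Mx : M x.

Definition psum n (f : pserR R) := \sum_(0 <= i < n) phi (f i) * x ^+ i.

Lemma psumS n f : psum n.+1 f = psum n f + phi (f n) * x ^+ n.
Proof. by rewrite /psum big_nat_recr. Qed.

Lemma psum_conv f : exists l, forall n, ipow M n (l - psum n f).
Proof.
apply: (cl_conv cM) => n; rewrite psumS addrAC subrr add0r.
by apply/idealM/ipowX.
Qed.

Definition ps_ev f := projT1 (cid (psum_conv f)).
Lemma ps_evP f n : ipow M n (ps_ev f - psum n f).
Proof. by rewrite /ps_ev; case: cid. Qed.

Lemma ps_ev_uniq f l : (forall n, ipow M n (l - psum n f)) -> l = ps_ev f.
Proof.
move=> H; apply/subr0_eq/cl_sep => n.
by apply: (@ideal_sub_trans _ _ (psum n f)) => //; apply/ideal_sub_sym/ps_evP.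
Qed.

Lemma psum_shift n f : psum n.+1 f = phi (f 0%N) + x * psum n (fun i => f i.+1).
Proof.
rewrite /psum big_nat_recl // expr0 mulr1; congr (_ + _); rewrite mulr_sumr.
by apply: eq_bigr => i _; rewrite exprS mulrCA.
Qed.

Lemma psumD n f g : psum n (f + g) = psum n f + psum n g.
Proof. by rewrite /psum -big_split; apply: eq_bigr => i _; rewrite psD rmorphD mulrDl. Qed.

Lemma psumC n a f : psum n (ps_C R a * f) = phi a * psum n f.
Proof. by rewrite /psum mulr_sumr; apply: eq_bigr => i _; rewrite psC rmorphM mulrA. Qed.

Lemma psumM n f g : ipow M n (psum n (f * g) - psum n f * psum n g).
Proof.
elim: n f g => [|n IH] f g; first exact: ipow0.
pose f' : pserR R := fun i => f i.+1.
have E : f * g = ps_C R (f 0%N) * g + (ps_X R : pserR R) * (f' * g).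
  by rewrite {1}(ps_shift f) mulrDl mulrA.
have EX : psum n.+1 ((ps_X R : pserR R) * (f' * g)) = x * psum n (f' * g).
  rewrite psum_shift psXM rmorph0 add0r; congr (_ * psum n _); apply/funext => i; exact: psXM.
rewrite E psumD psumC EX (psum_shift n f) -/f' psumS.
set a := phi _; set G := psum n g; set F := psum n f'; set H := psum n _; set c := phi _.
have -> : a * (G + c * x ^+ n) + x * H - (a + x * F) * (G + c * x ^+ n) =
  x * (H - F * G) + - (F * c) * x ^+ n.+1 by rewrite exprS; ring.
have H1 : ipow M n.+1 (x * (H - F * G)) by apply: ipowS => //; apply: IH.
by apply: (idealD H1); apply/idealM/ipowX.
Qed.

Lemma ps_ev_zmod : zmod_morphism ps_ev.
Proof.
move=> f g; apply/esym/ps_ev_uniq => n.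
have -> : psum n (f - g) = psum n f - psum n g.
  by rewrite /psum -sumrB; apply: eq_bigr => i _; rewrite psB rmorphB mulrBl.
have -> : ps_ev f - ps_ev g - (psum n f - psum n g) = (ps_ev f - psum n f) - (ps_ev g - psum n g) by ring.
by apply: idealB; apply: ps_evP.
Qed.

Lemma ps_ev_monoid : monoid_morphism ps_ev.
Proof.
split=> [|f g]; apply/esym/ps_ev_uniq => n.
  case: n => [|n]; first exact: ipow0.
  rewrite psum_shift (_ : psum n _ = 0) ?mulr0 ?addr0 ?rmorph1 ?subrr; first exact: ideal0.
  by rewrite /psum big1 // => i _; rewrite rmorph0 mul0r.
apply: ideal_sub_trans (ideal_subM (ps_evP f n) (ps_evP g n)) _.
exact/ideal_sub_sym/psumM.
Qed.

Definition ps_evm : {rmorphism pserR R -> D} := HB.pack ps_ev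
  (GRing.isZmodMorphism.Build (pserR R) D ps_ev ps_ev_zmod)
  (GRing.isMonoidMorphism.Build (pserR R) D ps_ev ps_ev_monoid).

Lemma ps_evm0 f : M (ps_evm f - phi (f 0%N)).
Proof.
apply/ipow1; have := ps_evP f 1; by rewrite psum_shift /psum big_geq // mulr0 addr0.
Qed.

(** Complete Nakayama: the remainder divided by x is expanded again and again, the successive
    coefficients are collected into power series, and closedness of K handles the limit. *)
Lemma ps_evm_span (K : ideal D) (es : seq D) :
  (forall y, exists c : nat -> R, iadd1 K x (y - \sum_(i < size es) phi (c i) * es`_i)) ->
  forall y, exists c : nat -> pserR R, K (y - \sum_(i < size es) ps_evm (c i) * es`_i).
Proof.
move=> H y.
have /choice[F FP] : forall z, exists cq : (nat -> R) * D,
    K (z - \sum_(i < size es) phi (cq.1 i) * es`_i - x * cq.2).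
  by move=> z; have [c /iadd1P[q [w [Kw E]]]] := H z; exists (c, q); rewrite E /= [x * q]mulrC addrK.
pose Y n := iter n (fun z => (F z).2) y.
pose C i : pserR R := fun n => (F (Y n)).1 i.
exists C; apply: cl_closed => n.
have E : K (y - \sum_(i < size es) psum n (C i) * es`_i - x ^+ n * Y n).
  elim: n => [|n IH].
    rewrite big1 ?subr0 ?expr0 ?mul1r ?subrr; first exact: ideal0.
    by move=> i _; rewrite /psum big_geq // mul0r.
  have := idealD IH (idealM (x ^+ n) (FP (Y n))).
  have -> : \sum_(i < size es) psum n.+1 (C i) * es`_i =
      \sum_(i < size es) psum n (C i) * es`_i + x ^+ n * \sum_(i < size es) phi ((F (Y n)).1 i) * es`_i.
    rewrite mulr_sumr -big_split; apply: eq_bigr => i _; rewrite psumS mulrDl; congr (_ + _).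
    by rewrite mulrAC mulrC mulrA.
  set A := bigop _ _ _; set B := bigop _ _ _; rewrite [Y n.+1]/=.
  congr (K _); rewrite exprS; ring.
rewrite -[y - _](subrK (y - \sum_(i < size es) psum n (C i) * es`_i - x ^+ n * Y n)).
apply: idealD; last exact: isumR.
apply: isumL.
have -> : y - \sum_(i < size es) ps_evm (C i) * es`_i - (y - \sum_(i < size es) psum n (C i) * es`_i - x ^+ n * Y n)
  = - (\sum_(i < size es) (ps_evm (C i) - psum n (C i)) * es`_i) + x ^+ n * Y n.
  under [in RHS]eq_bigr do rewrite mulrBl; rewrite sumrB.
  set A := bigop _ _ _; set B := bigop _ _ _; ring.
apply: idealD; last exact/idealMl/ipowX.
by apply/idealN/idealS => i _; apply/idealMl/ps_evP.
Qed.

End Eval.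
End Complete.

(* Power series rings inherit this integral form, whereas a version with denominators would not pass to infinitely
   many coefficients. *)
Definition derivation R (d : R -> R) :=
  (forall x y, d (x + y) = d x + d y) /\ (forall x y, d (x * y) = x * d y + y * d x).
Definition der_perfect (p : nat) R := p%:R = 0 :> R ->
  forall x : R, (forall d, derivation d -> d x = 0) -> exists y, x = y ^+ p.

(** * Derivations of power series in characteristic p *)

Lemma der0 R (d : R -> R) : derivation d -> d 0 = 0.
Proof. by move=> [dD _]; apply: (addrI (d 0)); rewrite -dD !addr0. Qed.
Lemma derN R (d : R -> R) x : derivation d -> d (- x) = - d x.
Proof. by move=> dd; apply/eqP; rewrite -addr_eq0 -dd.1 addNr der0. Qed.
Lemma der_sum R (d : R -> R) (T : Type) (r : seq T) (P : pred T) (F : T -> R) :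
  derivation d -> d (\sum_(i <- r | P i) F i) = \sum_(i <- r | P i) d (F i).
Proof.
move=> dd; elim: r => [|i r IH]; first by rewrite !big_nil der0.
by rewrite !big_cons; case: ifP => _; rewrite ?dd.1 IH.
Qed.
Lemma der1 R (d : R -> R) : derivation d -> d 1 = 0.
Proof.
move=> dd; have := dd.2 1 1; rewrite !mul1r => E.
by apply: (addrI (d 1)); rewrite addr0 -E.
Qed.
Lemma derX R (d : R -> R) x n : derivation d -> d (x ^+ n) = n%:R * x ^+ n.-1 * d x.
Proof.
move=> dd; elim: n => [|n IH]; first by rewrite expr0 der1 // !mul0r.
rewrite exprS dd.2 IH [n.+1.-1]/=; case: n {IH} => [|n]; first by rewrite expr0 !mul0r mulr0 add0r mulr1.
by rewrite [n.+1.-1]/= exprS -[n.+2]addn1 natrD; ring.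
Qed.

Lemma frobD_mod R (I : ideal R) p x y : prime p -> I p%:R -> I ((x + y) ^+ p - (x ^+ p + y ^+ p)).
Proof.
move=> pp Ip; rewrite exprDn; case: p pp Ip => [|p] // pp Ip.
rewrite big_ord_recr big_ord_recl /= subnn subn0 bin0 binn !mulr1n expr0 mul1r mulr1.
set A := bigop _ _ _; have -> : x ^+ p.+1 + A + y ^+ p.+1 - (x ^+ p.+1 + y ^+ p.+1) = A by ring.
apply: idealS => i _; rewrite -mulr_natr; apply: idealM.
have /dvdnP[k ->] : (p.+1 %| 'C(p.+1, bump 0 i))%N by apply: prime_dvd_bin; rewrite //= /bump /= add1n ltnS ltn_ord.
by rewrite natrM; apply: idealM.
Qed.

Lemma frobD R p (x y : R) : prime p -> p%:R = 0 :> R -> (x + y) ^+ p = x ^+ p + y ^+ p.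
Proof.
move=> pp p0; apply/subr0_eq.
exact: (@frobD_mod _ (izero R) p x y pp p0).
Qed.

Lemma psCXn R (a : R) k n : (ps_C R a * (ps_X R : pserR R) ^+ k) n = if n == k then a else 0.
Proof.
rewrite psC -[(ps_X R : pserR R) ^+ k]mulr1 psXnM; case: ltngtP => [_|kn|->]; rewrite ?mulr0 ?subnn ?mulr1 //.
by rewrite -subn_gt0 in kn; case: (n - k)%N kn => // m _; rewrite mulr0.
Qed.

(** Coefficientwise derivations make the coefficients p-th powers, and the derivative in X kills
    those of index not divisible by p. Since no denominators occur, the roots of the coefficients
    form a power series. *)
Lemma pser_der_perfect p R : prime p -> der_perfect p R -> der_perfect p (pserR R).
Proof.
move=> pp dR p0 f fd.
have pR : p%:R = 0 :> R.
  by have := congr1 (ps_eval0 R) p0; rewrite rmorph_nat rmorph0.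
have coef n : exists u, (if (p %| n)%N then f n = u ^+ p else f n = 0).
  have [pn|pn] := boolP (p %| n)%N.
    apply: dR => // d dd; pose d' (g : pserR R) : pserR R := fun n => d (g n).
    suff /fd/(congr1 (@^~ n)) : derivation d' by rewrite /= ps0.
    split=> [g h|g h]; apply/funext => m; first exact: dd.1.
    rewrite psD {1}/d' !psM der_sum //; under eq_bigr do rewrite dd.2.
    rewrite big_split /=; congr (_ + _).
    rewrite [in RHS]big_nat_rev /=; apply: eq_big_nat => i /andP[_]; rewrite ltnS => im.
    by rewrite add0n subSS subKn.
  exists 0; case: n pn => [|n] pn; first by rewrite dvdn0 in pn.
  have cop : coprime n.+1 p by rewrite coprime_sym prime_coprime.
  have E : n.+1%:R * f n.+1 = 0.
    pose d' (g : pserR R) : pserR R := fun n => n.+1%:R * g n.+1.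
    suff /fd/(congr1 (@^~ n)) : derivation d' by rewrite /= ps0.
    split=> [g h|g h]; apply/funext => m; first by rewrite /d' !psD mulrDr.
    rewrite psD {1}/d' !psM mulr_sumr.
    transitivity (\sum_(0 <= i < m.+2) (i%:R + (m.+1 - i)%:R) * (g i * h (m.+1 - i)%N)).
      by apply: eq_big_nat => i /andP[_]; rewrite ltnS => im; rewrite -natrD subnKC.
    under eq_bigr do rewrite mulrDl.
    rewrite big_split /= addrC; congr (_ + _).
      rewrite big_nat_recr //= subnn mul0r addr0; apply: eq_big_nat => i /andP[_]; rewrite ltnS => im.
      by rewrite subSn // mulrCA.
    rewrite big_nat_recl // mul0r add0r [in RHS]big_nat_rev; apply: eq_big_nat => i /andP[_]; rewrite ltnS => im.
    by rewrite /d' add0n !subSS subKn //; set a := h _; set b := g _; ring.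
  have [/= km kn kmE _] := egcdnP p (ltn0Sn n).
  have : (km * n.+1)%:R * f n.+1 = (kn * p + 1)%:R * f n.+1 by rewrite kmE (eqP cop).
  by rewrite natrM -mulrA E mulr0 natrD natrM pR mulr0 add0r mul1r => <-.
have /choice[u uP] := coef.
have p0' := prime_gt0 pp.
exists (fun m => u (m * p)%N); apply/funext => n.
have pS : p%:R = 0 :> pserR R by rewrite -(rmorph_nat (ps_C R)) pR rmorph0.
have frob : forall N (v : nat -> R), (\sum_(i < N) ps_C R (v i) * (ps_X R : pserR R) ^+ i) ^+ p =
   \sum_(i < N) ps_C R (v i ^+ p) * (ps_X R : pserR R) ^+ (i * p).
  move=> N v; elim: N => [|N IH]; first by rewrite !big_ord0 expr0n eqn0Ngt p0'.
  rewrite !big_ord_recr frobD //; congr (_ + _); first exact: IH.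
  by rewrite exprMn -rmorphXn -exprM.
(* Frobenius is expanded on finite sums only; the p-th power of the tail does not reach the
   coefficient under consideration. *)
have trunc : forall N (g : pserR R), g = \sum_(i < N) ps_C R (g i) * (ps_X R : pserR R) ^+ i +
   (ps_X R : pserR R) ^+ N * (fun n => g (n + N)%N).
  move=> N g; apply/funext => m; rewrite psD psXnM ps_sum; under eq_bigr do rewrite psCXn.
  case: ltnP => [mN|Nm].
    rewrite addr0 (bigD1 (Ordinal mN)) //= eqxx big1 ?addr0 // => i im.
    by case: eqP => // E; case/eqP: im; apply/val_inj.
  rewrite subnK // big1 ?add0r // => i _; case: eqP => // E.
  by have := ltn_ord i; rewrite -E ltnNge Nm.
pose g : pserR R := fun m => u (m * p)%N; rewrite -/g.
rewrite {1}(trunc n.+1 g) frobD // (frob n.+1 g) exprMn -exprM psD psXnM.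
rewrite (leq_trans (ltnSn n)) ?leq_pmulr // addr0 ps_sum.
under eq_bigr do rewrite psCXn.
have [pn|pn] := boolP (p %| n)%N; have := uP n; rewrite ?pn ?(negbTE pn) => E.
  have /dvdnP[k kE] := pn; have kn : (k < n.+1)%N by rewrite ltnS kE leq_pmulr.
  rewrite (bigD1 (Ordinal kn)) //= -kE eqxx big1 ?addr0 ?E /g -?kE // => i ik.
  by rewrite {1}kE eqn_pmul2r //; case: eqP => // E'; case/eqP: ik; apply/val_inj.
rewrite E big1 // => i _; case: eqP => // E'.
by case/negP: pn; rewrite E' dvdn_mull.
Qed.

(** A regular local ring over D, local over M, whose derivations detect p-th powers. Each power
    series variable sent into M preserves these properties and raises the dimension by one. *)
Record coef_ring p D R (M : ideal D) (phi : {rmorphism R -> D}) (d : nat) : Prop := CoefRing {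
  cr_noeth : noetherian R;
  cr_prime : is_prime (ipre phi M);
  cr_unit : forall x, ~ ipre phi M x -> is_unit x;
  cr_reg : regat (izero R) (ipre phi M) d;
  cr_der : der_perfect p R
}.

Lemma coef_ring_ev p D R (M : ideal D) (cM : clocal M) (phi : {rmorphism R -> D}) d x (Mx : M x) :
  prime p -> coef_ring p M phi d -> coef_ring p M (ps_evm cM phi Mx) d.+1.
Proof.
move=> pp [nR pR uR rR dR].
have E : ipre (ps_evm cM phi Mx) M = ps_max (ipre phi M).
  apply/ideal_eq/ideal_ext => f; have H := ps_evm0 cM phi Mx f; split=> Hf.
    have H' : M (ps_evm cM phi Mx f) by [].
    have : M (phi (f 0%N)) by have := idealB H' H; rewrite opprB addrC subrK.
    by [].
  have H' : M (phi (f 0%N)) by [].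
  have : M (ps_evm cM phi Mx f) by have := idealD H H'; rewrite subrK.
  by [].
split; rewrite ?E.
- exact: ps_noeth.
- exact: ipre_prime.
- exact: ps_local.
- exact: ps_regular.
- exact: pser_der_perfect.
Qed.

Lemma coef_ring_evs p D (M : ideal D) (cM : clocal M) xs : prime p -> (forall x, x \in xs -> M x) ->
  forall (R : comPzRingType) (phi : {rmorphism R -> D}) d, coef_ring p M phi d ->
  exists (S : comPzRingType) (psi : {rmorphism S -> D}), coef_ring p M psi (d + size xs) /\
  forall (es : seq D) (K : ideal D),
  (forall y, exists c : nat -> R, isum K (igen xs) (y - \sum_(i < size es) phi (c i) * es`_i)) ->
  forall y, exists c : nat -> S, K (y - \sum_(i < size es) psi (c i) * es`_i).
Proof.
move=> pp; elim: xs => [|x xs IH] Mxs R phi d cR.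
  exists R, phi; rewrite addn0; split=> // es K H y; have [c cP] := H y; exists c.
  by apply: isum_sub cP => // z /igen_nil ->.
have Mx : M x by apply: Mxs; rewrite mem_head.
have [|S [psi [cS H]]] := IH _ (pserR R) (ps_evm cM phi Mx) d.+1 (coef_ring_ev cM Mx pp cR).
  by move=> z zx; apply: Mxs; rewrite inE zx orbT.
exists S, psi; rewrite addnS; split=> // es K HR; apply/H/ps_evm_span => y.
have [c cP] := HR y; exists c; apply: isum_sub cP => z.
  by move=> Kz; apply/isumL/isumL.
move=> /igen_cons[r [w [xw ->]]]; apply: idealD; first by apply/idealM/iadd1R.
exact/isumL/isumR.
Qed.

(** * Coefficient rings of complete local domains *)

Lemma sr_deriv (R : comNzRingType) (U : subring R) (f : {poly R}) : (forall i, U f`_i) -> forall i, U f^`()`_i.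
Proof. by move=> Uf i; rewrite coef_deriv -mulr_natr; apply/srM/sr_nat. Qed.

Lemma horner_shift2 (R : comNzRingType) (U : subring R) (f : {poly R}) (a u : R) : (forall i, U f`_i) -> U a -> U u ->
  exists2 c, U c & f.[a + u] = f.[a] + f^`().[a] * u + c * u ^+ 2.
Proof.
move=> + Ua Uu; elim/poly_ind: f => [_|f b IH Uf].
  by exists 0; [apply: sr0|rewrite deriv0 !horner0; ring].
have {}Uf i : U f`_i by have := Uf i.+1; rewrite coefD coefMX coefC addr0.
have [c Uc E] := IH Uf.
have Ud : U f^`().[a].
  rewrite horner_coef; apply: srS => i _; apply: srM; [exact: sr_deriv|exact: srX].
exists (c * (a + u) + f^`().[a]); first by apply: srD => //; apply: srM => //; apply: srD.
rewrite derivD derivM derivC derivX mulr1 addr0 !(hornerD, hornerM, hornerX, hornerC) E; ring.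
Qed.

Lemma horner_cong (R : comNzRingType) (I : ideal R) (f : {poly R}) (x y : R) : I (x - y) -> I (f.[x] - f.[y]).
Proof.
move=> Ixy; pose U := rimage (idfun : {rmorphism R -> R}).
have UT z : U z by exists z.
have [c _] := horner_shift2 (fun i => UT f`_i) (UT y) (UT (x - y)); rewrite addrC subrK => ->.
have -> : f.[y] + f^`().[y] * (x - y) + c * (x - y) ^+ 2 - f.[y] = (f^`().[y] + c * (x - y)) * (x - y) by ring.
exact: idealM.
Qed.

Lemma subring_max D (E0 : subring D) (P : set D -> Prop) : P E0 ->
  (forall F : set (set D), F !=set0 -> total_on F subset -> (forall A, F A -> E0 `<=` A /\ P A) ->
     P (\bigcup_(X in F) X)) ->
  exists E : subring D, [/\ E0 `<=` E, P E & forall E' : subring D, E `<=` E' -> P E' -> E' `<=` E].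
Proof.
move=> P0 PU.
pose good (A : set D) := exists E : subring D, [/\ sr_set E = A, E0 `<=` E & P A].
have [F FP tF|A [HA maxA]] := @Zorn_bigcup D [set A | A = set0 \/ good A].
  have [[A0 FA0 gA0]|no] := pselect (exists2 A, F A & good A); last first.
    left; apply/seteqP; split=> // x [A FA Ax]; have [E0'|gA] := FP _ FA; first by rewrite E0' in Ax.
    by case: no; exists A.
  pose G := [set A | F A /\ good A].
  have EG : \bigcup_(X in F) X = \bigcup_(X in G) X.
    apply/seteqP; split=> x [A FA Ax]; last by exists A; case: FA.
    by have [E0'|gA] := FP _ FA; [rewrite E0' in Ax|exists A].
  have ch A B : G A -> G B -> A `<=` B \/ B `<=` A by move=> [FA _] [FB _]; apply: tF.
  right; rewrite EG.
  have [E00 [EE00 E0E00 PE00]] := gA0.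
  have two x y : (\bigcup_(X in G) X) x -> (\bigcup_(X in G) X) y ->
      exists E : subring D, [/\ G E, E x & E y].
    move=> [A GA Ax] [B GB By]; have [H|H] := ch _ _ GA GB.
      have [_ [E1 [EE1 _ _]]] := GB; exists E1; rewrite EE1; split=> //; exact: H.
    have [_ [E1 [EE1 _ _]]] := GA; exists E1; rewrite EE1; split=> //; exact: H.
  have s1 : (\bigcup_(X in G) X) 1 by exists A0 => //; rewrite -EE00; apply: sr1.
  have sB x y : (\bigcup_(X in G) X) x -> (\bigcup_(X in G) X) y -> (\bigcup_(X in G) X) (x - y).
    by move=> Gx Gy; have [E1 [GE Ex Ey]] := two _ _ Gx Gy; exists E1 => //; apply: srB.
  have sM x y : (\bigcup_(X in G) X) x -> (\bigcup_(X in G) X) y -> (\bigcup_(X in G) X) (x * y).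
    by move=> Gx Gy; have [E1 [GE Ex Ey]] := two _ _ Gx Gy; exists E1 => //; apply: srM.
  exists (Subring s1 sB sM); split=> //; first by move=> x E0x; exists A0 => //; rewrite -EE00; apply: E0E00.
  apply: PU; first by exists A0.
    exact: ch.
  by move=> A [_ [E1 [<- H1 H2]]].
case: HA => [A0|[E [EA E0E PE]]].
  exfalso; apply: (maxA E0); last by right; exists E0; split=> // x.
  by rewrite A0; apply: (@properI _ _ _ 1) => //; apply: sr1.
rewrite -EA in maxA PE; exists E; split=> // E' EE' PE' x E'x; apply: contrapT => nEx.
apply: (maxA E'); first by apply: (@properI _ _ _ x).
by right; exists E'; split=> //; apply: subset_trans EE'.
Qed.

Section CoefLift.
Variables (D : comNzRingType) (U : subring D) (M : ideal D) (b : set D) (p : nat).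
Hypothesis b0 : b 0.
Hypothesis bD : forall x y, b x -> b y -> b (x + y).
Hypothesis bM : forall u x, U u -> b x -> b (u * x).
Hypothesis bU : b `<=` U.
Hypothesis bm : b `<=` M.
Hypothesis mm : forall x y, U x -> U y -> M x -> M y -> b (x * y).
Hypothesis M1 : ~ M 1.
Hypothesis Uinv : forall x, U x -> ~ M x -> exists y, U y /\ M (x * y - 1).
Hypothesis charH : (prime p /\ b p%:R) \/ (forall n, ~ M n.+1%:R).

Lemma bN x : b x -> b (- x).
Proof. by rewrite -mulN1r; apply/bM/srN/sr1. Qed.
Lemma bS (I : Type) (r : seq I) (P : pred I) F : (forall i, P i -> b (F i)) -> b (\sum_(i <- r | P i) F i).
Proof. by move=> H; elim/big_rec: _ => // i x /H; apply: bD. Qed.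

Lemma Uinv2 x : U x -> ~ M x -> exists y, U y /\ b (x * y - 1).
Proof.
move=> Ux Mx; have [y [Uy My]] := Uinv Ux Mx; set m := x * y - 1 in My.
have Um : U m by apply: srB; [apply: srM|apply: sr1].
exists (y * (1 - m)); split; first by apply: srM => //; apply: srB => //; apply: sr1.
have -> : x * (y * (1 - m)) - 1 = - (m * m) by rewrite /m; ring.
by apply/bN/mm.
Qed.

(** A first lift of a small subfield: integers modulo b in residue characteristic 0, p-th powers
    modulo b otherwise. The latter form a ring because p lies in b, and such a power in M lies in b
    because products of two elements of U in M do. *)
Lemma base_ring : exists E0 : subring D, [/\ E0 `<=` U, b `<=` E0, forall x, E0 x -> M x -> b x &
  (forall n, ~ M n.+1%:R) \/ (prime p /\ forall u, U u -> E0 (u ^+ p))].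
Proof.
have [[pp bp]|ch0] := charH.
  pose pw : set D := [set x | exists2 u, U u & b (x - u ^+ p)].
  have Ip (u v : D) : U u -> U v -> b ((u + v) ^+ p - (u ^+ p + v ^+ p)).
    move=> Uu Uv; rewrite exprDn; case: (p) pp bp => [|q] // pq bq.
    rewrite big_ord_recr big_ord_recl /= subnn subn0 bin0 binn !mulr1n expr0 mul1r mulr1.
    set A := bigop _ _ _; have -> : u ^+ q.+1 + A + v ^+ q.+1 - (u ^+ q.+1 + v ^+ q.+1) = A by ring.
    apply: bS => i _; rewrite -mulr_natr.
    have /dvdnP[k ->] : (q.+1 %| 'C(q.+1, bump 0 i))%N by apply: prime_dvd_bin; rewrite //= /bump /= add1n ltnS ltn_ord.
    by rewrite natrM mulrA; apply: bM => //; apply: srM; [apply: srM; apply: srX|apply: sr_nat].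
  have pwD x y : pw x -> pw y -> pw (x + y).
    move=> [u Uu bu] [v Uv bv]; exists (u + v); first exact: srD.
    have -> : x + y - (u + v) ^+ p = (x - u ^+ p) + (y - v ^+ p) - ((u + v) ^+ p - (u ^+ p + v ^+ p)) by ring.
    by apply: bD; [apply: bD|apply/bN/Ip].
  have pwU x : pw x -> U x.
    by move=> [u Uu bu]; rewrite -[x](subrK (u ^+ p)); apply: srD; [apply: bU|apply: srX].
  have pwM x y : pw x -> pw y -> pw (x * y).
    move=> Px [v Uv bv]; have [u Uu bu] := Px; exists (u * v); first exact: srM.
    have -> : x * y - (u * v) ^+ p = x * (y - v ^+ p) + v ^+ p * (x - u ^+ p) by rewrite exprMn; ring.
    by apply: bD; apply: bM => //; [apply: pwU|apply: srX].
  have pwX u : U u -> pw (u ^+ p) by move=> Uu; exists u => //; rewrite subrr.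
  have pw1 : pw 1 by rewrite -(expr1n _ p); apply/pwX/sr1.
  have bpw x : b x -> pw x.
    by move=> bx; exists 0; rewrite ?expr0n ?eqn0Ngt ?prime_gt0 //= ?subr0 //; apply: sr0.
  have pwN1 : pw (- 1).
    have E : - 1 = p.-1%:R - p%:R :> D by rewrite -{2}(prednK (prime_gt0 pp)) -addn1 natrD; ring.
    rewrite E; apply: (pwD _ _ _ (bpw _ (bN bp))).
    by elim: (p.-1) => [|n IH]; [apply: bpw|rewrite -addn1 natrD; apply: pwD].
  have pwB x y : pw x -> pw y -> pw (x - y).
    by move=> Px Py; rewrite -[- y]mulN1r; apply: pwD => //; apply: pwM.
  exists (Subring pw1 pwB pwM); split=> //; last by right; split.
  move=> x [u Uu bu] Mx; have Mu : M (u ^+ p) by have := idealB Mx (bm bu); rewrite opprB addrC subrK.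
  have {}Mu : M u.
    apply: contrapT => nMu; have [y [Uy bxy]] := Uinv2 Uu nMu; apply: M1.
    suff H : M ((u * y) ^+ p - 1).
      by have := idealB (idealMl (y ^+ p) Mu) H; rewrite exprMn opprB addrC subrK.
    have := horner_cong 'X^p (bm bxy : M (u * y - 1)); rewrite !hornerXn expr1n; exact.
  rewrite -[x](subrK (u ^+ p)); apply: bD => //.
  case: (p) (prime_gt1 pp) => [|[|q]] // _; rewrite exprS; apply: mm => //; first exact: srX.
  by rewrite exprS; apply: idealMl.
pose zb : set D := [set x | exists z : int, b (x - z%:~R)].
have uint (z : int) : U z%:~R.
  by case: z => n; rewrite ?NegzE ?rmorphN /=; [exact: sr_nat|apply/srN/sr_nat].
have zb1 : zb 1 by exists 1; rewrite subrr.
have zbB x y : zb x -> zb y -> zb (x - y).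
  move=> [z bz] [w bw]; exists (z - w); rewrite rmorphB /=.
  have -> : x - y - (z%:~R - w%:~R) = (x - z%:~R) - (y - w%:~R) by ring.
  by apply: bD => //; apply: bN.
have zbU x : zb x -> U x.
  by move=> [z bz]; rewrite -[x](subrK z%:~R); apply: srD => //; apply: bU.
have zbM x y : zb x -> zb y -> zb (x * y).
  move=> Zx [w bw]; have [z bz] := Zx; exists (z * w); rewrite rmorphM /=.
  have -> : x * y - z%:~R * w%:~R = x * (y - w%:~R) + w%:~R * (x - z%:~R) by ring.
  by apply: bD; apply: bM => //; apply: zbU.
exists (Subring zb1 zbB zbM); split=> //; last by left.
  by move=> x bx; exists 0; rewrite subr0.
move=> x [z bz] Mx; have Mz : M z%:~R by have := idealB Mx (bm bz); rewrite opprB addrC subrK.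
suff z0 : z = 0 by rewrite z0 subr0 in bz.
case: z Mz {bz} => [[|n]|n] //; first by move/ch0.
by rewrite NegzE rmorphN => /idealN; rewrite opprK => /ch0.
Qed.

(** The residue field of U lifts across an ideal of square zero modulo b. A subring E maximal with E
    meeting M inside b meets every class: if it missed that of al, some a in the class could be
    adjoined. When al is transcendental modulo M any a will do; when its minimal monic relation is
    f, one needs f(a) in b. *)
Lemma coef_lift : exists E : subring D, [/\ E `<=` U, b `<=` E, forall x, E x -> M x -> b x,
  forall x, U x -> exists2 e, E e & M (x - e) &
  forall s x, E s -> ~ M s -> U x -> E (s * x) -> E x].
Proof.
have [E0 [E0U bE0 E0M chE]] := base_ring.
have [||E [E0E [EU EM] maxE]] := @subring_max D E0 (fun A => A `<=` U /\ forall x, A x -> M x -> b x).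
- by [].
- move=> F _ _ FP; split=> [x [A FA Ax]|x [A FA Ax]]; first exact: (FP A FA).2.1.
  exact: (FP A FA).2.2.
have bE : b `<=` E by apply: subset_trans E0E.
have Einv s x : E s -> ~ M s -> U x -> E (s * x) -> E x.
  move=> Es Ms Ux Esx.
  have Eprod s' t : E s' -> ~ M s' -> E t -> ~ M t -> ~ M (s' * t).
    move=> Es' Ms' Et Mt Mst; have [y [Uy by']] := Uinv2 (EU _ Es') Ms'; apply: Mt.
    have -> : t = y * (s' * t) - t * (s' * y - 1) by ring.
    by apply: idealB; apply: idealM => //; apply: bm.
  pose A : set D := [set x | U x /\ exists2 s, E s & ~ M s /\ E (s * x)].
  have A1 : A 1 by split; [apply: sr1|exists 1; [apply: sr1|split=> //; rewrite mulr1; apply: sr1]].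
  have AB u v : A u -> A v -> A (u - v).
    move=> [Uu [s1 Es1 [M1' E1]]] [Uv [s2 Es2 [M2 E2]]]; split; first exact: srB.
    exists (s1 * s2); [exact: srM|split; first exact: Eprod].
    rewrite mulrBr mulrAC -[s1 * s2 * v]mulrA; apply: srB; first exact: srM.
    exact: srM.
  have AM u v : A u -> A v -> A (u * v).
    move=> [Uu [s1 Es1 [M1' E1]]] [Uv [s2 Es2 [M2 E2]]]; split; first exact: srM.
    exists (s1 * s2); [exact: srM|split; first exact: Eprod].
    by rewrite mulrACA; apply: srM.
  apply: (maxE (Subring A1 AB AM)); last by split=> //; exists s.
    by move=> y Ey; split; [apply: EU|exists 1; [apply: sr1|split=> //; rewrite mul1r]].
  split=> [y []//|y [Uy [t Et [Mt Ety]]] My].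
  have [w [Uw bw]] := Uinv2 (EU _ Et) Mt.
  have -> : y = w * (t * y) - y * (t * w - 1) by ring.
  apply: bD; last by apply/bN/bM.
  by apply: bM => //; apply: EM => //; apply: idealM.
exists E; split=> // al Ual; apply: contrapT => nEal.
have Enot a : U a -> M (al - a) -> ~ E a by move=> Ua Ma Ea; apply: nEal; exists a.
have noadj a : U a -> M (al - a) -> (forall g : {poly D}, (forall i, E g`_i) -> M g.[a] -> b g.[a]) -> False.
  move=> Ua Ma H; apply: (Enot a) => //; apply: (maxE (adj E a)); last exact: adj_gen.
    exact: adj_incl.
  split; first by apply: adj_sub.
  move=> _ [n [c [Ec ->]]].
  have -> : \sum_(i < n) c i * a ^+ i = (\poly_(i < n) c i).[a] by rewrite horner_poly.
  by apply: H => i; rewrite coef_poly; case: ifP => // _; apply: sr0.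
have Upoly (g : {poly D}) a : (forall i, E g`_i) -> U a -> U g.[a].
  by move=> Eg Ua; rewrite horner_coef; apply: srS => i _; apply: srM; [apply: EU|apply: srX].
have bpoly (g : {poly D}) a : (forall i, b g`_i) -> U a -> b g.[a].
  by move=> Eg Ua; rewrite horner_coef; apply: bS => i _; rewrite mulrC; apply: bM => //; apply: srX.
pose rel d := exists f : {poly D}, [/\ forall i, E f`_i, size f = d.+1, f`_d = 1 & M f.[al]].
have torel (g : {poly D}) n : (size g <= n)%N -> (forall i, E g`_i) -> M g.[al] -> (exists i, ~ M g`_i) ->
    exists2 d, (d < n)%N & rel d.
  elim: n g => [|n IH] g; first by rewrite leqn0 size_poly_eq0 => /eqP -> _ _ [i]; rewrite coef0; case.
  move=> sg Eg Mg [i Mi].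
  have [Mn|Mn] := pselect (M g`_n).
    have bn : b g`_n := EM _ (Eg n) Mn.
    have [||||d dn rd] := IH (g - g`_n *: 'X^n).
    - apply/leq_sizeP => j nj; rewrite coefB coefZ coefXn; case: eqP => [->|/eqP jn]; first by rewrite mulr1 subrr.
      by rewrite mulr0 subr0 nth_default // (leq_trans sg) // ltn_neqAle eq_sym jn.
    - move=> j; rewrite coefB coefZ coefXn; apply: srB => //; apply: srM => //.
      by case: eqP => _; [apply: sr1|apply: sr0].
    - by rewrite hornerD hornerN hornerZ; apply: idealB => //; apply: idealMl.
    - exists i; rewrite coefB coefZ coefXn; case: eqP => [E1|_]; last by rewrite mulr0 subr0.
      by rewrite E1 in Mi.
    by exists d => //; apply: ltnW.
  have [y [Uy by']] := Uinv2 (EU _ (Eg n)) Mn.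
  have Ey : E y.
    apply: (Einv g`_n) => //; rewrite -[_ * y](subrK 1); apply: srD; [exact: bE|exact: sr1].
  exists n => //; exists (y *: g + (1 - g`_n * y) *: 'X^n).
  have Ec : E (1 - g`_n * y) by apply: srB; [apply: sr1|apply: srM].
  have lc : (y *: g + (1 - g`_n * y) *: 'X^n)`_n = 1.
    by rewrite coefD !coefZ coefXn eqxx mulr1 mulrC addrC subrK.
  split=> //.
  - move=> j; rewrite coefD !coefZ coefXn; apply: srD; apply: srM => //.
    by case: eqP => _; [apply: sr1|apply: sr0].
  - apply/eqP; rewrite eqn_leq; apply/andP; split; last first.
      by rewrite ltnNge; apply/negP => /leq_sizeP/(_ n (leqnn n)); rewrite lc => /eqP; rewrite oner_eq0.
    apply/leq_sizeP => j nj; rewrite coefD !coefZ coefXn (gtn_eqF nj) mulr0 addr0.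
    by rewrite nth_default ?mulr0 // (leq_trans sg).
  - rewrite hornerD !hornerZ; apply: idealD; first exact: idealM.
    by apply: idealMl; rewrite -opprB; apply/idealN/bm.
have [[d0 rd0]|norel] := pselect (exists d, rel d); last first.
  apply: (noadj al) => //; first by rewrite subrr.
  move=> g Eg Mg; apply: bpoly => // i; apply: EM => //; apply: contrapT => Mi; apply: norel.
  by have [|d _ rd] := torel g (size g) (leqnn _) Eg Mg; [exists i|exists d].
have [d rd dmin] := min_nat (ex_intro rel d0 rd0).
have small (g : {poly D}) : (size g <= d)%N -> (forall i, E g`_i) -> M g.[al] -> forall i, b g`_i.
  move=> sg Eg Mg i; apply: EM => //; apply: contrapT => Mi.
  have [|e ed re] := torel g d sg Eg Mg; first by exists i.
  by have := dmin _ re; rewrite leqNgt ed.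
have reduce (f : {poly D}) a : (forall i, E f`_i) -> size f = d.+1 -> f`_d = 1 -> b f.[a] -> U a -> M (al - a) ->
    forall n (g : {poly D}), (size g <= n)%N -> (forall i, E g`_i) -> M g.[a] -> b g.[a].
  move=> Ef sf f1 bf Ua Ma n; elim: n => [|n IH] g sg Eg Mg.
    by move: sg; rewrite leqn0 size_poly_eq0 => /eqP ->; rewrite horner0.
  have [nd|dn] := ltnP n d.
    apply: bpoly => //; apply: small => //; first by rewrite (leq_trans sg).
    by have := idealD (horner_cong g Ma) Mg; rewrite subrK.
  pose h := g - (g`_n *: 'X^(n - d)) * f.
  have bt : b ((g`_n *: 'X^(n - d)) * f).[a].
    by rewrite hornerM; apply: bM => //; rewrite hornerZ hornerXn; apply: srM; [apply: EU|apply: srX].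
  have hE : g.[a] = h.[a] + ((g`_n *: 'X^(n - d)) * f).[a] by rewrite /h hornerD hornerN subrK.
  have coefh j : h`_j = g`_j - g`_n * (if (j < n - d)%N then 0 else f`_(j - (n - d))).
    by rewrite /h coefB -scalerAl coefZ coefXnM.
  rewrite hE; apply: bD => //; apply: IH.
  - apply/leq_sizeP => j nj; rewrite coefh ltnNge (leq_trans (leq_subr d n) nj) /=.
    move: nj; rewrite leq_eqVlt => /orP[/eqP <-|nj]; first by rewrite subKn // f1 mulr1 subrr.
    have gj : g`_j = 0 by rewrite nth_default // (leq_trans sg).
    by rewrite gj (nth_default _ (n := j - (n - d))) ?mulr0 ?subr0 // sf ltn_subRL subnK.
  - by move=> j; rewrite coefh; apply: srB => //; apply: srM => //; case: ifP => _ //; apply: sr0.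
  - by have := idealB Mg (bm bt); rewrite hE addrK.
have [f [Ef sf f1 Mf]] := rd.
suff [f' [a [Ef' sf' f1' [bf' Ua Ma]]]] : exists (f' : {poly D}) (a : D), [/\ forall i, E f'`_i, size f' = d.+1, f'`_d = 1 &
    [/\ b f'.[a], U a & M (al - a)]].
  by apply: (noadj a) => // g Eg Mg; apply: (reduce f' a) (leqnn _) Eg Mg.
have Mal : M (al - al) by rewrite subrr.
have d_gt0 : (0 < d)%N.
  rewrite lt0n; apply/eqP => d0'; apply: M1; rewrite d0' in sf f1.
  by have /size1_polyC fC := eq_leq sf; rewrite fC f1 hornerC in Mf.
(* If the degree d vanishes in the residue field then p divides it. But X^p - al^p has its
   coefficients in E and vanishes at al, so minimality gives d = p and this relation can be used. *)
have [Md|Md] := pselect (M d%:R).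
  case: chE => [/(_ d.-1)|[pp pE]]; first by rewrite prednK.
  have Mp : M p%:R by case: charH => [[_ /bm]//|/(_ d.-1)]; rewrite prednK.
  have pd : (p <= d)%N.
    apply: dvdn_leq => //; apply: contraT; rewrite -prime_coprime // => cop; exfalso.
    apply: M1; have [/= km kn kmE _] := egcdnP d (prime_gt0 pp).
    have := congr1 (fun n : nat => n%:R : D) kmE; rewrite (eqP cop) !natrD !natrM => E1.
    have -> : (1 : D) = km%:R * p%:R - kn%:R * d%:R by rewrite E1 mulr1n; ring.
    by apply: idealB; apply: idealM.
  have cf j : ('X^p - (al ^+ p)%:P : {poly D})`_j = (if j == p then 1 else 0) - (if j == 0%N then al ^+ p else 0).
    by rewrite coefB coefXn coefC; case: eqP.
  have p0 := prime_gt0 pp.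
  set g := 'X^p - _ in cf.
  have gE j : E g`_j by rewrite cf; apply: srB; case: eqP => // _; apply/E0E/pE.
  have sg : size g = p.+1 by rewrite size_XnsubC.
  have g1 : g`_p = 1 by rewrite cf eqxx gtn_eqF // subr0.
  have g0 : g.[al] = 0 by rewrite hornerD hornerN hornerXn hornerC subrr.
  have dp : d = p by apply/eqP; rewrite eqn_leq pd dmin //; exists g; rewrite g0.
  by exists g, al; rewrite dp g0.
(* The derivative has invertible leading coefficient d and smaller degree than f, so by minimality
   it does not vanish at al. One Newton step then moves the value of f into b. *)
have nMf' : ~ M f^`().[al].
  move=> Mf'; have [||||e ed re] := torel f^`() d.
  - by apply/leq_sizeP => i di; rewrite coef_deriv nth_default ?mul0rn // sf ltnS.
  - exact: sr_deriv.
  - by [].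
  - by exists d.-1; rewrite coef_deriv prednK // f1.
  by have := dmin _ re; rewrite leqNgt ed.
have Uf' : U f^`().[al].
  by apply: Upoly => //; apply: sr_deriv.
have [y [Uy My]] := Uinv Uf' nMf'.
have Uf := Upoly _ _ Ef Ual.
exists f, (al - y * f.[al]); split=> //; split.
- have Uy' : U (- (y * f.[al])) by apply/srN/srM.
  have [c Uc' cE] := horner_shift2 (fun i => EU _ (Ef i)) Ual Uy'; rewrite cE.
  have -> : f.[al] + f^`().[al] * - (y * f.[al]) = (1 - f^`().[al] * y) * f.[al] by ring.
  have Uc : U (1 - f^`().[al] * y) by apply: srB; [apply: sr1|apply: srM].
  apply: bD; first by apply: mm => //; rewrite -opprB; apply: idealN.
  by apply: bM => //; rewrite expr2; apply: mm => //; apply/idealN/idealM.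
- by apply: srB => //; apply: srM.
- by rewrite opprB addrC subrK; apply: idealM.
Qed.
End CoefLift.

Section CoefRing.
Variables (D : comNzRingType) (M : ideal D) (p m : nat).
Hypothesis cM : clocal M.
Hypothesis domD : is_prime (izero D).
Notation pi := (m%:R : D).
Hypothesis Mpi : M pi.
Hypothesis charH : (prime p /\ (p%:R = 0 :> D \/ p = m)) \/ (forall n, ~ M n.+1%:R).
Let noeth := cl_noeth cM.
Let pM := cl_prime cM.

Let full : subring D := rimage (idfun : {rmorphism D -> D}).
Let fullT x : full x. Proof. by exists x. Qed.

(** Stage n of a descending tower, with W the stage before: U contains pi W and M^(n+1), and these
    two together make up the part of U inside M. *)
Record coef_step (n : nat) (W U : subring D) : Prop := CoefStep {
  cs_sub : U `<=` W;
  cs_step : forall x, W x -> U (pi * x);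
  cs_pow : ipow M n.+1 `<=` U;
  cs_max : forall x, U x -> M x -> exists u y, [/\ W u, ipow M n.+1 y & x = pi * u + y];
  cs_inv : forall s x, U s -> ~ M s -> U (s * x) -> U x
}.

Lemma coef_step0 : coef_step 0 full full.
Proof.
split=> // x _ Mx.
by exists 0, x; split=> //; [apply/ipow1|rewrite mulr0 add0r].
Qed.

(** Apply [coef_lift] with b = pi U + M^(n+2). By [cs_max], products of two elements of U in M lie
    in b, since M^(2n+2) is inside M^(n+2). *)
Lemma coef_stepS n W U : coef_step n W U ->
  exists E, coef_step n.+1 U E /\ forall x, U x -> exists2 e, E e & M (x - e).
Proof.
move=> [UW piW MU UM Uinv].
have Upi : U pi by rewrite -[pi]mulr1; apply/piW/sr1.
pose b : set D := [set x | exists u y, [/\ U u, ipow M n.+2 y & x = pi * u + y]].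
have [| | | | | | | | |E [EU bE EM UE Einv]] := @coef_lift D U M b p.
- by exists 0, 0; split; [exact: sr0|exact: ideal0|rewrite mulr0 addr0].
- move=> _ _ [u [y [Uu My ->]]] [u' [y' [Uu' My' ->]]]; exists (u + u'), (y + y').
  by split; [exact: srD|exact: idealD|ring].
- move=> v _ Uv [u [y [Uu My ->]]]; exists (v * u), (v * y).
  by split; [exact: srM|exact: idealM|ring].
- move=> _ [u [y [Uu My ->]]]; apply: srD; first exact: srM.
  by apply: MU; apply: ipowS_sub My.
- move=> _ [u [y [Uu My ->]]]; apply: idealD; first exact: idealMl.
  by apply/ipow1; apply: (@ipow_le _ _ _ n.+2) My.
- move=> x x' Ux Ux' Mx Mx'; have [w [y [Ww My ->]]] := UM _ Ux Mx; have [w' [y' [Ww' My' ->]]] := UM _ Ux' Mx'.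
  exists (pi * (w * w') + (w * y' + w' * y)), (y * y'); split; last by ring.
    apply: srD; first by apply/piW/srM.
    by apply: MU; apply: idealD; apply: idealM.
  apply: (@ipow_le _ _ _ (n.+1 + n.+1)); first by rewrite addSn ltnS leq_addl.
  exact: ipowD.
- by case: pM.
- move=> x Ux Mx; have [y xy] := cl_unit cM Mx; exists y; split.
    by apply: (Uinv x) => //; rewrite xy; apply: sr1.
  by rewrite xy subrr.
- case: charH => [[pp H]|H]; [left; split=> //|by right].
  case: H => [->|->]; [exists 0|exists 1]; exists 0; split; rewrite ?mulr0 ?mulr1 ?addr0 //.
exists E; split=> //; split=> //.
- by move=> x Ux; apply: bE; exists x, 0; split=> //; rewrite addr0.
- by move=> y My; apply: bE; exists 0, y; split=> //; rewrite mulr0 add0r.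
move=> s x Es Ms Esx; apply: (Einv s) => //; apply: (Uinv s) => //; exact: EU.
Qed.

(** V is the intersection of the tower. Elements of a stage can be approximated from the next stage
    to growing order, so every residue class survives in the limit. *)
Theorem coefficient_ring : exists V : subring D, [/\ forall x, exists2 v, V v & M (x - v),
  forall v, V v -> M v -> exists2 u, V u & v = pi * u,
  forall s x, V s -> ~ M s -> V (s * x) -> V x,
  V pi &
  forall x, (forall n, exists2 v, V v & ipow M n (x - v)) -> V x].
Proof.
have /choice[F FP] : forall a : nat * subring D * subring D, exists E, coef_step a.1.1 a.1.2 a.2 ->
    coef_step a.1.1.+1 a.2 E /\ forall x, a.2 x -> exists2 e, E e & M (x - e).
  move=> [[n W] U] /=; have [H|H] := pselect (coef_step n W U); last by exists U => /H.
  by have [E HE] := coef_stepS H; exists E.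
pose st := fix st n := if n is n'.+1 then ((st n').2, F (n', (st n').1, (st n').2)) else (full, full).
pose U n := (st n).2.
have stP n : coef_step n (st n).1 (st n).2.
  elim: n => [|n IH]; [exact: coef_step0|exact: (FP (n, (st n).1, (st n).2) IH).1].
have UE n x : U n x -> exists2 e, U n.+1 e & M (x - e).
  exact: (FP (n, (st n).1, (st n).2) (stP n)).2.
have WE n : (st n).1 = U n.-1 by case: n.
have Ude n k : U (n + k)%N `<=` U n.
  elim: k n => [|k IH] n x; first by rewrite addn0.
  by rewrite addnS => /(cs_sub (stP (n + k).+1)); exact: IH.
have Umono n k : (n <= k)%N -> U k `<=` U n by move=> /subnKC <-; apply: Ude.
have Upi n k x : U n x -> U (n + k)%N (pi ^+ k * x).
  elim: k => [|k IH] Ux; first by rewrite addn0 expr0 mul1r.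
  by rewrite exprS -mulrA addnS; apply: (cs_step (stP (n + k).+1)); apply: IH.
have Mpow n : ipow M n.+1 `<=` U n := cs_pow (stP n).
(* Modulo M the approximation is given by [UE]. Its error is, up to M^(n+1), pi times an element of
   an earlier stage, which is approximated in turn; n + 1 corrections reach M^(n+1). *)
have stepA n x : U n x -> exists2 e, U n.+1 e & ipow M n.+1 (x - e).
  move=> Ux.
  have H k : (k <= n.+1)%N -> exists e w, [/\ U n.+1 e, U (n - k)%N w & ipow M n.+1 (x - e - pi ^+ k * w)].
    elim: k => [|k IH] kn.
      exists 0, x; rewrite subn0 expr0 mul1r subr0 subrr; split=> //; exact: sr0.
    have [e [w [Ue Uw He]]] := IH (ltnW kn); rewrite ltnS in kn.
    have [e' Ue' Me'] := UE _ _ Uw.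
    have [w' [y [Ww' My E']]] := cs_max (stP (n - k)%N) (srB Uw (Umono _ _ (leqnSn _) _ Ue')) Me'.
    exists (e + pi ^+ k * e'), w'; split.
    - apply: srD => //; have := Upi _ k _ Ue'; by rewrite addSn subnK.
    - by rewrite WE in Ww'; rewrite subnS.
    have -> : x - (e + pi ^+ k * e') - pi ^+ k.+1 * w' = (x - e - pi ^+ k * w) + pi ^+ k * y.
      have -> : w = e' + (pi * w' + y) by rewrite -E' addrC subrK.
      by rewrite exprS; ring.
    apply: idealD => //; have -> : n.+1 = (k + (n - k).+1)%N by rewrite addnS subnKC.
    by apply: ipowD => //; apply: ipowX.
  have [e [w [Ue _ He]]] := H n.+1 (leqnn _); exists e => //.
  rewrite -[x - e](subrK (pi ^+ n.+1 * w)); apply: idealD => //.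
  by apply/idealMl/ipowX.
pose V0 : set D := [set x | forall n, U n x].
have V1 : V0 1 by move=> n; apply: sr1.
have VB x y : V0 x -> V0 y -> V0 (x - y) by move=> Vx Vy n; apply: srB.
have VM x y : V0 x -> V0 y -> V0 (x * y) by move=> Vx Vy n; apply: srM.
pose V := Subring V1 VB VM.
have closed x : (forall n, exists2 v, V v & ipow M n (x - v)) -> V x.
  move=> H n; have [v Vv Mv] := H n.+1; rewrite -[x](subrK v); apply: srD => //; exact: Mpow.
exists V; split=> //.
- move=> x.
  have /choice[g gP] : forall a : nat * D, exists e, U a.1 a.2 -> U a.1.+1 e /\ ipow M a.1.+1 (a.2 - e).
    move=> [n y] /=; have [H|H] := pselect (U n y); last by exists 0 => /H.
    by have [e e1 e2] := stepA n y H; exists e.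
  pose X := fix X n := if n is n'.+1 then g (n', X n') else x.
  have UX n : U n (X n) by elim: n => [|n IH]; [exact: fullT|exact: (gP (n, X n) IH).1].
  have XP n : ipow M n.+1 (X n - X n.+1) := (gP (n, X n) (UX n)).2.
  have [|l lP] := cl_conv cM (x := X).
    by move=> n; apply/ideal_sub_sym/ipowS_sub/XP.
  exists l.
    move=> n; rewrite -[l](subrK (X n.+1)); apply: srD; first exact/Mpow/lP.
    exact: (Umono _ _ (leqnSn n)).
  apply: ideal_sub_sym; apply: (@ideal_sub_trans _ _ (X 1%N)).
    by apply/ipow1/lP.
  by apply/ideal_sub_sym/ipow1/XP.
- move=> v Vv Mv.
  have /choice[wy wyP] : forall n, exists wy : D * D, [/\ (st n).1 wy.1, ipow M n.+1 wy.2 & v = pi * wy.1 + wy.2].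
    by move=> n; have [w [y H]] := cs_max (stP n) (Vv n) Mv; exists (w, y).
  have [pi0|pi0] := eqVneq pi 0.
    exists 0; [exact: sr0|rewrite mulr0; apply: (cl_sep cM) => n].
    by have [_ My ->] := wyP n; rewrite pi0 mul0r add0r; apply: ipowS_sub.
  have cancel x y : pi * x = pi * y -> x = y.
    move=> E; have : izero D (pi * (x - y)) by rewrite mulrBr E subrr.
    by case/domD.2 => [/eqP|/eqP]; [rewrite (negbTE pi0)|rewrite subr_eq0 => /eqP].
  (* Artin-Rees makes division by pi continuous, so the quotients found at the separate stages
     converge. *)
  have AR j : exists N, forall x, ipow M N (pi * x) -> ipow M j x.
    have [||N NP] := @artin_rees D noeth M (igen [:: pi]) (iscale (ipow M j) pi).
    - by move=> _ [x _ ->]; apply/igen1; exists x; rewrite // mulrC.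
    - move=> a x Ma /igen1[r ->]; exists j, (a ^+ j * r); first by apply/idealMl/ipowX.
      by rewrite ?mulrA // mulrC mulrA.
    exists N => x Hx; have [|y My E] := NP _ Hx; first by apply/igen1; exists x; rewrite mulrC.
    by rewrite (cancel x y) // E mulrC.
  have /choice[N NP] := AR.
  pose N' j := (\sum_(0 <= i < j.+1) N i + j.+2)%N.
  have N'S j : (N j <= N' j)%N by rewrite /N' big_nat_recr //= -addnA addnCA leq_addr.
  have N'S' j : (N j <= N' j.+1)%N by rewrite /N' 2?big_nat_recr //= -!addnA addnCA leq_addr.
  have N'j j : (j.+2 <= N' j)%N by rewrite /N' leq_addl.
  pose u j := (wy (N' j)).1.
  have uP j : ipow M (N' j).+1 (v - pi * u j) by have [_ My ->] := wyP (N' j); rewrite addrAC subrr add0r.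
  have [|l lP] := cl_conv cM (x := u).
    move=> j; apply: NP; rewrite mulrBr.
    have -> : pi * u j.+1 - pi * u j = (v - pi * u j) - (v - pi * u j.+1) by ring.
    by apply: idealB; [apply: ipow_le (uP j)|apply: ipow_le (uP j.+1)]; apply: leqW.
  exists l.
    move=> n; rewrite -[l](subrK (u n.+1)); apply: srD; first exact/Mpow/lP.
    have [Ww _ _] := wyP (N' n.+1); rewrite WE in Ww; apply: Umono Ww.
    have := N'j n.+1; case: (N' _) => // k; rewrite ltnS => H; exact: leq_trans (ltnW (ltnW (ltnSn _))) H.
  apply/subr0_eq/(cl_sep cM) => j.
  have -> : v - pi * l = (v - pi * u j) - pi * (l - u j) by ring.
  apply: idealB; last exact/idealM/lP.
  by apply: ipow_le (uP j); apply: leqW; apply: leq_trans (N'j j); apply: leqW.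
- move=> s x Vs Ms Vsx n; exact: (cs_inv (stP n) (Vs n) Ms (Vsx n)).
- move=> n; exact: sr_nat.
Qed.

End CoefRing.

(** * Packing rings without zero divisors as integral domains *)

Section ClassicalInverse.
Variable R : comPzRingType.
Definition unitb (x : R) : bool := `[< is_unit x >].
Definition cinv (x : R) : R := if pselect (is_unit x) is left h then projT1 (cid h) else x.
Lemma cinvV : {in unitb, left_inverse 1 cinv *%R}.
Proof.
move=> x; rewrite unfold_in => /asboolP ux; rewrite /cinv; case: pselect => // h.
by case: cid => y /= <-; rewrite mulrC.
Qed.
Lemma cinv_unit x y : y * x = 1 -> unitb x.
Proof. by move=> H; apply/asboolP; exists y; rewrite mulrC. Qed.
Lemma cinv_out : {in [predC unitb], cinv =1 id}.
Proof. by move=> x; rewrite inE unfold_in => /asboolP ux; rewrite /cinv; case: pselect. Qed.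
End ClassicalInverse.

Section SubDomain.
Variables (R : idomainType) (S : subring R).
Lemma srT_neq0 : (1 : srT S) != 0.
Proof. by apply/eqP => /(congr1 val) /= /eqP; rewrite oner_eq0. Qed.
HB.instance Definition _ := GRing.PzSemiRing_isNonZero.Build (srT S) srT_neq0.
HB.instance Definition _ := GRing.ComNzRing_hasMulInverse.Build (srT S)
  (@cinvV (srT S)) (@cinv_unit (srT S)) (@cinv_out (srT S)).
Lemma srT_idom (x y : srT S) : x * y = 0 -> (x == 0) || (y == 0).
Proof.
move=> /(congr1 val) /= /eqP; rewrite mulf_eq0 => /orP[]/eqP E; apply/orP; [left|right];
  by apply/eqP/val_inj.
Qed.
HB.instance Definition _ := GRing.ComUnitRing_isIntegral.Build (srT S) srT_idom.
Definition sr_dom : idomainType := srT S.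
End SubDomain.

Section Domain.
Variables (R : comPzRingType) (domR : is_prime (izero R)).
(** The proof argument yields a separate type, so that the new structure does not interfere with
    instances on R. *)
Definition domT (_ : is_prime (izero R)) : Type := R.
HB.instance Definition _ := GRing.ComPzRing.copy (domT domR) R.
Lemma domT_neq0 : (1 : domT domR) != 0.
Proof. by apply/eqP; exact: domR.1. Qed.
HB.instance Definition _ := GRing.PzSemiRing_isNonZero.Build (domT domR) domT_neq0.
HB.instance Definition _ := GRing.ComNzRing_hasMulInverse.Build (domT domR)
  (@cinvV (domT domR)) (@cinv_unit (domT domR)) (@cinv_out (domT domR)).
Lemma domT_idom (x y : domT domR) : x * y = 0 -> (x == 0) || (y == 0).
Proof. by move=> /(domR.2 x y)[|] E; apply/orP; [left|right]; apply/eqP. Qed.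
HB.instance Definition _ := GRing.ComUnitRing_isIntegral.Build (domT domR) domT_idom.
Definition dom_ring : idomainType := domT domR.
Definition to_domf (x : R) : dom_ring := x.
Definition of_domf (x : dom_ring) : R := x.
Lemma to_dom_zmod : zmod_morphism to_domf. Proof. by []. Qed.
Lemma to_dom_monoid : monoid_morphism to_domf. Proof. by []. Qed.
Lemma of_dom_zmod : zmod_morphism of_domf. Proof. by []. Qed.
Lemma of_dom_monoid : monoid_morphism of_domf. Proof. by []. Qed.
Definition to_dom : {rmorphism R -> dom_ring} := HB.pack to_domf
  (GRing.isZmodMorphism.Build R dom_ring to_domf to_dom_zmod)
  (GRing.isMonoidMorphism.Build R dom_ring to_domf to_dom_monoid).
Definition of_dom : {rmorphism dom_ring -> R} := HB.pack of_domf
  (GRing.isZmodMorphism.Build dom_ring R of_domf of_dom_zmod)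
  (GRing.isMonoidMorphism.Build dom_ring R of_domf of_dom_monoid).
End Domain.

Lemma idom_prime0 (R : idomainType) : is_prime (izero R).
Proof.
split; first by move/eqP; rewrite oner_eq0.
by move=> x y /eqP; rewrite mulf_eq0 => /orP[]/eqP; [left|right].
Qed.

(** * Derivations of fields and p-th roots *)

Lemma coef_XsubC_exp (K : idomainType) (b : K) m : (('X - b%:P) ^+ m.+1)`_m = - (b *+ m.+1).
Proof.
elim: m => [|m IH]; first by rewrite expr1 coefB coefX coefC /= sub0r.
rewrite exprS mulrBl coefB coefXM coefCM /= IH.
have -> : (('X - b%:P) ^+ m.+1)`_m.+1 = 1.
  have := monicP (monic_exp m.+1 (monicXsubC b)); rewrite lead_coefE size_exp_XsubC; exact.
by rewrite mulr1 [in RHS]mulrS opprD addrC.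
Qed.

Lemma natp_neq0 (K : comNzRingType) p m : prime p -> p%:R = 0 :> K -> (0 < m < p)%N -> exists c : nat, c%:R * m%:R = 1 :> K.
Proof.
move=> pp p0 /andP[m0 mp]; have cop : coprime m p.
  by rewrite coprime_sym prime_coprime // gtnNdvd.
have [/= km kn kmE _] := egcdnP p m0; exists km.
by rewrite -natrM kmE (eqP cop) natrD natrM p0 mulr0 add0r.
Qed.

Lemma polyp0 p (R : nzRingType) : p%:R = 0 :> R -> p%:R = 0 :> {poly R}.
Proof. by move=> H; rewrite -(rmorph_nat (@polyC R)) H rmorph0. Qed.

Lemma frobB p (R : comNzRingType) (x y : R) : prime p -> p%:R = 0 :> R -> (x - y) ^+ p = x ^+ p - y ^+ p.
Proof.
by move=> pp h0; apply/eqP; rewrite eq_sym subr_eq -frobD // subrK.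
Qed.

Section PthRoot.
Variables (p : nat) (C : idomainType) (K : fieldType) (i : {rmorphism C -> K}) (b : K).
Hypotheses (pp : prime p) (p0 : p%:R = 0 :> K) (inj_i : injective i).
Hypothesis ip : forall x : K, exists c, i c = x ^+ p.

Lemma Cp0 : p%:R = 0 :> C.
Proof. by apply: inj_i; rewrite rmorph_nat p0 rmorph0. Qed.

Lemma pth_unit (c : C) : c != 0 -> exists u, u * c = 1.
Proof.
move=> c0; have ic0 : i c != 0 by apply: contra c0 => /eqP E; apply/eqP/inj_i; rewrite E rmorph0.
have [d dE] := ip (i c)^-1; exists (d * c ^+ p.-1).
rewrite -mulrA -exprSr prednK ?prime_gt0 //.
by apply: inj_i; rewrite rmorphM rmorphXn rmorph1 dE -exprMn mulVf // expr1n.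
Qed.

Lemma pth_reduce (f : {poly C}) : exists q r a, [/\ i a = b ^+ p, f = q * ('X^p - a%:P) + r & (size r <= p)%N].
Proof.
have [a aE] := ip b; exists (Pdiv.Ring.rdivp f ('X^p - a%:P)), (Pdiv.Ring.rmodp f ('X^p - a%:P)), a.
have mX : 'X^p - a%:P \is monic by apply/monicXnsubC/prime_gt0.
split=> //; first exact: Pdiv.RingMonic.rdivp_eq.
by have := Pdiv.Ring.ltn_rmodpN0 f (monic_neq0 mX); rewrite size_XnsubC ?prime_gt0.
Qed.

Lemma map_Xp a : i a = b ^+ p -> map_poly i ('X^p - a%:P) = ('X - b%:P) ^+ p.
Proof.
move=> aE; rewrite rmorphB /= map_polyXn map_polyC /= aE frobB //; last exact: polyp0.
by rewrite rmorphXn.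
Qed.

Hypothesis ib : ~ exists c, i c = b.

(** A relation of least degree divides X^p - b^p = (X - b)^p, so up to a scalar it is a power of X -
    b with exponent below p. Its second coefficient is an invertible multiple of b, which puts b in
    C. *)
Lemma pth_indep (f : {poly C}) : (size f <= p)%N -> (map_poly i f).[b] = 0 -> f = 0.
Proof.
move=> sf fb; apply/eqP; apply: contrapT => /negP f0.
have [|g [g0 gb] nmin] := @min_size _ (fun g => g != 0 /\ (map_poly i g).[b] = 0); first by exists f.
set n := size g in nmin; have np : (n <= p)%N by apply: leq_trans sf; apply: nmin.
have lg0 : lead_coef g != 0 by rewrite lead_coef_eq0.
have [u uE] := pth_unit lg0.
have u0 : u != 0 by apply/eqP => u0; move/eqP: uE; rewrite u0 mul0r eq_sym oner_eq0.
pose h := u *: g.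
have mh : h \is monic by rewrite monicE lead_coefZ uE.
have sh : size h = n by rewrite size_scale.
have hb : (map_poly i h).[b] = 0 by rewrite map_polyZ hornerZ gb mulr0.
have [a aE] := ip b.
have mX : 'X^p - a%:P \is monic by apply/monicXnsubC/prime_gt0.
have E := Pdiv.RingMonic.rdivp_eq mh ('X^p - a%:P).
set q := Pdiv.Ring.rdivp _ _ in E; set r := Pdiv.Ring.rmodp _ _ in E.
have r0 : r = 0.
  apply/eqP/contraT => r0; have := Pdiv.Ring.ltn_rmodpN0 ('X^p - a%:P) (monic_neq0 mh).
  rewrite -/r sh ltnNge nmin //; split=> //.
  have := congr1 (fun P : {poly C} => (map_poly i P).[b]) E.
  rewrite map_Xp // rmorphD rmorphM /= hornerD hornerM hb mulr0 add0r => <-.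
  by rewrite horner_exp hornerXsubC subrr expr0n eqn0Ngt prime_gt0.
have dv : map_poly i h %| ('X - b%:P) ^+ p.
  by rewrite -(map_Xp aE) E r0 addr0 rmorphM /= dvdp_mulIr.
have [m mp hE] := dvdp_exp_XsubCP dv.
have {}hE : map_poly i h = ('X - b%:P) ^+ m.
  by apply/eqP; rewrite -eqp_monic ?monic_exp ?monicXsubC //; apply: monic_map.
have sm : n = m.+1 by rewrite -sh -(size_map_inj_poly inj_i (rmorph0 i)) hE size_exp_XsubC.
case: m => [|m] in mp hE sm.
  by move: hb; rewrite hE expr0 hornerC => /eqP; rewrite oner_eq0.
have mlt : (0 < m.+1 < p)%N by rewrite /= -sm.
have [c cE] := natp_neq0 pp p0 mlt.
apply: ib; exists (- (c%:R * h`_m)).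
rewrite rmorphN rmorphM rmorph_nat -coef_map hE coef_XsubC_exp mulrN opprK.
by rewrite -[b *+ _]mulr_natl mulrA cE mul1r.
Qed.

Lemma pth_deriv (f : {poly C}) : (map_poly i f).[b] = 0 -> (map_poly i f^`()).[b] = 0.
Proof.
have [q [r [al [alE E1 sr]]]] := pth_reduce f => f0.
have Xa : (('X - b%:P) ^+ p).[b] = 0 by rewrite horner_exp hornerXsubC subrr expr0n eqn0Ngt prime_gt0.
have r0 : r = 0.
  apply: (pth_indep sr); rewrite -f0 E1 rmorphD rmorphM /= hornerD hornerM.
  by rewrite (map_Xp alE) Xa mulr0 add0r.
have X' : ('X^p - al%:P)^`() = 0.
  by rewrite derivB derivC subr0 derivXn -mulr_natr (polyp0 Cp0) mulr0.
rewrite E1 r0 addr0 derivM X' mulr0 addr0 rmorphM /= hornerM (map_Xp alE) Xa mulr0 //.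
Qed.
End PthRoot.

Lemma adj_map_poly (C B : comNzRingType) (i : {rmorphism C -> B}) (S : subring B) (b y : B) :
  (forall x, S x -> exists c, i c = x) -> adj S b y -> exists f : {poly C}, (map_poly i f).[b] = y.
Proof.
move=> Si [n [c [Sc ->]]]; have /choice[d dE] := fun j => Si _ (Sc j).
exists (\sum_(j < n) (d j)%:P * 'X^j); rewrite rmorph_sum horner_sum; apply: eq_bigr => j _.
by rewrite rmorphM /= map_polyC map_polyXn hornerM hornerC hornerXn -dE.
Qed.

Lemma adj_poly (B : idomainType) (S : subring B) (b y : B) : adj S b y ->
  exists f : {poly sr_dom S}, (map_poly (@sr_val B S : {rmorphism sr_dom S -> B}) f).[b] = y.
Proof. by apply: adj_map_poly => x /sr_lift. Qed.

(** If a is not a p-th power, take a subring E containing all p-th powers and maximal without a.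
    Then K = E[a], and differentiation in a over E does not kill a. *)
Lemma field_der_perfect (K : fieldType) p : prime p -> der_perfect p K.
Proof.
move=> pp p0 a da; apply: contrapT => na.
pose pw := [set x | exists y : K, x = y ^+ p].
have pw1 : pw 1 by exists 1; rewrite expr1n.
have pwB x y : pw x -> pw y -> pw (x - y).
  by move=> [u ->] [v ->]; exists (u - v); rewrite frobB.
have pwM x y : pw x -> pw y -> pw (x * y).
  by move=> [u ->] [v ->]; exists (u * v); rewrite exprMn.
have [//|F [A FA] _ FP [B FB]|E [E0E Ea maxE]] := @subring_max K (Subring pw1 pwB pwM) (fun A => ~ A a).
  exact: (FP B FB).2.
have adjp (S : subring K) : E `<=` S -> forall x : K, exists c : sr_dom S, sr_val c = x ^+ p.
  by move=> ES x; apply/sr_lift/ES/E0E; exists x.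
pose C := sr_dom E; pose i : {rmorphism C -> K} := @sr_val K E.
have inj_i : injective i := @sr_val_inj K E.
have ip : forall x : K, exists c, i c = x ^+ p by apply: adjp.
have nonE x : ~ E x -> ~ exists c, i c = x by move=> nEx [c cE]; apply: nEx; rewrite -cE; apply: sr_valP.
(* For x outside E[a], maximality gives a in E[x]. The powers of x below p are independent over
   E[a], so a equals the constant term of its expression and lies in E. *)
have span x : adj E a x.
  apply: contrapT => nx; pose S := adj E a.
  have Ex : ~ E x by move=> /(@adj_incl _ E a)/nx.
  have [f fE] : exists f : {poly C}, (map_poly i f).[x] = a.
    apply: adj_poly; apply: contrapT => H; apply: Ex; apply: (maxE (adj E x)) => //; last exact: adj_gen.
    exact: adj_incl.
  have [q [r [al [alE E1 sr]]]] := pth_reduce x pp ip f.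
  have rE : (map_poly i r).[x] = a.
    by rewrite -fE E1 rmorphD rmorphM /= hornerD hornerM (map_Xp pp p0 alE) horner_exp hornerXsubC subrr
      expr0n eqn0Ngt prime_gt0 //= mulr0 add0r.
  have EC : forall c : C, S (i c) by move=> c; apply/adj_incl/sr_valP.
  pose j : {rmorphism C -> sr_dom S} := sr_corestr EC.
  have [a' a'E] : exists a' : sr_dom S, sr_val a' = a by apply/sr_lift/adj_gen.
  pose k : {rmorphism sr_dom S -> K} := @sr_val K S.
  have g0 : map_poly j r - a'%:P = 0.
    apply: (@pth_indep p (sr_dom S) K k x pp p0 (@sr_val_inj K S)).
    - by apply: adjp => y; apply: adj_incl.
    - by move=> [c cE]; apply: nx; rewrite -cE; apply: sr_valP.
    - rewrite (leq_trans (size_polyD _ _)) // geq_max size_polyN (leq_trans (size_poly _ _)) //=.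
      by rewrite (leq_trans (size_polyC_leq1 _)) // prime_gt0.
    rewrite rmorphB /= map_polyC -map_poly_comp hornerD hornerN hornerC /=.
    have -> : map_poly (k \o j) r = map_poly i r by apply: eq_map_poly.
    by rewrite rE a'E subrr.
  apply: Ea; have := congr1 (fun P : {poly _} => k P`_0) g0.
  rewrite coefB coef_map coefC eqxx coef0 rmorphB rmorph0 /= => /eqP; rewrite subr_eq0 => /eqP Ea'.
  have -> : a = i r`_0 by rewrite -a'E; apply/esym.
  exact: sr_valP.
have /choice[F FE] : forall x, exists f : {poly C}, (map_poly i f).[a] = x.
  by move=> x; apply/adj_poly/span.
have wd (f : {poly C}) : (map_poly i f).[a] = 0 -> (map_poly i f^`()).[a] = 0.
  exact: (@pth_deriv p C K i a pp p0 inj_i ip (nonE _ Ea) f).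
pose d x := (map_poly i (F x)^`()).[a].
have dE x (f : {poly C}) : (map_poly i f).[a] = x -> d x = (map_poly i f^`()).[a].
  move=> fx; apply/eqP; rewrite -subr_eq0 -hornerN -hornerD -rmorphB -derivB; apply/eqP/wd.
  by rewrite rmorphB hornerD hornerN FE fx subrr.
have dd : derivation d.
  split=> x y.
    by rewrite (dE _ (F x + F y)) ?derivD ?rmorphD /= ?hornerD // !FE.
  rewrite (dE _ (F x * F y)) ?derivM ?rmorphD ?rmorphM /= ?hornerD ?hornerM ?FE // addrC; congr (_ + _); exact: mulrC.
have /eqP := da d dd; rewrite (dE _ 'X) ?map_polyX ?hornerX // derivX rmorph1 hornerC.
by rewrite oner_eq0.
Qed.

(** * Finite extensions and Cohen's structure theorems *)

Lemma elimination S (P : ideal S) (pP : is_prime P) n (a : 'I_n.+1 -> 'I_n -> S) :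
  exists c : 'I_n.+1 -> S, (exists k, ~ P (c k)) /\ forall i, P (\sum_k c k * a k i).
Proof.
elim: n a => [|n IH] a.
  by exists (fun=> 1); split=> [|[]//]; exists ord0; apply: pP.1.
(* Fraction-free Gaussian elimination modulo P: a pivot in the last column clears that column by
   cross-multiplication; without a pivot the column vanishes modulo P. *)
have [[r Hr]|no] := pselect (exists r, ~ P (a r ord_max)); last first.
  have Pa k : P (a k ord_max) by apply: contrapT => H; apply: no; exists k.
  have [c [[k ck] cP]] := IH (fun k i => a (lift ord_max k) (lift ord_max i)).
  exists (fun k => if unlift ord_max k is Some k' then c k' else 0); split.
    by exists (lift ord_max k); rewrite liftK.
  move=> i; have [i' ->|->] := unliftP ord_max i; last first.
    by apply: idealS => k' _; apply: idealM.
  rewrite (bigD1_ord ord_max) //= unlift_none mul0r add0r.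
  have := cP i'; under [X in _ -> P X]eq_bigr do rewrite liftK; exact.
have [c [[k ck] cP]] := IH (fun k i => a r ord_max * a (lift r k) (lift ord_max i) - a (lift r k) ord_max * a r (lift ord_max i)).
exists (fun k => if unlift r k is Some k' then a r ord_max * c k' else - \sum_k' c k' * a (lift r k') ord_max); split.
  by exists (lift r k); rewrite liftK => /pP.2[].
move=> i; rewrite (bigD1_ord r) //= unlift_none.
under [X in _ + X]eq_bigr do rewrite liftK.
have [i' ->|->] := unliftP ord_max i; last first.
  rewrite mulNr mulr_suml addrC -sumrB; apply: idealS => k' _.
  by have -> : forall u v w : S, u * v * w - v * w * u = 0 by [move=> u v w; ring].
have := cP i'; rewrite (_ : \sum_k0 _ = - (\sum_k' c k' * a (lift r k') ord_max) * a r (lift ord_max i') +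
  \sum_i0 a r ord_max * c i0 * a (lift r i0) (lift ord_max i')) //.
rewrite mulNr mulr_suml addrC -sumrB; apply: eq_bigr => k' _; ring.
Qed.

Section Span.
Variables (R D : comPzRingType) (phi : {rmorphism R -> D}).
Definition lspan (es : seq D) (y : D) := exists c : nat -> R, y = \sum_(i < size es) phi (c i) * es`_i.

Lemma lspan_cons e es y : lspan (e :: es) y <-> exists r z, lspan es z /\ y = phi r * e + z.
Proof.
split=> [[c ->]|[r [z [[c ->] ->]]]].
  by exists (c 0%N), (\sum_(i < size es) phi (c i.+1) * es`_i); split; [exists (c \o succn)|rewrite big_ord_recl].
by exists (fun i => if i is j.+1 then c j else r); rewrite [RHS]big_ord_recl.
Qed.
Lemma lspan0 es : lspan es 0.
Proof. by exists (fun=> 0); rewrite big1 // => i _; rewrite rmorph0 mul0r. Qed.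
Lemma lspanD es x y : lspan es x -> lspan es y -> lspan es (x + y).
Proof.
move=> [c ->] [d ->]; exists (fun i => c i + d i); rewrite -big_split.
by apply: eq_bigr => i _; rewrite rmorphD mulrDl.
Qed.
Lemma lspanZ es a x : lspan es x -> lspan es (phi a * x).
Proof.
move=> [c ->]; exists (fun i => a * c i); rewrite mulr_sumr.
by apply: eq_bigr => i _; rewrite rmorphM mulrA.
Qed.
Lemma lspanS es (T : Type) (r : seq T) (P : pred T) F : (forall i, P i -> lspan es (F i)) -> lspan es (\sum_(i <- r | P i) F i).
Proof. by move=> H; elim/big_rec: _ => [|i x /H]; [exact: lspan0|exact: lspanD]. Qed.
Lemma lspan_mem es e : e \in es -> lspan es e.
Proof.
elim: es => // e' es IH; rewrite inE => /predU1P[->|/IH H]; apply/lspan_cons.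
  by exists 1, 0; split; [exact: lspan0|rewrite rmorph1 mul1r addr0].
by exists 0, e; split=> //; rewrite rmorph0 mul0r add0r.
Qed.

(** Elimination among the powers of x gives a relation modulo P with coefficients in R not all in P.
    The lowest coefficient outside P is a multiple of x modulo P, hence in Q. *)
Lemma incomparable es (P Q : ideal D) x : (forall y, lspan es y) -> is_prime P -> P `<=` Q -> Q x -> ~ P x ->
  exists2 c, Q (phi c) & ~ P (phi c).
Proof.
move=> span pP PQ Qx Px.
have /choice[a aE] := fun k : nat => span (x ^+ k).
have [c [[k ck] cP]] := elimination (ipre_prime phi pP) (fun (k : 'I_(size es).+1) (i : 'I_(size es)) => a k i).
pose C k : R := if insub k is Some k' then c k' else 0.
have CE (j : 'I_(size es).+1) : C j = c j by rewrite /C insubT ?ltn_ord //= => h; congr c; apply/val_inj.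
have rel : P (\sum_(j < (size es).+1) phi (C j) * x ^+ j).
  rewrite (_ : \sum_(j < _) _ = \sum_(i < size es) phi (\sum_j c j * a j i) * es`_i).
    by apply: idealS => i _; apply/idealMl/cP.
  under [RHS]eq_bigr do rewrite rmorph_sum mulr_suml.
  rewrite exchange_big; apply: eq_bigr => j _; rewrite CE {1}aE mulr_sumr.
  by apply: eq_bigr => i _; rewrite rmorphM mulrA.
have [|m Cm mmin] := @min_nat (fun k => ~ P (phi (C k))); first by exists k; rewrite CE.
exists (C m) => //.
have mlt : (m < (size es).+1)%N by apply: leq_trans (ltn_ord k); rewrite ltnS; apply: mmin; rewrite CE.
have {rel} : P (x ^+ m * (phi (C m) + x * \sum_(m.+1 <= j < (size es).+1) phi (C j) * x ^+ (j - m.+1))).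
  move: rel; rewrite -(big_mkord xpredT (fun j => phi (C j) * x ^+ j)) (big_cat_nat (leq0n m) (ltnW mlt)) /= (big_ltn mlt).
  have H : P (\sum_(0 <= i < m) phi (C i) * x ^+ i).
    rewrite big_seq_cond; apply: idealS => i; rewrite andbT mem_index_iota => /andP[_ im].
    apply: idealMl; apply: contrapT => /mmin; by rewrite leqNgt im.
  move=> /idealB/(_ H); rewrite addrAC subrr add0r mulrDr [x ^+ m * phi _]mulrC.
  congr (P (_ + _)); rewrite mulrA -exprSr mulr_sumr; apply: eq_big_nat => j /andP[mj _].
  by rewrite mulrCA -exprD subnKC.
case/pP.2 => [/(prime_exp pP)//|/PQ H].
by have := idealB H (idealMl (\sum_(m.+1 <= j < (size es).+1) phi (C j) * x ^+ (j - m.+1)) Qx); rewrite addrK.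
Qed.

Lemma ht_ge_contract es (I P : ideal D) d : (forall y, lspan es y) -> ht_ge I P d -> ht_ge (ipre phi I) (ipre phi P) d.
Proof.
move=> span; elim: d P => [|d IH] P H; have pP := ht_ge_prime H.
  by apply: ht_ge0; [exact: ipre_prime|move=> x; exact: (ht_ge_I H)].
have [Q hQ QP] := ht_ge_pred H; have [x Px Qx] := proper_sub QP.
have [c Pc Qc] := incomparable span (ht_ge_prime hQ) QP.1 Px Qx.
apply: ht_geS (IH _ hQ) _; first exact: ipre_prime.
by apply: (properI (x := c)) => // z; apply: QP.1.
Qed.
End Span.

Lemma exact_height R (noeth : noetherian R) (P : ideal R) : is_prime P ->
  exists d, ht_ge (izero R) P d /\ ~ ht_ge (izero R) P d.+1.
Proof.
move=> pP; have [s sE] := noeth_fg noeth P.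
have mP : min_over P (isum (izero R) (igen s)).
  split=> // [|Q pQ sQ QP x /sE sx]; last by apply/sQ/isumR.
  by apply: isum0_sub => x /igen_mem/sE.
have bd d : ht_ge (izero R) P d -> (d <= size s)%N by exact: height_le.
have [|d hd dmax] := max_nat _ bd; first by exists 0%N; apply: ht_ge0.
by exists d; split=> // /dmax; rewrite ltnn.
Qed.

(** The integer m is the intended uniformiser of a coefficient ring: 0 in equal characteristic, p in
    mixed characteristic. In residue characteristic 0 the prime p is arbitrary. *)
Record cohen_type (p m : nat) D (M : ideal D) : Prop := CohenType {
  ct_prime : prime p;
  ct_max : M m%:R;
  ct_char : [\/ p%:R = 0 :> D /\ m = 0%N, p = m | (forall n, ~ M n.+1%:R) /\ m = 0%N]
}.

Lemma cohen_type_exists D (M : ideal D) : is_prime M -> exists p m, cohen_type p m M.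
Proof.
move=> pM; have [[n Mn]|no] := pselect (exists n, M n.+1%:R); last first.
  exists 2, 0%N; split=> //.
  by apply: Or33; split=> // n Mn; apply: no; exists n.
have [|q [q0 Mq] qmin] := @min_nat (fun n => (0 < n)%N /\ M n%:R); first by exists n.+1.
have q1 : (1 < q)%N by case: q q0 Mq {qmin} => [|[|q]] // _ /pM.1.
have qp : prime q.
  have /dvdnP[k kE] := pdiv_dvd q; have pq := pdiv_prime q1.
  have k0 : (0 < k)%N by move: q0; rewrite kE muln_gt0 => /andP[].
  have : M (k%:R * (pdiv q)%:R) by rewrite -natrM -kE.
  case/pM.2 => H.
    have := qmin k (conj k0 H); rewrite leqNgt {1}kE.
    by rewrite -[X in (X < _)%N]muln1 ltn_pmul2l // prime_gt1.
  have H' := qmin _ (conj (pdiv_gt0 q) H).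
  by rewrite (_ : q = pdiv q) //; apply/eqP; rewrite eqn_leq H' pdiv_leq.
have [Dq|Dq] := pselect (q%:R = 0 :> D).
  by exists q, 0%N; split=> //; apply: Or31.
by exists q, q; split=> //; apply: Or32.
Qed.

Lemma coef_ring_dom p D S (M : ideal D) (psi : {rmorphism S -> D}) d :
  coef_ring p M psi d -> is_prime (izero S).
Proof.
move=> cS; have pS := cr_prime cS; have := regat_sat_prime (cr_noeth cS) pS (cr_reg cS).
congr is_prime; apply/ideal_eq/ideal_ext => z; split; last by move=> ->.
by move=> [t Nt tz]; apply: (psatM (cr_unit cS) Nt tz).
Qed.

Section CoefType.
Variables (D : idomainType) (M : ideal D) (p m : nat).
Hypothesis cM : clocal M.
Hypothesis ctM : cohen_type p m M.
Notation pi := (m%:R : D).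
Let pM := cl_prime cM.
Let noeth := cl_noeth cM.

(** The coefficient ring is a field or a discrete valuation ring with uniformiser pi, according to
    whether pi vanishes; the Boolean in the statement is its dimension. *)
Lemma coef_ring_exists : exists V : subring D, [/\ forall x, exists2 v, V v & M (x - v),
  forall x, (forall n, exists2 v, V v & ipow M n (x - v)) -> V x, V pi &
  coef_ring p M (@sr_val D V : {rmorphism sr_ring V -> D}) (m%:R != 0 :> D)].
Proof.
have [pp Mpi ct] := ctM.
have [|V [VM Vpi Vinv Vp Vcl]] := coefficient_ring cM (idom_prime0 D) Mpi (p := p).
  by case: ct => [[? ?]|?|[? ?]]; [left; split=> //; left|left; split=> //; right|right].
exists V; split=> //.
pose phi : {rmorphism sr_ring V -> D} := @sr_val D V.
pose N := ipre phi M.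
have pN : is_prime N by apply: ipre_prime.
have uN x : ~ N x -> is_unit x.
  move=> Nx; have [w xw] := cl_unit cM (Nx : ~ M (phi x)).
  have Vw : V w.
    by apply: (Vinv (phi x)) => //; [exact: sr_valP|rewrite xw; apply: sr1].
  have [w' w'E] := sr_lift Vw.
  by exists w'; apply: sr_val_inj; rewrite rmorphM rmorph1 /= w'E; exact: xw.
have [pi' pi'E] := sr_lift Vp.
have NpiE x : N x -> exists y, x = pi' * y.
  move=> Nx; have [u Vu E] := Vpi _ (sr_valP x) Nx; have [y yE] := sr_lift Vu.
  by exists y; apply: sr_val_inj; rewrite rmorphM /= pi'E yE.
have Npi : N pi' by rewrite /= /mkset /phi /= pi'E.
have fact x : x <> 0 -> exists k u, ~ N u /\ x = pi' ^+ k * u.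
  move=> x0; apply: contrapT => no; apply/x0/sr_val_inj; rewrite rmorph0; apply: (cl_sep cM) => n.
  suff [y ->] : exists y, x = pi' ^+ n * y.
    by rewrite rmorphM rmorphXn /=; apply/idealMl/ipowX.
  elim: n => [|n [y E]]; first by exists x; rewrite expr0 mul1r.
  have [Ny|Ny] := pselect (N y); last by case: no; exists n, y.
  by have [z zE] := NpiE y Ny; exists z; rewrite exprSr -mulrA -zE.
have noV : noetherian (sr_ring V).
  move=> I; have [[x Ix x0]|no] := pselect (exists2 x, I x & x <> 0); last first.
      exists [::]; apply: ideal_ext => x; split.
        by move=> Ix; have [->|x0] := pselect (x = 0); [|case: no; exists x].
      by move/igen_nil ->.
    have Ik y : I y -> y <> 0 -> exists2 k, I (pi' ^+ k) & exists z, y = pi' ^+ k * z.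
      move=> Iy /fact[k [u [Nu E]]]; exists k; last by exists u.
      have [w uw] := uN _ Nu; have -> : pi' ^+ k = y * w by rewrite E -mulrA uw mulr1.
      exact: idealMl.
    have [|k Hk kmin] := @min_nat (fun k => I (pi' ^+ k)); first by have [k Hk _] := Ik x Ix x0; exists k.
    exists [:: pi' ^+ k]; apply: ideal_ext => y; split; last first.
      exact: igen1_sub.
    move=> Iy; have [->|y0] := pselect (y = 0); first exact: ideal0.
    have [j Hj [z ->]] := Ik y Iy y0.
    by apply: idealMl; rewrite -(subnK (kmin j Hj)) exprD; apply/idealM/igen_mem; rewrite mem_head.
split=> //.
- have [pi0|pi0] := eqVneq (m%:R : D) 0.
    apply: (regat0 pN) => // x /NpiE[y ->].
    have -> : pi' = 0 by apply: sr_val_inj; rewrite pi'E pi0 rmorph0.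
    by rewrite mul0r.
  apply: (@regat_nzd _ noV _ _ _ pi') => //.
    move=> y E; apply/sr_val_inj/eqP.
    have /eqP := congr1 (@sr_val D V) E; rewrite rmorphM rmorph0 /= pi'E mulf_eq0 (negbTE pi0) /=; exact.
  apply: (regat0 pN); first by apply: iadd1_sub.
  by move=> x /NpiE[y ->]; apply/idealMl/iadd1R.
(* If p = 0 then pi = 0, and V is a field. *)
- move=> pV x.
  have pD : p%:R = 0 :> D by have := congr1 (@sr_val D V) pV; rewrite rmorph_nat rmorph0.
  have pi0 : pi' = 0.
    apply: sr_val_inj; rewrite pi'E rmorph0; case: ct => [[_ ->]|<-|[_ ->]] //.
  have fld (y : srT V) : y != 0 -> y \is a GRing.unit.
    move=> y0; rewrite unfold_in; apply/asboolP/uN => /NpiE[z E].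
    by move/eqP: y0; apply; rewrite E pi0 mul0r.
  pose K : fieldType := HB.pack (srT V) (GRing.UnitRing_isField.Build (srT V) fld).
  exact: (@field_der_perfect K p pp pV x).
Qed.
End CoefType.

Lemma span_pow R D (phi : {rmorphism R -> D}) (M : ideal D) xs n :
  (forall x, exists r, M (x - phi r)) -> (forall x, M x <-> igen xs x) ->
  exists es, forall y, exists2 z, lspan phi es z & ipow M n (y - z).
Proof.
move=> phiM xsE; elim: n => [|n [es IH]].
  by exists [::] => y; exists 0; [exact: lspan0|exact: ipow0].
pose es' := 1 :: [seq x * e | x <- xs, e <- es]; exists es' => y.
have [r /xsE/igenP[c cE]] := phiM y.
have /choice[z zP] : forall i, exists z, lspan phi es z /\ ipow M n (c i - z).
  by move=> i; have [z z1 z2] := IH (c i); exists z.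
exists (phi r * 1 + \sum_(i < size xs) xs`_i * z i).
  apply: lspanD; first by apply/lspanZ/lspan_mem; rewrite mem_head.
  apply: lspanS => i _; have [[d ->] _] := zP i; rewrite mulr_sumr; apply: lspanS => j _.
  rewrite mulrCA; apply/lspanZ/lspan_mem; rewrite inE; apply/orP; right.
  by apply/allpairsP; exists (xs`_i, es`_j); rewrite /= !mem_nth.
rewrite mulr1 opprD addrA cE -sumrB; apply: idealS => i _.
have -> : c i * xs`_i - xs`_i * z i = xs`_i * (c i - z i) by ring.
by apply: ipowS; [apply/xsE/igen_mem/mem_nth|have [] := zP i].
Qed.

Lemma min_over_pow D (M : ideal D) (I : ideal D) : clocal M -> min_over M I ->
  exists n, ipow M n `<=` I.
Proof.
move=> cM mM; apply: (ipow_fg_nil (cl_noeth cM)) => x Mx.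
have [t [n [Mt It]]] := min_over_nil (cl_noeth cM) mM Mx.
by exists n; have [u tu] := cl_unit cM Mt; rewrite -[x ^+ n]mul1r -tu mulrAC; apply: idealMl.
Qed.

Section Structure.
Variables (D : idomainType) (M : ideal D).
Hypothesis cM : clocal M.
Let pM := cl_prime cM.
Let noeth := cl_noeth cM.

(** Power series in generators of M over a coefficient ring reach all of D, by [coef_ring_evs] with
    the single module generator 1. *)
Theorem cohen_quotient : exists (p d : nat) S (psi : {rmorphism S -> D}),
  coef_ring p M psi d /\ forall y, exists x, psi x = y.
Proof.
have [p [m ct]] := cohen_type_exists pM.
have [V [VM _ _ cV]] := coef_ring_exists cM ct.
have [xs xsE] := noeth_fg noeth M.
have [|S [psi [cS H]]] := coef_ring_evs cM (ct_prime ct) _ cV (xs := xs).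
  by move=> x /igen_mem/xsE.
exists p, (addn (m%:R != 0 :> D) (size xs)), S, psi; split=> // y.
have [|c cE] := H [:: 1] (izero D) _ y.
  move=> z; have [v Vv /xsE Mv] := VM z; have [v' v'E] := sr_lift Vv; exists (fun=> v').
  have -> : \sum_(i < size [:: (1 : D)]) (@sr_val D V) v' * [:: 1]`_i = v by rewrite big_ord1 /= mulr1 v'E.
  exact: isumR.
by exists (c 0%N); move/eqP: cE; rewrite big_ord1 mulr1 subr_eq0 => /eqP.
Qed.

(** With a system of parameters in place of generators of M, D becomes a finite module. *)
Theorem cohen_finite p m : cohen_type p m M -> exists (d : nat) S (psi : {rmorphism S -> D}) (es : seq D),
  [/\ coef_ring p M psi d, injective psi & forall y, lspan psi es y].
Proof.
move=> ct; have [V [VM Vcl Vp cV]] := coef_ring_exists cM ct.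
pose phi : {rmorphism sr_ring V -> D} := @sr_val D V.
have [xs xsE] := noeth_fg noeth M.
have phiM x : exists r, M (x - phi r).
  by have [v Vv Mv] := VM x; have [v' v'E] := sr_lift Vv; exists v'; rewrite /phi /= v'E.
have [d [hd hd']] := exact_height noeth pM.
have Mpi := ct_max ct.
pose e : nat := (m%:R != 0 :> D).
have [s [sM sd [es esP]]] : exists s, [/\ forall x, x \in s -> M x, (e + size s <= d)%N &
    exists es, forall y, exists c : nat -> sr_ring V, isum (izero D) (igen s) (y - \sum_(i < size es) phi (c i) * es`_i)].
  (* A nonzero pi counts as the first parameter, and the others are chosen modulo pi. *)
  have [pi0|pi0] := eqVneq (m%:R : D) 0.
    have [s [sd sM mM]] := height_params noeth pM (@izero_sub _ M) hd'.
    exists s; split=> //; first by rewrite /e pi0 eqxx.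
    have [n nI] := min_over_pow cM mM; have [es esP] := span_pow n phiM xsE.
    by exists es => y; have [z [c ->] /nI yz] := esP y; exists c.
  have d0 : (0 < d)%N.
    have H1 : ht_ge (izero D) M 1.
      apply: (@ht_geS _ _ (izero D)) => //; first by apply: ht_ge0 => //; apply: idom_prime0.
      by apply: (properI (x := m%:R)) => // /eqP; rewrite (negbTE pi0).
    by rewrite lt0n; apply/eqP => d0; apply: hd'; rewrite d0.
  have zM' : iadd1 (izero D) m%:R `<=` M by apply: iadd1_sub.
  have hd2 : ~ ht_ge (iadd1 (izero D) m%:R) M d.-1.+1.
    rewrite prednK // => H; apply: hd'; apply: (ht_ge_nzd noeth) H => y /eqP.
    by rewrite mulf_eq0 (negbTE pi0) => /eqP.
  have [s [sd sM mM]] := height_params noeth pM zM' hd2.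
  exists s; split=> //; first by rewrite /e pi0 add1n -(prednK d0) ltnS.
  have [n nI] := min_over_pow cM mM; have [es esP] := span_pow n phiM xsE.
  exists es.
  have H y : exists c : nat -> sr_ring V, iadd1 (igen s) m%:R (y - \sum_(i < size es) phi (c i) * es`_i).
    have [z [c ->] /nI yz] := esP y; exists c; apply: isum_sub yz => w.
      by apply: isum_sub => [x ->|x]; [|apply: isumR].
    exact: iadd1L.
  move=> y; have [c cP] := ps_evm_span cM Mpi H y.
  (* V is closed, so power series in pi over V take their values in V; hence generation modulo (s,
     pi) becomes generation modulo s over V itself. *)
  have evV f : V (ps_evm cM phi Mpi f).
    apply: Vcl => k; exists (psum phi m%:R k f); last exact: (ps_evP cM phi Mpi f k).
    by apply: srS => i _; apply: srM; [apply: sr_valP|apply: srX].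
  have /choice[c' c'E] := fun i => sr_lift (evV (c i)).
  exists c'; apply: isumR; rewrite (_ : \sum_(i < size es) phi (c' i) * es`_i = \sum_(i < size es) ps_evm cM phi Mpi (c i) * es`_i) //.
  by apply: eq_bigr => i _; rewrite /phi /= c'E.
have [S [psi [cS H]]] := coef_ring_evs cM (ct_prime ct) sM cV.
have span y : lspan psi es y.
  have [c cE] := H es (izero D) esP y; exists c.
  by move/eqP: cE; rewrite subr_eq0 => /eqP.
(* Injectivity is a dimension count: chains of D contract strictly to S, and a nonzero kernel would
   add a step beyond the dimension of S. *)
exists (e + size s)%N, S, psi, es; split=> // x y E.
apply: contrapT => xy.
have pS := cr_prime cS; pose q := ipre psi (izero D).
have qx : q (x - y) by rewrite /= /mkset rmorphB E subrr.
have p0 := coef_ring_dom cS.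
have h1 : ht_ge (izero S) q 1.
  apply: (@ht_geS _ _ (izero S)); first by apply: ipre_prime; apply: idom_prime0.
    by apply: ht_ge0.
  apply: (properI (x := x - y)) => //.
  by move/eqP; rewrite subr_eq0 => /eqP.
have := regat_ht (cr_noeth cS) (cr_reg cS) (ht_ge_cat h1 (ht_ge_contract span hd)).
by rewrite add1n ltnNge sd.
Qed.

End Structure.

(** * Condition J-0: a nonempty open set of regular points *)

Definition J0 (C : comPzRingType) := exists2 f : C, f <> 0 &
  forall P : ideal C, is_prime P -> ~ P f -> exists d, regat (izero C) P d.

Lemma regat_localeq R (I J Q : ideal R) d : I `<=` J ->
  (forall x, J x -> exists2 t, ~ Q t & I (t * x)) -> regat I Q d -> regat J Q d.
Proof.
move=> IJ JI [pQ [s [ss sQ sg hd]]]; split=> //; exists s; split=> //.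
  by move=> x /sg[t Qt H]; exists t => //; apply: isum_mono H.
have H : forall d (P : ideal R), P `<=` Q -> ht_ge I P d -> ht_ge J P d.
  elim=> [|k IH] P PQ h; have pP := ht_ge_prime h.
    apply: ht_ge0 => // x /JI[t Qt Itx].
    by case: (pP.2 _ _ (ht_ge_I h Itx)) => // /PQ.
  by have [P' hP' P'P] := ht_ge_pred h; have P'P1 := P'P.1; apply: ht_geS (IH _ _ hP') P'P => // x /P'P1/PQ.
exact: H hd.
Qed.

Section PolyRing.
Variable C : idomainType.
Hypothesis noeth : noetherian C.

Lemma noeth_poly : noetherian {poly C}.
Proof.
apply: (hilbert_basis (g := @polyC C) (b := 'X) noeth) => f; exists (size f), (fun i => f`_i).
by rewrite -{1}[f]coefK poly_def; apply: eq_bigr => i _; rewrite mul_polyC.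
Qed.

Section Ext.
Variables (P : ideal C) (pP : is_prime P).
Definition pext : ideal {poly C}.
Proof.
exists [set f : {poly C} | forall i, P f`_i].
- by move=> i; rewrite coef0.
- by move=> f g Pf Pg i; rewrite coefD; apply: idealD.
- by move=> f g Pg i; rewrite coefM; apply: idealS => j _; apply: idealM.
Defined.

Lemma pext_lead (Q : ideal {poly C}) (f : {poly C}) : (forall c, P c -> Q c%:P) -> Q f -> ~ pext f ->
  exists g : {poly C}, [/\ Q g, pext (f - g), ~ P (lead_coef g) & (size g <= size f)%N].
Proof.
move=> PQ; have [n] := ubnP (size f); elim: n f => // n IH f sf Qf nf.
have [Pl|Pl] := pselect (P (lead_coef f)); last first.
  by exists f; split=> //; rewrite subrr.
have f0 : f != 0 by apply/eqP => f0; apply: nf; rewrite f0.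
pose k := lead_coef f *: 'X^((size f).-1).
have Pk : pext k by move=> i; rewrite coefZ; apply: idealMl.
have Qk : Q k by rewrite /k -mul_polyC mulrC; apply/idealM/PQ.
have sk : (size (f - k)%R < size f)%N.
  rewrite (leq_ltn_trans (n := (size f).-1)) //; last by rewrite prednK // size_poly_gt0.
  apply/leq_sizeP => j; rewrite leq_eqVlt => /orP[/eqP <-|js].
    by rewrite coefB coefZ coefXn eqxx mulr1 lead_coefE subrr.
  rewrite coefB coefZ coefXn gtn_eqF // mulr0 subr0 nth_default //.
  by rewrite -ltnS prednK ?size_poly_gt0 // in js.
have [||g [Qg fg lg sg]] := IH (f - k) _ (idealB Qf Qk).
- by apply: leq_trans sk _; rewrite -ltnS.
- by move=> H; apply: nf; rewrite -[f](subrK k); apply: idealD.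
exists g; split=> //; last by apply: leq_trans sg _; apply: ltnW.
by have -> : f - g = (f - k - g) + k by [ring]; apply: idealD.
Qed.

Lemma pext_prime : is_prime pext.
Proof.
split=> [|f g fg]; first by move=> /(_ 0%N); rewrite coef1 eqxx => /pP.1.
apply: contrapT => /not_orP[nf ng].
have PT c : P c -> idealT {poly C} c%:P by [].
have [f' [_ ff lf _]] := pext_lead PT (I : idealT {poly C} f) nf.
have [g' [_ gg lg _]] := pext_lead PT (I : idealT {poly C} g) ng.
have H : pext (f' * g').
  have -> : f' * g' = f * g - f * (g - g') - g' * (f - f') by ring.
  by apply: idealB; [apply: idealB => //; apply: idealM|apply: idealM].
by have := H (size (f' * g')).-1; rewrite -lead_coefE lead_coefM => /pP.2[].
Qed.
End Ext.

Lemma ht_ge_pext (P : ideal C) d : ht_ge (izero C) P d -> ht_ge (izero {poly C}) (pext P) d.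
Proof.
elim: d P => [|d IH] P h; have pP := ht_ge_prime h.
  by apply: ht_ge0; [apply: pext_prime|move=> f ->].
have [Q hQ [QP PQ]] := ht_ge_pred h; apply: ht_geS (IH _ hQ) _; first exact: pext_prime.
split=> [f Qf i|H]; first exact: QP.
by apply: PQ => c Pc; have := H c%:P _ 0%N; rewrite coefC eqxx; apply=> i; rewrite coefC; case: eqP => // _.
Qed.

(** Either Q is extended from P and the parameters of P suffice, or an element of Q of least degree
    outside the extension gives one more parameter, by pseudo-division. *)
Lemma regat_poly (Q : ideal {poly C}) d : is_prime Q -> regat (izero C) (ipre (@polyC C) Q) d ->
  exists e, regat (izero {poly C}) Q e.
Proof.
move=> pQ; set P := ipre _ Q => -[pP [s [ss sP sg hd]]].
have PQ c : P c -> Q c%:P by [].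
have extQ f : pext P f -> Q f.
  by move=> Pf; rewrite -[f]coefK poly_def; apply: idealS => i _; rewrite -mul_polyC; apply/idealMl/PQ/Pf.
have igs f : pext P f -> exists2 t, ~ P t & igen (map (@polyC C) s) (t%:P * f).
  move=> Pf; have /choice[t tP] : forall i, exists t, ~ P t /\ igen s (t * f`_i).
    move=> i; have [t Pt [z [y [-> sy E]]]] := sg _ (Pf i).
    by exists t; split=> //; rewrite E add0r.
  exists (\prod_(i < size f) t i); first by apply: prod_outside => // i _; have [] := tP i.
  have -> : (\prod_(i < size f) t i)%:P * f = \sum_(i < size f) (\prod_(i < size f) t i)%:P * (f`_i *: 'X^i).
    by rewrite -mulr_sumr -poly_def coefK.
  apply: idealS => i _.
  rewrite -mul_polyC mulrA -polyCM; apply: idealMl.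
  have H0 : igen s ((\prod_(i < size f) t i) * f`_i).
    by rewrite (bigD1 i) // mulrAC; apply: idealMl; exact: (tP i).2.
  exact: (@rmorph_igen _ _ (@polyC C : {rmorphism C -> {poly C}}) _ _ H0).
have zs (x : {poly C}) u : igen u x -> isum (izero {poly C}) (igen u) x by apply: isumR.
have sPm x : x \in map (@polyC C) s -> Q x by move=> /mapP[c /sP Pc ->].
have hx := ht_ge_pext hd.
have [Qext|nQ] := pselect (forall f, Q f -> pext P f).
  exists d; split=> //; exists (map (@polyC C) s); split; rewrite ?size_map //.
    by move=> x /Qext/igs[t Pt H]; exists t%:P => //; apply: zs.
  exact: ht_ge_sub pQ hx extQ.
have [|h0 [Qh0 nh0] nmin] := @min_size _ (fun f => Q f /\ ~ pext P f).
  by move/existsNP: nQ => [f /not_implyP[Qf nf]]; exists f.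
have [h [Qh h0h lh sh]] := pext_lead PQ Qh0 nh0.
have nh : ~ pext P h by move=> H; apply: nh0; rewrite -[h0](subrK h); apply: idealD.
have hn0 : h != 0 by apply/eqP => H; apply: nh; rewrite H.
exists d.+1; split=> //; exists (h :: map (@polyC C) s); split.
- by rewrite /= size_map ss.
- by move=> x; rewrite inE => /predU1P[->|/sPm].
- move=> x Qx; have [k E] : exists k, lead_coef h ^+ k *: x = x %/ h * h + x %% h.
    by eexists; exact: Pdiv.Idomain.divp_eq.
  have Qr : Q (x %% h).
    have -> : x %% h = lead_coef h ^+ k *: x - x %/ h * h by rewrite E addrAC subrr add0r.
    by apply: idealB; [rewrite -mul_polyC|]; apply: idealM.
  have er : pext P (x %% h).
    apply: contrapT => nr; have := nmin _ (conj Qr nr).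
    by rewrite leqNgt (leq_trans _ sh) // ltn_modp.
  have [t Pt tr] := igs _ er.
  exists (t%:P * (lead_coef h ^+ k)%:P).
    rewrite -polyCM => /(pP.2 t (lead_coef h ^+ k)) [//|/(prime_exp pP)//].
  rewrite -mulrA (mul_polyC (lead_coef h ^+ k) x) E; apply: zs; rewrite mulrDr; apply: idealD.
    by rewrite mulrA; apply/idealM/igen_mem; rewrite mem_head.
  by apply: igen_sub tr => z zs'; apply: igen_mem; rewrite inE zs' orbT.
- by apply: (ht_geS pQ hx); apply: (properI (x := h)).
Qed.
End PolyRing.

(** Elements of C killed by all its derivations are p-th powers in the fraction field. The
    fractional form, unlike [der_perfect], is stable under adjoining algebraic elements. *)
Definition nfrac p (C : idomainType) := forall x : C, (forall d, derivation d -> d x = 0) ->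
  exists u v : C, v != 0 /\ v ^+ p * x = u ^+ p.

Definition coef_der (C : idomainType) (d : C -> C) (f : {poly C}) : {poly C} := \poly_(i < size f) d f`_i.

Section CoefDer.
Variables (C : idomainType) (d : C -> C).
Hypothesis dd : derivation d.
Lemma coef_coef_der f i : (coef_der d f)`_i = d f`_i.
Proof. by rewrite coef_poly; case: ltnP => // fi; rewrite nth_default // der0. Qed.
Lemma coef_der_derivation : derivation (coef_der d).
Proof.
split=> f g; apply/polyP => i; first by rewrite !(coefD, coef_coef_der) dd.1.
rewrite coefD coef_coef_der // (coefM f g) der_sum // (coefM f) coefMr -big_split.
by apply: eq_bigr => j _; rewrite dd.2 !coef_coef_der.
Qed.
Lemma coef_derC c : coef_der d c%:P = (d c)%:P.
Proof. by apply/polyP => i; rewrite coef_coef_der !coefC; case: eqP => // _; rewrite der0. Qed.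
End CoefDer.

Lemma deriv_derivation (C : idomainType) : derivation (@deriv C : {poly C} -> {poly C}).
Proof. by split=> f g; rewrite ?derivD // derivM addrC; congr (_ + _); rewrite mulrC. Qed.

(** * Constants of derivations of polynomial rings *)

Section FrobPoly.
Variables (p : nat) (C : idomainType).
Hypotheses (pp : prime p) (p0 : p%:R = 0 :> C).

Lemma natp_unit (m : nat) : (0 < m < p)%N -> m%:R != 0 :> C.
Proof.
move=> mp; have [c cE] := natp_neq0 pp p0 mp; apply/eqP => m0.
by move/eqP: cE; rewrite m0 mulr0 eq_sym oner_eq0.
Qed.

Lemma natr_frob (m : nat) : m%:R ^+ p = m%:R :> C.
Proof.
elim: m => [|m IH]; first by rewrite expr0n eqn0Ngt prime_gt0.
by rewrite -addn1 natrD frobD // IH expr1n.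
Qed.

Lemma derp R (d : R -> R) x : derivation d -> p%:R = 0 :> R -> d (x ^+ p) = 0.
Proof. by move=> dd h; rewrite derX // h !mul0r. Qed.

Lemma deriv0_coef (f : {poly C}) i : f^`() = 0 -> ~~ (p %| i)%N -> f`_i = 0.
Proof.
move=> f0 pi; case: i pi => [|i] pi; first by rewrite dvdn0 in pi.
have := congr1 (fun g : {poly C} => g`_i) f0; rewrite coef_deriv coef0 -mulr_natr => /eqP.
rewrite mulf_eq0 => /orP[/eqP //|/eqP i0].
have cop : coprime i.+1 p by rewrite coprime_sym prime_coprime.
have [/= km kn kmE _] := egcdnP p (ltn0Sn i).
have := congr1 (fun n : nat => n%:R : C) kmE.
by rewrite (eqP cop) natrD !natrM i0 p0 !mulr0 add0r => /eqP; rewrite eq_sym oner_eq0.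
Qed.

Lemma poly_pth n (h : nat -> C) : (forall i, (i < n)%N -> exists u v : C, v != 0 /\ v ^+ p * h i = u ^+ p) ->
  exists2 V : C, V != 0 & exists w : nat -> C, forall i, (i < n)%N -> V ^+ p * h i = w i ^+ p.
Proof.
elim: n => [|n IH] H; first by exists 1; [exact: oner_neq0|exists (fun=> 0)].
have [|V V0 [w wE]] := IH; first by move=> i ilt; apply/H/ltnW.
have [u [v [v0 vE]]] := H n (ltnSn n).
exists (V * v); first by rewrite mulf_neq0.
exists (fun i => if (i < n)%N then v * w i else V * u) => i; rewrite ltnS leq_eqVlt => /orP[/eqP ->|ilt].
  by rewrite ltnn !exprMn -mulrA vE.
by rewrite ilt !exprMn -wE // mulrA [v ^+ p * _]mulrC.
Qed.

Lemma frob_sum R (T : Type) (r : seq T) (F : T -> R) : p%:R = 0 :> R ->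
  (\sum_(i <- r) F i) ^+ p = \sum_(i <- r) F i ^+ p.
Proof.
move=> h; elim: r => [|x r IH]; first by rewrite !big_nil expr0n eqn0Ngt prime_gt0.
by rewrite !big_cons frobD // IH.
Qed.

Lemma assemble (h : {poly C}) : (forall i, ~~ (p %| i)%N -> h`_i = 0) ->
  (forall i, exists u v : C, v != 0 /\ v ^+ p * h`_i = u ^+ p) ->
  exists2 V : C, V != 0 & exists G : {poly C}, V ^+ p *: h = G ^+ p.
Proof.
move=> h0 hp; have [V V0 [w wE]] := @poly_pth (size h) (fun i => h`_i) (fun i _ => hp i).
exists V => //; exists (\sum_(i < size h | (p %| i)%N) w i *: 'X^(i %/ p)).
rewrite big_mkcond frob_sum; last exact: polyp0.
rewrite -{1}[h]coefK poly_def scaler_sumr; apply: eq_bigr => i _.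
case: ifP => [pi|/negbT/h0 ->]; last by rewrite scale0r scaler0 expr0n eqn0Ngt prime_gt0.
by rewrite exprZn -exprM divnK // scalerA wE.
Qed.

Lemma nfrac_poly : nfrac p C -> nfrac p {poly C}.
Proof.
move=> nC f df.
have [||V V0 [G GE]] := assemble (h := f).
- by move=> i; apply/deriv0_coef/df/deriv_derivation.
- move=> i; apply: nC => d dd; rewrite -coef_coef_der // df ?coef0 //; exact: coef_der_derivation.
exists G, V%:P; split; first by rewrite polyC_eq0.
by rewrite -GE -mul_polyC polyC_exp.
Qed.
End FrobPoly.

(** * Adjoining one algebraic element to a domain *)

Section Step.
Variables (C B : idomainType) (i : {rmorphism C -> B}) (b : B).
Hypothesis inj_i : injective i.
Hypothesis gen : forall x, exists f : {poly C}, (map_poly i f).[b] = x.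

Definition ev : {rmorphism {poly C} -> B} := horner_eval b \o map_poly i.
Lemma evE f : ev f = (map_poly i f).[b]. Proof. by []. Qed.
Lemma evC c : ev c%:P = i c. Proof. by rewrite evE map_polyC hornerC. Qed.
Lemma evX : ev 'X = b. Proof. by rewrite evE map_polyX hornerX. Qed.
Lemma ev_surj x : exists f, ev f = x. Proof. exact: gen. Qed.
Lemma evZ c f : ev (c *: f) = i c * ev f. Proof. by rewrite -mul_polyC rmorphM evC. Qed.
Lemma i_neq0 c : c != 0 -> i c != 0.
Proof. by apply: contra => /eqP H; apply/eqP/inj_i; rewrite H rmorph0. Qed.

Definition minrel (h : {poly C}) := [/\ h != 0, ev h = 0 & forall g, ev g = 0 -> (size g < size h)%N -> g = 0].

Lemma minrel_exists g : g != 0 -> ev g = 0 -> exists h, minrel h.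
Proof.
move=> g0 eg; have [|h [h0 eh] nmin] := @min_size _ (fun f => f != 0 /\ ev f = 0); first by exists g.
exists h; split=> // f ef fh; apply/eqP/contraT => f0.
by have := nmin f (conj f0 ef); rewrite leqNgt fh.
Qed.

Section Minrel.
Variable h : {poly C}.
Hypothesis hP : minrel h.
Let h0 : h != 0. Proof. by case: hP. Qed.
Let eh : ev h = 0. Proof. by case: hP. Qed.
Let hmin g : ev g = 0 -> (size g < size h)%N -> g = 0. Proof. by case: hP => _ _; apply. Qed.
Let lh0 : lead_coef h != 0. Proof. by rewrite lead_coef_eq0. Qed.

Lemma ev_div g : exists k q r, [/\ lead_coef h ^+ k *: g = q * h + r, (size r < size h)%N & i (lead_coef h ^+ k) * ev g = ev r].
Proof.
have [k E] : exists k, lead_coef h ^+ k *: g = g %/ h * h + g %% h.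
  by eexists; exact: Pdiv.Idomain.divp_eq.
exists k, (g %/ h), (g %% h); split=> //; first by rewrite ltn_modp.
by rewrite -evZ E rmorphD rmorphM eh mulr0 add0r.
Qed.

Lemma ev_ker g : ev g = 0 -> exists k q, lead_coef h ^+ k *: g = q * h.
Proof.
move=> eg; have [k [q [r [E sr er]]]] := ev_div g; exists k, q.
by rewrite E (hmin _ sr) ?addr0 // -er eg mulr0.
Qed.

Lemma size_minrel : (1 < size h)%N.
Proof.
rewrite ltnNge; apply/negP => /size1_polyC hC; move: eh; rewrite hC evC => /eqP; apply/negP/i_neq0.
by apply/eqP => H; case/eqP: h0; rewrite hC H.
Qed.

Lemma ev_deriv : ev h^`() = 0 -> h^`() = 0.
Proof. by move=> H; apply: hmin => //; apply: lt_size_deriv. Qed.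

(** E is a derivation of C[X] with values in B. If it kills h it kills every relation, since
    relations are multiples of h up to powers of the leading coefficient; so it induces a derivation
    of B. *)
Lemma descend (E : {poly C} -> B) : (forall f g, E (f + g) = E f + E g) ->
  (forall f g, E (f * g) = ev f * E g + ev g * E f) -> E h = 0 ->
  exists2 d : B -> B, derivation d & forall f, d (ev f) = E f.
Proof.
move=> ED EM Eh.
have E0 : E 0 = 0 by apply: (addrI (E 0)); rewrite -ED !addr0.
have EN f : E (- f) = - E f by apply/eqP; rewrite -addr_eq0 -ED addNr E0.
have Ek f : ev f = 0 -> E f = 0.
  move=> ef; have [k [q E1]] := ev_ker ef; have := congr1 E E1; rewrite -mul_polyC !EM ef eh Eh.
  rewrite mulr0 !mul0r !addr0 evC => /eqP; rewrite mulf_eq0 => /orP[|/eqP //].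
  by rewrite rmorphXn expf_eq0 => /andP[_ /eqP] H; case/negP: (i_neq0 lh0); apply/eqP.
have /choice[F FE] := ev_surj.
have wd f g : ev f = ev g -> E f = E g.
  move=> fg; apply/eqP; rewrite -subr_eq0 -EN -ED; apply/eqP/Ek.
  by rewrite rmorphB fg subrr.
exists (fun x => E (F x)) => [|f]; last by apply: wd; rewrite FE.
split=> x y; first by rewrite -ED; apply: wd; rewrite rmorphD !FE.
rewrite -{2}(FE x) -{3}(FE y) -EM; apply: wd; by rewrite rmorphM !FE.
Qed.

(** Jacobian criterion for one equation: D maps Q^2 into Q, so if Q contains h but not D h, then h
    is outside Q^2 even locally, and dividing by h keeps regularity. Away from the leading
    coefficient of h, B agrees with C[X]/(h). *)
Lemma J0_step (D : {poly C} -> {poly C}) : noetherian C -> J0 C -> derivation D -> ev (D h) <> 0 -> J0 B.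
Proof.
move=> noeth [f0 f0n fP] dD eDh.
exists (i f0 * i (lead_coef h) * ev (D h)).
  apply/eqP; rewrite !mulf_neq0 ?i_neq0 //; apply/eqP => //.
move=> Q' pQ' nf; pose Q := ipre ev Q'; have pQ : is_prime Q := ipre_prime ev pQ'.
have nP : ~ Q' (i f0) by move=> H; apply/nf/idealMl/idealMl.
have nl : ~ Q' (i (lead_coef h)) by move=> H; apply/nf/idealMl/idealM.
have nD : ~ Q (D h) by move=> H; apply/nf/idealM/H.
have nPoly := noeth_poly noeth.
have [d rd] : exists d, regat (izero C) (ipre (@polyC C) Q) d.
  apply: fP; first exact: ipre_prime.
  by move=> H; apply: nP; rewrite -evC; exact: H.
have [e re] := regat_poly pQ rd.
have Qh : Q h by have H : Q' (ev h) by [rewrite eh]; exact: H.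
case: e re => [|e] re.
  have [_ [s [/size0nil -> _ sg _]]] := re.
  have [t Qt [z [y [-> /igen_nil -> /eqP]]]] := sg h Qh.
  rewrite addr0 mulf_eq0 (negbTE h0) orbF => /eqP t0.
  by case: Qt; rewrite t0.
exists e; apply/(regat_surj ev_surj).
have r1 : regat (iadd1 (izero {poly C}) h) Q e.
  apply: (regat_quot nPoly re Qh) => t Qt [z [y [-> Qy E]]].
  have DQ2 : forall y, ideal_mul Q Q y -> Q (D y).
    suff H : ideal_mul Q Q `<=` [set y | Q y /\ Q (D y)] by move=> w /H[].
    have K0 : [set y | Q y /\ Q (D y)] 0 by rewrite /mkset der0 //; split.
    have KD x w : [set y | Q y /\ Q (D y)] x -> [set y | Q y /\ Q (D y)] w -> [set y | Q y /\ Q (D y)] (x + w).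
      by move=> [H1 H2] [H3 H4]; rewrite /mkset dD.1; split; apply: idealD.
    have KM x w : [set y | Q y /\ Q (D y)] w -> [set y | Q y /\ Q (D y)] (x * w).
      by move=> [H1 H2]; rewrite /mkset dD.2; split; [apply: idealM|apply: idealD; [apply: idealM|apply: idealMl]].
    apply: (@imul_sub _ Q Q (Ideal K0 KD KM)) => x w Qx Qw.
    have H : Q (x * w) /\ Q (D (x * w)).
      by rewrite dD.2; split; [apply: idealM|apply: idealD; apply: idealMl].
    exact: H.
  have := DQ2 _ Qy; have -> : y = t * h by rewrite E add0r.
  rewrite dD.2 => /idealB/(_ (idealMl (D t) Qh)); rewrite addrK => /pQ.2[] //.
apply: regat_localeq r1.
  by apply: iadd1_sub; [move=> x ->|].
move=> g eg; have [k [q E]] := ev_ker eg; exists (lead_coef h ^+ k)%:P.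
  by move=> H; have : Q' (ev (lead_coef h ^+ k)%:P) := H; rewrite evC rmorphXn => /(prime_exp pQ').
rewrite mul_polyC E; apply/iadd1P; exists q, 0; split=> //; exact/esym/add0r.
Qed.

(** If every derivation killed h at b, then h' = 0 and the ratios of the coefficients of h to the
    leading one would be constants, hence fractional p-th powers. A multiple of h would be a p-th
    power G^p, with G a relation of smaller degree. *)
Lemma der_sep p : prime p -> p%:R = 0 :> C -> nfrac p C -> exists2 D, derivation D & ev (D h) <> 0.
Proof.
move=> pp p0 nC; apply: contrapT => no.
have all0 (D : {poly C} -> {poly C}) : derivation D -> ev (D h) = 0 by move=> dD; apply: contrapT => H; apply: no; exists D.
have h'0 : h^`() = 0 by apply/ev_deriv/all0/deriv_derivation.
(* The factor a^(p-1) replaces each coefficient c of h by a^p times the ratio c / a. *)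
pose a := lead_coef h; have a0 : a != 0 := lh0; pose h1 := a ^+ p.-1 *: h.
have [||V V0 [G GE]] := assemble pp p0 (h := h1).
- by move=> j pj; rewrite coefZ (deriv0_coef pp p0 h'0 pj) mulr0.
- move=> j; apply: nC => d dd.
  (* The leading terms cancel, so this relation is shorter than h. *)
  have H : a *: coef_der d h - d a *: h = 0.
    apply: hmin; first by rewrite rmorphB !evZ eh all0 ?mulr0 ?subrr //; apply: coef_der_derivation.
    have := size_minrel; case sh: (size h) => [|[|n]] // _.
    rewrite ltnS; apply/leq_sizeP => m; rewrite leq_eqVlt => /orP[/eqP <-|nm].
      by rewrite coefB !coefZ coef_coef_der // /a lead_coefE sh /= mulrC subrr.
    by rewrite coefB !coefZ coef_coef_der // nth_default ?sh // der0 // !mulr0 subrr.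
  have := congr1 (fun P : {poly C} => P`_j) H; rewrite coefB !coefZ coef0 coef_coef_der // => /eqP.
  rewrite subr_eq0 => /eqP Hj; rewrite dd.2 derX //.
  case: p pp p0 @h1 {no} => [|[|q]] // _ p0; rewrite [q.+2.-1]/= [q.+1.-1]/=.
  have q1 : q.+1%:R = -1 :> C by apply/eqP; rewrite -addr_eq0 -[1]/(1%:R) -natrD addn1 p0.
  move=> _; have -> : a ^+ q.+1 * d h`_j = a ^+ q * (a * d h`_j) by rewrite exprSr mulrA.
  by rewrite Hj q1; ring.
have eG : ev G = 0.
  have := congr1 ev GE; rewrite /h1 !evZ eh !mulr0 rmorphXn => /esym/eqP.
  by rewrite expf_eq0 => /andP[_ /eqP].
have G0 : G != 0.
  apply/eqP => G0; have : V ^+ p *: (a ^+ p.-1 *: h) = 0 by rewrite -/h1 GE G0 expr0n eqn0Ngt prime_gt0.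
  by move/eqP; rewrite -!mul_polyC !mulf_eq0 !polyC_eq0 !expf_eq0 (negbTE V0) (negbTE a0) (negbTE h0) !andbF.
case/eqP: G0; apply: hmin => //.
have := congr1 (fun P : {poly C} => size P) GE.
rewrite /h1 !size_scale ?expf_neq0 // => sh.
have := size_exp G p; rewrite -sh => sE; have := size_minrel; rewrite -(prednK (n := size h)) ?(ltnW size_minrel) //.
have [->|Gn] := eqVneq (size G) 0%N; first by [].
rewrite sE ltnS => GG; rewrite -(prednK (n := size G)) ?lt0n // ltnS.
by rewrite ltn_Pmulr ?prime_gt1 //; move: GG; rewrite muln_gt0 => /andP[].
Qed.

Section CharP.
Variable p : nat.
Hypotheses (pp : prime p) (p0 : p%:R = 0 :> C).
Let Bp0 : p%:R = 0 :> B. Proof. by rewrite -(rmorph_nat i) p0 rmorph0. Qed.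

Section Separable.
Hypothesis sep : ev h^`() <> 0.

(** Differentiating A r = h^m k with 0 < m < p and evaluating at b gives m h'(b) k(b) = 0;
    separability then yields another factor h. *)
Lemma pth_divides r : r^`() = 0 -> ev r = 0 -> exists2 A, A != 0 & exists k, A *: r = h ^+ p * k.
Proof.
move=> r' er.
suff H m : (m <= p)%N -> exists2 A, A != 0 & exists k, A *: r = h ^+ m * k by exact: H.
elim: m => [|m IH] mp; first by exists 1; [exact: oner_neq0|exists r; rewrite scale1r mul1r].
have [A A0 [k E]] := IH (ltnW mp).
suff ek : ev k = 0.
  have [j [q E']] := ev_ker ek; exists (lead_coef h ^+ j * A); first by rewrite mulf_neq0 ?expf_neq0.
  by exists q; rewrite -scalerA E scalerAr E' mulrCA exprS mulrCA mulrA mulrC mulrA.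
case: m E mp {IH} => [|m] E mp.
  by rewrite mul1r in E; rewrite -E evZ er mulr0.
have := congr1 (@deriv C) E; rewrite derivZ r' scaler0 derivM deriv_exp [m.+1.-1]/=.
have -> : h^`() * h ^+ m *+ m.+1 * k + h ^+ m.+1 * k^`() = h ^+ m * (m.+1%:R * h^`() * k + h * k^`()).
  by rewrite -mulr_natl exprS; ring.
move/esym/eqP; rewrite mulf_eq0 expf_eq0 (negbTE h0) andbF /= => /eqP/(congr1 ev).
rewrite rmorphD !rmorphM rmorph_nat eh mul0r addr0 rmorph0 => /eqP.
rewrite !mulf_eq0 -(rmorph_nat i) => /orP[/orP[|/eqP //]|/eqP //].
by rewrite (negbTE (i_neq0 (natp_unit pp p0 _))).
Qed.

Lemma pth_size r : r^`() = 0 -> ev r = 0 -> r != 0 -> (p * (size h).-1 < size r)%N.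
Proof.
move=> r' er r0; have [A A0 [k E]] := pth_divides r' er.
have k0 : k != 0.
  by apply/eqP => k0; move/eqP: E; rewrite k0 mulr0 -mul_polyC mulf_eq0 polyC_eq0 (negbTE A0) (negbTE r0).
have hp0 : h ^+ p != 0 by rewrite expf_neq0.
have := congr1 (fun P : {poly C} => size P) E; rewrite size_scale // size_mul // => ->.
have := size_exp h p; rewrite mulnC => <-.
have := k0; rewrite -size_poly_gt0; have := hp0; rewrite -size_poly_gt0.
by case: (size (h ^+ p)) => // s1 _; case: (size k) => // s2 _; rewrite /= addnS ltnS leq_addr.
Qed.

Let n := (size h).-1.
(** A relation between powers of b^p is a polynomial in X^p, hence has derivative zero; [pth_size]
    forces its degree beyond the range considered. So b^p has the same degree as b. *)
Lemma pth_free (G : nat -> C) : \sum_(j < n) i (G j) * b ^+ (j * p) = 0 -> forall j, (j < n)%N -> G j = 0.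
Proof.
move=> H j jn; pose g := \poly_(j < n) G j.
suff g0 : g = 0 by have := congr1 (fun P : {poly C} => P`_j) g0; rewrite coef_poly jn coef0.
apply/eqP/contraT => g0; pose r := g \Po 'X^p.
have er : ev r = 0.
  rewrite -H /r /g poly_def rmorph_sum rmorph_sum; apply: eq_bigr => m _.
  by rewrite /= comp_polyZ comp_Xn_poly; change (ev (G m *: 'X^p ^+ m) = i (G m) * b ^+ (m * p)); rewrite evZ rmorphXn rmorphXn evX -exprM mulnC.
have r' : r^`() = 0 by rewrite deriv_comp derivXn -mulr_natr polyp0 // mulr0 mulr0.
have sr : (size r).-1 = ((size g).-1 * p)%N by rewrite size_comp_poly size_polyXn.
have sg : (size g <= n)%N := size_poly _ _.
have g1 : (0 < size g)%N by rewrite size_poly_gt0.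
have r0 : r != 0.
  apply: contra g0 => /eqP r0; have := sr; rewrite r0 size_poly0 /= => /esym/eqP.
  rewrite muln_eq0 [p == _]eqn0Ngt prime_gt0 // orbF => /eqP s1.
  have gC : g = (g`_0)%:P by apply: size1_polyC; rewrite -(prednK g1) s1.
  by move: r0; rewrite /r gC comp_polyC => ->.
have := pth_size r' er r0; rewrite -(prednK (n := size r)) ?size_poly_gt0 // sr ltnS mulnC leq_pmul2r ?prime_gt0 //.
by move=> H1; move: (leq_trans sg H1); rewrite -{1}(prednK g1) ltnn.
Qed.

Lemma coords y : exists2 a : C, a != 0 & exists c : nat -> C, i a * y = \sum_(j < n) i (c j) * b ^+ j.
Proof.
have [g <-] := gen y; have [k [q [r [_ sr E]]]] := ev_div g.
exists (lead_coef h ^+ k); first by rewrite expf_neq0.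
exists (fun j => r`_j); rewrite E evE (@horner_coef_wide _ n); last first.
  by apply: leq_trans (size_poly _ _) _; rewrite /n -ltnS prednK // (ltn_trans _ size_minrel).
by apply: eq_bigr => j _; rewrite coef_map.
Qed.

Lemma pth_coords x : exists2 V : C, V != 0 & exists c : nat -> C,
  i (V ^+ p) * x = \sum_(j < n) i (c j) * b ^+ (j * p).
Proof.
pose v (k : nat) := if k is j.+1 then b ^+ (j * p) else x.
have /choice[a aP] : forall k, exists ac : C * (nat -> C), ac.1 != 0 /\ i ac.1 * v k = \sum_(j < n) i (ac.2 j) * b ^+ j.
  by move=> k; have [a a0 [c cE]] := coords (v k); exists (a, c).
have [c [[k ck] cP]] := elimination (idom_prime0 C) (fun (k : 'I_n.+1) (j : 'I_n) => (a k).2 j).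
have rel : \sum_(k < n.+1) i (c k * (a k).1) * v k = 0.
  transitivity (\sum_(j < n) i (\sum_k c k * (a k).2 j) * b ^+ j); last first.
    by rewrite big1 // => j _; have -> := cP j; rewrite rmorph0 mul0r.
  under [RHS]eq_bigr do rewrite rmorph_sum mulr_suml.
  rewrite exchange_big; apply: eq_bigr => m _; rewrite rmorphM -mulrA (aP m).2 mulr_sumr.
  by apply: eq_bigr => j _; rewrite rmorphM mulrA.
rewrite big_ord_recl [v _]/= in rel.
set V := c ord0 * _ in rel.
pose G (j : nat) := if insub j is Some m then c (lift ord0 m) * (a (lift ord0 m)).1 else 0.
have GE (m : 'I_n) : G m = c (lift ord0 m) * (a (lift ord0 m)).1.
  rewrite /G; case: insubP => [m' _ mE|]; last by rewrite ltn_ord.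
  by rewrite (_ : m' = m) //; apply: val_inj.
have V0 : V != 0.
  apply/eqP => V0; apply/ck/eqP.
  have G0 : forall j, (j < n)%N -> G j = 0.
    rewrite V0 rmorph0 mul0r add0r in rel; apply: pth_free; rewrite -[RHS]rel; apply: eq_bigr => m _.
    by rewrite GE.
  suff : c k * (a k).1 == 0 by rewrite mulf_eq0 (negbTE (aP k).1) orbF.
  have [m ->|->] := unliftP ord0 k; last by rewrite -/V V0.
  by rewrite -GE G0.
exists V => //; exists (fun j => - (V ^+ p.-1 * G j)).
have -> : V ^+ p = V ^+ p.-1 * V by rewrite -exprSr prednK // prime_gt0.
move: rel => /eqP; rewrite addr_eq0 => /eqP rel.
rewrite rmorphM -mulrA rel mulrN mulr_sumr -sumrN; apply: eq_bigr => m _.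
by rewrite GE rmorphN [i (V ^+ _ * _)]rmorphM mulNr mulrA.
Qed.

(** Derivations of C extend to the separable extension up to a factor, so a constant x has constant
    coordinates on the powers of b^p. These coordinates are fractional p-th powers, and therefore x
    is one. *)
Lemma nfrac_sep : nfrac p C -> nfrac p B.
Proof.
move=> nC x dx; have [V V0 [c cE]] := pth_coords x.
have dc j (d : C -> C) : (j < n)%N -> derivation d -> d (c j) = 0.
  move=> jn dd; have dcd := coef_der_derivation dd.
  (* The usual extension of d, multiplied by h'(b) to clear its denominator. *)
  have [|||D dD DE] := descend (E := fun g => ev h^`() * ev (coef_der d g) - ev (coef_der d h) * ev g^`()).
  - by move=> f g; rewrite dcd.1 derivD !rmorphD; ring.
  - by move=> f g; rewrite dcd.2 derivM !rmorphD !rmorphM; ring.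
  - by rewrite mulrC subrr.
  have Dp y : D (y ^+ p) = 0 by apply: derp.
  have DC y : D (i y) = ev h^`() * i (d y).
    by rewrite -evC DE coef_derC // derivC rmorph0 mulr0 subr0 evC.
  have := congr1 D cE; rewrite dD.2 dx // mulr0 add0r [i (_ ^+ _)]rmorphXn Dp mulr0 der_sum //.
  under eq_bigr do rewrite dD.2 exprM Dp mulr0 add0r DC mulrC -mulrA -exprM.
  rewrite -mulr_sumr => /esym/eqP; rewrite mulf_eq0 => /orP[/eqP//|/eqP] H.
  exact: (pth_free (G := fun j => d (c j)) H).
have [W W0 [w wE]] := @poly_pth p C n c (fun j jn => nC (c j) (fun d dd => dc j d jn dd)).
exists (\sum_(j < n) i (w j) * b ^+ j), (i (W * V)); split; first by rewrite i_neq0 ?mulf_neq0.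
rewrite frob_sum // -rmorphXn exprMn rmorphM -mulrA cE mulr_sumr; apply: eq_bigr => j _.
by rewrite exprMn -rmorphXn -wE // rmorphM mulrA exprM.
Qed.
End Separable.
End CharP.
End Minrel.
End Step.

(** * Purely inseparable extensions *)

Lemma derMn R (d : R -> R) x n : derivation d -> d (n%:R * x) = n%:R * d x.
Proof.
move=> dd; rewrite dd.2 (_ : d n%:R = 0) ?mulr0 ?addr0 //.
by elim: n => [|n IH]; [exact: der0|rewrite -addn1 natrD dd.1 IH der1 // addr0].
Qed.

Lemma iter_der R (d : R -> R) k x y : derivation d ->
  iter k d (x * y) = \sum_(j < k.+1) 'C(k, j)%:R * (iter j d x * iter (k - j) d y).
Proof.
move=> dd; elim: k => [|k IH]; first by rewrite big_ord1 bin0 mul1r.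
rewrite iterS IH der_sum //.
under eq_bigr => j _ do rewrite derMn // dd.2 mulrDr [_ * iter j.+1 d x]mulrC -!iterS.
rewrite big_split /= [RHS]big_ord_recl bin0 subn0 mul1r.
under [X in _ = _ + X]eq_bigr => j _ do rewrite lift0 binS natrD mulrDl subSS.
rewrite big_split /= addrA; congr (_ + _).
rewrite big_ord_recl bin0 subn0 mul1r; congr (_ + _).
rewrite [RHS]big_ord_recr /= bin_small // mul0r addr0; apply: eq_bigr => j _.
by rewrite /bump add1n; congr (_ * (_ * _)); rewrite -iterS -subSn ?subSS.
Qed.

Section Lie.
Variables (p : nat) (C : idomainType).
Hypotheses (pp : prime p) (p0 : p%:R = 0 :> C).
Hypothesis nC : nfrac p C.
Variables (d0 : C -> C) (a : C).
Hypotheses (dd0 : derivation d0) (e0 : d0 a != 0).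
Notation e := (d0 a).
Definition vanish (c : C) := forall d, derivation d -> d a = 0 -> d c = 0.
(** The scaling makes theta a = e^p, which every derivation kills; iterates of theta on powers of a
    are then explicit. *)
Definition theta (x : C) := e ^+ p.-1 * d0 x.

Lemma der_scale (d : C -> C) u : derivation d -> derivation (fun x => u * d x).
Proof. by move=> dd; split=> x y; rewrite ?dd.1 ?dd.2; ring. Qed.
Lemma der_add (d d' : C -> C) : derivation d -> derivation d' -> derivation (fun x => d x + d' x).
Proof. by move=> dd dd'; split=> x y; rewrite ?dd.1 ?dd.2 ?dd'.1 ?dd'.2; ring. Qed.
Lemma der_lie (d d' : C -> C) : derivation d -> derivation d' -> derivation (fun x => d (d' x) - d' (d x)).
Proof.
move=> dd dd'; split=> x y; first by rewrite dd'.1 dd.1 dd.1 dd'.1; ring.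
by rewrite dd'.2 dd.2 !(dd.1, dd'.1) !(dd.2, dd'.2); ring.
Qed.
Lemma theta_der : derivation theta. Proof. exact: der_scale. Qed.
(** In the Leibniz formula for the p-th iterate all inner binomial coefficients are divisible by
    p. *)
Lemma iter_thetap : derivation (iter p theta).
Proof.
have td := theta_der; split=> x y.
  by elim: (p) => // k IH; rewrite !iterS IH td.1.
rewrite iter_der //; case: p pp p0 => [|q] // qp q0.
rewrite big_ord_recr big_ord_recl /= bin0 binn ?subn0 ?subnn !mul1r.
rewrite big1 => [|j _]; first by rewrite addr0; congr (_ + _); rewrite mulrC.
have /dvdnP[k ->] : (q.+1 %| 'C(q.+1, bump 0 j))%N by apply: prime_dvd_bin; rewrite //= /bump add1n ltnS ltn_ord.
by rewrite natrM q0 mulr0 mul0r.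
Qed.

Lemma theta_a : theta a = e ^+ p.
Proof. by rewrite /theta -exprSr prednK // prime_gt0. Qed.

Lemma theta_ap k : theta (a ^+ k) = k%:R * a ^+ k.-1 * e ^+ p.
Proof. by rewrite derX ?theta_a //; apply: theta_der. Qed.

Lemma vanish_theta c : vanish c -> vanish (theta c).
Proof.
move=> vc d dd da; rewrite /theta dd.2 derX //.
(* The derivation e [d0, d] + d(e) d0 kills a, hence kills c. *)
have := vc (fun x => e * (d0 (d x) - d (d0 x)) + d e * d0 x).
move=> /(_ (der_add (der_scale e (der_lie dd0 dd)) (der_scale (d e) dd0))).
rewrite da der0 // => H; have {}H := H (_ : _ = 0); rewrite vc // der0 // in H.
have {}H : e * d (d0 c) = d e * d0 c.
  by apply/eqP; rewrite -subr_eq0 -oppr_eq0 opprB; apply/eqP; rewrite -[RHS]H; [ring|ring].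
case: p pp p0 => [|[|q]] // _ q0; rewrite [q.+2.-1]/= [q.+1.-1]/=.
have q1 : q.+1%:R = -1 :> C by apply/eqP; rewrite -addr_eq0 -[1]/(1%:R) -natrD addn1 q0.
have -> : e ^+ q.+1 * d (d0 c) = e ^+ q * (e * d (d0 c)) by rewrite exprSr mulrA.
by rewrite H q1; ring.
Qed.

Lemma vanish_iter c k : vanish c -> vanish (iter k theta c).
Proof. by move=> vc; elim: k => // k IH; apply: vanish_theta. Qed.

Lemma theta_p c : vanish c -> iter p theta c = 0.
Proof.
move=> vc; apply: vc; first exact: iter_thetap.
case: p pp p0 theta_a theta_der => [|[|q]] // _ q0 ta td; rewrite iterSr ta iterSr.
rewrite (derX _ _ td) q0 !mul0r; elim: q {q0 ta} => // q IH; rewrite iterSr der0 //.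
Qed.

Lemma theta0_pth c : vanish c -> theta c = 0 -> exists u v : C, v != 0 /\ v ^+ p * c = u ^+ p.
Proof.
move=> vc tc; apply: nC => d dd.
have d0c : d0 c = 0 by move/eqP: tc; rewrite mulf_eq0 expf_eq0 (negbTE e0) andbF => /eqP.
have H0 : e * d a + - d a * e = 0 by ring.
have := vc (fun x => e * d x + - d a * d0 x) (der_add (der_scale _ dd) (der_scale _ dd0)) H0.
by rewrite d0c mulr0 addr0 => /eqP; rewrite mulf_eq0 (negbTE e0) => /eqP.
Qed.

Lemma iter_theta_ak k : iter k theta (a ^+ k) = k`!%:R * e ^+ (p * k).
Proof.
elim: k => [|k IH]; first by rewrite muln0 mulr1.
rewrite iterSr theta_ap [k.+1.-1]/=.
have tC (m : nat) (x y : C) : iter m theta (x * y ^+ p) = iter m theta x * y ^+ p.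
  elim: m => // m IHm; rewrite !iterS IHm theta_der.2 (derp _ theta_der p0) mulr0 add0r mulrC //.
rewrite tC; have tn (m n : nat) (x : C) : iter m theta (n%:R * x) = n%:R * iter m theta x.
  by elim: m => // m IHm; rewrite !iterS IHm derMn //; apply: theta_der.
by rewrite tn IH factS natrM mulnS exprD; ring.
Qed.

(** Induction on the order of nilpotency of theta at c. The (k)-th iterate of c is a fractional p-th
    power by [theta0_pth]; subtracting the matching multiple of a^k, with k! coming from
    [iter_theta_ak], lowers the order. *)
Lemma lie_span k c : (k <= p)%N -> vanish c -> iter k theta c = 0 ->
  exists2 Q : C, Q != 0 & exists w : nat -> C, Q ^+ p * c = \sum_(j < k) w j ^+ p * a ^+ j.
Proof.
elim: k c => [|k IH] c kp vc kc.
  by exists 1; [exact: oner_neq0|exists (fun=> 0); rewrite big_ord0; rewrite /= in kc; rewrite kc mulr0].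
pose c1 := iter k theta c.
have [u [v [v0 vE]]] := theta0_pth (vanish_iter k vc) (kc : theta c1 = 0).
have fE : k`!%:R = k`!%:R ^+ p :> C by rewrite natr_frob.
have f0 : k`!%:R != 0 :> C.
  elim: (k) kp => [|m IHm] mp; first by rewrite oner_eq0.
  by rewrite factS natrM mulf_neq0 ?IHm ?(ltnW mp) //; apply: (natp_unit pp p0).
have tp (m : nat) (y x : C) : iter m theta (y ^+ p * x) = y ^+ p * iter m theta x.
  by elim: m => // m IHm; rewrite !iterS IHm theta_der.2 (derp _ theta_der p0) mulr0 addr0.
have tB (m : nat) (x y : C) : iter m theta (x - y) = iter m theta x - iter m theta y.
  by elim: m => // m IHm; rewrite !iterS IHm theta_der.1 derN //; apply: theta_der.
pose c2 := (v * e ^+ k * k`!%:R) ^+ p * c - u ^+ p * a ^+ k.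
have [||Q Q0 [w wE]] := IH c2 (ltnW kp).
- move=> d dd da; have dp y : d (y ^+ p) = 0 by apply: derp.
  have dak : d (a ^+ k) = 0 by rewrite derX // da mulr0.
  by rewrite /c2 dd.1 derN // !dd.2 !dp (vc d) // dak !mulr0 !addr0 subrr.
- rewrite /c2 tB !tp iter_theta_ak -vE /c1 !exprMn -fE -exprM mulnC; ring.
exists (Q * (v * e ^+ k * k`!%:R)); first by rewrite !mulf_neq0 ?expf_neq0.
exists (fun j => if (j < k)%N then w j else Q * u).
rewrite big_ord_recr /= ltnn; under eq_bigr => j _ do rewrite ltn_ord.
rewrite -wE /c2 !exprMn; ring.
Qed.

Lemma lie c : vanish c -> exists2 Q : C, Q != 0 & exists w : nat -> C, Q ^+ p * c = \sum_(j < p) w j ^+ p * a ^+ j.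
Proof. by move=> vc; apply: lie_span => //; apply: theta_p. Qed.
End Lie.

Section Root.
Variables (p : nat) (C B : idomainType) (i : {rmorphism C -> B}) (b : B) (a : C).
Hypotheses (pp : prime p) (p0 : p%:R = 0 :> C).
Hypothesis inj_i : injective i.
Hypothesis gen : forall x, exists f : {poly C}, (map_poly i f).[b] = x.
Hypothesis hP : minrel i b ('X^p - a%:P).
Notation ev := (ev i b).

Lemma root_pth : b ^+ p = i a.
Proof.
have [_ /eqP E _] := hP; apply/eqP; rewrite -subr_eq0 -(eqP E) rmorphB rmorphXn.
by rewrite evX evC.
Qed.

(** A constant x has derivative zero in b, so x = i c with c in C. Derivations of C killing a extend
    to B, so they kill c. By [lie] c is, up to a p-th power, a sum of terms w_j^p a^j, which is a
    p-th power in B because a = b^p there. *)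
Lemma nfrac_root : nfrac p C -> nfrac p B.
Proof.
move=> nC x dx.
have hmin : forall g : {poly C}, ev g = 0 -> (size g <= p)%N -> g = 0.
  by case: hP => _ _ H g eg sg; apply: H => //; rewrite size_XnsubC ?prime_gt0.
have P0 := polyp0 p0.
have [g gx] := ev_surj gen x.
pose r := Pdiv.Ring.rmodp g ('X^p - a%:P).
have mX : 'X^p - a%:P \is monic by apply/monicXnsubC/prime_gt0.
have sr : (size r <= p)%N.
  by have := Pdiv.Ring.ltn_rmodpN0 g (monic_neq0 mX); rewrite size_XnsubC ?prime_gt0.
have er : ev r = x.
  rewrite -gx (Pdiv.RingMonic.rdivp_eq mX g) rmorphD rmorphM; case: hP => _ -> _.
  by rewrite mulr0 add0r.
have r'0 : r^`() = 0.
  have [|||D dD DE] := descend inj_i gen hP (E := fun g => ev g^`()).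
  - by move=> f f'; rewrite derivD rmorphD.
  - by move=> f f'; rewrite derivM rmorphD !rmorphM addrC mulrC; congr (_ + _); rewrite mulrC.
  - by rewrite derivB derivXn derivC subr0 -mulr_natr P0 mulr0 rmorph0.
  apply: hmin; first by rewrite -DE er dx.
  have [->|rn0] := eqVneq r 0; first by rewrite deriv0 size_poly0.
  by apply: leq_trans sr; apply/ltnW/lt_size_deriv.
have rC : r = (r`_0)%:P.
  apply/polyP => j; rewrite coefC; case: eqP => [->//|j0].
  have [jp|pj] := ltnP j p; last by rewrite nth_default // (leq_trans sr).
  by apply: (deriv0_coef pp p0 r'0); apply/negP => /dvdn_leq; case: j j0 jp => // j _ jp /(_ isT); rewrite leqNgt jp.
have xc : x = i r`_0 by rewrite -er {1}rC evC.
have van : vanish a r`_0.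
  move=> d dd da; have dcd := coef_der_derivation dd.
  have [|||D dD DE] := descend inj_i gen hP (E := fun g => ev (coef_der d g)).
  - by move=> f f'; rewrite dcd.1 rmorphD.
  - by move=> f f'; rewrite dcd.2 rmorphD !rmorphM.
  - by rewrite dcd.1 derN // (derp _ dcd P0) coef_derC // da sub0r oppr0 rmorph0.
  by apply: inj_i; rewrite rmorph0 -(dx D dD) xc -[i r`_0](evC i b) DE coef_derC // evC.
(* If all derivations killed a, it would be a fractional p-th power, and b would satisfy a linear
   relation. *)
have [d0 dd0 e0] : exists2 d : C -> C, derivation d & d a != 0.
  apply: contrapT => no.
  have [|u [v [v0 E]]] := nC a.
    by move=> d dd; apply/eqP/contraT => da; case: no; exists d.
  have : v *: 'X - u%:P = 0.
    apply: hmin.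
      rewrite rmorphB evZ evX evC; apply/eqP.
      have : (i v * b - i u) ^+ p == 0.
        rewrite frobB //; last by rewrite -(rmorph_nat i) p0 rmorph0.
        by rewrite exprMn root_pth -!rmorphXn -rmorphM E subrr.
      by rewrite expf_eq0 => /andP[].
    apply: leq_trans (prime_gt1 pp); rewrite (leq_trans (size_polyD _ _)) // geq_max size_polyN.
    by rewrite (leq_trans (size_scale_leq _ _)) ?size_polyX // (leq_trans (size_polyC_leq1 _)).
  move=> /(congr1 (fun P : {poly C} => P`_1)); rewrite coefB coefZ coefX coefC coef0 /= mulr1 subr0 => v0'.
  by rewrite v0' eqxx in v0.
have [Q Q0 [w wE]] := lie pp p0 nC dd0 e0 van.
exists (\sum_(j < p) i (w j) * b ^+ j), (i Q); split.
  by apply: contra Q0 => /eqP H; apply/eqP/inj_i; rewrite H rmorph0.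
rewrite frob_sum //; last by rewrite -(rmorph_nat i) p0 rmorph0.
rewrite xc -rmorphXn -rmorphM wE rmorph_sum; apply: eq_bigr => j _.
by rewrite rmorphM !rmorphXn exprMn -!exprM mulnC exprM root_pth -rmorphXn.
Qed.
End Root.

Lemma gen_over (C B : idomainType) (i : {rmorphism C -> B}) (b : B) (S : subring B) :
  (forall c, S (i c)) -> (forall x, exists f : {poly C}, (map_poly i f).[b] = x) ->
  forall x, exists f : {poly sr_dom S}, (map_poly (@sr_val B S : {rmorphism sr_dom S -> B}) f).[b] = x.
Proof.
move=> Si gen x; have [f <-] := gen x; pose j : {rmorphism C -> sr_dom S} := sr_corestr Si.
exists (map_poly j f); rewrite -map_poly_comp; congr (_.[_]); exact: eq_map_poly.
Qed.

(** Induction on the degree of h. If h is inseparable it is a polynomial in X^p, so b^p satisfies a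
    shorter relation; over the ring generated by b^p, the element b is either separable or a p-th
    root. *)
Lemma nfrac_step p : prime p -> forall n (C B : idomainType) (i : {rmorphism C -> B}) (b : B), injective i ->
  (forall x, exists f : {poly C}, (map_poly i f).[b] = x) -> p%:R = 0 :> C -> nfrac p C ->
  forall h, minrel i b h -> (size h <= n)%N -> nfrac p B.
Proof.
move=> pp; elim=> [|n IH] C B i b inj_i gen p0 nC h hP sh.
  by have := size_minrel inj_i hP; rewrite ltnNge (leq_trans sh).
have [h'0|sep] := pselect (ev i b h^`() = 0); last exact: (nfrac_sep inj_i gen hP pp p0 sep nC).
have {}h'0 := ev_deriv hP h'0.
have [hn0 eh hmin] := hP; have s1 := size_minrel inj_i hP.
pose G := \poly_(j < size h) h`_(j * p).
have hG : h = G \Po 'X^p.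
  apply/polyP => j; rewrite coef_comp_poly_Xn ?prime_gt0 //.
  case: ifP => [/divnK pj|/negbT/(deriv0_coef pp p0 h'0)//].
  rewrite coef_poly pj; case: ltnP => // hj; rewrite nth_default //.
  by apply: leq_trans hj _; apply: leq_div.
have sG : (size G < size h)%N.
  have := size_comp_poly G 'X^p; rewrite -hG size_polyXn /= => E.
  have : (0 < size G)%N by rewrite size_poly_gt0; apply: contra hn0 => /eqP G0; rewrite hG G0 comp_poly0.
  move: s1 E; case: (size h) => [|[|m]] // _; case: (size G) => [|k] //= E _.
  have k0 : (0 < k)%N by case: k E.
  by rewrite E ltnS ltn_Pmulr ?prime_gt1.
have G0 : G != 0 by apply: contra hn0 => /eqP G0; rewrite hG G0 comp_poly0.
pose S := adj (rimage i) (b ^+ p).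
have Si c : S (i c) by apply: adj_incl; exists c.
pose B1 := sr_dom S; pose j : {rmorphism B1 -> B} := @sr_val B S.
have inj_j : injective j := @sr_val_inj B S.
pose i1 : {rmorphism C -> B1} := sr_corestr Si.
have ji1 f : map_poly j (map_poly i1 f) = map_poly i f by rewrite -map_poly_comp; exact: eq_map_poly.
have inj_i1 : injective i1 by move=> x y E; apply: inj_i; have := congr1 j E.
have [b1 b1E] : exists b1 : B1, j b1 = b ^+ p by apply/sr_lift/adj_gen.
have evj f : j (map_poly i1 f).[b1] = (map_poly i f).[b ^+ p] by rewrite -horner_map ji1 b1E.
have gen1 x : exists f : {poly C}, (map_poly i1 f).[b1] = x.
  have [f fE] := adj_map_poly (fun y (H : rimage i y) => H) (sr_valP x); exists f; apply: inj_j; rewrite evj; exact: fE.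
have eG : ev i1 b1 G = 0.
  apply: inj_j; rewrite rmorph0 evE evj -eh evE hG map_comp_poly map_polyXn horner_comp hornerXn //.
have [h1 h1P] := minrel_exists G0 eG.
have nB1 : nfrac p B1.
  apply: (IH C B1 i1 b1 inj_i1 gen1 p0 nC h1 h1P).
  have [_ _ h1min] := h1P; rewrite leqNgt; apply/negP => nh1.
  case/eqP: G0; apply: h1min => //; apply: leq_trans nh1; rewrite ltnS.
  by rewrite -ltnS; apply: leq_trans sh.
have B1p : p%:R = 0 :> B1 by rewrite -(rmorph_nat i1) p0 rmorph0.
have gen2 := gen_over Si gen.
have eX : ev j b ('X^p - b1%:P) = 0 by rewrite rmorphB rmorphXn evX evC b1E subrr.
have Xn0 : 'X^p - b1%:P != 0 by apply/monic_neq0/monicXnsubC/prime_gt0.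
have [h2 h2P] := minrel_exists Xn0 eX.
have [h2'0|sep] := pselect (ev j b h2^`() = 0); last exact: (nfrac_sep inj_j gen2 h2P pp B1p sep nB1).
have {}h2'0 := ev_deriv h2P h2'0.
apply: (nfrac_root (a := b1) pp B1p inj_j gen2 _ nB1).
have [h2n eh2 h2min] := h2P; have s2 := size_minrel inj_j h2P.
suff sh2 : (p < size h2)%N.
  split=> // g eg; rewrite size_XnsubC ?prime_gt0 // ltnS => gp.
  by apply: h2min => //; apply: leq_ltn_trans gp sh2.
have : (p %| (size h2).-1)%N.
  apply: contraT => H; have := deriv0_coef pp B1p h2'0 H; rewrite -lead_coefE => /eqP.
  by rewrite lead_coef_eq0 (negbTE h2n).
by move: s2; case: (size h2) => [|[|m]] // _ /dvdn_leq; apply.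
Qed.

(** In characteristic p the last field supplies the derivation that [J0_step] asks for, and it must
    itself be inherited so as to be available for the next generator. *)
Record good (C : idomainType) : Prop := Good {
  good_noeth : noetherian C;
  good_J0 : J0 C;
  good_char : (forall n, n.+1%:R != 0 :> C) \/ exists p, [/\ prime p, p%:R = 0 :> C & nfrac p C]
}.

Lemma good_step (C B : idomainType) (i : {rmorphism C -> B}) (b : B) : injective i ->
  (forall x, exists f : {poly C}, (map_poly i f).[b] = x) -> good C -> good B.
Proof.
move=> inj_i gen [nC jC chC].
have nB : noetherian B.
  apply: (hilbert_basis (g := i) (b := b) nC) => x; have [f <-] := gen x; exists (size f), (fun k => f`_k).
  by rewrite horner_coef size_map_inj_poly ?rmorph0 //; apply: eq_bigr => k _; rewrite coef_map.
have [[g [g0 eg]]|trans] := pselect (exists g, g != 0 /\ ev i b g = 0).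
  have [h hP] := minrel_exists g0 eg.
  case: chC => [ch0|[p [pp p0 nfC]]]; split=> //.
  - apply: (J0_step inj_i gen hP (D := @deriv C) nC jC (@deriv_derivation C)).
    move/(ev_deriv hP) => h'0; have s1 := size_minrel inj_i hP.
    have := congr1 (fun P : {poly C} => P`_((size h).-2)) h'0; rewrite coef_deriv coef0 -mulr_natr.
    case sh: (size h) s1 => [|[|m]] // _; move/eqP; rewrite mulf_eq0 (negbTE (ch0 _)) orbF.
    by have [h0 _ _] := hP; rewrite /= -[m.+1]/(m.+2.-1) -sh -lead_coefE lead_coef_eq0 (negbTE h0).
  - by left=> n; rewrite -(rmorph_nat i) (i_neq0 inj_i).
  - have [D dD Dh] := der_sep inj_i hP pp p0 nfC.
    exact: (J0_step inj_i gen hP nC jC dD Dh).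
  - right; exists p; split=> //; first by rewrite -(rmorph_nat i) p0 rmorph0.
    exact: (nfrac_step pp inj_i gen p0 nfC hP (leqnn _)).
have inj_e f : ev i b f = 0 -> f = 0.
  by move=> ef; apply/eqP/contraT => f0; case: trans; exists f.
split=> //.
  have [f0 f0n fP] := jC; exists (i f0).
    by move/eqP: f0n => f0n; apply/eqP; rewrite (i_neq0 inj_i).
  move=> Q pQ nf.
  have [||d rd] := fP (ipre (@polyC C : {rmorphism C -> {poly C}}) (ipre (ev i b) Q)).
  - by do 2 apply: ipre_prime.
  - by move=> H; apply: nf; rewrite -(evC i b); exact: H.
  have [e re] := regat_poly (ipre_prime (ev i b) pQ) rd.
  exists e; apply/(regat_surj (ev_surj gen)); apply: regat_localeq re.
    by move=> x ->; exact: (rmorph0 (ev i b)).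
  move=> x ex; exists 1; first by move=> H; apply: pQ.1; rewrite -(rmorph1 (ev i b)); exact: H.
  by rewrite mul1r; apply: inj_e.
case: chC => [ch0|[p [pp p0 nfC]]]; [left=> n; by rewrite -(rmorph_nat i) (i_neq0 inj_i)|right; exists p].
split=> //; first by rewrite -(rmorph_nat i) p0 rmorph0.
move=> x dx; have /choice[F FE] := ev_surj gen.
have inj2 f g : ev i b f = ev i b g -> f = g.
  by move=> E; apply/subr0_eq/inj_e; rewrite rmorphB E subrr.
have FK f : F (ev i b f) = f by apply: inj2; rewrite FE.
have [|u [v [v0 E]]] := nfrac_poly pp p0 nfC (x := F x).
  move=> d dd; apply: inj_e; apply: (dx (fun y => ev i b (d (F y)))).
  have FD y z : F (y + z) = F y + F z by apply: inj2; rewrite rmorphD !FE.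
  have FM y z : F (y * z) = F y * F z by apply: inj2; rewrite rmorphM !FE.
  by split=> y z; rewrite ?FD ?FM ?dd.1 ?dd.2 rmorphD ?rmorphM ?FE.
exists (ev i b u), (ev i b v); split.
  by apply: contra v0 => /eqP H; apply/eqP/inj_e.
by rewrite -[x in _ * x]FE -!rmorphXn -rmorphM E.
Qed.

Lemma good_iso (C B : idomainType) (i : {rmorphism C -> B}) : injective i ->
  (forall x, exists c, i c = x) -> good C -> good B.
Proof.
move=> inj_i sur; apply: (good_step (b := 0) inj_i) => x; have [c <-] := sur x.
by exists c%:P; rewrite map_polyC hornerC.
Qed.

Lemma good_adjs (B : idomainType) (S : subring B) s : good (sr_dom S) -> good (sr_dom (adjs S s)).
Proof.
elim: s S => [|b s IH] S gS //; apply: IH.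
pose j : {rmorphism sr_dom S -> sr_dom (adj S b)} :=
  sr_corestr (S := adj S b) (f := (@sr_val B S : {rmorphism sr_dom S -> B})) (fun c => adj_incl b (sr_valP c)).
have [b1 b1E] := sr_lift (adj_gen S b).
apply: (good_step (i := j) (b := b1)) gS.
  by move=> x y E; apply: sr_val_inj; have := congr1 (@sr_val B (adj S b)) E.
move=> x; have [f fE] := adj_poly (sr_valP x); exists f; apply: sr_val_inj.
rewrite -[LHS](horner_map (@sr_val B (adj S b) : {rmorphism sr_dom (adj S b) -> B})) /=.
rewrite b1E -fE -map_poly_comp; congr (_.[_]); exact: eq_map_poly.
Qed.

(** * Regular loci over complete local rings, and Nagata's criterion *)

Lemma ipre_inj0 R S (f : {rmorphism R -> S}) : injective f ->
  ipre f (izero S) = izero R.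
Proof.
move=> inj_f; apply/ideal_eq/ideal_ext => x; split=> [fx|->]; last exact: (rmorph0 f).
by apply: inj_f; rewrite rmorph0; exact: fx.
Qed.

Lemma J0_iso R S (f : {rmorphism R -> S}) : injective f -> (forall y, exists x, f x = y) ->
  J0 R -> J0 S.
Proof.
move=> inj_f fS [x x0 xP]; exists (f x) => [E|P pP nfx]; first by apply/x0/inj_f; rewrite E rmorph0.
have [|d rd] := xP (ipre f P) (ipre_prime f pP); first exact: nfx.
by exists d; apply/(regat_surj fS); rewrite ipre_inj0.
Qed.

Lemma char_cases D : is_prime (izero D) ->
  (forall n, n.+1%:R <> 0 :> D) \/ exists2 p, prime p & p%:R = 0 :> D.
Proof.
move=> pD; have [p [m [pp m0 ct]]] := cohen_type_exists pD.
case: ct => [[p0 _]|pm|[H _]]; [by right; exists p|right; exists p => //; rewrite pm; exact: m0|left=> n; exact: H].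
Qed.

Lemma coef_ring_reg p D S (M : ideal D) (psi : {rmorphism S -> D}) d :
  coef_ring p M psi d -> forall P : ideal S, is_prime P -> P `<=` ipre psi M /\ exists e, regat (izero S) P e.
Proof.
move=> cS P pP; have PN : P `<=` ipre psi M := local_sub (cr_unit cS) pP.1.
by split=> //; apply: (serre (cr_noeth cS) pP PN (cr_reg cS)).
Qed.

Lemma good_coef_ring p D S (M : ideal D) (psi : {rmorphism S -> D}) d (cS : coef_ring p M psi d) :
  prime p -> (forall n, n.+1%:R <> 0 :> S) \/ p%:R = 0 :> S -> good (dom_ring (coef_ring_dom cS)).
Proof.
move=> pp ch; have pS := coef_ring_dom cS.
pose t := to_dom (coef_ring_dom cS).
have tS : forall y, exists x, t x = y by move=> y; exists y.
split.
- exact: noeth_surj tS (cr_noeth cS).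
- apply: (J0_iso (f := t)) => //; exists 1; first exact: pS.1.
  by move=> P pP _; apply: (coef_ring_reg cS pP).2.
case: ch => [ch|p0]; [left=> n; apply/eqP/ch|right; exists p; split=> // x dx].
have [//|y yE] := cr_der cS p0 (x := x).
by exists y, 1; rewrite oner_neq0 expr1n mul1r; split.
Qed.

Lemma adjs_min R (S S' : subring R) s : S `<=` S' -> (forall b, b \in s -> S' b) -> adjs S s `<=` S'.
Proof.
elim: s S => [|b s IH] S SS sS //=; apply: IH => [|c cs]; last by apply: sS; rewrite inE cs orbT.
by apply: adj_sub => //; apply: sS; rewrite mem_head.
Qed.

Lemma good_generated (C B : idomainType) (f : {rmorphism C -> B}) s : injective f ->
  (forall x, adjs (rimage f) s x) -> good C -> good B.
Proof.
move=> inj_f gen gC.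
pose j : {rmorphism C -> sr_dom (rimage f)} := sr_corestr (S := rimage f) (fun x => ex_intro _ x erefl).
have g1 : good (sr_dom (rimage f)).
  apply: (good_iso (i := j)) gC => [x y E|y].
    by apply: inj_f; have := congr1 (@sr_val B (rimage f)) E.
  by have [c cE] := sr_valP y; exists c; apply: sr_val_inj.
have g2 := good_adjs s g1.
apply: (good_iso (i := (@sr_val B _ : {rmorphism sr_dom (adjs (rimage f) s) -> B}))) g2.
  exact: sr_val_inj.
by move=> x; apply: sr_lift.
Qed.

Theorem good_clocal (D : idomainType) (M : ideal D) : clocal M -> good D.
Proof.
move=> cM; have pM := cl_prime cM.
have [p [m [ct ch]]] : exists p m, cohen_type p m M /\ ((forall n, n.+1%:R <> 0 :> D) \/ p%:R = 0 :> D).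
  case: (char_cases (idom_prime0 D)) => [ch|[p pp p0]].
    by have [p [m ct]] := cohen_type_exists pM; exists p, m; split=> //; left.
  by exists p, 0%N; split; [split=> //; apply: Or31|right].
have [d [S [psi [es [cS inj_psi span]]]]] := cohen_finite cM ct.
have gS : good (dom_ring (coef_ring_dom cS)).
  apply: good_coef_ring (ct_prime ct) _; case: ch => [ch|p0]; [left=> n n0|right].
    by apply: (ch n); rewrite -(rmorph_nat psi) n0 rmorph0.
  by apply: inj_psi; rewrite rmorph_nat p0 rmorph0.
pose f : {rmorphism dom_ring (coef_ring_dom cS) -> D} := psi \o of_dom (coef_ring_dom cS).
apply: (good_generated (f := f) (s := es)) gS => [x y E|x]; first by have := inj_psi _ _ E.
have [c ->] := span x; apply: srS => i _; have [H1 H2] := adjs_sub (rimage f) es.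
by apply: srM; [apply: H1; exists (c i)|apply/H2/mem_nth].
Qed.

Theorem J0_good (C : idomainType) (B : comPzRingType) (f : {rmorphism C -> B}) s : is_prime (izero B) -> injective f ->
  (forall x, adjs (rimage f) s x) -> good C -> J0 B.
Proof.
move=> pB inj_f gen gC; pose t := to_dom pB.
pose f' : {rmorphism C -> dom_ring pB} := t \o f.
suff [_ JB _] : good (dom_ring pB) by apply: (J0_iso (f := of_dom pB)) JB => // y; exists y.
apply: (good_generated (f := f') (s := map t s)) gC => // x.
pose S := adjs (rimage f') (map t s).
have S1 : [set y | S (t y)] 1 := sr1 S.
have SB y z : S (t y) -> S (t z) -> S (t (y - z)) by move=> Sy Sz; apply: (srB Sy Sz).
have SM y z : S (t y) -> S (t z) -> S (t (y * z)) by move=> Sy Sz; apply: (srM Sy Sz).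
have [H1 H2] := adjs_sub (rimage f') (map t s).
apply: (@adjs_min _ (rimage f) (Subring S1 SB SM) s _ _ _ (gen x)) => [_ [c <-]|b bs].
  by apply: H1; exists c.
by apply/H2/mapP; exists b.
Qed.

Lemma clocal_dom D (M : ideal D) (pD : is_prime (izero D)) : clocal M ->
  exists M' : ideal (dom_ring pD), clocal M'.
Proof.
move=> cM; have S y : exists x, to_dom pD x = y by exists y.
exists (iimg S M); apply: (clocal_surj cM) => x E; have -> : x = 0 := E; exact: ideal0.
Qed.

(** The image of D in B is again a complete local domain, hence [good], and B is generated over it
    by finitely many elements. *)
Theorem J0_complete (D B : comPzRingType) (M : ideal D) (f : {rmorphism D -> B}) : clocal M ->
  is_prime (izero B) -> finite_type f -> J0 B.
Proof.
move=> cM pB /finite_typeP[s sP].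
pose D1 := sr_ring (rimage f).
pose g : {rmorphism D -> D1} := sr_corestr (S := rimage f) (fun x => ex_intro _ x erefl).
have gS : forall y, exists x, g x = y by move=> y; have [c cE] := sr_valP y; exists c; apply: sr_val_inj.
have kM : ipre g (izero D1) `<=` M.
  move=> x gx; apply: contrapT => /(cl_unit cM)[y xy].
  have : f 1 = 0 by rewrite -xy rmorphM -[f x](sr_corestrE (S := rimage f) (fun x => ex_intro _ x erefl)) -/g (_ : g x = 0) // rmorph0 mul0r.
  by rewrite rmorph1 => /pB.1.
have c1 := clocal_surj cM gS kM.
have p1 : is_prime (izero D1).
  have := ipre_prime (@sr_val B (rimage f) : {rmorphism D1 -> B}) pB.
  by rewrite ipre_inj0 //; apply: sr_val_inj.
have [M2 c2] := clocal_dom p1 c1; have g2 := good_clocal c2.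
pose h : {rmorphism dom_ring p1 -> B} := (@sr_val B (rimage f) : {rmorphism D1 -> B}) \o of_dom p1.
apply: (@J0_good (dom_ring p1) B h s pB) => // [x y E|x]; first exact: sr_val_inj.
have [H1 H2] := adjs_sub (rimage h) s.
apply: adjs_min (sP x) => [_ [c <-]|]; last exact: H2.
by apply: H1; exists (g c).
Qed.

Lemma outside_product R (p : ideal R) (qs : seq (ideal R)) : is_prime p ->
  (forall q, List.In q qs -> ~ q `<=` p) -> exists2 y, ~ p y & forall q, List.In q qs -> q y.
Proof.
move=> pp; elim: qs => [|q qs IH] H; first by exists 1; [exact: pp.1|].
have [|y py yq] := IH; first by move=> q' q's; apply: H; right.
have [z qz pz] : exists2 z, q z & ~ p z.
  by apply: contrapT => no; apply: (H q); [left|move=> z qz; apply: contrapT => pz; apply: no; exists z].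
exists (z * y); first by move=> /pp.2[].
by move=> q' [<-|/yq q'y]; [apply: idealMl|apply: idealM].
Qed.

Definition singular_ideal (B : comPzRingType) : ideal B :=
  icap (fun P => is_prime P /\ ~ exists d, regat (izero B) P d).

(** Let E be the intersection of the nonregular primes, and suppose a regular P contains E. A
    minimal prime p of E below P is regular. J-0 of B/p and [regat_ext] give f g outside p such that
    all primes above p avoiding f g are regular. Multiplying by y from the other listed primes puts
    f g y in E but not in p. *)
Theorem nagata (B : comPzRingType) : noetherian B ->
  (forall P : ideal B, is_prime P -> J0 (quotient_ring P)) -> zariski_open (@regular_locus B).
Proof.
move=> noeth JB; pose reg (P : ideal B) := exists d, regat (izero B) P d.
pose E := singular_ideal B.
exists E; apply/seteqP; split=> P.
  by move=> nP x Ex; apply: Ex; split; [exact: Defs.primeP|move=> rP; apply: nP; apply/(regularP noeth)].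
move=> EP /(regularP noeth)[d rd]; have pP := Defs.primeP P.
have [p mp pP'] := min_prime_below noeth pP EP; have [pp Ep pmin] := mp.
have [e re] := serre noeth pp pP' rd.
have [f pf fP] := regat_ext noeth re.
have [g' g'0 gP] := JB p pp; have [g gE] := quot_surj g'.
have pg : ~ p g by move=> H; apply: g'0; rewrite -gE; apply/quot_eq0.
have loc Q : is_prime Q -> p `<=` Q -> ~ Q (f * g) -> reg Q.
  move=> pQ pQ' nQ; have kQ : ipre (quotient_map p) (izero _) `<=` Q.
    by move=> x /quot_eq0/pQ'.
  have [||k rk] := gP (iimg (@quot_surj B p) Q).
  - exact: iimg_prime.
  - by rewrite -gE => /(iimgP _ _ kQ) Qg; apply/nQ/idealM.
  exists (e + k)%N; apply: fP; first by move=> Qf; apply/nQ/idealMl.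
  have := (regat_surj (@quot_surj B p) _ _ _).1 rk.
  have -> : ipre (quotient_map p) (iimg (@quot_surj B p) Q) = Q.
    by apply/ideal_eq/ideal_ext => x; apply: iimgP.
  by rewrite ipre_quot.
have [ps [psP psE]] := primes_over noeth E.
have [qs qsE] := filter_In ps (fun q => ~ q `<=` p).
have [|y py yq] := @outside_product B p qs pp; first by move=> q /qsE[].
suff /Ep/pp.2[/pp.2[]|] : E (f * g * y) by [].
move=> Q [pQ nQ]; have EQ : E `<=` Q by move=> x; apply.
have [q qps qQ] := psE Q pQ EQ.
have [qp|qp] := pselect (q `<=` p); last by apply/idealM/qQ/yq/qsE.
have [pq _] := psP q qps.
apply: idealMl; apply: contrapT => nfg; apply: nQ; apply: loc => // x px.
by apply: qQ; apply: (pmin q) => //; case: (psP q qps).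
Qed.

(** * Dimension functions and catenarity *)

Definition dimfun R (del : ideal R -> nat) := forall P Q : ideal R,
  is_prime P -> is_prime Q -> P `<=` Q ->
  ht_ge P Q (del Q - del P) /\ forall e, ht_ge P Q e -> (del P + e <= del Q)%N.

(** Along a saturated chain the function grows by exactly one per step: a larger jump would provide
    a prime to insert. *)
Lemma dimfun_catenary R (del : ideal R -> nat) : dimfun del -> catenary R.
Proof.
move=> dd.
suff H d (c : nat -> Spec R) (P Q : Spec R) : saturated_chain P Q d c -> (del P + d = del Q)%N.
  by move=> P Q PQ d c d' c' /H E /H E'; apply/eqP; rewrite -(eqn_add2l (del P)) E E'.
move=> [c0 cd ch sat]; rewrite -(ideal_eq c0) -(ideal_eq cd).
have : (d <= d)%N by []; elim: {-2}d => [|k IH] kd; first by rewrite addn0.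
rewrite addnS IH ?(ltnW kd) //.
have [H1 H2] := ch k kd.
have [g le] := dd _ _ (Defs.primeP (c k)) (Defs.primeP (c k.+1)) H1.
have l1 : ht_ge (c k) (c k.+1) 1.
  by apply: (ht_geS (Defs.primeP _) _ (ch k kd)); apply: ht_ge0 => //; apply: Defs.primeP.
have := le 1%N l1; rewrite addn1 leq_eqVlt => /orP[/eqP //|lt2].
have g2 : ht_ge (c k) (c k.+1) 2 by apply: ht_ge_le g; rewrite ltn_subRL addn1.
have [Q1 h1 q1] := ht_ge_pred g2; have [Q0 h0 q0] := ht_ge_pred h1.
case: (sat k kd (PrimeIdeal (ht_ge_prime h1))); split=> //=.
by have Hc := ht_ge_I h0; have [q01 q02] := q0; split=> [x /Hc/q01//|H]; apply: q02 => x /H/Hc.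
Qed.

Lemma dimfun_surj R S (f : {rmorphism R -> S}) del : (forall y, exists x, f x = y) ->
  dimfun del -> dimfun (fun P : ideal S => del (ipre f P)).
Proof.
move=> fS dd P Q pP pQ PQ; have [g le] := dd _ _ (ipre_prime f pP) (ipre_prime f pQ) (fun x => PQ (f x)).
by split=> [|e]; [apply/(ht_ge_surj fS)|move/(ht_ge_surj fS)/le].
Qed.

(** D is a quotient of a regular local ring S, where the dimension of the localisation is such a
    function by [regat_dim]. *)
Theorem dimfun_complete D (M : ideal D) : clocal M -> is_prime (izero D) -> exists del, @dimfun D del.
Proof.
move=> cM pD.
have [M2 c2] := clocal_dom pD cM; have [p [d [S [psi [cS psiS]]]]] := cohen_quotient c2.
pose phi : {rmorphism S -> D} := of_dom pD \o psi.
suff [del dd] : exists del, @dimfun S del.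
  exists (fun P => del (ipre phi P)); apply: dimfun_surj dd => y.
  by have [x xE] := psiS y; exists x; rewrite /= xE.
have nS := cr_noeth cS.
have /choice[del delP] : forall P : ideal S, exists e, is_prime P -> regat (izero S) P e.
  move=> P; have [pP|] := pselect (is_prime P); last by exists 0%N.
  by have [_ [e re]] := coef_ring_reg cS pP; exists e.
exists del => P Q pP pQ PQ.
have rP := delP P pP; have rQ := delP Q pQ.
have htreg I e : regat (izero S) I e -> ht_ge (izero S) I e by move=> [_ [s []]].
have z0 : izero S `<=` P by move=> x ->.
have [k kn [h1 h2]] := regat_dim nS pQ rQ pP z0 PQ.
have kP : k = del P.
  apply/eqP; rewrite eqn_leq (regat_ht nS rP h1) /=.
  have := regat_ht nS rQ (ht_ge_cat (htreg _ _ rP) h2).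
  by rewrite -{2}(subnKC kn) leq_add2r.
split=> [|e he]; first by rewrite -kP.
exact: (regat_ht nS rQ (ht_ge_cat (htreg _ _ rP) he)).
Qed.

(** * Comparison of cardinalities through finite trees *)

Section Trees.
(** The same trees serve as codes and, through [evl], as ring expressions. Finite trees over an
    infinite set are no more numerous than the set, so injections into trees replace cardinal
    arithmetic. *)
Inductive tr (A : Type) := Lf of A | Nd of nat | Br of nat & tr A & tr A.
Arguments Nd {A}.

Fixpoint lvs (A : Type) (X : A -> Prop) (t : tr A) : Prop :=
  match t with Lf a => X a | Nd _ => True | Br _ l r => lvs X l /\ lvs X r end.

Lemma lvs_mono (A : Type) (X Y : A -> Prop) t : (forall a, X a -> Y a) -> lvs X t -> lvs Y t.
Proof. by move=> XY; elim: t => [a|n|n l IHl r IHr]; [exact: XY| |move=> [/IHl ? /IHr ?]]. Qed.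

(** Label 0 marks a substituted leaf and the old branchings are shifted, which makes substitution
    injective. *)
Fixpoint tsub (A B : Type) (f : A -> tr B) (t : tr A) : tr B :=
  match t with Lf a => Br 0 (f a) (Nd 0) | Nd n => Nd n | Br n l r => Br n.+1 (tsub f l) (tsub f r) end.

Lemma tsub_inj (A B : Type) (f : A -> tr B) : injective f -> injective (tsub f).
Proof.
move=> fi; elim=> [a|n|n l IHl r IHr] [b|m|m l' r'] //=; first by move=> [/fi ->].
  by move=> [->].
by move=> [-> /IHl -> /IHr ->].
Qed.

Lemma lvs_tsub (A B : Type) (f : A -> tr B) (X : A -> Prop) (Y : B -> Prop) t :
  (forall a, X a -> lvs Y (f a)) -> lvs X t -> lvs Y (tsub f t).
Proof.
move=> XY; elim: t => [a /XY H|n|n l IHl r IHr [/IHl ? /IHr ?]] //; by split.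
Qed.

Definition tdrop1 (A : Type) (s : A) (a : A) : tr A := if pselect (a = s) then Nd 0 else Lf a.
(** Shifting the numerals frees [Nd 0] to stand for the dropped leaf, so no information is lost. *)
Fixpoint tdrop (A : Type) (s : A) (t : tr A) : tr A :=
  match t with Lf a => tdrop1 s a | Nd n => Nd n.+1 | Br n l r => Br n (tdrop s l) (tdrop s r) end.

Lemma tdrop_inj (A : Type) (s : A) : injective (tdrop s).
Proof.
elim=> [a|n|n l IHl r IHr] [b|m|m l' r'] //=; rewrite /tdrop1; try by case: pselect.
- by case: pselect => ea; case: pselect => eb //= _; congr Lf; rewrite ea eb.
- by move=> [->].
- by move=> [-> /IHl -> /IHr ->].
Qed.

Lemma lvs_tdrop (A : Type) (s : A) (X Y : A -> Prop) t : (forall a, X a -> a <> s -> Y a) -> lvs X t -> lvs Y (tdrop s t).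
Proof.
move=> XY; elim: t => [a Xa|n|n l IHl r IHr [/IHl ? /IHr ?]] //=.
by rewrite /tdrop1; case: pselect => //= ne; apply: XY.
Qed.

Fixpoint tcode (A : Type) (t : tr A) : nat :=
  match t with Lf _ => 0%N | Nd n => pickle (0%N, n, 0%N, 0%N) | Br n l r => pickle (1%N, n, tcode l, tcode r) end.

Lemma tcode_inj (A : Type) (t t' : tr A) : lvs (fun=> False) t -> lvs (fun=> False) t' -> tcode t = tcode t' -> t = t'.
Proof.
elim: t t' => [a|n|n l IHl r IHr] [b|m|m l' r'] //.
- by move=> _ _ /(pcan_inj pickleK)[->].
- by move=> _ _ /(pcan_inj pickleK).
- by move=> _ _ /(pcan_inj pickleK).
- by move=> [? ?] [? ?] /(pcan_inj pickleK)[-> /IHl -> // /IHr ->].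
Qed.

Fixpoint tchain (A : Type) (n : nat) (ts : nat -> tr A) : tr A :=
  if n is n'.+1 then Br 0 (ts 0%N) (tchain n' (fun i => ts i.+1)) else Nd 0.

Lemma tchain_inj (A : Type) n m (ts us : nat -> tr A) : tchain n ts = tchain m us ->
  n = m /\ forall i, (i < n)%N -> ts i = us i.
Proof.
elim: n m ts us => [|n IH] [|m] ts us //= [E /IH[-> H]]; split=> // -[|i] //; exact: H.
Qed.

Lemma lvs_tchain (A : Type) (X : A -> Prop) n (ts : nat -> tr A) : (forall i, lvs X (ts i)) -> lvs X (tchain n ts).
Proof. by elim: n ts => //= n IH ts H; split=> //; apply: IH. Qed.

(** Up to countable sets, X is at least as large as U. *)
Definition big (U : Type) (X : U -> Prop) := exists g : U -> tr U, injective g /\ forall c, lvs X (g c).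

(** Trees without leaves are countable, and Cantor's diagonal argument applies once k has two
    elements. *)
Lemma big_empty (k : Type) (a b : k) : a <> b -> ~ big (U := nat -> k) (fun=> False).
Proof.
move=> ab [g [gi gl]]; pose h c := tcode (g c).
have hi : injective h by move=> c d /(tcode_inj (gl c) (gl d))/gi.
pose flip (x : k) := if pselect (x = a) then b else a.
have flipP x : flip x <> x.
  by rewrite /flip; case: pselect => e; [subst; exact: nesym|exact: nesym].
pose c n := if pselect (exists d, h d = n) is left e then flip (projT1 (cid e) n) else a.
have E : c (h c) = flip (c (h c)).
  rewrite {1}/c; case: pselect => [e|]; last by case; exists c.
  by case: cid => d /= /hi ->.
exact: (flipP _ (esym E)).
Qed.
End Trees.
Arguments Nd {A}.

(** * Well-orders and recursion along them *)

Section WellOrder.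
Lemma well_order_prop (A : Type) : exists lt : A -> A -> Prop, well_founded lt /\ forall x y, [\/ x = y, lt x y | lt y x].
Proof.
have [R Rwo] := well_ordering_principle {classic A}.
have minP (P : A -> Prop) : (exists x, P x) -> exists2 m, P m & forall x, P x -> R m x.
  move=> [x Px]; have [|m [[Pm mP] _]] := Rwo (fun x => `[< P x >]).
    by exists x; rewrite unfold_in; apply/asboolP.
  exists m; first by move: Pm; rewrite unfold_in => /asboolP.
  by move=> y Py; apply: mP; rewrite unfold_in; apply/asboolP.
have anti x y : R x y -> R y x -> x = y.
  move=> xy yx; have [|m [_ mU]] := Rwo (fun z => `[< z = x \/ z = y >]).
    by exists x; rewrite unfold_in; apply/asboolP; left.
  have rr z : R z z by have [|m' -> /(_ z erefl)] // := minP (eq^~ z); exists z.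
  rewrite -(mU x); last first.
    split; first by rewrite unfold_in; apply/asboolP; left.
    by move=> z; rewrite unfold_in => /asboolP[->|->].
  apply: mU; split; first by rewrite unfold_in; apply/asboolP; right.
  by move=> z; rewrite unfold_in => /asboolP[->|->].
exists (fun x y => R x y /\ x <> y); split; last first.
  move=> x y; have [xy|xy] := pselect (x = y); first exact: Or31.
  have [|m H mP] := minP (fun z => z = x \/ z = y); first by exists x; left.
  case: H => E; rewrite E in mP; [apply: Or32|apply: Or33]; split; [by apply: mP; right| |by apply: mP; left|]; by [|exact: nesym].
move=> x; apply: contrapT => nx.
have [|m nm mP] := minP (fun z => ~ Acc (fun x y => R x y /\ x <> y) z); first by exists x.
apply: nm; split=> y [ym ne]; apply: contrapT => ny; apply/ne/anti => //; exact: mP.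
Qed.

Variables (A : Type) (lt : A -> A -> Prop).
Hypothesis wf : well_founded lt.
Hypothesis tot : forall x y, [\/ x = y, lt x y | lt y x].

Lemma wo_asym x y : lt x y -> ~ lt y x.
Proof. by elim: (wf x) y => z _ IH y zy yz; apply: (IH y yz z). Qed.

Lemma wo_trans x y z : lt x y -> lt y z -> lt x z.
Proof.
move=> xy yz; case: (tot x z) => [xz|//|zx]; first by rewrite xz in xy; case: (wo_asym xy).
exfalso; move: y z xy yz zx; elim: (wf x) => u _ IH y z uy yz zu; exact: (IH z zu u y).
Qed.

Lemma wo_min (P : A -> Prop) : (exists x, P x) -> exists2 m, P m & forall x, P x -> ~ lt x m.
Proof.
move=> [x Px]; apply: contrapT => no; move: Px; elim: (wf x) => y _ IH Py.
by apply: no; exists y => // z Pz zy; apply: (IH z).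
Qed.

(** F is shown earlier values only; the default d replaces all others. *)
Lemma wf_fix (T : Type) (d : T) (F : A -> (A -> T) -> T) :
  exists w : A -> T, forall i, w i = F i (fun j => if pselect (lt j i) then w j else d).
Proof.
pose G i (rec : forall j, lt j i -> T) := F i (fun j => if pselect (lt j i) is left h then rec j h else d).
exists (Fix wf (fun=> T) G) => i; rewrite {1}Fix_eq.
  by rewrite /G; congr (F i _); apply/funext => j; case: pselect.
by move=> x f g fg; rewrite /G; congr (F x _); apply/funext => j; case: pselect.
Qed.
End WellOrder.

Section Lex.
Variables (A I : Type) (lt : A -> A -> Prop) (li : I -> I -> Prop) (rk : I -> A).
Hypotheses (wf : well_founded lt) (tot : forall x y, [\/ x = y, lt x y | lt y x]).
Hypotheses (wfi : well_founded li) (toti : forall x y, [\/ x = y, li x y | li y x]).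
Definition prec j i := lt (rk j) (rk i) \/ (rk j = rk i /\ li j i).
Lemma prec_wf : well_founded prec.
Proof.
suff H a : forall i, rk i = a -> Acc prec i by move=> i; exact: (H (rk i)).
elim: (wf a) => b _ IH i; elim: (wfi i) => j _ IHj rj; split=> l [|[E lj]].
  by rewrite rj => /IH; apply.
by apply: IHj; rewrite // E.
Qed.
Lemma prec_tot x y : [\/ x = y, prec x y | prec y x].
Proof.
case: (tot (rk x) (rk y)) => [E|H|H]; [|by apply: Or32; left|by apply: Or33; left].
by case: (toti x y) => [->|H|H]; [apply: Or31|apply: Or32; right|apply: Or33; right].
Qed.
End Lex.

(** Plays the part of an initial ordinal. If some segment is big, S is the segment below the least x
    whose segment is big; otherwise S is everything. *)
Lemma small_alphabet (U : Type) : exists (lt : U -> U -> Prop) (S : U -> Prop),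
  [/\ well_founded lt, forall x y, [\/ x = y, lt x y | lt y x],
   exists J : U -> tr U, injective J /\ forall c, lvs S (J c) &
   forall x, S x -> ~ big (fun y => lt y x)].
Proof.
have [lt [wf tot]] := well_order_prop U; exists lt.
have [[x0 bx0]|no] := pselect (exists x, big (fun y => lt y x)).
  have [|x bx xmin] := wo_min wf (P := fun x => big (fun y => lt y x)); first by exists x0.
  exists (fun y => lt y x); split=> // y yx bY; exact: (xmin y).
exists (fun=> True); split=> // [|x _ bx]; last by apply: no; exists x.
by exists (@Lf U); split=> // a b [].
Qed.

Lemma rank_exists (U : Type) (lt : U -> U -> Prop) (S : U -> Prop) t : well_founded lt ->
  (forall x y, [\/ x = y, lt x y | lt y x]) -> lvs S t ->
  lvs (fun=> False) t \/ exists2 s, S s & lvs (fun x => x = s \/ lt x s) t.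
Proof.
move=> wf tot; elim: t => [a|n|n l IHl r IHr] /=.
- by move=> Sa; right; exists a => //; left.
- by left.
move=> [/IHl[Hl|[s Ss Hs]] /IHr[Hr|[s' Ss' Hs']]].
- by left.
- by right; exists s' => //; split=> //; apply: lvs_mono Hl.
- by right; exists s => //; split=> //; apply: lvs_mono Hr.
- right; case: (tot s s') => [E|H|H].
  + by exists s => //; split=> //; rewrite E.
  + by exists s' => //; split=> //; apply: lvs_mono Hs => x [->|xs]; right=> //; apply: (wo_trans wf tot) H.
  + by exists s => //; split=> //; apply: lvs_mono Hs' => x [->|xs]; right=> //; apply: (wo_trans wf tot) H.
Qed.

Definition olt (U : Type) (lt : U -> U -> Prop) (x y : option U) :=
  match x, y with None, Some _ => True | Some a, Some b => lt a b | _, None => False end.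
Lemma olt_wf (U : Type) (lt : U -> U -> Prop) : well_founded lt -> well_founded (olt lt).
Proof.
move=> wf; have N : Acc (olt lt) None by split=> -[].
case=> [a|]; last exact: N.
by elim: (wf a) => b _ IH; split=> -[c|] H; [exact: IH|exact: N].
Qed.
Lemma olt_tot (U : Type) (lt : U -> U -> Prop) : (forall x y, [\/ x = y, lt x y | lt y x]) ->
  forall x y, [\/ x = y, olt lt x y | olt lt y x].
Proof.
move=> tot [a|] [b|]; [|exact: Or33|exact: Or32|exact: Or31].
by case: (tot a b) => [->|H|H]; [apply: Or31|apply: Or32|apply: Or33].
Qed.

(** * Size of a complete local ring and separated families in it *)

Lemma prime_sep R (P : ideal R) n (c : nat -> R) (xs : seq R) : is_prime P ->
  (exists2 i, (i < n)%N & ~ P (c i)) ->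
  (forall i j, (i < j < size xs)%N -> ~ P (xs`_i - xs`_j)) ->
  (forall x, x \in xs -> P (\sum_(i < n) c i * x ^+ i)) -> (size xs < n)%N.
Proof.
move=> pP [i0 i0n ci0] sep rt.
have pq := quot_dom pP.
pose D := dom_ring pq; pose f : {rmorphism R -> D} := to_dom pq \o quotient_map P.
have f0 x : (f x == 0) = `[< P x >].
  by apply/eqP/asboolP => [/quot_eq0|Px] //; apply/(quot_eq0 P).
pose F : {poly D} := \poly_(i < n) f (c i).
have F0 : F != 0.
  apply/eqP => /(congr1 (fun p : {poly D} => p`_i0)); rewrite coef_poly i0n coef0 => /eqP.
  by rewrite f0 => /asboolP.
have := max_poly_roots (rs := map f xs) F0; rewrite size_map => H.
apply: leq_trans (size_poly n _); apply: H.
  apply/allP => _ /mapP[x /rt Px ->]; rewrite /root horner_poly.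
  have -> : \sum_(i < n) f (c i) * f x ^+ i = f (\sum_(i < n) c i * x ^+ i).
    by rewrite rmorph_sum; apply: eq_bigr => i _; rewrite rmorphM rmorphXn.
  by rewrite f0; apply/asboolP.
apply/(uniqP 0) => i j; rewrite !inE size_map => ilt jlt.
rewrite !(nth_map 0) // => /eqP; rewrite -subr_eq0 -rmorphB f0 => /asboolP Pij.
case: (ltngtP i j) => // ij; [case: (sep i j)|case: (sep j i)]; rewrite ?ij //.
by rewrite -opprB; apply: idealN.
Qed.

Lemma finite_index (U : choiceType) (X : U -> Prop) n : (forall l : seq U, uniq l -> (forall x, x \in l -> X x) -> (size l < n)%N) ->
  exists r : U -> nat, forall x y, X x -> X y -> r x = r y -> x = y.
Proof.
move=> H.
have [||m [l [ul lX sl]] mmax] := @max_nat (fun m => exists l : seq U, [/\ uniq l, forall x, x \in l -> X x & size l = m]) n.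
- by exists 0%N, [::].
- by move=> m [l [ul lX <-]]; apply/ltnW/H.
exists (fun x => index x l).
have Xl x : X x -> x \in l.
  move=> Xx; apply: contraT => nxl; have := mmax m.+1; rewrite ltnn; apply.
  exists (x :: l); split; rewrite /= ?nxl ?sl // => y.
  by rewrite inE => /predU1P[->|/lX].
by move=> x y /Xl xl /Xl yl E; rewrite -(nth_index x xl) E nth_index.
Qed.

Section Coordinates.
Variables (T : comPzRingType) (M : ideal T).
Hypothesis cM : clocal M.
Let k := quotient_ring M.
Definition rep (a : k) : T := cs_repr a.
Lemma repK a : quotient_map M (rep a) = a. Proof. exact: cs_reprK. Qed.
Lemma rep_mod x : M (x - rep (quotient_map M x)).
Proof. by apply/(quot_eq0 M); rewrite rmorphB repK subrr. Qed.
Lemma rep_inj a b : M (rep a - rep b) -> a = b.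
Proof. by move=> /(quot_eq0 M)/eqP; rewrite rmorphB !repK subr_eq0 => /eqP. Qed.

(** The coordinates of x are its residue class and, recursively, those of the coefficients when x
    minus its representative is written in generators of M. *)
Lemma coord_pow n : exists e : T -> nat -> k, forall x y, e x = e y -> ipow M n (x - y).
Proof.
have [xs xsE] := noeth_fg (cl_noeth cM) M.
elim: n => [|n [e eP]]; first by exists (fun _ _ => 0) => x y _; apply: ipow0.
have /choice[a aP] : forall x, exists a : nat -> T, x - rep (quotient_map M x) = \sum_(i < size xs) a i * xs`_i.
  by move=> x; have /xsE/igenP[a aE] := rep_mod x; exists a.
exists (fun x m => if (unpickle m : option (nat * nat)) is Some (i, l) then
   (if i is j.+1 then e (a x j) l else quotient_map M x) else 0) => x y E.
have E0 : quotient_map M x = quotient_map M y.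
  by have := congr1 (fun h : nat -> k => h (pickle (0%N, 0%N))) E; cbv beta; rewrite pickleK.
have Ea j : e (a x j) = e (a y j).
  by apply/funext => l; have := congr1 (fun h : nat -> k => h (pickle (j.+1, l))) E; cbv beta; rewrite pickleK.
have -> : x - y = (x - rep (quotient_map M x)) - (y - rep (quotient_map M y)) by rewrite E0; ring.
rewrite !aP -sumrB; apply: idealS => i _; rewrite -mulrBl mulrC.
by apply: ipowS; [apply/xsE/igen_mem/mem_nth|apply: eP].
Qed.

Lemma coord_inj : exists e : T * T -> nat -> k, injective e.
Proof.
have /choice[e eP] := coord_pow.
exists (fun xy m => if (unpickle m : option (bool * (nat * nat))) is Some (b, (n, l)) then
  e n (if b then xy.1 else xy.2) l else 0) => -[x y] [x' y'] E.
have H b n : e n (if b then x else y) = e n (if b then x' else y').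
  by apply/funext => l; have := congr1 (fun h : nat -> k => h (pickle (b, (n, l)))) E; cbv beta; rewrite pickleK.
congr pair; apply/subr0_eq/(cl_sep cM) => n; apply: eP; [exact: (H true)|exact: (H false)].
Qed.

Variables (tau : T) (Mtau : M tau).
Lemma series_lim (c : nat -> k) : exists l, forall n, ipow M n (l - \sum_(0 <= j < n) rep (c j) * tau ^+ j).
Proof.
apply: (cl_conv cM) => n; rewrite big_nat_recr //= addrAC subrr add0r.
by apply/idealM/ipowX.
Qed.
Definition series (c : nat -> k) : T := projT1 (cid (series_lim c)).
Lemma seriesP c n : ipow M n (series c - \sum_(0 <= j < n) rep (c j) * tau ^+ j).
Proof. by rewrite /series; case: cid. Qed.
Lemma series_shift c : series c = rep (c 0%N) + tau * series (fun j => c j.+1).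
Proof.
apply/subr0_eq/(cl_sep cM) => n.
have H := ipowS_sub (seriesP c n.+1); have H' := idealM tau (seriesP (fun j => c j.+1) n).
have -> : series c - (rep (c 0%N) + tau * series (fun j => c j.+1)) =
  (series c - \sum_(0 <= j < n.+1) rep (c j) * tau ^+ j) - tau * (series (fun j => c j.+1) - \sum_(0 <= j < n) rep (c j.+1) * tau ^+ j).
  rewrite big_nat_recl // expr0 mulr1.
  have -> : \sum_(0 <= i < n) rep (c i.+1) * tau ^+ i.+1 = tau * \sum_(0 <= j < n) rep (c j.+1) * tau ^+ j.
    by rewrite mulr_sumr; apply: eq_bigr => j _; rewrite exprS mulrCA.
  ring.
exact: idealB.
Qed.
(** At the first index where c and d differ, the difference of the series is a power of tau times a
    unit. *)
Lemma series_sep (P : ideal T) c d : is_prime P -> ~ P tau -> c <> d -> ~ P (series c - series d).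
Proof.
move=> pP Pt cd.
have [m mP] : exists m, c m <> d m by apply: contrapT => H; apply/cd/funext => m; apply: contrapT => H'; apply: H; exists m.
have sep0 c' d' : c' 0%N <> d' 0%N -> ~ P (series c' - series d').
  rewrite (series_shift c') (series_shift d') => ne H.
  suff nM : ~ M (rep (c' 0%N) + tau * series (fun j => c' j.+1) - (rep (d' 0%N) + tau * series (fun j => d' j.+1))).
    by have := unit_ideal (cl_unit cM nM) H; apply: pP.1.
  move=> H'; apply/ne/rep_inj.
  have := idealB H' (idealMl (series (fun j => c' j.+1) - series (fun j => d' j.+1)) Mtau).
  by congr (M _); ring.
elim: m c d mP {cd} => [|m IH] c d mP; first exact: sep0.
have [E0|] := pselect (c 0%N = d 0%N); last exact: sep0.
rewrite (series_shift c) (series_shift d) E0.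
have -> : forall a b u v : T, a + u * v - (a + u * b) = u * (v - b) by move=> a b u v; ring.
by case/pP.2 => //; apply: IH.
Qed.
End Coordinates.

Lemma bij_inverse R S (f : {rmorphism R -> S}) : bijective f ->
  exists g : {rmorphism S -> R}, cancel f g /\ cancel g f.
Proof.
move=> [g fg gf].
have gB : zmod_morphism g by move=> x y; apply: (can_inj fg); rewrite rmorphB !gf.
have gM : monoid_morphism g.
  by split=> [|x y]; apply: (can_inj fg); rewrite ?rmorph1 ?rmorphM !gf.
pose g' : {rmorphism S -> R} := HB.pack g (GRing.isZmodMorphism.Build S R g gB) (GRing.isMonoidMorphism.Build S R g gM).
by exists g'.
Qed.

Lemma bij_inj_surj (X Y : Type) (f : X -> Y) : injective f -> (forall y, exists x, f x = y) -> bijective f.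
Proof.
move=> fi /choice[g gP]; exists g => // x; apply/fi/gP.
Qed.

(** * Rings whose localisations are fields *)

Section SubringVal.
Variables (R : comPzRingType) (S : subring R).
Implicit Types x y : sr_ring S.
Lemma sr_valM x y : sr_val (x * y) = sr_val x * sr_val y. Proof. by []. Qed.
Lemma sr_valD x y : sr_val (x + y) = sr_val x + sr_val y. Proof. by []. Qed.
Lemma sr_valX x n : sr_val (x ^+ n) = sr_val x ^+ n. Proof. exact: (rmorphXn (@sr_val R S)). Qed.
Lemma sr_val_sum n (F : nat -> sr_ring S) : sr_val (\sum_(k < n) F k) = \sum_(k < n) sr_val (F k).
Proof. exact: (rmorph_sum (@sr_val R S)). Qed.
End SubringVal.

(** All localisations at primes are fields. With the Noetherian property this gives regularity, and
    it survives separable adjunctions. *)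
Definition punctual R := forall Q : ideal R, is_prime Q -> forall x, Q x -> exists2 t, ~ Q t & t * x = 0.

Lemma punctual_regular R : noetherian R -> punctual R -> regular_ring R.
Proof.
move=> nR pR; split=> // P; apply/regularP => //; exists 0%N; have pP := Defs.primeP P; split=> //.
exists [::]; split=> // [x Px|].
  by have [t Pt E] := pR P pP x Px; exists t => //; rewrite E.
by apply: ht_ge0 => // x ->.
Qed.

Lemma punctual_surj R S (f : {rmorphism R -> S}) : (forall y, exists x, f x = y) ->
  punctual R -> punctual S.
Proof.
move=> fS pR Q pQ y; have [x <-] := fS y => Qx.
have [t Qt tx] := pR (ipre f Q) (ipre_prime f pQ) x Qx.
by exists (f t) => //; rewrite -rmorphM tx rmorph0.
Qed.

Section Nonzero.
Variables (R : comPzRingType) (R1 : 1 <> 0 :> R).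
Definition nzT (_ : 1 <> 0 :> R) : Type := R.
HB.instance Definition _ := GRing.ComPzRing.copy (nzT R1) R.
Lemma nzT_neq0 : (1 : nzT R1) != 0.
Proof. exact/eqP. Qed.
HB.instance Definition _ := GRing.PzSemiRing_isNonZero.Build (nzT R1) nzT_neq0.
Definition nz_ring : comNzRingType := nzT R1.
End Nonzero.

(* A separable relation f0 (b) = 0, f0' (b) invertible: differentiating s h = q d for a polynomial d of minimal
   degree vanishing at the prime shows that q (b) is a cofactor outside the prime which kills d (b). *)
Section Separable.
Variables (V B : comNzRingType) (j : {rmorphism V -> B}) (b : B).
Hypothesis gen : forall x, exists f : {poly V}, (map_poly j f).[b] = x.
Hypothesis pV : punctual V.
Variable f0 : {poly V}.
Hypotheses (f0b : (map_poly j f0).[b] = 0) (f0'b : is_unit (map_poly j f0^`()).[b]).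

Let e : {rmorphism {poly V} -> B} := horner_eval b \o map_poly j.
Let eE f : e f = (map_poly j f).[b]. Proof. by []. Qed.
Let eC c : e c%:P = j c. Proof. by rewrite eE map_polyC hornerC. Qed.
Let eZ c f : e (c *: f) = j c * e f. Proof. by rewrite -mul_polyC rmorphM eC. Qed.

Lemma punctual_coef (p : ideal V) (r : {poly V}) : is_prime p -> (forall k, p r`_k) -> exists2 s, ~ p s & s *: r = 0.
Proof.
move=> pp rp; have /choice[t tP] : forall k, exists t, ~ p t /\ t * r`_k = 0.
  by move=> k; have [t pt tr] := pV pp (rp k); exists t.
exists (\prod_(k < size r) t k); first by apply: prod_outside => // k _; case: (tP k).
apply/polyP => k; rewrite coefZ coef0; have [kr|kr] := ltnP k (size r); last by rewrite nth_default ?mulr0.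
by rewrite (bigD1 (Ordinal kr)) //= mulrAC (tP k).2 mul0r.
Qed.

Lemma punctual_lead (p : ideal V) (Q : ideal {poly V}) : is_prime p -> forall m (f : {poly V}), (size f <= m)%N ->
  Q f -> (exists k, ~ p f`_k) -> exists d, [/\ Q d, ~ p (lead_coef d) & (size d <= size f)%N].
Proof.
move=> pp; elim=> [|m IH] f fm Qf [k fk].
  by case: fk; rewrite nth_default ?(leq_trans fm) //.
have [pl|pl] := pselect (p (lead_coef f)); last by exists f.
have [t pt tl] := pV pp pl.
have sf : (0 < size f)%N.
  by rewrite lt0n size_poly_eq0; apply/eqP => E; apply: fk; rewrite E coef0.
have st : (size (t *: f) < size f)%N.
  rewrite -[size f]prednK // ltnS; apply/leq_sizeP => l; rewrite coefZ leq_eqVlt => /orP[/eqP <-|ll].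
    exact: tl.
  by rewrite nth_default ?mulr0 // -[size f]prednK.
have [|||d [Qd pd sd]] := IH (t *: f).
- by rewrite -ltnS (leq_trans st).
- by rewrite -mul_polyC; apply: idealM.
- by exists k; rewrite coefZ => /pp.2[].
by exists d; split=> //; rewrite (leq_trans sd) // ltnW.
Qed.

Lemma punctual_separable : punctual B.
Proof.
move=> Q pQ x Qx; pose p := ipre j Q; pose P0 := ipre e Q.
have pp : is_prime p by apply: ipre_prime.
have jp s : ~ p s -> ~ Q (j s) by [].
have Qcoef (f : {poly V}) : (forall k, p f`_k) -> Q (e f).
  move=> fp; rewrite eE horner_poly; apply: idealS => k _; apply/idealMl/fp.
have [|d [Qd pd] mmin] := @min_size _ (fun d => P0 d /\ ~ p (lead_coef d)).
  have [||d [dP0 pd _]] := @punctual_lead p P0 pp _ f0 (leqnn _).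
  - by change (Q (e f0)); rewrite eE f0b.
  - apply: contrapT => no; have H : Q (e f0^`()).
      by apply: Qcoef => k; rewrite coef_deriv -mulr_natr; apply: idealMl; apply: contrapT => H; apply: no; exists k.+1.
    by apply: pQ.1; apply: unit_ideal f0'b H.
  by exists d.
have small (r : {poly V}) : P0 r -> (size r < size d)%N -> forall k, p r`_k.
  move=> Qr rd k; apply: contrapT => rk.
  have [|d' [Qd' pd' sd']] := punctual_lead pp (leqnn _) Qr; first by exists k.
  by have := mmin d' (conj Qd' pd'); rewrite leqNgt (leq_ltn_trans sd' rd).
have divd f : P0 f -> exists u q, ~ p u /\ u *: f = q * d.
  move=> Qf; have [l E] : exists l, (lead_coef d ^+ l) *: f = Pdiv.CommonRing.rdivp f d * d + Pdiv.CommonRing.rmodp f d.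
    by exists (Pdiv.CommonRing.rscalp f d); apply: Pdiv.ComRing.rdivp_eq.
  have dn0 : d != 0 by apply/eqP => d0; apply: pd; rewrite d0 lead_coef0.
  have [||s ps sr] := punctual_coef pp (small (Pdiv.CommonRing.rmodp f d) _ _).
  - have -> : Pdiv.CommonRing.rmodp f d = lead_coef d ^+ l *: f - Pdiv.CommonRing.rdivp f d * d by rewrite E addrC addKr.
    by apply: idealB; [rewrite -mul_polyC|]; apply: idealM.
  - by rewrite Pdiv.CommonRing.ltn_rmodp.
  exists (s * lead_coef d ^+ l), (s *: Pdiv.CommonRing.rdivp f d); split.
    by move=> /pp.2[//|/(prime_exp pp)].
  by rewrite -scalerA E scalerDr sr addr0 scalerAl.
have Qf0 : P0 f0 by change (Q (e f0)); rewrite eE f0b.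
have [u [q [pu uE]]] := divd f0 Qf0.
have qd0 : e q * e d = 0 by rewrite -rmorphM -uE eZ eE f0b mulr0.
have Qq : ~ Q (e q).
  move=> Qq; have : Q (j u * e f0^`()).
    rewrite -eZ -derivZ uE derivM rmorphD !rmorphM; apply: idealD; first exact: idealM.
    exact: idealMl.
  by case/pQ.2 => [/jp //|H]; apply: pQ.1; apply: unit_ideal f0'b H.
have [F FE] := gen x; have QF : P0 F by change (Q (e F)); rewrite eE FE.
have [v [q2 [pv vE]]] := divd F QF.
exists (e q * j v); first by move=> /pQ.2[//|/jp].
by rewrite -FE -eE -mulrA -eZ vE rmorphM mulrCA qd0 mulr0.
Qed.
End Separable.

(** Elimination among the powers of c gives a relation. One of least degree has nonvanishing
    derivative at c, by characteristic zero, and no factor X unless c = 0. *)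
Lemma alg_relation (D : idomainType) (L : fieldType) (g : {rmorphism D -> L}) (es : seq L) (c : L) : injective g ->
  (forall n, n.+1%:R <> 0 :> D) ->
  (forall x, exists s r, s <> 0 /\ g s * x = \sum_(k < size es) g (r k) * es`_k) ->
  exists f : {poly D}, [/\ (map_poly g f).[c] = 0, (map_poly g f^`()).[c] <> 0 & c <> 0 -> f`_0 <> 0].
Proof.
move=> inj_g ch span; set n := size es.
have g0 a : g a = 0 -> a = 0 by move=> ga; apply: inj_g; rewrite ga rmorph0.
have /choice[s] := fun m : nat => span (c ^+ m); move/choice => [r srP].
have [u [[k0 uk] uP]] := elimination (idom_prime0 D) (fun (m : 'I_n.+1) (k : 'I_n) => r m k).
pose F : {poly D} := \poly_(m < n.+1) ((if insub m is Some o then u o else 0) * s m).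
have Fu (m : 'I_n.+1) : F`_m = u m * s m.
  by rewrite coef_poly ltn_ord valK.
have F0 : F != 0.
  apply/eqP => /(congr1 (fun p : {poly D} => p`_k0)); rewrite Fu coef0 => /eqP.
  rewrite mulf_eq0 => /orP[]/eqP //; exact: (srP k0).1.
have Fc : (map_poly g F).[c] = 0.
  rewrite (@horner_coef_wide _ n.+1); last by rewrite (leq_trans (size_poly _ _)) // size_poly.
  rewrite (eq_bigr (fun m : 'I_n.+1 => \sum_(k < n) g (u m * r m k) * es`_k)).
    rewrite exchange_big big1 //= => k _; rewrite -mulr_suml -rmorph_sum /=.
    by have -> : \sum_(i < n.+1) u i * r i k = 0 := uP k; rewrite rmorph0 mul0r.
  move=> m _; rewrite coef_map_id0 ?rmorph0 // Fu (rmorphM g) -mulrA (srP m).2 mulr_sumr.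
  by apply: eq_bigr => k _; rewrite rmorphM mulrA.
have [|f [fn0 fc] mmin] := @min_size _ (fun f : {poly D} => f != 0 /\ (map_poly g f).[c] = 0); first by exists F.
exists f; split=> // [f'c|c0 f00]; last first.
  pose f1 : {poly D} := \poly_(k < (size f).-1) f`_k.+1.
  have fE : f = f1 * 'X.
    apply/polyP => -[|k]; rewrite coefMX //= coef_poly; case: ltnP => // sk.
    by rewrite nth_default //; case: (size f) sk.
  have f1n : f1 != 0 by apply/eqP => f10; case/eqP: fn0; rewrite fE f10 mul0r.
  suff /mmin : f1 != 0 /\ (map_poly g f1).[c] = 0 by rewrite {1}fE size_mulX // ltnn.
  split=> //; move: fc; have -> : map_poly g f = map_poly g f1 * 'X.
    by rewrite {1}fE (rmorphM (map_poly g)) /= map_polyX.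
  by rewrite hornerMX => /eqP; rewrite mulf_eq0 => /orP[/eqP //|/eqP/c0].
have f'0 : f^`() = 0.
  apply/eqP/contraT => nf'; have := mmin _ (conj nf' f'c).
  by rewrite leqNgt lt_size_deriv.
have fC : f = (f`_0)%:P.
  apply/polyP => -[|k]; first by rewrite coefC.
  rewrite coefC /=; have := congr1 (fun p : {poly D} => p`_k) f'0; rewrite coef_deriv coef0 -mulr_natr => /eqP.
  by rewrite mulf_eq0 => /orP[/eqP //|/eqP/ch].
move: fc; rewrite fC map_polyC hornerC => /g0 E; by case/eqP: fn0; rewrite fC E.
Qed.

(** * Formal fibres *)

Section Fibre.
Variables (D : idomainType) (T W : comPzRingType) (L : fieldType).
Variables (i : {rmorphism D -> T}) (g : {rmorphism D -> L}) (al : {rmorphism T -> W}) (be : {rmorphism L -> W}).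
Hypothesis nT : noetherian T.
Hypothesis i_approx : forall a u, a <> 0 -> exists c r, u = i c + i a * r.
Hypothesis i_split : forall x, exists z y d, [/\ d <> 0, x * z = 0 & (x + z) * y = i d].
Hypothesis D_char : forall n, n.+1%:R <> 0 :> D.
Hypothesis sq : forall a, al (i a) = be (g a).
Hypothesis W_gen : forall S : subring W, (forall t, S (al t)) -> (forall l, S (be l)) -> forall w, S w.

(** Since T = D + a T and a becomes 0, every element of W comes from L; so W is L or zero. *)
Lemma special_fibre a : a <> 0 -> g a = 0 -> regular_ring W.
Proof.
move=> a0 ga; have beS y : exists l, be l = y.
  apply: (W_gen (S := rimage be)) => [t|l]; last by exists l.
  have [c [r ->]] := i_approx t a0; exists (g c).
  by rewrite rmorphD rmorphM !sq ga rmorph0 mul0r addr0.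
apply: punctual_regular.
  apply: (noeth_surj beS) => J; have [[x Jx x0]|no] := pselect (exists2 x, J x & x <> 0); last first.
    exists [::]; apply: ideal_ext => x; rewrite -[ideal_span _]/(igen [::]) igen_nil; split=> [Jx|->]; last exact: ideal0.
    by apply: contrapT => x0; apply: no; exists x.
  have J1 : J 1 by rewrite -(@mulVf _ x); [apply: idealM|apply/eqP].
  exists [:: 1]; apply: ideal_ext => y; split=> _; last by rewrite -[y]mulr1; apply: idealM.
  by rewrite -[y]mulr1; apply/idealM/igen_mem/mem_head.
apply: (punctual_surj beS) => Q pQ x Qx; exists 1; first exact: pQ.1.
rewrite mul1r; apply/eqP/contraT => x0; exfalso; apply: pQ.1.
by rewrite -(@mulVf _ x) //; apply: idealM.
Qed.

Section Generic.
Hypothesis inj_g : injective g.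
Variable es : seq L.
Hypothesis es_span : forall x, exists s r, s <> 0 /\ g s * x = \sum_(k < size es) g (r k) * es`_k.

Lemma g_neq0 a : a <> 0 -> g a != 0.
Proof. by move=> a0; apply/eqP => ga; apply/a0/inj_g; rewrite ga rmorph0. Qed.
Lemma be_cancel a w : a <> 0 -> w * be (g a) = 0 -> w = 0.
Proof.
move=> a0 E; rewrite -[w]mulr1 -(rmorph1 be) -(divff (g_neq0 a0)) rmorphM mulrA E mul0r //.
Qed.

(** The image in W of T with the nonzero elements of D inverted. *)
Definition frac_ring : subring W.
Proof.
exists [set w | exists t s, s <> 0 /\ w * be (g s) = al t].
- by exists 1, 1; rewrite !rmorph1 mulr1; split=> //; apply/eqP/oner_neq0.
- move=> w w' [t [s [s0 E]]] [t' [s' [s'0 E']]]; exists (t * i s' - t' * i s), (s * s').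
  split; first by apply/eqP; rewrite mulf_neq0 //; apply/eqP.
  by rewrite rmorphB !rmorphM !sq -E -E'; ring.
- move=> w w' [t [s [s0 E]]] [t' [s' [s'0 E']]]; exists (t * t'), (s * s').
  split; first by apply/eqP; rewrite mulf_neq0 //; apply/eqP.
  by rewrite !rmorphM -E -E'; ring.
Defined.

Lemma frac_al t : frac_ring (al t).
Proof. by exists t, 1; rewrite !rmorph1 mulr1; split=> //; apply/eqP/oner_neq0. Qed.
Lemma frac_be a : frac_ring (be (g a)).
Proof. by rewrite -sq; apply: frac_al. Qed.
Lemma frac_inv a : a <> 0 -> frac_ring (be (g a)^-1).
Proof.
move=> a0; exists 1, a; split=> //.
by rewrite -rmorphM mulVf ?rmorph1 // g_neq0.
Qed.

Lemma frac_noeth : noetherian (sr_ring frac_ring).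
Proof.
move=> J; pose f : {rmorphism T -> sr_ring frac_ring} := sr_corestr frac_al.
have [ts tsE] := noeth_fg nT (ipre f J).
exists (map f ts); apply: ideal_ext => w; split; last first.
  by apply: igen_sub => _ /mapP[t tts ->]; have /tsE : igen ts t := igen_mem tts.
move=> Jw; have [t [s [s0 E]]] := sr_valP w.
have [v vE] := sr_lift (frac_inv s0); have [v' v'E] := sr_lift (frac_be s).
have Ew : w * v' = f t by apply: sr_val_inj; rewrite sr_valM v'E E.
have -> : w = v * f t.
  apply: sr_val_inj; rewrite -Ew !sr_valM vE v'E mulrCA -[X in _ * X]rmorphM mulVf ?rmorph1 ?mulr1 //.
  exact: g_neq0.
apply/idealM/rmorph_igen/tsE; change (J (f t)); rewrite -Ew; exact: idealMl.
Qed.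

(** By [i_split] some z kills x while x + z is a unit; so z is outside every prime containing x. *)
Lemma frac_punctual : punctual (sr_ring frac_ring).
Proof.
move=> Q pQ x Qx; have [t [s [s0 E]]] := sr_valP x; have [z [y [d [d0 xz xzy]]]] := i_split t.
have [zz zzE] := sr_lift (frac_al z); exists zz.
  move=> Qz; have [tt ttE] := sr_lift (frac_al t); have [yy yyE] := sr_lift (frac_al y).
  have [ss ssE] := sr_lift (frac_be s); have [dd ddE] := sr_lift (frac_inv d0).
  have Qt : Q tt by have -> : tt = ss * x; [apply: sr_val_inj; rewrite sr_valM ttE ssE mulrC|apply: idealM].
  apply: pQ.1; have -> : 1 = (tt + zz) * (yy * dd).
    apply: sr_val_inj; rewrite !sr_valM sr_valD ttE zzE yyE ddE mulrA -rmorphD -rmorphM xzy sq.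
    by rewrite -rmorphM mulfV ?rmorph1 // g_neq0.
  by apply/idealMl/idealD.
apply: sr_val_inj; rewrite sr_valM zzE; apply: (be_cancel s0).
by rewrite -mulrA E -rmorphM mulrC xz rmorph0.
Qed.

(** The constant term of a relation of y is nonzero and invertible in the fraction ring, which makes
    the inverse of y a polynomial in y. *)
Lemma frac_inverse (S : subring W) y : frac_ring `<=` S -> y <> 0 -> S (be y) -> S (be y^-1).
Proof.
move=> FS y0 Sy; have [f [fy _ /(_ y0) f0]] := alg_relation y inj_g D_char es_span.
have -> : y^-1 = - (g f`_0)^-1 * \sum_(k < size f) g f`_k.+1 * y ^+ k.
  set sm := \sum_(k < _) _; have E : g f`_0 = - (y * sm).
    have := fy; rewrite (@horner_coef_wide _ (size f).+1); last first.
      by rewrite (leq_trans (size_poly _ _)).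
    rewrite big_ord_recl expr0 mulr1 coef_map_id0 ?rmorph0 // => /eqP; rewrite addr_eq0 => /eqP ->.
    congr (- _); rewrite mulr_sumr; apply: eq_bigr => k _.
    by rewrite coef_map_id0 ?rmorph0 // exprS; ring.
  have sm0 : sm != 0.
    by apply/eqP => sm0; have := g_neq0 f0; rewrite E sm0 mulr0 oppr0 eqxx.
  by rewrite E invrN opprK invfM mulfVK.
rewrite rmorphM rmorphN rmorph_sum; apply: srM; first by apply/srN/FS/frac_inv.
by apply: srS => k _; rewrite rmorphM rmorphXn; apply: srM; [apply/FS/frac_be|apply: srX].
Qed.

Lemma adj_punctual (S : subring W) c : frac_ring `<=` S -> punctual (sr_ring S) ->
  punctual (sr_ring (adj S (be c))).
Proof.
move=> FS pS; set b := be c.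
have [E1|W1] := pselect (1 = 0 :> W).
  move=> Q pQ; case: pQ.1; have -> : 1 = 0 :> sr_ring (adj S b) by apply: sr_val_inj.
  exact: ideal0.
have S1 : 1 <> 0 :> sr_ring S by move=> /(congr1 (@sr_val _ S)).
have B1 : 1 <> 0 :> sr_ring (adj S b) by move=> /(congr1 (@sr_val _ _)).
have SA : S `<=` adj S b by move=> x Sx; apply: adj_incl.
pose j : {rmorphism sr_ring S -> sr_ring (adj S b)} :=
  sr_corestr (S := adj S b) (f := @sr_val _ S) (fun x => SA _ (sr_valP x)).
pose j' : {rmorphism nz_ring S1 -> nz_ring B1} := j.
have [b' b'E] := sr_lift (@adj_gen _ S b).
have gS a : S (be (g a)) by apply/FS/frac_be.
pose ka : {rmorphism D -> nz_ring S1} := sr_corestr (S := S) (f := be \o g) gS.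
have [f [fc f'c _]] := alg_relation c inj_g D_char es_span.
have nzsum m (G : nat -> nz_ring B1) : sr_val (\sum_(k < m) G k : sr_ring (adj S b)) =
  \sum_(k < m) sr_val (G k : sr_ring (adj S b)) by exact: (sr_val_sum (S := adj S b)).
have nzmul (x : nz_ring B1) k : sr_val (x * (b' : nz_ring B1) ^+ k : sr_ring (adj S b)) =
  sr_val (x : sr_ring (adj S b)) * b ^+ k.
  have <- : sr_val b' ^+ k = b ^+ k by rewrite b'E.
  by rewrite -sr_valX.
have ev (F : {poly D}) : sr_val ((map_poly j' (map_poly ka F)).[b'] : sr_ring (adj S b)) = be (map_poly g F).[c].
  rewrite !(@horner_coef_wide _ (size F)); first last.
  - by rewrite (leq_trans (size_poly _ _)) // size_poly.
  - exact: size_poly.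
  rewrite (nzsum _ (fun k => (map_poly j' (map_poly ka F))`_k * (b' : nz_ring B1) ^+ k)) rmorph_sum; apply: eq_bigr => k _.
  by rewrite nzmul !coef_map_id0 ?rmorph0 // (rmorphM be) (rmorphXn be).
apply: (@punctual_separable (nz_ring S1) (nz_ring B1) j' b' _ pS (map_poly ka f)).
- move=> x; have [m [a [Sa xE]]] := @sr_valP _ (adj S b) x.
  have /choice[A AE] : forall k, exists y : sr_ring S, sr_val y = a k by move=> k; apply: sr_lift.
  exists (\poly_(k < m) (A k : nz_ring S1)); apply: (@sr_val_inj _ (adj S b)).
  rewrite (@horner_coef_wide _ m); last by rewrite (leq_trans (size_poly _ _)) // size_poly.
  rewrite xE (nzsum _ (fun k => (map_poly j' _)`_k * (b' : nz_ring B1) ^+ k)); apply: eq_bigr => k _.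
  by rewrite nzmul coef_map_id0 ?rmorph0 // coef_poly ltn_ord -AE.
- by apply: (@sr_val_inj _ (adj S b)); rewrite ev fc rmorph0.
- have [|y yE] := @sr_lift _ (adj S b) (be (map_poly g f^`()).[c]^-1).
    apply: frac_inverse => //; last by rewrite -ev; apply: sr_valP.
    by move=> x /FS/SA.
  exists y; apply: (@sr_val_inj _ (adj S b)); rewrite sr_valM deriv_map ev yE -rmorphM mulfV ?rmorph1 //.
  exact/eqP.
Qed.

Lemma generic_fibre : regular_ring W.
Proof.
have [H1 H2] := adjs_sub frac_ring (map be es).
have all w : adjs frac_ring (map be es) w.
  apply: W_gen => [t|l]; first by apply/H1/frac_al.
  have [s [r [s0 E]]] := es_span l.
  have -> : l = \sum_(k < size es) (g s)^-1 * g (r k) * es`_k.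
    rewrite (eq_bigr (fun k => (g s)^-1 * (g (r k) * es`_k))); last by move=> k _; rewrite mulrA.
    by rewrite -mulr_sumr -E mulKf // g_neq0.
  rewrite rmorph_sum; apply: srS => k _; rewrite !rmorphM; apply: srM; last by apply/H2/map_f/mem_nth.
  by apply: srM; apply: H1; [apply: frac_inv|apply: frac_be].
have surj w : exists x, @sr_val _ (adjs frac_ring (map be es)) x = w by apply/sr_lift/all.
apply: punctual_regular; first exact: (@noeth_surj _ _ (@sr_val _ (adjs frac_ring (map be es))) surj (noeth_adjs frac_noeth)).
apply: (@punctual_surj _ _ (@sr_val _ (adjs frac_ring (map be es))) surj).
have : exists2 S : subring W, frac_ring `<=` S & punctual (sr_ring S) /\ S = frac_ring.
  by exists frac_ring => //; split=> //; apply: frac_punctual.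
move=> [S FS [pS <-]] {H1 H2 all surj}.
elim: es S FS pS => [|c cs IH] S FS pS //=; apply: IH; last exact: adj_punctual.
by move=> x /FS Sx; apply: adj_incl.
Qed.
End Generic.
End Fibre.

(** * Tensor products and residue fields *)

Section Tensor.
Variables (A B C : comPzRingType) (f : {rmorphism A -> B}) (g : {rmorphism A -> C}).
Let W := tensor_product f g.
Definition tp (b : B) (c : C) : W := @Defs.cs_pi (tensor_setoid f g) [:: (b, c)].

Lemma tpDl b b' c : tp (b + b') c = tp b c + tp b' c.
Proof. by rewrite /tp -cs_piD; apply/(cs_piP (S := tensor_setoid f g)); apply: tensor_Dl. Qed.
Lemma tpDr b c c' : tp b (c + c') = tp b c + tp b c'.
Proof. by rewrite /tp -cs_piD; apply/(cs_piP (S := tensor_setoid f g)); apply: tensor_Dr. Qed.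
Lemma tpM b c b' c' : tp b c * tp b' c' = tp (b * b') (c * c').
Proof. by rewrite /tp -cs_piM. Qed.
Lemma tpZ a b c : tp (f a * b) c = tp b (g a * c).
Proof. by apply/(cs_piP (S := tensor_setoid f g)); apply: tensor_balanced. Qed.

Lemma tpl_zmod : zmod_morphism (tp^~ 1).
Proof.
have H b b' : tp (b - b') 1 + tp b' 1 = tp b 1 by rewrite -tpDl subrK.
by move=> b b' /=; rewrite -(H b b') addrK.
Qed.
Lemma tpl_monoid : monoid_morphism (tp^~ 1).
Proof. by split=> [//|b b' /=]; rewrite tpM mulr1. Qed.
Definition tpl : {rmorphism B -> W} := HB.pack (tp^~ 1)
  (GRing.isZmodMorphism.Build B W (tp^~ 1) tpl_zmod) (GRing.isMonoidMorphism.Build B W (tp^~ 1) tpl_monoid).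

Lemma tpr_zmod : zmod_morphism (tp 1).
Proof.
have H c c' : tp 1 (c - c') + tp 1 c' = tp 1 c by rewrite -tpDr subrK.
by move=> c c' /=; rewrite -(H c c') addrK.
Qed.
Lemma tpr_monoid : monoid_morphism (tp 1).
Proof. by split=> [//|c c' /=]; rewrite tpM mulr1. Qed.
Definition tpr : {rmorphism C -> W} := HB.pack (tp 1)
  (GRing.isZmodMorphism.Build C W (tp 1) tpr_zmod) (GRing.isMonoidMorphism.Build C W (tp 1) tpr_monoid).

Lemma tp_square a : tpl (f a) = tpr (g a).
Proof. by rewrite /= -[f a]mulr1 tpZ mulr1. Qed.

Lemma tensor_generated (S : subring W) : (forall b, S (tpl b)) -> (forall c, S (tpr c)) -> forall w, S w.
Proof.
move=> Sb Sc w; rewrite -[w]cs_reprK; elim: (cs_repr w) => [|[b c] s IH]; first exact: sr0.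
have -> : @Defs.cs_pi (tensor_setoid f g) ((b, c) :: s) = tpl b * tpr c + @Defs.cs_pi (tensor_setoid f g) s.
  by rewrite /= tpM mulr1 mul1r /tp -cs_piD.
by apply: srD => //; apply: srM.
Qed.
End Tensor.

Section ResidueField.
Variables (D : idomainType) (P : Spec D) (L : fieldType) (h : {rmorphism residue_field P -> L}).
Let g : {rmorphism D -> L} := h \o residue_map P.

Let gE a : g a = h (quotient_map (localization_ideal P) (localization_map P a)). Proof. by []. Qed.

Lemma residue_zero a : P a -> g a = 0.
Proof.
move=> Pa; rewrite gE.
have -> : quotient_map (localization_ideal P) (localization_map P a) = 0; last exact: rmorph0.
by apply/quot_eq0 => I H; apply: H; exists a.
Qed.

Lemma residue_neq0 a : ~ P a -> g a <> 0.
Proof.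
move=> Pa ga; have [y ay] := loc_unit (localization_isloc P) Pa.
have : h (quotient_map _ (localization_map P a * y)) = 0.
  by rewrite !rmorphM -[h _]/(g a) ga mul0r.
by rewrite ay !rmorph1 => /eqP; rewrite oner_eq0.
Qed.

Lemma residue_frac x : exists s r, ~ P s /\ g s * h x = g r.
Proof.
have [z <-] := quot_surj x; have [r [s [Ps E]]] := loc_frac (localization_isloc P) z.
by exists s, r; split=> //; rewrite !gE -E !rmorphM.
Qed.

Lemma residue_span : module_finite h -> exists es : seq L, forall x, exists s (r : 'I_(size es) -> D),
  ~ P s /\ g s * x = \sum_(k < size es) g (r k) * es`_k.
Proof.
have pP := Defs.primeP P.
move=> [es esP]; exists es => x; have [a ->] := esP x.
have /choice[s] := fun k => residue_frac (a k); move/choice => [r srP].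
exists (\prod_(k < size es) s k), (fun k => \prod_(l < size es | l != k) s l * r k); split.
  elim/big_ind: _ => [|u v Pu Pv /pP.2[]|k _] //; [exact: pP.1|by case: (srP k)].
rewrite mulr_sumr; apply: eq_bigr => k _; rewrite mulrA; congr (_ * _).
have gM u v : g (u * v) = g u * g v by exact: (rmorphM g).
by rewrite (bigD1 k) // !gM -(srP k).2; ring.
Qed.
End ResidueField.

(* Only residue fields of primes below the maximal ideal matter: nonzero primes give fields or zero, and
   the zero prime gives the separable base change of a finite product of fields. *)
Lemma regular_fibre (D : idomainType) T (i : {rmorphism D -> T}) :
  noetherian T -> (forall a u, a <> 0 -> exists c r, u = i c + i a * r) ->
  (forall x, exists z y d, [/\ d <> 0, x * z = 0 & (x + z) * y = i d]) ->
  (forall n, n.+1%:R <> 0 :> D) ->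
  forall (P : Spec D) (L : fieldType) (h : {rmorphism residue_field P -> L}), module_finite h ->
  regular_ring (tensor_product i (h \o residue_map P)).
Proof.
move=> nT F2 F3 ch P L h fh; pose g : {rmorphism D -> L} := h \o residue_map P.
have gen := @tensor_generated _ _ _ i g.
have [[a Pa a0]|no] := pselect (exists2 a, P a & a <> 0).
  apply: (special_fibre F2 (@tp_square _ _ _ i g) gen a0); exact: residue_zero.
have P0 a : P a -> a = 0 by move=> Pa; apply: contrapT => a0; apply: no; exists a.
have [es esP] := residue_span fh.
apply: (generic_fibre nT F3 ch (@tp_square _ _ _ i g) gen _ (es := es)).
  move=> x y E; apply/subr0_eq/P0; apply: contrapT => H.
  have gxy : g (x - y) = 0 by rewrite rmorphB E subrr.
  exact: (residue_neq0 (h := h) H gxy).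
move=> x; have [s [r [Ps E]]] := esP x; exists s, r; split=> // s0.
by apply: Ps; rewrite s0.
Qed.

Lemma krull_chain R (M P : ideal R) m : clocal M -> is_prime P -> krull_dim (quotient_ring P) m ->
  ht_ge P M m /\ ~ ht_ge P M m.+1.
Proof.
move=> cM pP [[c cc] nc]; pose q := @quot_surj R P; have pM := cl_prime cM.
have subM (Q : ideal R) (pQ : is_prime Q) : Q `<=` M := local_sub (cl_unit cM) pQ.1.
split.
  have h1 : ht_ge (izero _) (c m) m by exists c => //; split=> // x ->.
  have := (ht_ge_surj q _ _ _).1 h1; rewrite ipre_quot => h2.
  by apply: (ht_ge_sub pM h2); apply: subM (ht_ge_prime h2).
move=> h; apply: nc; have : ht_ge (izero (quotient_ring P)) (iimg q M) m.+1.
  by apply/(ht_ge_surj q); rewrite ipre_quot ipre_iimg_quot //; apply: subM.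
by move=> [c' cc' _]; exists c'.
Qed.

(** * Transfinite construction of the subring *)

Section Construction.
Variables (T : comPzRingType) (M : ideal T) (ps : seq (ideal T)).
Hypothesis cM : clocal M.
Hypothesis ps_prime : forall P, List.In P ps -> is_prime P.
Hypothesis ps_ne : exists P, List.In P ps.
Hypothesis ps_max : forall P, List.In P ps -> ~ (M `<=` P).
Hypothesis ps_red : forall x, (forall P, List.In P ps -> P x) -> x = 0.
Hypothesis ps_char : forall P, List.In P ps -> forall n, ~ P n.+1%:R.
Let kM := quotient_ring M.
Let kS : choiceType := {classic (nat -> kM)}.

(** Since the primes of [ps] have intersection zero, these elements are nonzerodivisors. *)
Definition avoids (t : T) := forall P, List.In P ps -> ~ P t.

Lemma avoids1 : avoids 1. Proof. by move=> P /ps_prime[]. Qed.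
Lemma avoidsM x y : avoids x -> avoids y -> avoids (x * y).
Proof. by move=> ax ay P Pps /(ps_prime Pps).2[]; [apply: ax|apply: ay]. Qed.
Lemma avoids_neq0 x : avoids x -> x <> 0.
Proof. by move=> ax x0; have [P Pps] := ps_ne; apply: (ax P Pps); rewrite x0. Qed.
Lemma avoids_cancel x y : avoids x -> x * y = 0 -> y = 0.
Proof.
move=> ax xy; apply: ps_red => P Pps.
have : P (x * y) by rewrite xy.
by case/(ps_prime Pps).2 => // /(ax P Pps).
Qed.

Section Values.
Variables (I : Type) (w : I -> T).
Fixpoint evl (t : tr I) : T :=
  match t with Lf j => w j | Nd n => n%:R | Br 0 l r => evl l - evl r | Br _ l r => evl l * evl r end.

Definition evl_ring (X : I -> Prop) : subring T.
Proof.
exists [set x | exists2 t, lvs X t & evl t = x].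
- by exists (Nd 1).
- by move=> _ _ [t Xt <-] [u Xu <-]; exists (Br 0 t u).
- by move=> _ _ [t Xt <-] [u Xu <-]; exists (Br 1 t u).
Defined.

Definition clean (X : I -> Prop) := forall t, lvs X t -> evl t <> 0 -> avoids (evl t).

Lemma clean0 : clean (fun=> False).
Proof.
move=> t tF; have [z ->] : exists z : int, evl t = z%:~R.
  elim: t tF => [//|n _|n l IHl r IHr [/IHl[a aE] /IHr[b bE]]]; first by exists (n : int).
  by case: n => [|n] /=; [exists (a - b); rewrite aE bE rmorphB|exists (a * b); rewrite aE bE rmorphM].
case: z => [[|n]|n] z0 P Pps //; first exact: (ps_char Pps).
by rewrite NegzE mulrNz => /idealN; rewrite opprK; apply: (ps_char Pps).
Qed.

(** For [clean] X: v is transcendental, modulo each prime of [ps], over the ring of values of trees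
    on X. *)
Definition generic (X : I -> Prop) (v : T) := forall n (ts : nat -> tr I), (forall j, lvs X (ts j)) ->
  (exists2 j, (j < n)%N & evl (ts j) <> 0) -> avoids (\sum_(j < n) evl (ts j) * v ^+ j).

Lemma clean_add X i : generic X (w i) -> clean (fun j => j = i \/ X j).
Proof.
move=> gi t tX t0.
have : adj (evl_ring X) (w i) (evl t).
  elim: t tX {t0} => [j [->|Xj]|n _|n l IHl r IHr [/IHl Hl /IHr Hr]]; first exact: adj_gen.
  - by apply: adj_incl; exists (Lf j).
  - by apply: adj_incl; exists (Nd n).
  - by case: n => [|n]; [exact: (srB Hl Hr)|exact: (srM Hl Hr)].
move=> [n [c [cP E]]].
have /choice[ts tsP] : forall j, exists t, lvs X t /\ evl t = c j by move=> j; have [u] := cP j; exists u.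
have E' : evl t = \sum_(j < n) evl (ts j) * w i ^+ j.
  by rewrite E; apply: eq_bigr => j _; rewrite (tsP j).2.
rewrite E'; apply: gi => [j|]; first by have [] := tsP j.
apply: contrapT => no; apply: t0; rewrite E' big1 // => j _.
have [->|ne] := pselect (evl (ts j) = 0); first by rewrite mul0r.
by case: no; exists j.
Qed.

(* The values u + t * series c, for c running over the sequences in the residue field, are separated by the primes;
   if none of them were generic then each c would be coded by a polynomial and the rank of a root of it. *)
Lemma generic_exists X u t : clean X -> avoids t -> (exists v, generic X v /\ exists r, v - u = r * t) \/
  exists g : kS -> tr I, injective g /\ forall c, lvs X (g c).
Proof.
move=> cX At; have [ex|no] := pselect (exists v, generic X v /\ exists r, v - u = r * t); first by left.
right; have [tau Mtau tauP] : exists2 a, M a & forall P, List.In P ps -> ~ P a.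
  by apply: prime_avoidance0 => P Pps; split; [apply: ps_prime|apply: ps_max].
pose y (c : kS) := u + t * series cM Mtau c.
have ysep P c d : List.In P ps -> c <> d -> ~ P (y c - y d).
  move=> Pps cd; have -> : y c - y d = t * (series cM Mtau c - series cM Mtau d) by rewrite /y; ring.
  case/(ps_prime Pps).2 => [/(At P Pps)//|]; apply: series_sep => //; [exact: ps_prime|exact: tauP].
have /choice[f fP] : forall c, exists d : nat * (nat -> tr I) * nat, [/\ forall j, lvs X (d.1.2 j),
    exists2 j, (j < d.1.1)%N & evl (d.1.2 j) <> 0, List.In (nth M ps d.2) ps &
    (nth M ps d.2) (\sum_(j < d.1.1) evl (d.1.2 j) * y c ^+ j)].
  move=> c; apply: contrapT => noc; apply: no; exists (y c); split; last first.
    by exists (series cM Mtau c); rewrite /y; ring.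
  move=> n ts tsX ne P Pps PS; apply: noc; have [l ll lE] := nth_In M Pps.
  by exists (n, ts, l); split => //=; rewrite lE.
pose key c := Br (f c).2 (Nd 0) (tchain (f c).1.1 (f c).1.2).
have /choice[r rP] : forall K, exists r : kS -> nat, forall c d, key c = K -> key d = K -> r c = r d -> c = d.
  move=> K; have [[c0 c0K]|none] := pselect (exists c, key c = K); last first.
    by exists (fun=> 0%N) => c d cK; case: none; exists c.
  apply: (@finite_index kS (fun c => key c = K) (f c0).1.1) => l ul lK.
  have [tX [j0 j0n ne0] Pin PS] := fP c0; set n := (f c0).1.1 in j0n PS *; set P := nth M ps (f c0).2 in Pin PS.
  rewrite -(size_map y); apply: (@prime_sep _ P n (fun j => evl ((f c0).1.2 j))); first exact: ps_prime.
  - by exists j0 => //; apply: (cX _ _ _ _ Pin).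
  - move=> i j; rewrite size_map => /andP[ij jl].
    have il := ltn_trans ij jl.
    rewrite !(nth_map c0) //; apply: (ysep _ _ _ Pin) => /eqP.
    by rewrite (nth_uniq c0 il jl ul) => /eqP E; rewrite E ltnn in ij.
  - move=> _ /mapP[c cl ->]; have := lK c cl; rewrite -c0K => -[E /tchain_inj[En Ets]].
    have [_ _ _] := fP c; rewrite E En; congr (P _); apply: eq_bigr => j _.
    by rewrite Ets // En.
exists (fun c => Br (r (key c) c) (Nd 0) (key c)); split=> [c d [E K K']|c].
  have KK : key c = key d by rewrite /key K K'.
  by apply: (rP (key d)) => //; rewrite -E KK.
by split=> //; split=> //; apply: lvs_tchain; have [] := fP c.
Qed.
End Values.

Lemma evl_ext (I : Type) (w w' : I -> T) (X : I -> Prop) t : (forall j, X j -> w j = w' j) ->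
  lvs X t -> evl w t = evl w' t.
Proof.
move=> H; elim: t => [j /H//|n|n l IHl r IHr [/IHl El /IHr Er]] //.
by case: n => [|n] /=; rewrite El Er.
Qed.

Lemma generic_ext (I : Type) (w w' : I -> T) (X : I -> Prop) v :
  (forall j, X j -> w j = w' j) -> generic w X v -> generic w' X v.
Proof.
move=> H g n ts tsX [j jn ne].
have E i : evl w' (ts i) = evl w (ts i) by rewrite (evl_ext H (tsX i)).
rewrite (eq_bigr (fun j : 'I_n => evl w (ts j) * v ^+ j)); last by move=> i _; rewrite E.
by apply: g => //; exists j; rewrite -?E.
Qed.


(** A pair is ranked by the largest letter of its code, ties being broken by a second well-order.
    Pairs before i use letters up to the rank s of i; if they coded all sequences, so would the
    letters strictly below s after dropping s, against [small_alphabet]. *)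
Lemma small_order : exists pr : T * T -> T * T -> Prop,
  [/\ well_founded pr, forall x y, [\/ x = y, pr x y | pr y x] &
   forall i, ~ exists g : kS -> tr (T * T), injective g /\ forall c, lvs (pr^~ i) (g c)].
Proof.
have [lt [S [wf tot [J [Ji JS]] small]]] := small_alphabet kS.
have [e ei] := coord_inj cM.
have [li [wfi toti]] := well_order_prop (T * T)%type.
pose below (o : option kS) x := if o is Some s then x = s \/ lt x s else False.
have /choice[rk rkP] : forall i, exists o : option kS, lvs (below o) (J (e i)) /\ forall s, o = Some s -> S s.
  move=> i; case: (rank_exists wf tot (JS (e i))) => [H|[s Ss H]]; first by exists None.
  by exists (Some s); split=> // _ [<-].
have prw := @prec_wf _ _ _ _ rk (olt_wf wf) wfi.
have prt := @prec_tot _ _ _ _ rk (olt_tot tot) toti.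
exists (prec (olt lt) li rk); split=> // i [g [gi gX]].
have mono j x : prec (olt lt) li rk j i -> below (rk j) x -> below (rk i) x.
  case=> [|[-> //]]; case: (rk j) => [s|] //; case: (rk i) => [s'|] //= ss'.
  by case=> [->|xs]; right=> //; apply: (wo_trans wf tot) ss'.
have hX c : lvs (below (rk i)) (tsub (fun j => J (e j)) (g c)).
  by apply: lvs_tsub (gX c) => j ji; apply: lvs_mono (rkP j).1 => x; apply: mono.
have hi : injective (fun c => tsub (fun j => J (e j)) (g c)).
  by move=> c d /(tsub_inj (inj_comp Ji ei))/gi.
have := (rkP i).2; case: (rk i) hX => [s|] hX Ss; last first.
  apply: (@big_empty kM 0 1); last by exists (fun c => tsub (fun j => J (e j)) (g c)).
  by move=> E; apply: (cl_prime cM).1; apply/(quot_eq0 M); rewrite rmorph1.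
apply: (small s (Ss s erefl)); exists (fun c => tdrop s (tsub (fun j => J (e j)) (g c))); split.
  by move=> c d H; apply: hi; exact: (@tdrop_inj _ s _ _ H).
by move=> c; apply: lvs_tdrop (hX c) => x /= [|].
Qed.

Lemma generic_family : exists w : T * T -> T, clean w (fun=> True) /\
  forall u t, avoids t -> exists r, w (u, t) - u = r * t.
Proof.
have [pr [wf tot no]] := small_order.
(* A second entry that is not allowed is treated as 1, so that the recursion is total. *)
pose av t := if pselect (avoids t) then t else 1.
have avP t : avoids (av t) by rewrite /av; case: pselect => // ?; apply: avoids1.
pose cond (w : T * T -> T) i v := generic w (pr^~ i) v /\ exists r, v - i.1 = r * av i.2.
(* The value 0 stands for failure, which [step] excludes. *)
have [w wE] := wf_fix wf 0 (fun i w => if pselect (exists v, cond w i v) is left e then projT1 (cid e) else 0).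
have step i : clean w (pr^~ i) -> cond w i (w i).
  move=> ci; rewrite wE; set w' := fun j => if _ then _ else _.
  have ww' j : pr j i -> w j = w' j by rewrite /w'; case: pselect.
  have ex : exists v, cond w' i v.
    have [[v [gv vr]]|[g gP]] := generic_exists i.1 ci (avP i.2); last by case: (no i); exists g.
    by exists v; split=> //; apply: generic_ext gv.
  case: pselect => // ex'; case: cid => v /= [gv vr]; split=> //.
  by apply: generic_ext gv => j ji; rewrite ww'.
have cl i : clean w (pr^~ i).
  elim: (wf i) => j _ IH t tX; case: (rank_exists wf tot tX) => [tF|[s sj tY]]; first exact: (clean0 tF).
  have [gs _] := step s (IH s sj); exact: (clean_add gs tY).
exists w; split.
  move=> t tX; case: (rank_exists wf tot tX) => [tF|[s sj tY]]; first exact: (clean0 tF).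
  have [gs _] := step s (cl s); exact: (clean_add gs tY).
move=> u t At; have [_ /=] := step (u, t) (cl (u, t)).
by rewrite /av; case: pselect.
Qed.

Theorem good_subring : exists A : subring T,
  [/\ forall a, A a -> a <> 0 -> avoids a,
   forall u t, avoids t -> exists2 a, A a & exists r, a - u = r * t &
   forall a x, A a -> a <> 0 -> A (a * x) -> A x].
Proof.
have [w [cw wt]] := generic_family; pose R := evl_ring w (fun=> True).
have Rav x : R x -> x <> 0 -> avoids x by move=> [t tT <-]; apply: cw.
have av0 x : avoids x -> x <> 0 by apply: avoids_neq0.
pose Aset := [set x | exists g, [/\ R g, avoids g & R (g * x)]].
have A1 : Aset 1 by exists 1; split; rewrite ?mulr1; [exact: sr1|exact: avoids1|exact: sr1].
have AB x y : Aset x -> Aset y -> Aset (x - y).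
  move=> [g [Rg ag Rgx]] [h [Rh ah Rhy]]; exists (g * h); split; [exact: srM|exact: avoidsM|].
  have -> : g * h * (x - y) = h * (g * x) - g * (h * y) by ring.
  by apply: srB; apply: srM.
have AM x y : Aset x -> Aset y -> Aset (x * y).
  move=> [g [Rg ag Rgx]] [h [Rh ah Rhy]]; exists (g * h); split; [exact: srM|exact: avoidsM|].
  by rewrite mulrACA; apply: srM.
exists (Subring A1 AB AM); split.
- move=> a [g [Rg ag Rga]] a0 P Pps Pa; have ga : g * a <> 0.
    by move=> /(avoids_cancel ag).
  by apply: (Rav _ Rga ga P Pps); apply: idealM.
- move=> u t At; exists (w (u, t)); last exact: wt.
  exists 1; split; [exact: sr1|exact: avoids1|rewrite mul1r]; by exists (Lf (u, t)).
- move=> a x [g [Rg ag Rga]] a0 [h [Rh ah Rhax]]; have ga : g * a <> 0.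
    by move=> /(avoids_cancel ag).
  exists (h * (g * a)); split; [exact: srM|exact: avoidsM (Rav _ Rga ga)|].
  have -> : h * (g * a) * x = g * (h * (a * x)) by ring.
  exact: srM.
Qed.

(** * The subring: completion, openness, catenarity *)

Variables (D : idomainType) (i : {rmorphism D -> T}).
Hypothesis inj_i : injective i.
Hypothesis i_av : forall a, a <> 0 -> avoids (i a).
Hypothesis i_dense : forall u t, avoids t -> exists a r, i a - u = r * t.
Hypothesis i_div : forall a x b, a <> 0 -> i a * x = i b -> exists c, x = i c.

Lemma approx a u : a <> 0 -> exists c r, u = i c + i a * r.
Proof.
move=> a0; have [c [r E]] := i_dense u (i_av a0); exists c, (- r).
by rewrite mulrN (mulrC (i a)) -E; ring.
Qed.

Lemma i_dvd a b x : a <> 0 -> i b = i a * x -> exists c, b = a * c.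
Proof.
move=> a0 E; have [c cE] := i_div a0 (esym E); exists c; apply: inj_i.
by rewrite E cE rmorphM.
Qed.

(** Density with modulus t^2 gives i a = t (1 + r t), and 1 + r t is a unit. *)
Lemma trace_exists t : M t -> avoids t -> exists a u v, [/\ a <> 0, i a = t * u & u * v = 1].
Proof.
move=> Mt At; have [a [r E]] := i_dense t (avoidsM At At).
have [v uv] : is_unit (1 + r * t) by rewrite -[r]opprK mulNr; apply: (cl_sub1 cM); apply: idealM.
have aE : i a = t * (1 + r * t) by rewrite -[i a](subrK t) E; ring.
exists a, (1 + r * t), v; split=> // a0.
have := avoids_neq0 At; apply.
by rewrite -[t]mulr1 -uv mulrA -aE a0 rmorph0 mul0r.
Qed.

Lemma trace_dvd t : avoids t -> exists a y, a <> 0 /\ i a = t * y.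
Proof.
move=> At; have [Mt|/(cl_unit cM)[y ty]] := pselect (M t).
  by have [a [u [v [a0 E _]]]] := trace_exists Mt At; exists a, u.
by exists 1, y; split; [apply/eqP/oner_neq0|rewrite rmorph1].
Qed.

Section Extension.
Variables (a : D) (a0 : a <> 0).

(** The ideal i(J) + i(a) T. As D/(a) and T/(i a) agree, it realises the correspondence between
    ideals of D containing a and ideals of T containing i a. *)
Definition ext (J : ideal D) : ideal T.
Proof.
exists [set t | exists c r, J c /\ t = i c + i a * r].
- by exists 0, 0; rewrite rmorph0 mulr0 addr0; split=> //.
- move=> _ _ [c [r [Jc ->]]] [c' [r' [Jc' ->]]]; exists (c + c'), (r + r').
  by split; [apply: idealD|rewrite rmorphD; ring].
- move=> u _ [c [r [Jc ->]]]; have [d [s ->]] := approx u a0.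
  exists (d * c), (s * i c + i d * r + i a * s * r); split; first exact: idealM.
  by rewrite rmorphM; ring.
Defined.

Lemma ext_i (J : ideal D) c : J c -> ext J (i c).
Proof. by move=> Jc; exists c, 0; rewrite mulr0 addr0. Qed.

Lemma ext_r (J : ideal D) t : ext J (i a * t).
Proof. by exists 0, t; rewrite rmorph0 add0r; split=> //. Qed.

Lemma ext_iP (J : ideal D) c : J a -> ext J (i c) <-> J c.
Proof.
move=> Ja; split; last exact: ext_i.
move=> [d [r [Jd E]]]; have [|e eE] := @i_dvd a (c - d) r a0; first by rewrite rmorphB E; ring.
by rewrite -[c](subrK d) eE; apply: idealD => //; apply: idealMl.
Qed.

Lemma ipre_ext (J : ideal D) : J a -> ipre i (ext J) = J.
Proof. by move=> Ja; apply/ideal_eq/ideal_ext => x; apply: ext_iP. Qed.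

Lemma ext_prime (J : ideal D) : J a -> is_prime J -> is_prime (ext J).
Proof.
move=> Ja [J1 JM]; split=> [|x y]; first by rewrite -(rmorph1 i) => /(ext_iP _ Ja).
have [c [r ->]] := approx x a0; have [d [s ->]] := approx y a0 => H.
have /(ext_iP _ Ja)/JM[Jc|Jd] : ext J (i (c * d)).
  have := idealB H (ext_r J (i c * s + i d * r + i a * r * s)).
  by congr (ext J _); rewrite rmorphM; ring.
  by left; apply: idealD; [apply: ext_i|apply: ext_r].
by right; apply: idealD; [apply: ext_i|apply: ext_r].
Qed.

Lemma ht_ext (P Q : ideal T) d : P (i a) -> Q (i a) -> ht_ge P Q d <-> ht_ge (ipre i P) (ipre i Q) d.
Proof.
move=> Pa Qa; pose K := igen [:: i a].
pose q : {rmorphism T -> quotient_ring K} := quotient_map K.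
have qS : forall y, exists x, q x = y := @quot_surj _ _.
pose f : {rmorphism D -> quotient_ring K} := q \o i.
have fS y : exists x, f x = y.
  have [t <-] := qS y; have [c [r ->]] := approx t a0; exists c.
  apply/eqP; rewrite eq_sym -subr_eq0 -rmorphB; apply/eqP/quot_eq0.
  by apply/igen1; exists r; ring.
have E (J : ideal T) : J (i a) -> ipre q (iimg qS J) = J.
  move=> Ja; apply/ideal_eq/ideal_ext => x; apply: iimgP => y /quot_eq0.
  exact: igen1_sub.
have E' (J : ideal T) : J (i a) -> ipre f (iimg qS J) = ipre i J.
  move=> Ja; apply/ideal_eq/ideal_ext => x.
  have : ipre q (iimg qS J) (i x) <-> J (i x) by rewrite E.
  exact.
rewrite -{1}(E P Pa) -{1}(E Q Qa) -(E' P Pa) -(E' Q Qa).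
by split=> [/(ht_ge_surj qS)/(ht_ge_surj fS)|/(ht_ge_surj fS)/(ht_ge_surj qS)].
Qed.

(** A map killing a factors through D/(a), which is also T/(i a). *)
Lemma ext_map S (f : {rmorphism D -> S}) : f a = 0 ->
  exists g : {rmorphism T -> S}, forall c, g (i c) = f c.
Proof.
move=> fa; have /choice[h hP] := fun u => approx u a0.
have key c t r : t = i c + i a * r -> f (h t) = f c.
  move=> E; have [s sE] := hP t; have [|e eE] := @i_dvd a (h t - c) (r - s) a0.
    by rewrite rmorphB; have := E; rewrite {1}sE => /eqP; rewrite -subr_eq => /eqP <-; ring.
  by rewrite -[h t](subrK c) eE rmorphD rmorphM fa mul0r add0r.
have gB : zmod_morphism (f \o h).
  move=> x y /=; have [r rE] := hP x; have [s sE] := hP y.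
  by rewrite -rmorphB; apply: (key _ _ (r - s)); rewrite {1}rE {1}sE rmorphB; ring.
have gM : monoid_morphism (f \o h).
  split=> [|x y] /=; first by rewrite -(rmorph1 f); apply: (key _ _ 0); rewrite rmorph1; ring.
  have [r rE] := hP x; have [s sE] := hP y.
  rewrite -rmorphM; apply: (key _ _ (s * i (h x) + i (h y) * r + i a * r * s)).
  by rewrite {1}rE {1}sE rmorphM; ring.
pose g : {rmorphism T -> S} := HB.pack (f \o h)
  (GRing.isZmodMorphism.Build T S (f \o h) gB) (GRing.isMonoidMorphism.Build T S (f \o h) gM).
exists g.
by move=> c; apply: (key _ _ 0); ring.
Qed.
End Extension.

(** Generators of the extension of J are approximated modulo a by elements of J; together with a
    these generate J. *)
Lemma sub_noeth : noetherian D.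
Proof.
move=> J; suff [s sE] : exists s, forall x, J x <-> igen s x by exists s; apply: ideal_ext.
have [[a Ja a0]|no] := pselect (exists2 a, J a & a <> 0); last first.
  exists [::] => x; rewrite igen_nil; split=> [Jx|->]; last exact: ideal0.
  by apply: contrapT => x0; apply: no; exists x.
have [ts tsE] := noeth_fg (cl_noeth cM) (ext a0 J).
have /choice[c cP] : forall k, exists c, J c /\ exists r, ts`_k = i c + i a * r.
  move=> k; have [kl|kl] := ltnP k (size ts); last first.
    by exists 0; split; [|exists 0; rewrite nth_default // rmorph0; ring].
  have /tsE[c [r [Jc E]]] := igen_mem (mem_nth 0 kl).
  by exists c; split=> //; exists r.
exists (a :: mkseq c (size ts)) => x; split; last first.
  by apply: igen_sub => y; rewrite in_cons => /orP[/eqP -> //|/mapP[k _ ->]]; case: (cP k).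
move=> Jx; have /tsE/igenP[u uE] := ext_i a0 Jx.
have /choice[d dP] : forall k, exists d, exists s, u k = i d + i a * s by move=> k; apply: approx.
have [r rE] : exists r, i x = i (\sum_(k < size ts) d k * c k) + i a * r.
  have /choice[s sP] : forall k, exists s, u k * ts`_k = i (d k * c k) + i a * s.
    move=> k; have [s ->] := dP k; have [_ [r ->]] := cP k.
    by exists (i (d k) * r + s * i (c k) + i a * s * r); rewrite rmorphM; ring.
  exists (\sum_(k < size ts) s k); rewrite uE mulr_sumr rmorph_sum -big_split.
  by apply: eq_bigr => k _; apply: sP.
have [|e eE] := @i_dvd a (x - \sum_(k < size ts) d k * c k) r a0; first by rewrite rmorphB rE; ring.
apply/igen_cons; exists e, (\sum_(k < size ts) d k * c k); split; last by rewrite mulrC -eE; ring.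
by apply: idealS => k _; apply/idealM/igen_mem/mapP; exists (k : nat) => //; rewrite mem_iota /=.
Qed.

Let N := ipre i M.
Lemma sub_prime : is_prime N. Proof. exact/ipre_prime/(cl_prime cM). Qed.
Lemma sub_unit x : ~ N x -> is_unit x.
Proof.
move=> Nx; have x0 : x <> 0 by move=> x0; apply: Nx; rewrite x0.
have /(cl_unit cM)[y xy] : ~ M (i x) := Nx.
have [|c cE] := @i_div x y 1 x0; first by rewrite xy rmorph1.
by exists c; apply: inj_i; rewrite rmorphM -cE xy rmorph1.
Qed.
Lemma sub_local : local_ring N.
Proof. exact: local_ringP sub_noeth sub_prime sub_unit. Qed.

Lemma N_neq0 : exists2 a, N a & a <> 0.
Proof.
have [t Mt At] : exists2 t, M t & forall P, List.In P ps -> ~ P t.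
  by apply: prime_avoidance0 => P Pps; split; [apply: ps_prime|apply: ps_max].
have [a [u [v [a0 E _]]]] := trace_exists Mt At.
by exists a => //; rewrite /N /= /mkset E; apply: idealMl.
Qed.

Lemma pow_approx k t : ipow M k t -> forall a, a <> 0 -> N a -> exists c r, ipow N k c /\ t = i c + i a * r.
Proof.
move=> Mt a a0 Na; suff : ipow M k `<=` ext a0 (ipow N k) by move=> /(_ _ Mt)[c [r H]]; exists c, r.
elim: k {Mt t} => [|k IH] t; first by move=> _; have [c [r E]] := approx t a0; exists c, r; split=> //; apply: ipow0.
move: t; apply: imul_sub => m y Mm /IH[d [s [Nd ->]]].
have [c [r mE]] := approx m a0.
exists (c * d), (i c * s + r * i d + i a * r * s); split; last by rewrite mE rmorphM; ring.
apply: ipowS => //; have : M (m - i a * r) by apply: idealB => //; apply: idealMl.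
by rewrite /N /= /mkset mE addrK.
Qed.

Lemma pow_contract k c : ipow M k (i c) -> ipow N k c.
Proof.
move=> Mc; have [a Na a0] := N_neq0.
have aNk : ipow N k.+1 (a ^+ k.+1) by apply: ipowX.
have ak0 : a ^+ k.+1 <> 0 by apply/eqP; rewrite expf_neq0 //; apply/eqP.
have Nak : N (a ^+ k.+1) by apply: (ipow1 N _).1; apply: (ipow_le (n := k.+1)) aNk.
have [d [r [Nd E]]] := pow_approx Mc ak0 Nak.
have [|e eE] := @i_dvd (a ^+ k.+1) (c - d) r ak0; first by rewrite rmorphB E; ring.
rewrite -[c](subrK d) eE; apply: idealD => //; exact/idealMl/ipowS_sub.
Qed.

Lemma pow_dense k t : exists c, ipow M k (t - i c).
Proof.
have [a Na a0] := N_neq0; have ak0 : a ^+ k <> 0 by apply/eqP; rewrite expf_neq0 //; apply/eqP.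
have [c [r ->]] := approx t ak0; exists c; rewrite addrC addKr; apply: idealMl.
by rewrite rmorphXn; apply: ipowX.
Qed.

Lemma completion_iso : exists phi : {rmorphism T -> completion N},
  bijective phi /\ forall c, phi (i c) = completion_map N c.
Proof.
have /choice[h hP] : forall t, exists c : nat -> D, forall k, ipow M k (t - i (c k)).
  by move=> t; have /choice[c cP] := pow_dense^~ t; exists c.
have hC t : cauchy_seq N (h t).
  move=> k; exists k => p q kp kq; apply: pow_contract; rewrite rmorphB.
  have := idealB (ipow_le kq (hP t q)) (ipow_le kp (hP t p)).
  by congr (ipow M k _); ring.
pose f t : completion_setoid N := mk_cauchy (hC t).
have eqf (x : cauchy N) t : (forall k, exists n, forall p, (n <= p)%N -> ipow M k (t - i (val x p))) -> cs_eq (f t) (x : completion_setoid N).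
  move=> H k; have [n nP] := H k; exists (maxn n k) => p; rewrite geq_max => /andP[np kp].
  apply: pow_contract; rewrite rmorphB.
  have := idealB (nP p np) (ipow_le kp (hP t p)).
  by congr (ipow M k _); rewrite /=; ring.
have fB x y : cs_eq (f (x - y)) (cs_add (f x) (cs_opp (f y))).
  apply: eqf => k; exists k => p kp; rewrite /= rmorphD rmorphN.
  have := idealB (ipow_le kp (hP x p)) (ipow_le kp (hP y p)).
  by congr (ipow M k _); ring.
have f1 : cs_eq (f 1) (cs_one (completion_setoid N)).
  by apply: eqf => k; exists 0%N => p _; rewrite /= rmorph1 subrr.
have fM x y : cs_eq (f (x * y)) (cs_mul (f x) (f y)).
  apply: eqf => k; exists k => p kp; rewrite /= rmorphM.
  have := idealD (idealMl y (ipow_le kp (hP x p))) (idealM (i (h x p)) (ipow_le kp (hP y p))).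
  by congr (ipow M k _); ring.
pose phi := setoid_rmorphism fB f1 fM; exists phi; split; last first.
  move=> c; apply/(cs_piP (S := completion_setoid N)); apply: eqf => k; exists 0%N => p _.
  by rewrite /= subrr.
apply: bij_inj_surj.
  move=> x y /(cs_piP (S := completion_setoid N)) H; apply/subr0_eq/(cl_sep cM) => k.
  have [n /(_ (maxn n k) (leq_maxl _ _)) /= Hn] := H k.
  have kp := leq_maxr n k.
  have H2 : ipow M k (i (h x (maxn n k) - h y (maxn n k))) by apply: rmorph_pow Hn.
  have := idealD (idealB (ipow_le kp (hP x _)) (ipow_le kp (hP y _))) H2.
  by congr (ipow M k _); rewrite rmorphB; ring.
move=> z; rewrite -[z]cs_reprK; set x := cs_repr z.
have /choice[n nP] := @cauchyP _ _ x.
pose m := fix m k := if k is k'.+1 then maxn (m k') (n k) else n 0%N.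
have mle k : (m k <= m k.+1)%N by rewrite /= leq_maxl.
have nm k : (n k <= m k)%N by case: k => // k; rewrite /= leq_maxr.
have [|l lP] := cl_conv cM (x := fun k => i (val x (m k))).
  by move=> k; rewrite -rmorphB; apply: (rmorph_pow (I := N)) => //; apply: nP => //; apply: leq_trans (mle k).
exists l; apply/(cs_piP (S := completion_setoid N)); apply: eqf => k; exists (n k) => p np.
apply: (@ideal_sub_trans _ _ (i (val x (m k)))) => //; rewrite -rmorphB.
by apply: (rmorph_pow (I := N)) => //; apply: nP.
Qed.

Lemma min_ext (Q : ideal D) a (a0 : a <> 0) s : Q a -> min_over Q (isum (izero D) (igen s)) ->
  min_over (ext a0 Q) (isum (izero T) (igen (map i s))).
Proof.
move=> Qa [pQ sQ mQ]; split; first exact: ext_prime.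
  apply: isum0_sub => _ /mapP[y ys ->]; exact/ext_i/sQ/isumR/igen_mem.
move=> R pR sR RQ t [c [r [Qc ->]]].
have H : Q `<=` ipre i R.
  apply: mQ; first exact: ipre_prime.
    by apply: isum0_sub => y ys; apply/sR/isumR/igen_mem/map_f.
  by move=> x Rx; apply/(ext_iP a0 _ Qa)/RQ.
by apply: idealD; [exact: (H c Qc)|apply: idealMl; exact: (H a Qa)].
Qed.

(** Parameters of the extension R are replaced by elements of Q congruent to them modulo (i a)^2,
    hence modulo R^2; by Nakayama these still generate R locally. The height of Q is bounded below
    by extending parameters of Q to T. *)
Lemma sub_regat (Q : ideal D) a (a0 : a <> 0) d : Q a -> is_prime Q ->
  regat (izero T) (ext a0 Q) d -> regat (izero D) Q d.
Proof.
move=> Qa pQ [pR [s [ss sR sg hR]]]; split=> //; set R := ext a0 Q in pR sR sg hR.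
have aa0 : a * a <> 0 by apply/eqP; rewrite mulf_neq0 //; apply/eqP.
have Ra : R (i a) by apply: ext_i.
have /choice[c cP] : forall j, exists c, Q c /\ exists r, s`_j = i c + i a * (i a * r).
  move=> j; have Rs : R s`_j.
    by have [jl|jl] := ltnP j (size s); [apply/sR/mem_nth|rewrite nth_default //].
  have [c [r E]] := approx s`_j aa0; exists c; split; last by exists r; rewrite E rmorphM; ring.
  have : R (s`_j - i (a * a) * r) by apply: idealB => //; apply: idealMl; rewrite rmorphM; apply: idealM.
  by rewrite E addrK => /(ext_iP a0 _ Qa).
pose cs := mkseq c d.
have csQ x : x \in cs -> Q x by move=> /mapP[j _ ->]; case: (cP j).
have csm j : (j < d)%N -> c j \in cs by move=> jd; apply/mapP; exists j => //; rewrite mem_iota.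
have [t Rt tP] : exists2 t, ~ R t & forall x, R x -> igen (map i cs) (t * x).
  apply: (nakayama_at (cl_noeth cM) (pP := pR) (K := igen (map i cs)) (L := R)) => x Rx; have [t Rt] := sg x Rx.
  move=> H; exists t => //; have H1 : isum (izero T) (igen s) `<=` isum (igen (map i cs)) (ideal_mul R R); last exact: H1.
  apply: isum0_sub => y /(nthP 0)[j jl <-]; have [_ [r ->]] := cP j.
  apply: idealD; first by apply/isumL/igen_mem/map_f/csm; rewrite -ss.
  by apply/isumR/imul_mem => //; apply: idealMl.
exists cs; split=> //; first by rewrite size_mkseq.
  (* The multiplier t is replaced by an element of D congruent to it modulo a nonzero generator b.
     If all generators were 0, t would kill i a and be 0. *)
  move=> x Qx; have [[b bcs b0]|no] := pselect (exists2 b, b \in cs & b <> 0); last first.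
    have : t * i a = 0.
      have : igen (map i cs) `<=` izero T.
        apply: igen_sub => _ /mapP[y ycs ->]; have -> : y = 0 by apply: contrapT => y0; apply: no; exists y.
        exact: (rmorph0 i).
      by apply; apply: tP.
    rewrite mulrC => /(avoids_cancel (i_av a0)) E.
    by case: Rt; rewrite E.
  have [u [r tE]] := approx t b0; exists u.
    move=> Qu; apply: Rt; rewrite tE; apply: idealD; first exact: ext_i.
    by apply/idealMl/ext_i/csQ.
  apply: isumR; have Jb : igen cs b by apply: igen_mem.
  apply/(ext_iP b0 _ Jb).
  have H : igen (map i cs) `<=` ext b0 (igen cs).
    by apply: igen_sub => _ /mapP[y ycs ->]; apply/ext_i/igen_mem.
  have := idealB (H _ (tP _ (ext_i a0 Qx))) (ext_r b0 (igen cs) (r * i x)).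
  by congr (ext b0 _ _); rewrite tE rmorphM; ring.
have [e [he1 he2]] := exact_height sub_noeth pQ.
have [de|ed] := leqP d e; first exact: ht_ge_le he1.
have [|s' [s'e _ mQ]] := height_params sub_noeth pQ _ he2; first by move=> x ->.
have := height_le (cl_noeth cM) (min_ext a0 Qa mQ) hR; rewrite size_map => H.
by have := leq_trans H s'e; rewrite leqNgt ed.
Qed.

Hypothesis ps_min : forall P Q, List.In P ps -> List.In Q ps -> Q `<=` P -> P `<=` Q.
Hypothesis T_char : forall n, n.+1%:R <> 0 :> T.

(** An element e outside P, but in the minimal primes different from P, makes T and T/P agree away
    from e; and T/P satisfies J-0 as a complete local domain. *)
Lemma comp_regular (P : ideal T) : List.In P ps -> exists2 x, ~ P x &
  forall I, is_prime I -> ~ I x -> exists d, regat (izero T) I d.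
Proof.
move=> Pps; have pP := ps_prime Pps.
have [qs qsE] := filter_In ps (fun q => ~ q `<=` P).
have [|e Pe eq] := @outside_product T P qs pP; first by move=> q /qsE[].
have ftq : finite_type (quotient_map P).
  by exists [::] => S SA _ _ _ y; have [x <-] := quot_surj y.
have [h' h0 hP] := J0_complete cM (quot_dom pP) ftq; have [h hE] := quot_surj h'.
have Ph : ~ P h by move=> H; apply: h0; rewrite -hE; apply/quot_eq0.
exists (e * h) => [/pP.2[]//|R pR nR].
have Re : ~ R e by move=> H; apply/nR/idealMl.
have Rh : ~ R h by move=> H; apply/nR/idealM.
have PR : P `<=` R.
  have [q qps qR] : exists2 q, List.In q ps & q `<=` R.
    apply: contrapT => no; have [|y Ry yq] := @outside_product T R ps pR.
      by move=> q qps qR; apply: no; exists q.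
    by apply: Ry; rewrite (ps_red yq).
  have [qP|qP] := pselect (q `<=` P); first by move=> x /(ps_min Pps qps qP)/qR.
  by case: Re; apply/qR/eq/qsE.
have kR : ipre (quotient_map P) (izero _) `<=` R by rewrite ipre_quot.
have [||d rd] := hP (iimg (@quot_surj T P) R); first exact: iimg_prime.
  by rewrite -hE => /(iimgP _ _ kR).
exists d; have := (regat_surj (@quot_surj T P) _ _ _).1 rd.
rewrite ipre_quot ipre_iimg_quot // => -[_ [s [ss sR sg hR]]]; split=> //; exists s; split=> //.
  move=> x /sg[t Rt [p [y [Pp ys E]]]]; exists (e * t); first by move=> /pR.2[].
  have ep : e * p = 0.
    apply: ps_red => q qps; have [qP|qP] := pselect (q `<=` P).
      by apply/idealM/(ps_min Pps qps qP).
    by apply/idealMl/eq/qsE.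
  by apply: isumR; rewrite -mulrA E mulrDr ep add0r; apply: idealM.
by apply: ht_ge_mono hR => x ->.
Qed.

(** A combination t of the elements [x P] avoids all minimal primes and divides a nonzero a of D. A
    prime of D missing a extends to a prime missing t, hence missing some [x P]. *)
Lemma sub_J0 : J0 D.
Proof.
have /choice[x xP] : forall P, exists x, List.In P ps -> ~ P x /\
    forall I, is_prime I -> ~ I x -> exists d, regat (izero T) I d.
  move=> P; have [/comp_regular[x Px xP]|] := pselect (List.In P ps); first by exists x.
  by exists 0.
pose xs := mkseq (fun j => x (nth M ps j)) (size ps).
have [|t tI At] := @prime_avoidance0 _ (igen xs) ps.
  move=> P Pps; split; first exact: ps_prime.
  move=> H; have [] := xP P Pps; case; apply/H/igen_mem.
  have [j jl jE] := nth_In M Pps; apply/mapP; exists j; first by rewrite mem_iota.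
  by rewrite jE.
have [a [y [a0 aE]]] := trace_dvd At; exists a => // Q pQ Qa.
have [[b Qb b0]|no] := pselect (exists2 b, Q b & b <> 0); last first.
  exists 0%N; split=> //; exists [::]; split=> //.
    move=> z Qz; exists 1; first exact: pQ.1.
    have -> : z = 0 by apply: contrapT => z0; apply: no; exists z.
    by rewrite mulr0.
  by apply: ht_ge0 => // z ->.
pose R := ext b0 Q; have pR : is_prime R by apply: ext_prime.
have nt : ~ R t by move=> Rt; apply: Qa; apply/(ext_iP b0 _ Qb); rewrite aE; apply: idealMl.
have [P [Pps Rx]] : exists P, List.In P ps /\ ~ R (x P).
  apply: contrapT => no; apply: nt; move: t tI {At aE}; apply: igen_sub => _ /mapP[j + ->].
  rewrite mem_iota /= => jl; apply: contrapT => nR; apply: no; exists (nth M ps j).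
  by split=> //; apply: In_nth.
have [d rd] := (xP P Pps).2 R pR Rx.
by exists d; exact: (sub_regat Qb pQ rd).
Qed.

Lemma sub_good : good D.
Proof.
split; [exact: sub_noeth|exact: sub_J0|left=> n].
by apply/eqP => E; apply: (T_char (n := n)); rewrite -(rmorph_nat i) E rmorph0.
Qed.

(** A quotient B/P on which some nonzero element of D vanishes is of finite type over the complete
    ring T; otherwise D embeds in it and [sub_good] applies. *)
Theorem sub_openness (B : comPzRingType) (f : {rmorphism D -> B}) : finite_type f ->
  zariski_open (@regular_locus B).
Proof.
move=> ft; apply: nagata => [|P pP]; first exact: noeth_finite_type sub_noeth ft.
pose f' : {rmorphism D -> quotient_ring P} := quotient_map P \o f.
have ft' : finite_type f' by apply: finite_type_comp => //; apply: quot_surj.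
have [[a a0 fa]|no] := pselect (exists2 a, a <> 0 & f' a = 0).
  have [g gi] := ext_map a0 fa.
  apply: (J0_complete (f := g) cM (quot_dom pP)).
  have [s sP] := ft'; exists s => S Sg Ss SD SM; apply: sP => // c.
  by rewrite -gi.
have [s sP] := finite_typeP ft'.
apply: (J0_good (quot_dom pP) _ sP sub_good) => x y E; apply/eqP; rewrite -subr_eq0.
by apply/eqP; apply: contrapT => xy; apply: no; exists (x - y) => //; rewrite rmorphB E subrr.
Qed.

Definition reldim R (P : ideal R) (d : ideal R -> nat) := forall Q1 Q2 : ideal R,
  is_prime Q1 -> is_prime Q2 -> P `<=` Q1 -> Q1 `<=` Q2 ->
  ht_ge Q1 Q2 (d Q2 - d Q1) /\ forall e, ht_ge Q1 Q2 e -> (d Q1 + e <= d Q2)%N.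

Lemma reldim_T (P : ideal T) : is_prime P -> exists d, reldim P d.
Proof.
move=> pP; pose q := @quot_surj T P.
have cq : clocal (iimg q M).
  by apply: (clocal_surj cM q); rewrite ipre_quot; apply: local_sub (cl_unit cM) pP.1.
have [d dd] := dimfun_complete cq (quot_dom pP).
exists (fun Q => d (iimg q Q)) => Q1 Q2 p1 p2 PQ1 Q12.
have PQ2 : P `<=` Q2 by move=> x /PQ1/Q12.
have [||| h1 h2] := dd (iimg q Q1) (iimg q Q2); try by apply: iimg_prime; rewrite ?ipre_quot.
  by move=> _ [x Q1x <-]; exists x => //; apply: Q12.
split=> [|e he].
  by have := (ht_ge_surj q _ _ _).1 h1; rewrite !ipre_iimg_quot.
by apply: h2; apply/(ht_ge_surj q); rewrite !ipre_iimg_quot.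
Qed.

Lemma reldim_sub (P : ideal D) a : is_prime P -> P a -> a <> 0 -> exists d, reldim P d.
Proof.
move=> pP Pa a0; have [d dd] := reldim_T (ext_prime a0 Pa pP).
exists (fun Q => d (ext a0 Q)) => Q1 Q2 p1 p2 PQ1 Q12.
have Q1a := PQ1 a Pa; have Q2a := Q12 a Q1a.
have mono (I J : ideal D) : I `<=` J -> ext a0 I `<=` ext a0 J.
  by move=> IJ _ [c [r [Ic ->]]]; exists c, r; split=> //; apply: IJ.
have [h1 h2] := dd _ _ (ext_prime a0 Q1a p1) (ext_prime a0 Q2a p2) (mono _ _ PQ1) (mono _ _ Q12).
split=> [|e he]; first by have := h1; rewrite (ht_ext a0) ?ipre_ext //; apply: ext_i.
by apply: h2; apply/(ht_ext a0); [apply: ext_i..|rewrite !ipre_ext].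
Qed.

Variable n : nat.
Hypothesis n_gt1 : (1 < n)%N.
Hypothesis ps_all : forall Q, is_prime Q -> exists2 P, List.In P ps & P `<=` Q.
Hypothesis T_dim : ~ ht_ge (izero T) M n.+1.
Hypothesis ps_dim : forall P, List.In P ps ->
  (ht_ge P M 1 /\ ~ ht_ge P M 2) \/ (ht_ge P M n /\ ~ ht_ge P M n.+1).
Hypothesis ps_dimn : exists2 P, List.In P ps & ht_ge P M n.

Lemma prime_sub_M (Q : ideal T) : is_prime Q -> Q `<=` M.
Proof. by case=> Q1 _; apply: local_sub (cl_unit cM) Q1. Qed.
Lemma prime_sub_N (Q : ideal D) : is_prime Q -> Q `<=` N.
Proof. by case=> Q1 _; apply: local_sub sub_unit Q1. Qed.

Lemma coheight_le (Q : ideal D) a e : Q a -> a <> 0 -> ht_ge Q N e -> (e < n)%N.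
Proof.
move=> Qa a0 hQ; rewrite ltnNge; apply/negP => ne.
have [c cc [Qc cM']] : ht_ge (ext a0 Q) M e.
  apply/(ht_ext a0); [exact: ext_i| |by rewrite ipre_ext].
  exact: (ht_ge_I hQ Qa).
have pc := Defs.primeP (c 0%N); have [P Pps Pc] := ps_all pc.
have ca : c 0%N (i a) by apply/Qc/ext_i.
have h1 : ht_ge P (c 0%N) 1.
  apply: ht_ge1 (ps_prime Pps) pc _.
  by apply: (properI Pc ca); apply: i_av.
have h2 : ht_ge (c 0%N) M e by exists c => //; split.
apply: T_dim; apply: (ht_ge_le (d := (1 + e)%N)); first by rewrite add1n ltnS.
by apply: ht_ge_mono (ht_ge_cat h1 h2) => x ->.
Qed.

(** The extension R of P1 has height one over a minimal prime P. If P has coheight n this gives the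
    claim. If P had coheight 1, then R = M would be minimal over i a modulo a minimal prime of
    coheight n, contradicting n > 1. *)
Lemma ht1_coheight (P1 : ideal D) a : a <> 0 -> min_over P1 (isum (izero D) (igen [:: a])) ->
  ht_ge P1 N n.-1.
Proof.
move=> a0 mP; have [pP sP _] := mP.
have Pa : P1 a by apply/sP/iadd1R.
set R := ext a0 P1; have Ra : R (i a) by apply: ext_i.
have [pR _ mR] := min_ext a0 Pa mP; rewrite -/R in pR mR.
have RM := prime_sub_M pR; have pM := cl_prime cM.
have mPR (P : ideal T) : P `<=` R -> min_over R (isum P (igen [:: i a])).
  move=> PR; split=> //; first exact: iadd1_sub.
  move=> Q pQ sQ QR; apply: mR => // x [y [z [y0 zs ->]]]; apply: idealD; last by apply/sQ/isumR.
  by rewrite y0.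
have [P Pps PR] := ps_all pR; have pPi := ps_prime Pps; have PM := prime_sub_M pPi.
have [d dd] := reldim_T pPi.
have hPR : ht_ge P R 1.
  apply: ht_ge1 pPi pR _.
  by apply: (properI PR Ra); apply: i_av.
have [h1 l1] := dd P R pPi pR (fun x => id) PR.
have [h2 l2] := dd P M pPi pM (fun x => id) PM.
have [h3 l3] := dd R M pR pM PR RM.
have dR : d R = (d P).+1.
  apply/eqP; rewrite eqn_leq -{2}addn1 l1 // andbT -addn1 -leq_subLR.
  exact: (height_le (cl_noeth cM) (mPR P PR) h1).
have dM m : ht_ge P M m -> ~ ht_ge P M m.+1 -> d M = (d P + m)%N.
  move=> hm nm; apply/eqP; rewrite eqn_leq l2 // andbT -leq_subLR leqNgt; apply/negP => H.
  by apply: nm; apply: ht_ge_le h2.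
have [[p1 p2]|[p1 p2]] := ps_dim Pps; have := dM _ p1 p2 => dME; last first.
  rewrite -(ipre_ext a0 Pa); apply/(ht_ext a0) => //; first exact: RM.
  by move: h3; rewrite dME dR -addn1 subnDl subn1.
have MR : M `<=` R.
  move=> x Mx; apply: contrapT => Rx; have : ht_ge R M 1.
    by apply: ht_ge1 pR pM _; apply: (properI RM Mx).
  by move/l3; rewrite dR dME addn1 addn1 ltnn.
have [P' P'ps hn] := ps_dimn; have P'R : P' `<=` R by move=> x /(prime_sub_M (ps_prime P'ps))/MR.
have E : ideal_set R = M by apply/seteqP; split.
have := height_le (cl_noeth cM) (mPR P' P'R); rewrite (ideal_eq E) => /(_ _ hn) /=.
by rewrite leqNgt n_gt1.
Qed.

Lemma ht_ge_first R (P Q : ideal R) e : ht_ge P Q e.+1 ->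
  exists P', [/\ is_prime P', P `<` P' & ht_ge P' Q e].
Proof.
move=> [c cc [Pc cQ]]; have [H1 H2] := cc 0%N isT; exists (c 1%N); split; first exact: Defs.primeP.
  by split=> [x /Pc/H1//|H]; apply: H2 => x /H/Pc.
by exists (fun k => c k.+1) => [k ke|]; [apply: cc|split].
Qed.

(** The dimension function is n minus the coheight at nonzero primes and 0 at the zero prime. Above
    a nonzero prime its additivity comes from T; [ht1_coheight] makes it equal to 1 at every height
    one prime. *)
Theorem sub_catenary : catenary D.
Proof.
have pN := sub_prime.
have /choice[co coP] : forall Q : ideal D, exists e, is_prime Q -> (exists2 a, Q a & a <> 0) ->
    ht_ge Q N e /\ forall e', ht_ge Q N e' -> (e' <= e)%N.
  move=> Q; have [[pQ [a Qa a0]]|no] := pselect (is_prime Q /\ exists2 a, Q a & a <> 0); last first.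
    by exists 0%N => pQ Qa; case: no.
  have [d dd] := reldim_sub pQ Qa a0; have [h l] := dd Q N pQ pN (fun x => id) (prime_sub_N pQ).
  exists (d N - d Q)%N => _ _; split=> // e' /l H.
  by rewrite -(leq_add2l (d Q)) subnKC // (leq_trans _ H) // leq_addr.
have step (P Q : ideal D) a : is_prime P -> is_prime Q -> P a -> a <> 0 -> P `<=` Q ->
    [/\ (co Q <= co P)%N, (co P < n)%N, ht_ge P Q (co P - co Q) & forall e, ht_ge P Q e -> (e + co Q <= co P)%N].
  move=> pP pQ Pa a0 PQ; have Qa := PQ a Pa.
  have [hP mP] := coP P pP (ex_intro2 _ _ a Pa a0); have [hQ mQ] := coP Q pQ (ex_intro2 _ _ a Qa a0).
  have le e : ht_ge P Q e -> (e + co Q <= co P)%N by move=> h; apply/mP/(ht_ge_cat h hQ).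
  split=> //; [exact: (le 0%N (ht_ge0 pQ PQ))|exact: coheight_le Pa a0 hP|].
  have [d dd] := reldim_sub pP Pa a0.
  have [h1 l1] := dd P Q pP pQ (fun x => id) PQ.
  have [h2 l2] := dd Q N pQ pN PQ (prime_sub_N pQ).
  have [h3 l3] := dd P N pP pN (fun x => id) (prime_sub_N pP).
  suff -> : (co P - co Q)%N = (d Q - d P)%N by [].
  have := mP _ h3; have := l3 _ hP; have := mQ _ h2; have := l2 _ hQ; have := l1 0%N (ht_ge0 pQ PQ).
  rewrite addn0; lia.
pose isz (Q : ideal D) := forall x, Q x -> x = 0.
pose del Q := if pselect (isz Q) then 0%N else (n - co Q)%N.
have nz (Q : ideal D) : ~ isz Q -> exists2 a, Q a & a <> 0.
  by move=> H; apply: contrapT => no; apply: H => x Qx; apply: contrapT => x0; apply: no; exists x.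
apply: (@dimfun_catenary _ del) => P Q pP pQ PQ.
have h0 := ht_ge0 pQ PQ.
rewrite /del; case: pselect => Qz; case: pselect => Pz /=.
- split=> // -[|e] // /ht_ge_first[P' [pP' [_ H] /ht_ge_I P'Q]].
  by case: H => x /P'Q/Qz ->.
- by case: Pz => x /PQ/Qz.
- have [b Qb b0] := nz Q Qz; rewrite subn0.
  have bQ : isum (izero D) (igen [:: b]) `<=` Q.
    exact: iadd1_sub.
  have [P1 mP1 P1Q] := min_prime_below sub_noeth pQ bQ; have [pP1 bP1 _] := mP1.
  have P1b : P1 b by apply/bP1/iadd1R.
  have [l1 l2 h2 l3] := step P1 Q b pP1 pQ P1b b0 P1Q.
  have [hP1 mxP1] := coP P1 pP1 (ex_intro2 _ _ b P1b b0).
  have coE : co P1 = n.-1.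
    by have := mxP1 _ (ht1_coheight b0 mP1); lia.
  have PP1 : P `<` P1.
    by apply: (@properI _ P P1 b) => // [x /Pz ->|/Pz//].
  have h1 : ht_ge P P1 1 by apply: ht_ge1.
  split.
    have -> : (n - co Q)%N = (1 + (co P1 - co Q))%N by lia.
    exact: ht_ge_cat h1 h2.
  move=> [|e] // he; rewrite add0n.
  have [P' [pP' [PP' P'P] hP']] := ht_ge_first he.
  have [a P'a a0] : exists2 a, P' a & a <> 0.
    apply: nz => H; apply: P'P => x /H ->; exact: ideal0.
  have [_ l4 _ /(_ _ hP')] := step P' Q a pP' pQ P'a a0 (ht_ge_I hP'); lia.
- have [a Pa a0] := nz P Pz; have [l1 l2 h l3] := step P Q a pP pQ Pa a0 PQ.
  split; first by have -> : (n - co Q - (n - co P))%N = (co P - co Q)%N by lia.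
  by move=> e /l3; lia.
Qed.
(** Choose z in exactly the minimal primes that miss x. Then x z lies in all of them and x + z in
    none. *)
Lemma i_split x : exists z y d, [/\ d <> 0, x * z = 0 & (x + z) * y = i d].
Proof.
have [qs qsE] := filter_In ps (fun q => q x).
have [qs' qs'E] := filter_In ps (fun q => ~ q x).
have [|z Jz zq] := @prime_avoidance0 _ (icap (fun q => List.In q qs')) qs.
  move=> p /qsE[pps px]; have pp := ps_prime pps; split=> // H.
  have [|y py yq] := @outside_product T p qs' pp.
    by move=> q /qs'E[qps qx] /(ps_min pps qps)/(_ _ px).
  by apply/py/H.
have [a [y [a0 E]]] : exists a y, a <> 0 /\ i a = (x + z) * y.
  apply: trace_dvd => q qps.
  have [qx|qx] := pselect (q x).
    move=> H; have qz : q z by rewrite -(addKr x z) addrC; apply: idealB.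
    by apply: (zq q) => //; apply/qsE.
  have qz : q z by apply/Jz/qs'E.
  by move=> H; have := idealB H qz; rewrite addrK.
exists z, y, a; split=> //; apply: ps_red => q qps; have [qx|qx] := pselect (q x); first exact: idealMl.
by apply/idealM/Jz/qs'E.
Qed.

Theorem subring_good : [/\ local_ring N, quasi_excellent N, catenary D & ring_isomorphic (completion N) T].
Proof.
have [phi [bphi phiE]] := completion_iso; have [psi [psiK phiK]] := bij_inverse bphi.
split; [exact: sub_local| |exact: sub_catenary|by exists psi; exists phi].
split; last exact: sub_openness.
have phiS y : exists x, phi x = y by exists (psi y); apply: phiK.
apply: (regular_fibre (noeth_surj phiS (cl_noeth cM))) => [a u a0|x|k E].
- have [c [r E]] := approx (psi u) a0; exists c, (phi r).
  by rewrite -(phiK u) E rmorphD rmorphM !phiE.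
- have [z [y [d [d0 xz xzy]]]] := i_split (psi x).
  exists (phi z), (phi y), d; split=> //; first by rewrite -(phiK x) -rmorphM xz rmorph0.
  by rewrite -(phiK x) -rmorphD -rmorphM xzy phiE.
- by apply: (T_char (n := k)); rewrite -(rmorph_nat i) E rmorph0.
Qed.
End Construction.

Theorem quasi_excellent_catenary_domain T (M : ideal T) (n : nat) :
  complete_local_ring M -> char_zero T -> krull_dim T n -> (1 < n)%N ->
  (forall z : int, z%:~R <> 0 :> T -> ~ zero_divisor (z%:~R : T)) -> reduced T ->
  (forall P : Spec T, minimal_prime P -> krull_dim (quotient_ring P) 1 \/ krull_dim (quotient_ring P) n) ->
  (exists P1 : Spec T, minimal_prime P1 /\ krull_dim (quotient_ring P1) n) ->
  exists (A : idomainType) (N : ideal A),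
     [/\ local_ring N, quasi_excellent N, catenary A & ring_isomorphic (completion N) T].
Proof.
move=> /complete_clocal cM T_char T_dim n1 T_int T_red T_min [Pn [Pn_min Pn_dim]].
have nT := cl_noeth cM; have pM := cl_prime cM.
have [ps0 [ps0P ps0all]] := primes_over nT (izero T).
pose mnl (p : ideal T) := forall Q, is_prime Q -> Q `<=` p -> p `<=` Q.
have [ps psE] := filter_In ps0 mnl.
have ps_prime P : List.In P ps -> is_prime P by move=> /psE[/ps0P[]].
have ps_mnl P : List.In P ps -> mnl P by move=> /psE[].
have ps_all Q : is_prime Q -> exists2 P, List.In P ps & P `<=` Q.
  move=> pQ; have [Q' [pQ' _ mQ'] Q'Q] := min_prime_below nT pQ (@izero_sub _ Q).
  have [p pps pQ''] := ps0all Q' pQ' (@izero_sub _ Q'); exists p; last by move=> x /pQ''/Q'Q.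
  apply/psE; split=> // R pR Rp x px; apply: (mQ' R pR (@izero_sub _ R)); last exact: pQ''.
  by move=> y /Rp/pQ''.
have ps_ne : exists P, List.In P ps by have [P Pps _] := ps_all M pM; exists P.
have ps_min P Q : List.In P ps -> List.In Q ps -> Q `<=` P -> P `<=` Q.
  by move=> Pps Qps; apply: ps_mnl => //; apply: ps_prime.
have ps_red x : (forall P, List.In P ps -> P x) -> x = 0.
  move=> H; have [k /T_red //] : exists k, izero T (x ^+ k).
  by apply: radical_prime => // Q pQ _; have [P Pps PQ] := ps_all Q pQ; apply/PQ/H.
have ps_dim P : List.In P ps -> (ht_ge P M 1 /\ ~ ht_ge P M 2) \/ (ht_ge P M n /\ ~ ht_ge P M n.+1).
  move=> Pps; have pP := ps_prime P Pps.
  have [Q QP|d1|dn] := T_min (PrimeIdeal pP); first exact: (ps_mnl P Pps Q (Defs.primeP Q) QP).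
    by left; exact: (krull_chain cM pP d1).
  by right; exact: (krull_chain cM pP dn).
have ps_max P : List.In P ps -> ~ (M `<=` P).
  move=> Pps MP; have h1 : ht_ge P M 1.
    by case: (ps_dim P Pps) => -[h _] //; apply: ht_ge_le h; apply: ltnW.
  have [Q hQ [_ nQ]] := ht_ge_pred h1; apply: nQ => x /MP Px; exact: (ht_ge_I hQ Px).
have ps_dimn : exists2 P, List.In P ps & ht_ge P M n.
  have [P Pps PPn] := ps_all Pn (Defs.primeP Pn); exists P => //.
  have [h _] := krull_chain cM (Defs.primeP Pn) Pn_dim.
  by apply: ht_ge_mono h.
have T_dim' : ~ ht_ge (izero T) M n.+1 by move=> [c cc _]; apply: T_dim.2; exists c.
have T_char' k : k.+1%:R <> 0 :> T by move=> /T_char.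
(* Some power of an integer in a minimal prime is killed by an element outside that prime, and would
   be an integer zero divisor. *)
have ps_char P : List.In P ps -> forall k, ~ P k.+1%:R.
  move=> Pps k Pk.
  have mP : min_over P (izero T) by split=> // [|Q pQ _]; [exact: ps_prime|exact: ps_mnl].
  have [t [m [Pt E]]] := min_over_nil nT mP Pk.
  have E' : ((k.+1 ^ m)%N : int)%:~R = k.+1%:R ^+ m :> T by rewrite -natrX.
  apply: (T_int ((k.+1 ^ m)%N : int)); rewrite E'.
    by rewrite -natrX => /T_char/eqP; rewrite expn_eq0.
  by exists t; split=> [t0|]; [apply: Pt; rewrite t0|rewrite mulrC].
have [A [A1 A2 A3]] := good_subring cM ps_prime ps_ne ps_max ps_red ps_char.
have dA : is_prime (izero (sr_ring A)).
  split=> [|x y xy]; first by move=> /(congr1 (@sr_val _ A)) E; apply: (T_char' 0%N).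
  have [x0|x0] := pselect (x = 0); [by left|right].
  apply: (@sr_val_inj _ A); apply: (avoids_cancel (ps := ps) ps_prime ps_red (x := sr_val x)).
    by apply: A1; [exact: sr_valP|move=> E; apply: x0; apply: (@sr_val_inj _ A)].
  by have := congr1 (@sr_val _ A) xy.
pose D := dom_ring dA; pose i : {rmorphism D -> T} := @sr_val _ A \o of_dom dA.
have inj_i : injective i by move=> x y E; apply: (@sr_val_inj _ A).
have iA a : A (i a) by apply: (@sr_valP _ A).
have lift x : A x -> exists a, i a = x by move=> /sr_lift[y yE]; exists y.
have i_neq0 a : a <> 0 -> i a <> 0 by move=> a0 E; apply: a0; apply: inj_i; rewrite E rmorph0.
have i_av a : a <> 0 -> avoids ps (i a) by move=> a0; apply: A1 => //; apply: i_neq0.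
have i_dense u t : avoids ps t -> exists a r, i a - u = r * t.
  by move=> At; have [a Aa [r E]] := A2 u t At; have [c cE] := lift a Aa; exists c, r; rewrite cE.
have i_div a x b : a <> 0 -> i a * x = i b -> exists c, x = i c.
  by move=> a0 E; have [|c <-] := lift x; [apply: (A3 (i a)); rewrite ?E //; apply: i_neq0|exists c].
exists D, (ipre i M). exact: (subring_good cM ps_prime ps_ne ps_max ps_red inj_i i_av i_dense i_div ps_min T_char' n1 ps_all T_dim' ps_dim ps_dimn).
Qed.

(** * The filtration of a completion *)

Section CompletionFiltration.
Variables (A : comPzRingType) (N : ideal A).
Let S := completion_setoid N.

Definition cfil (k : nat) : ideal (completion N).
Proof.
exists [set X | exists x : cauchy N, @Defs.cs_pi S x = X /\ exists n0, forall n, (n0 <= n)%N -> ipow N k (val x n)].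
- exists (cauchy_cst N 0); split=> //; exists 0%N => n _; exact: ideal0.
- move=> _ _ [x [<- [n1 H1]]] [y [<- [n2 H2]]]; exists (cauchy_add x y); split; first exact: (cs_piD (S := S)).
  by exists (maxn n1 n2) => n; rewrite geq_max => /andP[l1 l2]; apply: idealD; [apply: H1|apply: H2].
- move=> a _ [x [<- [n1 H1]]]; exists (cauchy_mul (cs_repr a) x); split.
    by rewrite (cs_piM (S := S)) cs_reprK.
  by exists n1 => n l1; apply/idealM/H1.
Defined.

Lemma cfilM j k X Y : cfil j X -> cfil k Y -> cfil (j + k) (X * Y).
Proof.
move=> [x [<- [n1 H1]]] [y [<- [n2 H2]]]; exists (cauchy_mul x y); split; first exact: (cs_piM (S := S)).
by exists (maxn n1 n2) => n; rewrite geq_max => /andP[l1 l2]; apply: ipowD; [apply: H1|apply: H2].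
Qed.

Lemma cfil0 X : cfil 0 X.
Proof. by exists (cs_repr X); split; [exact: cs_reprK|exists 0%N => n _; apply: ipow0]. Qed.

Lemma cfil_cst k a : cfil k (completion_map N a) <-> ipow N k a.
Proof.
split=> [[x [/(cs_piP (S := S)) E [n1 H1]]]|H]; last first.
  by exists (cauchy_cst N a); split=> //; exists 0%N.
have [n2 H2] := E k; have := H2 _ (leq_maxr n1 n2) => /= Hn.
by have := idealB (H1 _ (leq_maxl n1 n2)) Hn; congr (ipow N k _); rewrite /=; ring.
Qed.

Lemma cfil_sep X : (forall k, cfil k X) -> X = 0.
Proof.
rewrite -[X]cs_reprK => H; apply/(cs_piP (S := S)) => k.
have [x [/(cs_piP (S := S)) E [n1 H1]]] := H k; have [n2 H2] := E k.
exists (maxn n1 n2) => n; rewrite geq_max => /andP[l1 l2] /=; rewrite subr0.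
by have := idealB (H1 _ l1) (H2 _ l2); congr (ipow N k _); rewrite /=; ring.
Qed.

Lemma cfil_dense k X : exists a, cfil k (X - completion_map N a).
Proof.
have [n nP] := cauchyP (cs_repr X) k; exists (val (cs_repr X) n).
exists (cauchy_add (cs_repr X) (cauchy_opp (cauchy_cst N (val (cs_repr X) n)))); split.
  by rewrite (cs_piD (S := S)) (cs_piN (S := S)) cs_reprK.
by exists n => p np; apply: nP.
Qed.
End CompletionFiltration.

(** The generators of N^j stay fixed while the coefficients become small, so infinite sums of such
    elements are finite combinations with convergent coefficients. *)
Lemma pow_split (A : comPzRingType) (N : ideal A) j k gs x : (forall y, ipow N j y <-> igen gs y) ->
  ipow N (j + k) x -> exists a : nat -> A, (forall l, ipow N k (a l)) /\ x = \sum_(l < size gs) a l * gs`_l.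
Proof.
move=> gsE H.
have sub i : ipow N (i + k) `<=` ideal_mul (ipow N i) (ipow N k).
  elim: i => [|i IH]; first by move=> y Hy; rewrite -[y]mul1r; apply: imul_mem => //; apply: ipow0.
  apply: imul_sub => a b Na /IH.
  suff H2 : ideal_mul (ipow N i) (ipow N k) `<=` colon (ideal_mul (ipow N i.+1) (ipow N k)) a by exact: H2.
  apply: imul_sub => u v Hu Hv.
  have : ideal_mul (ipow N i.+1) (ipow N k) (a * u * v) by apply: imul_mem => //; apply: ipowS.
  by rewrite -mulrA.
pose K := [set x | exists a : nat -> A, (forall l, ipow N k (a l)) /\ x = \sum_(l < size gs) a l * gs`_l].
have K0 : K 0 by exists (fun=> 0); split=> [l|]; [|rewrite big1 // => l _; rewrite mul0r].
have KD u v : K u -> K v -> K (u + v).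
  move=> [a [Ha ->]] [b [Hb ->]]; exists (fun l => a l + b l); split=> [l|]; first exact: idealD.
  by rewrite -big_split; apply: eq_bigr => l _; rewrite mulrDl.
have KM c v : K v -> K (c * v).
  move=> [a [Ha ->]]; exists (fun l => c * a l); split=> [l|]; first exact: idealM.
  by rewrite mulr_sumr; apply: eq_bigr => l _; rewrite mulrA.
have : Ideal K0 KD KM x; last by [].
apply: (imul_sub _ (sub j x H)) => u v /gsE/igenP[c ->] Hv.
exists (fun l => v * c l); split=> [l|]; first exact: idealMl.
by rewrite mulrC mulr_sumr; apply: eq_bigr => l _; rewrite mulrA.
Qed.

Record approximates (A T : comPzRingType) (N : ideal A) (M : ideal T) (i : {rmorphism A -> T}) : Prop := Approximates {
  ap_pow : forall k a, ipow M k (i a) <-> ipow N k a;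
  ap_dense : forall k t, exists a, ipow M k (t - i a)
}.

(** The delicate point is that the k-th filtration step lies in M^k. An approximating sequence has
    increments in N^(k+j); these are combinations of fixed generators of N^k with coefficients in
    N^j, and the coefficient sums converge in T. *)
Lemma completion_approximates (A T : comPzRingType) (N : ideal A) (M : ideal T) (f : {rmorphism completion N -> T}) :
  local_ring N -> clocal M -> bijective f -> approximates N M (f \o completion_map N).
Proof.
move=> lN cM bf; have [g [fK gK]] := bij_inverse bf; have [nA _ _] := lN; have [pN uN] := local_unit lN.
pose i : {rmorphism A -> T} := f \o completion_map N; have pM := cl_prime cM.
have giE a : g (i a) = completion_map N a by exact: fK.
have g1 t : cfil N 1 (g t) <-> M t.
  have sub X : cfil N 1 X -> M (f X).
    move=> HX; apply: contrapT => /(cl_unit cM)[u fu].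
    have : cfil N 1 (completion_map N 1); last by move=> /cfil_cst/ipow1/pN.1.
    by rewrite rmorph1 -(rmorph1 g) -fu rmorphM fK; apply: idealMl.
  split=> [/sub|Mt]; first by rewrite gK.
  have [a aE] := cfil_dense 1 (g t).
  have [Na|/uN ua] := pselect (N a).
    have /cfil_cst H : ipow N 1 a by apply/ipow1.
    by rewrite -[g t](subrK (completion_map N a)); apply: idealD.
  have := sub _ aE; rewrite rmorphB gK => /(idealB Mt); rewrite opprB addrC subrK => H.
  by case: pM.1; apply: unit_ideal H; apply/is_unit_rmorph/is_unit_rmorph.
have gpow k t : ipow M k t -> cfil N k (g t).
  elim: k t => [t _|k IH]; first exact: cfil0.
  have H2 : ipow M k.+1 `<=` ipre g (cfil N k.+1); last exact: H2.
  apply: imul_sub => a b /g1 Ha /IH Hb; change (cfil N k.+1 (g (a * b))).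
  by rewrite rmorphM -add1n; apply: cfilM.
have iN a : N a -> M (i a).
  by move=> Na; apply/g1; rewrite giE; apply/cfil_cst/ipow1.
have ap_powE k a : ipow N k a -> ipow M k (i a) by apply: rmorph_pow.
split=> [k a|k t]; first by split=> [/gpow|]; [rewrite giE => /cfil_cst|exact: ap_powE].
suff H X : cfil N k X -> ipow M k (f X).
  by have [a aE] := cfil_dense k (g t); exists a; have := H _ aE; rewrite rmorphB gK.
move=> HX; have [gs gsE] := noeth_fg nA (ipow N k).
have /choice[c cP] := fun j => cfil_dense (k + j) X.
have fil_le j l Y : (j <= l)%N -> cfil N l Y -> cfil N j Y.
  move=> jl [y [<- [n1 H1]]]; exists y; split=> //; exists n1 => n ln.
  by apply: ipow_le (H1 n ln).
have cN j : ipow N k (c j).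
  apply/cfil_cst; have := idealB HX (fil_le k _ _ (leq_addr j k) (cP j)).
  by rewrite opprB addrC subrK.
have cd j : ipow N (k + j) (c j.+1 - c j).
  apply/cfil_cst; rewrite rmorphB.
  have := idealB (cP j) (fil_le (k + j)%N _ _ (leq_add (leqnn k) (leqnSn j)) (cP j.+1)).
  by congr (cfil N _ _); ring.
have /choice[a aP] := fun j => pow_split gsE (cd j).
have /igenP[a0 a0E] : igen gs (c 0%N) by apply/gsE.
have /choice[al alP] : forall l, exists s, forall n, ipow M n (s - (i (a0 l) + \sum_(0 <= j < n) i (a j l))).
  move=> l; have [|s sP] := cl_conv cM (x := fun n => i (a0 l) + \sum_(0 <= j < n) i (a j l)).
    by move=> n; rewrite big_nat_recr //= addrA (addrC _ (i (a n l))) addrK; apply: ap_powE; apply: (aP n).1.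
  by exists s.
suff -> : f X = \sum_(l < size gs) al l * i gs`_l.
  apply: idealS => l _; apply/idealM/ap_powE/gsE/igen_mem/mem_nth/ltn_ord.
apply: (can_inj gK); rewrite fK; apply/subr0_eq/cfil_sep => n.
have cE : i (c n) = \sum_(l < size gs) (i (a0 l) + \sum_(0 <= j < n) i (a j l)) * i gs`_l.
  have -> : c n = \sum_(l < size gs) (a0 l + \sum_(0 <= j < n) a j l) * gs`_l.
    elim: n => [|n IH]; first by rewrite a0E; apply: eq_bigr => l _; rewrite big_geq // addr0.
    rewrite -[c n.+1](subrK (c n)) (aP n).2 {1}IH -big_split; apply: eq_bigr => l _.
    by rewrite big_nat_recr //=; ring.
  by rewrite rmorph_sum; apply: eq_bigr => l _; rewrite rmorphM rmorphD rmorph_sum.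
have H1 : cfil N n (X - completion_map N (c n)) by apply: fil_le (cP n); apply: leq_addl.
have H2 : cfil N n (g (i (c n) - \sum_(l < size gs) al l * i gs`_l)).
  apply: gpow; rewrite cE -sumrB; apply: idealS => l _; rewrite -mulrBl; apply: idealMl.
  by have := idealN (alP l n); rewrite opprB.
by have := idealD H1 H2; rewrite rmorphB giE addrA subrK.
Qed.

(** * Consequences of flatness of the completion *)

Section Flat.
Variables (A T : comPzRingType) (N : ideal A) (M : ideal T) (i : {rmorphism A -> T}).
Hypothesis lN : local_ring N.
Hypothesis cM : clocal M.
Hypothesis ap : approximates N M i.
Let nA : noetherian A. Proof. by case: lN. Qed.
Let uN x : ~ N x -> is_unit x. Proof. exact: (local_unit lN).2. Qed.
Let pN : is_prime N. Proof. exact: (local_unit lN).1. Qed.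
Let ap_powE k a := ap_pow ap k a.
Let dense k t := ap_dense ap k t.

Lemma ap_max a : M (i a) <-> N a.
Proof. by rewrite -(ipow1 M) -(ipow1 N); exact: (ap_powE 1%N a). Qed.

Lemma ap_krull (K : ideal A) a : (forall j, isum (ipow N j) K a) -> K a.
Proof.
move=> H; apply: (krull_cap nA H) => b Nb; apply: uN => N1b; apply: pN.1.
by rewrite -(subrK b 1); apply: idealD.
Qed.

Definition iext (K : ideal A) : ideal T := ideal_span [set i a | a in K].

Lemma iextP (K : ideal A) a : K a -> iext K (i a).
Proof. by move=> Ka I H; apply: H; exists a. Qed.

Lemma iext_sub (K : ideal A) (I : ideal T) : (forall a, K a -> I (i a)) -> iext K `<=` I.
Proof. by move=> H t; apply => _ [a Ka <-]; apply: H. Qed.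

Lemma iext_approx (K : ideal A) j t : iext K t -> exists2 a, K a & ipow M j (t - i a).
Proof.
pose F := [set t | exists2 a, K a & ipow M j (t - i a)].
have F0 : F 0 by exists 0; [|rewrite rmorph0 subrr].
have FD u v : F u -> F v -> F (u + v).
  move=> [a Ka Ha] [b Kb Hb]; exists (a + b); first exact: idealD.
  by have := idealD Ha Hb; congr (ipow M j _); rewrite rmorphD; ring.
have FM c u : F u -> F (c * u).
  move=> [a Ka Ha]; have [d dP] := dense j c; exists (d * a); first exact: idealM.
  have := idealD (idealM c Ha) (idealMl (i a) dP).
  by congr (ipow M j _); rewrite rmorphM; ring.
move=> Ht; have : Ideal F0 FD FM t; last by [].
apply: (iext_sub _ Ht) => a Ka; exists a => //.
by rewrite subrr.
Qed.

Lemma iext_contract_mod (K : ideal A) j a : isum (ipow M j) (iext K) (i a) -> isum (ipow N j) K a.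
Proof.
move=> [u [v [Hu /(@iext_approx K j)[b Kb Hb] E]]]; exists (a - b), b; split=> //; last by rewrite subrK.
apply/ap_powE; rewrite rmorphB E -addrA; exact: idealD.
Qed.

Lemma iext_contract (K : ideal A) a : iext K (i a) -> K a.
Proof. by move=> H; apply: ap_krull => j; apply/iext_contract_mod/isumR. Qed.

Lemma iext_closed (K : ideal A) t : (forall j, isum (ipow M j) (iext K) t) -> iext K t.
Proof. exact: cl_closed. Qed.

Lemma pow_iext k t : ipow M k t -> iext (ipow N k) t.
Proof.
move=> Mt; apply: iext_closed => j; have [a aP] := dense (maxn j k) t.
exists (t - i a), (i a); split; last by rewrite subrK.
  by apply: ipow_le aP; apply: leq_maxl.
apply/iextP/ap_powE; rewrite -(subKr t (i a)); apply: idealB => //.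
by apply: ipow_le aP; apply: leq_maxr.
Qed.

(** If a in A approximates t, then g a is close to K. By Artin-Rees, a small change of a brings it
    into K, so t is close to the extension of K, which is closed. *)
Lemma flat_nzd (K : ideal A) g : nzd K g -> nzd (iext K) (i g).
Proof.
move=> Kg t Ht; apply: iext_closed => j.
pose U := isum K (igen [:: g]); pose V := isum K (ideal_mul (ipow N j) (igen [:: g])).
have [|b y Nb|m mP] := @artin_rees _ nA N U V.
- apply: isum_sub; first exact: isumL.
  by apply: imul_sub => a b _ /(idealM a); apply: isumR.
- move=> [u [v [Ku gv ->]]]; exists j; rewrite mulrDr; apply: idealD; first by apply/isumL/idealM.
  by apply/isumR/imul_mem => //; apply: ipowX.
have [a aP] := dense (maxn j m) t.
have : isum (ipow M m) (iext K) (i (g * a)).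
  exists (i g * (i a - t)), (i g * t); split=> //; last by rewrite rmorphM; ring.
  by apply: idealM; have := idealN aP; rewrite opprB; apply/ipow_le/leq_maxr.
move/iext_contract_mod => [u [v [Nu Kv E]]].
have Uu : U u.
  have -> : u = - v + g * a by rewrite E; ring.
  by exists (- v), (g * a); split=> //; [apply: idealN|apply/idealMl/igen_mem/mem_head].
have [k [z [Kk /ideal_mul1[b Nb ->] E2]]] := mP u Nu Uu.
have Kab : K (a - b).
  apply: Kg; have -> : g * (a - b) = k + v by have := E; rewrite E2 => E3; rewrite mulrBr E3; ring.
  exact: idealD.
have -> : t = (t - i a + i b) + i (a - b) by rewrite rmorphB; ring.
apply: idealD; last by apply/isumR/iextP.
apply/isumL/idealD; last exact/ap_powE.
by apply: ipow_le aP; apply: leq_maxl.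
Qed.

Lemma uniform_pow (K I : ideal A) : (forall a, K a -> exists m, forall c, ipow N m c -> I (c * a)) ->
  exists m, forall a c, K a -> ipow N m c -> I (c * a).
Proof.
move=> H; have [s sE] := noeth_fg nA K.
suff [m mP] : exists m, forall a c, igen s a -> ipow N m c -> I (c * a).
  by exists m => a c /sE; apply: mP.
have {H} : forall a, a \in s -> exists m, forall c, ipow N m c -> I (c * a).
  by move=> a as'; apply/H/sE/igen_mem.
elim: s {sE} => [|a s IH] H.
  by exists 0%N => b c /igen_nil -> _; rewrite mulr0.
have [|m mP] := IH; first by move=> b bs; apply: H; rewrite inE bs orbT.
have [m' mP'] := H a (mem_head _ _); exists (maxn m m') => b c /igen_cons[r [y [ys ->]]] Nc.
rewrite mulrDr; apply: idealD.
  rewrite mulrCA; apply/idealM/mP'; apply: ipow_le Nc; exact: leq_maxr.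
apply: mP => //; apply: ipow_le Nc; exact: leq_maxl.
Qed.

(** Let H be the ideal of N-power torsion of A modulo x. Some g in N is a nonzerodivisor modulo H
    and a power of it sends w into the extension of H, so w lies there. As N^r kills H modulo x, the
    coefficients of w may be replaced by elements of A. *)
Lemma torsion_descends x k w : (forall t, ipow M k t -> exists u, t * w = i x * u) ->
  exists a r, w = i a + i x * r.
Proof.
move=> tw; pose X := igen [:: x].
pose Hs := [set y | exists m, forall c, ipow N m c -> X (c * y)].
have H0 : Hs 0 by exists 0%N => c _; rewrite mulr0.
have HD y z : Hs y -> Hs z -> Hs (y + z).
  move=> [m mP] [m' mP']; exists (maxn m m') => c Nc; rewrite mulrDr; apply: idealD.
    by apply: mP; apply: ipow_le Nc; apply: leq_maxl.
  by apply: mP'; apply: ipow_le Nc; apply: leq_maxr.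
have HM b y : Hs y -> Hs (b * y).
  by move=> [m mP]; exists m => c Nc; rewrite mulrCA; apply/idealM/mP.
pose H := Ideal H0 HD HM.
have [r rP] : exists r, forall a c, H a -> ipow N r c -> X (c * a) by apply: uniform_pow.
have [g Ng gH] : exists2 g, N g & nzd H g.
  have [|g Ng gP] := @common_nzd _ nA [:: H] N; last by exists g => //; apply: gP; left.
  move=> _ [<-|//] y Hy Ny; apply: Hy.
  have [|m mP] := @uniform_pow N (colon X y).
    by move=> b /Ny[m mP]; exists m => c /mP; rewrite /= /mkset; congr (X _); ring.
  exists m.+1; have sub : ipow N m.+1 `<=` colon X y.
    by apply: imul_sub => a c Na Nc; rewrite mulrC; apply: mP.
  by move=> c /sub; rewrite mulrC.
have iX : forall u, iext H (i x * u).
  by move=> u; apply/idealMl/iextP; exists 0%N => c _; apply/idealM/igen_mem/mem_head.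
have Hw : iext H w.
  have [|u E] := tw (i g ^+ k); first by apply/ipowX/ap_max.
  have : iext H (i g ^+ k * w) by rewrite E; apply: iX.
  elim: (k) => [|e IH]; first by rewrite mul1r.
  by rewrite exprS -mulrA => /(flat_nzd gH).
have [hs hsE] := noeth_fg nA H.
have Hgen : iext H `<=` igen (map i hs).
  by apply: iext_sub => a /hsE; apply: rmorph_igen.
have /igenP[c ->] := Hgen _ Hw; rewrite size_map.
suff [a [b E]] : exists a b : nat -> A, exists u : nat -> T, forall l, (l < size hs)%N ->
    c l * (map i hs)`_l = i (a l * hs`_l) + i x * u l.
  have [u uP] := E; exists (\sum_(l < size hs) a l * hs`_l), (\sum_(l < size hs) u l).
  rewrite rmorph_sum mulr_sumr -big_split; apply: eq_bigr => l _; exact: uP.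
have /choice[a aP] := fun l => dense r (c l).
have /choice[u uP] : forall l, exists u, (l < size hs)%N -> c l * (map i hs)`_l = i (a l * hs`_l) + i x * u.
  move=> l; have [ll|ll] := ltnP l (size hs); last by exists 0.
  have Hh : H hs`_l by apply/hsE/igen_mem/mem_nth.
  have sub : iext (ipow N r) `<=` colon (igen [:: i x]) (i hs`_l).
    apply: iext_sub => d Nd; have /igen1[v E] := rP _ _ Hh Nd; apply/igen1; exists (i v).
    by rewrite -!rmorphM mulrC E.
  have /igen1[u E] := sub _ (pow_iext (aP l)); exists u => _.
  by rewrite (nth_map 0) // [i x * u]mulrC -E rmorphM; ring.
by exists a, (fun=> 0), u.
Qed.
End Flat.

(** Compares the saturated chain 0, p, m with a saturated chain of length the exact height of m. *)
Lemma catenary_height R (p m : ideal R) d : noetherian R -> catenary R -> is_prime (izero R) ->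
  ht_ge (izero R) p 1 -> ~ ht_ge (izero R) p 2 -> ht_ge p m 1 -> ~ ht_ge p m 2 ->
  ht_ge (izero R) m d -> (d <= 2)%N.
Proof.
move=> nR cat p0 h1 n1 h2 n2 hm; have pm := ht_ge_prime hm; have pp := ht_ge_prime h1.
have [e [he ne]] := exact_height nR pm.
have de : (d <= e)%N.
  by rewrite leqNgt; apply/negP => ed; apply: ne; apply: ht_ge_le hm.
have [c cc [_ cm]] := he.
have c0 : ideal_set (c 0%N) = izero R.
  apply/seteqP; split=> [y cy|y ->]; last exact: ideal0.
  apply: contrapT => y0; apply: ne.
  have h0 : ht_ge (izero R) (c 0%N) 1.
    apply: ht_ge1 p0 (Defs.primeP _) _.
    by apply: (properI _ cy) => // z ->.
  have h3 : ht_ge (c 0%N) m e by exists c => //; split.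
  by have := ht_ge_cat h0 h3; rewrite add1n.
pose P0 := PrimeIdeal p0; pose Pp := PrimeIdeal pp; pose Pm := PrimeIdeal pm.
have [Q hQ [Qp pQ]] := ht_ge_pred h1; have [Q' hQ' [Q'm mQ']] := ht_ge_pred h2.
have lt1 : ideal_set P0 `<` ideal_set Pp.
  by split=> [|H] //; apply: pQ => y /H ->.
have lt2 : ideal_set Pp `<` ideal_set Pm.
  have pQ' := ht_ge_I hQ'; by split=> [y /pQ'/Q'm //|H]; apply: mQ' => y /H/pQ'.
have s2 : saturated_chain P0 Pm 2 (fun k => match k with 0%N => P0 | 1%N => Pp | _ => Pm end).
  split=> // [[|[|k]]|[|[|k]] _ P' [l1 l2]] //.
    apply: n1; apply: (ht_geS pp (ht_ge1 p0 (Defs.primeP P') l1) l2).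
  by apply: n2; apply: (ht_geS pm (ht_ge1 pp (Defs.primeP P') l1) l2).
have se : saturated_chain P0 Pm e c.
  split=> // k ke P' [l1 l2]; apply: ne.
  have hk j : (j <= e)%N -> ht_ge (izero R) (c j) j.
    move=> je; exists c; first by move=> l lj; apply: cc; apply: leq_trans je.
    by split=> // y ->.
  have up : forall j, (k.+1 + j <= e)%N -> ht_ge (c k.+1) (c (k.+1 + j)%N) j.
    elim=> [|j IH] je; first by rewrite addn0; apply: ht_ge0 => //; apply: Defs.primeP.
    have l : (k.+1 + j <= e)%N by lia.
    by apply: (ht_geS (Defs.primeP _) (IH l)); rewrite addnS; apply: cc; lia.
  have := up (e - k.+1)%N; rewrite subnKC // => /(_ (leqnn _)) hup.
  have := ht_ge_cat (ht_geS (Defs.primeP _) (ht_geS (Defs.primeP P') (hk k (ltnW ke)) l1) l2) hup.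
  rewrite (ideal_eq cm); congr (ht_ge _ _ _); lia.
by have := cat P0 Pm (@izero_sub _ m) _ _ _ _ s2 se => e2; rewrite e2.
Qed.

(** * A short saturated chain in the polynomial ring *)

Section PolyPrimes.
Variables (A : idomainType) (N : ideal A) (x y be : A) (r : nat).
Hypothesis lN : local_ring N.
Hypotheses (x0 : x <> 0) (Nx : N x) (Nbe : N be).
Hypothesis rel : y * (x - y) = x ^+ 2 * be.
Hypothesis shrink : forall a, ipow N r a -> exists c b, ipow N r.+1 b /\ a * y = x * (c * y + b).
Let F := {fraction A}.
Let io : {rmorphism A -> F} := @tofrac A.
Let z : F := io y / io x.
Let pev : {rmorphism {poly A} -> F} := horner_eval z \o map_poly io.
Hypothesis at1 : forall f, pev f = 0 -> N f.[1].
Let nA : noetherian A. Proof. by case: lN. Qed.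
Let pN : is_prime N. Proof. exact: (local_unit lN).1. Qed.
Let nAX : noetherian {poly A} := noeth_poly nA.

Definition zker : ideal {poly A} := ipre pev (izero F).
Definition mone : ideal {poly A} := ipre (horner_eval 1) N.

Let iox : io x != 0. Proof. by rewrite tofrac_eq0; apply/eqP. Qed.
Let pevC c : pev c%:P = io c. Proof. by rewrite /pev /= /horner_eval map_polyC hornerC. Qed.
Let pevX : pev 'X = z. Proof. by rewrite /pev /= /horner_eval map_polyX hornerX. Qed.
Let xz : io x * z = io y. Proof. by rewrite /z mulrC divfK. Qed.

Lemma zker_prime : is_prime zker.
Proof. exact/ipre_prime/idom_prime0. Qed.
Lemma mone_prime : is_prime mone.
Proof. exact: ipre_prime. Qed.
Lemma zker_mone : zker `<=` mone.
Proof. by move=> f /at1. Qed.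

Lemma zker_lin : zker (x%:P * 'X - y%:P).
Proof. by change (pev (x%:P * 'X - y%:P) = 0); rewrite rmorphB rmorphM !pevC pevX xz subrr. Qed.

Lemma lin_div (f : {poly A}) : exists m g c, x%:P ^+ m * f = g * (x%:P * 'X - y%:P) + c%:P.
Proof.
elim/poly_ind: f => [|f c0 [m [g [c E]]]]; first by exists 0%N, 0, 0; rewrite mulr0 mul0r add0r.
exists m.+1, (x%:P * 'X * g + c%:P), (c * y + x ^+ m.+1 * c0).
rewrite exprS mulrDr mulrA -(mulrA x%:P) E !rmorphD !rmorphM rmorphXn /= exprS; ring.
Qed.

(** By [lin_div], a power of x times f is a multiple of x X - y plus a constant, and the constant
    vanishes for f in [zker]. *)
Lemma zker_min : min_over zker (isum (izero {poly A}) (igen [:: x%:P * 'X - y%:P])).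
Proof.
split; first exact: zker_prime.
  by apply: iadd1_sub => //; apply: zker_lin.
move=> q pq sq qz f zf; have [m [g [c E]]] := lin_div f.
have : pev (x%:P ^+ m * f) = 0 by rewrite rmorphM (_ : pev f = 0) ?mulr0.
rewrite E rmorphD rmorphM (_ : pev (_ - _) = 0); last exact: zker_lin.
rewrite mulr0 add0r pevC => /eqP; rewrite tofrac_eq0 => /eqP c0.
have : q (x%:P ^+ m * f).
  by rewrite E c0 addr0; apply/idealM/sq/iadd1R.
case/pq.2 => // /(prime_exp pq)/qz H; have : pev x%:P = 0 by [].
by rewrite pevC => E'; have := iox; rewrite E' eqxx.
Qed.

(** For a prime q in between, [shrink] puts X L in q + [mone] L, where L is the extension of N^r.
    Since X is outside [mone], Nakayama puts L, hence N, in q. Then [rel] gives X (1 - X) in q, and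
    so 1 - X. *)
Lemma mone_min : min_over mone (isum zker (igen [:: x%:P])).
Proof.
have monex : mone x%:P by change (N x%:P.[1]); rewrite hornerC.
split; first exact: mone_prime.
  exact: iadd1_sub zker_mone _.
move=> q pq sq qm.
have zq : zker `<=` q by move=> f zf; apply/sq/isumL.
have xq : q x%:P by apply/sq/iadd1R.
have nX : ~ mone 'X by change (~ N 'X.[1]); rewrite hornerX; apply: pN.1.
have qX : ~ q 'X by move=> /qm.
pose L : ideal {poly A} := ideal_span [set a%:P | a in ipow N r].
have LC a : ipow N r a -> L a%:P by move=> Na I H; apply: H; exists a.
have NL b : ipow N r.+1 b -> ideal_mul mone L b%:P.
  have sub : ipow N r.+1 `<=` ipre (@polyC A) (ideal_mul mone L); last exact: sub.
  apply: imul_sub => a c Na Nc; change (ideal_mul mone L (a * c)%:P); rewrite polyCM.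
  by apply: imul_mem; [change (N a%:P.[1]); rewrite hornerC|apply: LC].
have XL l : L l -> isum q (ideal_mul mone L) ('X * l).
  have sub : L `<=` colon (isum q (ideal_mul mone L)) 'X; last exact: sub.
  move=> f; apply => _ [a Na <-]; have [c [b [Nb E]]] := shrink Na.
  change (isum q (ideal_mul mone L) ('X * a%:P)).
  have h1 : zker (a%:P * 'X - (c * y + b)%:P).
    change (pev (a%:P * 'X - (c * y + b)%:P) = 0); rewrite rmorphB rmorphM !pevC pevX.
    apply: (mulfI iox); rewrite mulr0 mulrBr mulrCA xz -!rmorphM E; apply/eqP.
    by rewrite subrr.
  exists (a%:P * 'X - (c * y + b)%:P - c%:P * (x%:P * 'X - y%:P) + c%:P * 'X * x%:P), b%:P; split.
  - apply: idealD; last exact: idealM.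
    by apply: idealB; [apply: zq|apply/idealM/zq/zker_lin].
  - exact: NL.
  - by rewrite polyCD polyCM; ring.
have [t mt tL] : exists2 t, ~ mone t & forall f, L f -> q (t * f).
  apply: (nakayama_at nAX (pP := mone_prime)) => f /XL H; by exists 'X.
have qN a : N a -> q a%:P.
  move=> Na; have /tL : L (a ^+ r)%:P by apply/LC/ipowX.
  by case/pq.2 => [/qm //|]; rewrite polyC_exp; apply: prime_exp.
have q1X : q (1 - 'X).
  have : q ('X * (1 - 'X)).
    have h1 : zker ('X * (1 - 'X) - be%:P).
      change (pev ('X * (1 - 'X) - be%:P) = 0); rewrite rmorphB rmorphM rmorphB rmorph1 pevC pevX.
      have ix2 : io x ^+ 2 != 0 by rewrite expf_neq0.
      apply: (mulfI ix2); have -> : io x ^+ 2 * (z * (1 - z) - io be) = io x * z * (io x - io x * z) - io x ^+ 2 * io be by ring.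
      by rewrite xz -rmorphXn -rmorphB -!rmorphM rel mulr0 /= subrr.
    by rewrite -(subrK be%:P ('X * (1 - 'X))); apply: idealD; [apply: zq|apply: qN].
  by case/pq.2.
move=> f mf; have /factor_theorem[g E] : root (f - f.[1]%:P) 1 by rewrite /root !hornerE subrr.
rewrite -(subrK f.[1]%:P f) E; apply: idealD; last exact: qN.
by rewrite -opprB mulrN; apply/idealN/idealM; rewrite polyC1.
Qed.

Lemma not_catenary_poly : ht_ge (izero A) N 2 -> ~ catenary {poly A}.
Proof.
move=> hN cat; have p0 := idom_prime0 {poly A}.
have h3 : ht_ge (izero {poly A}) mone 3.
  apply: (ht_geS mone_prime (ht_ge_pext hN)); split=> [f Nf|H].
    by change (N f.[1]); rewrite horner_coef; apply: idealS => k _; apply: idealMl.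
  have /H/(_ 1%N) : mone ('X - 1) by change (N ('X - 1).[1]); rewrite !hornerE subrr.
  by rewrite coefB coefX coef1 subr0 => /pN.1.
suff : (3 <= 2)%N by [].
apply: (catenary_height (p := zker) nAX cat p0 _ _ _ _ h3).
- apply: ht_ge1 p0 zker_prime _.
  apply: (properI (@izero_sub _ _) zker_lin) => E; have /(congr1 (fun p : {poly A} => p`_1)) : x%:P * 'X - y%:P = 0 := E.
  by rewrite coefB coefCM coefX coefC coef0 mulr1 subr0.
- by move/(height_le nAX zker_min).
- apply: ht_ge1 zker_prime mone_prime _.
  apply: (properI zker_mone (x := x%:P)); first by change (N x%:P.[1]); rewrite hornerC.
  by move=> H; have := pevC x; rewrite (_ : pev x%:P = 0) // => E; have := iox; rewrite -E eqxx.
- by move/(height_le nAX mone_min).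
Qed.
End PolyPrimes.

(** * Failure of universal catenarity *)

Section NotUniversallyCatenary.
Variables (A : idomainType) (T : comPzRingType) (N : ideal A) (M : ideal T) (i : {rmorphism A -> T}).
Hypothesis lN : local_ring N.
Hypothesis cM : clocal M.
Hypothesis ap : approximates N M i.
Variables (P0 J : ideal T).
Hypothesis pP0 : is_prime P0.
Hypothesis P0_dim : ~ ht_ge P0 M 2.
Hypothesis JM : J `<=` M.
Hypothesis J_P0 : ~ (J `<=` P0).
Hypothesis P0J : forall t, P0 t -> J t -> t = 0.
Hypothesis T_ht : ht_ge (izero T) M 2.
Let nT := cl_noeth cM.
Let pM := cl_prime cM.
Let nA : noetherian A. Proof. by case: lN. Qed.
Let pN : is_prime N. Proof. exact: (local_unit lN).1. Qed.
Let iN a : M (i a) <-> N a. Proof. exact: ap_max. Qed.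
Let ap_powE k a := ap_pow ap k a.

Let P0M : P0 `<=` M.
Proof. exact: local_sub (cl_unit cM) pP0.1. Qed.

Lemma min_over_P0 (I : ideal T) t : I `<=` M -> P0 `<=` I -> I t -> ~ P0 t -> min_over M I.
Proof.
move=> IM PI It Pt; split=> // Q pQ IQ QM x Mx; apply: contrapT => Qx; apply: P0_dim.
apply: (ht_geS pM _ (properI QM Mx Qx)).
apply: ht_ge1 pP0 pQ _.
by apply: (properI (x := t)) => // [y /PI/IQ|]; [|apply: IQ].
Qed.

Lemma i_nzd a t : a <> 0 -> i a * t = 0 -> t = 0.
Proof.
move=> a0 E; have z : iext i (izero A) `<=` izero T.
  by apply: iext_sub => b ->; rewrite rmorph0.
apply: z; apply: (flat_nzd lN cM ap (g := a)); last by rewrite E.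
by move=> b /eqP; rewrite mulf_eq0 => /orP[]/eqP.
Qed.

Lemma i_cancel a t u : a <> 0 -> i a * t = i a * u -> t = u.
Proof.
by move=> a0 E; apply/subr0_eq/(i_nzd a0); rewrite mulrBr E subrr.
Qed.

Lemma i_contract a b t : i b = i a * t -> exists c, b = a * c.
Proof.
move=> E; have /(iext_contract lN ap)/igen1[c ->] : iext i (igen [:: a]) (i b); last by exists c; rewrite mulrC.
by rewrite E; apply/idealMl/iextP/igen_mem/mem_head.
Qed.

Lemma N_nonzero k : exists2 x, x <> 0 & ipow N k x.
Proof.
have [[a Na a0]|no] := pselect (exists2 a, N a & a <> 0).
  by exists (a ^+ k); [apply/eqP; rewrite expf_neq0 //; apply/eqP|apply: ipowX].
have M0 t : M t -> t = 0.
  move=> Mt; apply: (cl_sep cM) => j; have [a aP] := ap_dense ap j.+1 t.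
  have Na : N a.
    apply/iN; rewrite -(subKr t (i a)); apply: idealB => //.
    by apply: (ipow1 M _).1; apply: ipow_le aP.
  have a0 : a = 0 by apply: contrapT => a0; apply: no; exists a.
  by move: aP; rewrite a0 rmorph0 subr0; apply: ipowS_sub.
have [Q hQ [_ nQ]] := ht_ge_pred T_ht.
by case: nQ => t /M0 ->.
Qed.

(** M is minimal over the images of parameters of N, so a single parameter would bound the height of
    M by 1. *)
Lemma ht_N : ht_ge (izero A) N 2.
Proof.
apply: contrapT => nh; have z0 : izero A `<=` N by move=> a ->.
have [s [s1 sN [_ _ mN]]] := height_params nA pN z0 nh.
have mM : min_over M (isum (izero T) (igen (map i s))).
  split=> //.
    apply: isum_sub => [t ->|]; first exact: ideal0.
    by apply: igen_sub => _ /mapP[a /sN/iN Ma ->].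
  move=> Q pQ sQ QM t Mt.
  have NQ : N `<=` ipre i Q.
    apply: mN; first exact: ipre_prime.
      apply: isum_sub => [a ->|]; first exact: ideal0.
      by apply: igen_sub => a as'; apply/sQ/isumR/igen_mem/map_f.
    by move=> a /QM/iN.
  have /(pow_iext cM ap) H : ipow M 1 t by apply/ipow1.
  by apply: (iext_sub _ H) => a /ipow1/NQ.
have := height_le nT mM T_ht; rewrite size_map => H.
by have := leq_trans H s1.
Qed.

(** The fraction w / x behaves as the idempotent equal to 1 modulo P0 and 0 modulo J. M^k multiplies
    w into x T, so w agrees modulo x with an element of A; adjusting that element gives y with i y =
    w + i x * tau and tau small. *)
Lemma poly_not_catenary : ~ catenary {poly A}.
Proof.
have [t0 Jt0 Pt0] : exists2 t, J t & ~ P0 t.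
  by apply: contrapT => no; apply: J_P0 => t Jt; apply: contrapT => Pt; apply: no; exists t.
have [k kP] : exists k, ipow M k `<=` isum P0 J.
  apply: (min_over_pow cM); apply: (min_over_P0 (t := t0)) => //.
  - exact: isum_sub.
  - by move=> t; apply: isumL.
  - exact: isumR.
(* The exponent k + 1 puts x in N^k and, even when k = 0, in N. *)
have [x x0 xk] := N_nonzero k.+1.
have Nx : N x by apply: (ipow1 N _).1; apply: ipow_le xk.
have [s [w [Ps Jw xE]]] : isum P0 J (i x) by apply/kP/ap_powE/ipowS_sub.
have pj p j : P0 p -> J j -> p * j = 0 by move=> Pp Jj; apply: P0J; [apply: idealMl|apply: idealM].
have P0x : ~ P0 (i x).
  move=> Px; have := i_nzd x0 (pj _ _ Px Jt0) => E.
  by apply: Pt0; rewrite E.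
have [r0 r0P] : exists r, ipow M r `<=` isum P0 (igen [:: i x]).
  apply: (min_over_pow cM); apply: (min_over_P0 (t := i x)) => //.
  - by apply: iadd1_sub => //; apply/iN.
  - by move=> t; apply: isumL.
  - by apply/iadd1R.
have [a1 [r1 wE]] : exists a r, w = i a + i x * r.
  apply: (torsion_descends lN cM ap (k := k)) => t /kP[p [j [Pp Jj ->]]].
  by exists j; rewrite mulrDl (pj _ _ Pp Jw) add0r xE mulrDl (pj _ _ Ps Jj) add0r mulrC.
(* Order k + 1 lets tau split along P0 + J, which yields [be] in N; order r0 + 1 is what [shrink]
   requires. *)
have [c tP] := ap_dense ap (maxn k.+1 r0.+1) r1.
set tau := i c - r1; pose y := a1 + x * c.
have yE : i y = w + i x * tau by rewrite wE /y /tau rmorphD rmorphM; ring.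
have tP' : ipow M (maxn k.+1 r0.+1) tau by have := idealN tP; rewrite opprB.
have tk : ipow M k.+1 tau by apply: ipow_le tP'; apply: leq_maxl.
have tr : ipow M r0.+1 tau by apply: ipow_le tP'; apply: leq_maxr.
have Mtau : M tau by apply: (ipow1 M _).1; apply: ipow_le tk.
have [p [j [Pp Jj tauE]]] := kP _ (ipowS_sub tk).
have relT : i (y * (x - y)) = i (x ^+ 2) * (p - j - tau ^+ 2).
  have tw : tau * w = j * i x by rewrite tauE xE mulrDl (pj _ _ Pp Jw) mulrDr (mulrC j s) (pj _ _ Ps Jj) !add0r.
  have ts : tau * s = p * i x by rewrite tauE xE mulrDl mulrDr (mulrC j s) (pj _ _ Ps Jj) (pj _ _ Pp Jw) !addr0.
  have -> : i (y * (x - y)) = s * w + i x * (tau * s) - i x * (tau * w) - i x ^+ 2 * tau ^+ 2.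
    by rewrite rmorphM rmorphB yE xE; ring.
  by rewrite (pj _ _ Ps Jw) tw ts rmorphXn; ring.
have [be beE] := i_contract relT.
have Nbe : N be.
  apply/iN; have x20 : x ^+ 2 <> 0 by apply/eqP; rewrite expf_neq0 //; apply/eqP.
  have -> : i be = p - j - tau ^+ 2 by apply: (i_cancel x20); rewrite -relT beE rmorphM.
  by apply: idealB; [apply: idealB; [exact: P0M|exact: JM]|rewrite expr2; apply: idealM].
have shrink a : ipow N r0 a -> exists c b, ipow N r0.+1 b /\ a * y = x * (c * y + b).
  move=> /ap_powE/r0P[q [u [Pq /igen1[t ->] aE]]].
  have ayE : i (a * y) = i x * (t * w + i a * tau).
    by rewrite rmorphM yE mulrDr {1}aE mulrDl (pj _ _ Pq Jw) add0r; ring.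
  have [a' a'E] := i_contract ayE.
  have ia' : i a' = t * w + i a * tau by apply: (i_cancel x0); rewrite -ayE a'E rmorphM.
  have [d dP] := ap_dense ap r0.+1 t.
  exists d, (a' - d * y); split; last by rewrite a'E; ring.
  apply/ap_powE; have -> : i (a' - d * y) = (t - i d) * w + (i a - i d * i x) * tau.
    by rewrite rmorphB ia' rmorphM yE; ring.
  by apply: idealD; [apply: idealMl|apply: idealM].
apply: (not_catenary_poly lN x0 Nx Nbe beE shrink _ ht_N) => f /= fz.
(* The value of f at y / x, cleared of denominators by a power of x. *)
pose F := \sum_(l < size f) f`_l * y ^+ l * x ^+ (size f - l).
have F0 : F = 0.
  apply/eqP; rewrite -tofrac_eq0; have iox : tofrac x != 0 by rewrite tofrac_eq0; apply/eqP.
  rewrite /F rmorph_sum; apply/eqP.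
  transitivity (tofrac x ^+ size f * (map_poly (@tofrac A) f).[tofrac y / tofrac x]); last first.
    by rewrite [X in _ * X]fz mulr0.
  rewrite (@horner_coef_wide _ (size f)); last exact: size_poly.
  rewrite mulr_sumr; apply: eq_bigr => l _.
  rewrite coef_map_id0 ?rmorph0 // !rmorphM !rmorphXn /=.
  have -> : tofrac x ^+ size f = tofrac x ^+ (size f - l) * tofrac x ^+ l by rewrite -exprD subnK // ltnW.
  have E : tofrac x ^+ l * (tofrac y / tofrac x) ^+ l = tofrac y ^+ l by rewrite -exprMn mulrC divfK.
  by rewrite -E; ring.
(* Modulo P0 the term s vanishes, so y / x becomes 1 + tau. *)
have cong l : P0 (i y ^+ l - (i x * (1 + tau)) ^+ l).
  rewrite subrXX; apply: idealMl; have -> : i y - i x * (1 + tau) = - s by rewrite yE xE; ring.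
  exact: idealN.
have P0sum : P0 (i x ^+ size f * \sum_(l < size f) i f`_l * (1 + tau) ^+ l).
  have : P0 (i F) by rewrite F0 rmorph0.
  have H : P0 (i F - i x ^+ size f * \sum_(l < size f) i f`_l * (1 + tau) ^+ l).
    rewrite /F rmorph_sum mulr_sumr -sumrB; apply: idealS => l _.
    have -> : i (f`_l * y ^+ l * x ^+ (size f - l)) - i x ^+ size f * (i f`_l * (1 + tau) ^+ l) =
      i f`_l * i x ^+ (size f - l) * (i y ^+ l - (i x * (1 + tau)) ^+ l).
      rewrite !rmorphM !rmorphXn exprMn.
      have -> : i x ^+ size f = i x ^+ (size f - l) * i x ^+ l by rewrite -exprD subnK // ltnW.
      by ring.
    exact: idealM.
  by move=> /idealB/(_ H); rewrite opprB addrC subrK.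
case: (pP0.2 _ _ P0sum) => [/(prime_exp pP0)//|/P0M H].
apply/iN; rewrite horner_coef rmorph_sum.
have H2 : M (\sum_(l < size f) i f`_l * (1 + tau) ^+ l - \sum_(l < size f) i (f`_l * 1 ^+ l)).
  rewrite -sumrB; apply: idealS => l _; rewrite rmorphM rmorphXn rmorph1 -mulrBr; apply: idealM.
  by rewrite subrXX; apply: idealMl; rewrite (addrC 1) addrK.
by have := idealB H H2; rewrite opprB addrC subrK.
Qed.

Theorem not_universally_catenary : ~ universally_catenary A.
Proof.
move=> uc; apply: poly_not_catenary; apply: (uc _ (@polyC A)).
exists [:: 'X] => S SC SX SD SM; elim/poly_ind => [|f c Sf].
  by rewrite -(rmorph0 (@polyC A)); apply: SC.
by apply: SD; [apply: SM => //; apply/SX/mem_head|apply: SC].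
Qed.
End NotUniversallyCatenary.

Theorem theorem3p6 (T : comPzRingType) (M : ideal T) (n : nat)
  (T_complete : complete_local_ring M)
  (T_char : char_zero T)
  (T_dim : krull_dim T n)
  (n_gt1 : (1 < n)%N)
  (T_integers : forall z : int, z%:~R <> 0 :> T -> ~ zero_divisor (z%:~R : T))
  (T_reduced : reduced T)
  (T_minimal : forall P : Spec T, minimal_prime P ->
     krull_dim (quotient_ring P) 1 \/ krull_dim (quotient_ring P) n)
  (T_dims : exists P0 P1 : Spec T,
     [/\ minimal_prime P0, minimal_prime P1,
         krull_dim (quotient_ring P0) 1 & krull_dim (quotient_ring P1) n]) :
  (exists (A : idomainType) (N : ideal A),
     [/\ local_ring N, quasi_excellent N, catenary A &
         ring_isomorphic (completion N) T]) /\
  ~ (exists (A : idomainType) (N : ideal A),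
       [/\ local_ring N, universally_catenary A &
           ring_isomorphic (completion N) T]).
Proof.
have [P0 [P1 [P0min P1min P0dim P1dim]]] := T_dims.
split.
  exact: (quasi_excellent_catenary_domain T_complete T_char T_dim n_gt1 T_integers T_reduced T_minimal (ex_intro _ P1 (conj P1min P1dim))).
move=> [A [N [lN uc [f bf]]]]; have cM := complete_clocal T_complete.
have ap := completion_approximates lN cM bf; have nT := cl_noeth cM.
have pP0 := Defs.primeP P0; have pP1 := Defs.primeP P1.
have [_ nh2] := krull_chain cM pP0 P0dim; have [hn _] := krull_chain cM pP1 P1dim.
have mnl (P : Spec T) Q : minimal_prime P -> is_prime Q -> Q `<=` P -> P `<=` Q.
  by move=> mP pQ QP; exact: (mP (PrimeIdeal pQ) QP).
have [ps [psP psall]] := primes_over nT (izero T).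
(* The intersection of these primes serves as J; they include all minimal primes other than P0. *)
have [qs qsE] := filter_In ps (fun q => ~ q `<=` P0).
apply: (not_universally_catenary lN cM ap (P0 := P0) (J := icap (fun q => List.In q qs)) pP0 nh2 _ _ _ _ uc).
- have [q qps qP1] := psall _ pP1 (@izero_sub _ P1); have [pq _] := psP q qps.
  apply: (subset_trans (B := q)) (local_sub (cl_unit cM) pq.1) => t; apply.
  apply/qsE; split=> // qP0; apply: nh2.
  have P01 : P0 `<=` P1 by move=> x /(mnl P0 q P0min pq qP0)/qP1.
  by apply: (ht_ge_le n_gt1); exact: ht_ge_mono P01 hn.
- move=> JP0; have [|y Py yq] := @outside_product T P0 qs pP0; first by move=> q /qsE[].
  by apply/Py/JP0.
- move=> t Pt Jt; have [k /T_reduced //] : exists k, izero T (t ^+ k).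
  apply: radical_prime => // Q pQ _; have [q qps qQ] := psall Q pQ (@izero_sub _ Q).
  have [pq _] := psP q qps; apply: qQ.
  by have [qP|qP] := pselect (q `<=` P0); [apply: (mnl P0)|apply/Jt/qsE].
- by apply: (ht_ge_mono (@izero_sub _ P1)); apply: ht_ge_le hn.
Qed.
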